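(* Over $\mathsf{RCA}_0$ the principles $\mathrm{BW}_{\mathrm{weak}}$ and $\mathrm{StCOH}$ are instance-wise equivalent. More precisely, $$\mathsf{RCA}_0 \vdash \exists e_1\, \forall X\, \bigl(\mathrm{StCOH}(\{e_1\}^X) \rightarrow \mathrm{BW}_{\mathrm{weak}}(X)\bigr),$$ $$\mathsf{RCA}_0 \vdash \exists e_2\, \forall Y\, \bigl(\mathrm{BW}_{\mathrm{weak}}(\{e_2\}^Y) \rightarrow \mathrm{StCOH}(Y)\bigr).$$ Moreover, in a language with higher-order functionals, $\{e_1\}$ and $\{e_2\}$ (i.e. the maps $X\mapsto\{e_1\}^X$ and $Y\mapsto\{e_2\}^Y$) can be given by fixed primitive recursive functionals.
   Context: $\mathsf{RCA}_0$ is the usual base system of reverse mathematics. $\{e\}^X$ denotes the set (or sequence) computed by the Turing machine with number $e$ relative to the oracle $X$; writing $P(\{e\}^X)$ includes that this computation is total and yields a code of an instance of the principle $P$. $\mathrm{BW}_{\mathrm{weak}}$ is the statement that every sequence $(y_i)_{i\in\mathbb N}$ of rational numbers in $[0,1]$ has a Cauchy subsequence (with no requirement on the rate): there is a strictly monotone $f:\mathbb N\to\mathbb N$ with $\forall n\,\exists s\,\forall v,w\ge s\ |y_{f(v)}-y_{f(w)}|<2^{-n}$. $\mathrm{BW}_{\mathrm{weak}}(X)$ is this statement for the single sequence coded by $X$. A set $S\subseteq\mathbb N$ is strongly cohesive for a sequence $(R_n)_{n\in\mathbb N}$ of subsets of $\mathbb N$ if $$\forall n\,\exists s\,\forall i<n\,\bigl(\forall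 j\ge s\,(j\in S\rightarrow j\in R_i)\ \lor\ \forall j\ge s\,(j\in S\rightarrow j\notin R_i)\bigr).$$ $\mathrm{StCOH}(Y)$ is the statement that for the sequence of sets $(R_n)_n$ coded by $Y$ there is an infinite strongly cohesive set; $\mathrm{StCOH}$ is $\forall Y\,\mathrm{StCOH}(Y)$. Instances $X$, $Y$ range over codes of instances of the respective principle. *)

(* Defs.v *)
(* A deep embedding of many-sorted classical first-order logic,
   of RCA_0 in the language of second-order arithmetic, and of Kohlenbach's
   RCA_0^omega in the language of all finite types. *)
From Stdlib Require Import List.
Import ListNotations.
Set Implicit Arguments.
Unset Strict Implicit.
Unset Printing Implicit Defensive.

(** * Many-sorted first-order logic *)

Record language := Language {
  sort : Type;
  sort_dec : forall s s' : sort, {s = s'} + {s <> s'};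
  fsym : Type;
  fdom : fsym -> list sort;
  fcod : fsym -> sort;
  rsym : Type;
  rdom : rsym -> list sort }.

(* Every sort has its own supply of de Bruijn indices: [Var s n] refers to the
   n-th enclosing quantifier among those over the sort [s]. *)
Inductive term (L : language) : sort L -> Type :=
| Var (s : sort L) (n : nat) : term s
| Fun (f : fsym L) : args (fdom f) -> term (fcod f)
with args (L : language) : list (sort L) -> Type :=
| ANil : args (L := L) nil
| ACons (s : sort L) (l : list (sort L)) : term s -> args l -> args (s :: l).

Arguments Var {L} s n.
Arguments Fun {L} f _.
Arguments ANil {L}.

Inductive form (L : language) : Type :=
| Rel (r : rsym L) : args (rdom r) -> form L
| Bot : form L
| Imp : form L -> form L -> form L
| And : form L -> form L -> form L
| Or : form L -> form L -> form L
| All (s : sort L) : form L -> form L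
| Ex (s : sort L) : form L -> form L.

Arguments Rel {L} r _.
Arguments Bot {L}.
Arguments All {L} s _.
Arguments Ex {L} s _.

Definition Not L (A : form L) : form L := Imp A Bot.
Definition Iff L (A B : form L) : form L := And (Imp A B) (Imp B A).

Definition sub (L : language) := forall s : sort L, nat -> term s.

Fixpoint tsubst L (u : sub L) (s : sort L) (t : term s) : term s :=
  match t with
  | Var s n => u s n
  | Fun f a => Fun f (asubst u a)
  end
with asubst L (u : sub L) (l : list (sort L)) (a : args l) : args l :=
  match a with
  | ANil => ANil
  | ACons t a => ACons (tsubst u t) (asubst u a)
  end.

Definition shift L (s : sort L) : sub L :=
  fun s' n => Var s' (if sort_dec s s' then S n else n).

Definition up L (s : sort L) (u : sub L) : sub L :=
  fun s' n =>
    match n with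
    | 0 => if sort_dec s s' then Var s' 0 else tsubst (shift s) (u s' 0)
    | S m => tsubst (shift s) (u s' (if sort_dec s s' then m else n))
    end.

Definition cast L (s s' : sort L) (e : s = s') (t : term s) : term s' :=
  match e in _ = s0 return term s0 with eq_refl => t end.

(* Instantiates index 0 of sort [s] and lowers the other indices of sort [s]. *)
Definition inst L (s : sort L) (t : term s) : sub L :=
  fun s' n =>
    match sort_dec s s' with
    | left e => match n with 0 => cast e t | S m => Var s' m end
    | right _ => Var s' n
    end.

(* Replaces index 0 of sort [s] and keeps all other variables. *)
Definition repl L (s : sort L) (t : term s) : sub L :=
  fun s' n =>
    match sort_dec s s' with
    | left e => match n with 0 => cast e t | S _ => Var s' n end
    | right _ => Var s' n
    end.

Fixpoint fsubst L (u : sub L) (A : form L) : form L :=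
  match A with
  | Rel r a => Rel r (asubst u a)
  | Bot => Bot
  | Imp A B => Imp (fsubst u A) (fsubst u B)
  | And A B => And (fsubst u A) (fsubst u B)
  | Or A B => Or (fsubst u A) (fsubst u B)
  | All s A => All s (fsubst (up s u) A)
  | Ex s A => Ex s (fsubst (up s u) A)
  end.

Definition closed_term L (s : sort L) (t : term s) : Prop :=
  forall u : sub L, tsubst u t = t.

(* Classical natural deduction from the axioms [T]. Rule [p_all_i] does not
   touch [T]: axioms with free variables stand for their universal closures. *)
Inductive prv (L : language) (T : form L -> Prop) :
    list (form L) -> form L -> Prop :=
| p_ax G A : T A -> prv T G A
| p_hyp G A : In A G -> prv T G A
| p_imp_i G A B : prv T (A :: G) B -> prv T G (Imp A B)
| p_imp_e G A B : prv T G (Imp A B) -> prv T G A -> prv T G B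
| p_and_i G A B : prv T G A -> prv T G B -> prv T G (And A B)
| p_and_e1 G A B : prv T G (And A B) -> prv T G A
| p_and_e2 G A B : prv T G (And A B) -> prv T G B
| p_or_i1 G A B : prv T G A -> prv T G (Or A B)
| p_or_i2 G A B : prv T G B -> prv T G (Or A B)
| p_or_e G A B C :
    prv T G (Or A B) -> prv T (A :: G) C -> prv T (B :: G) C -> prv T G C
| p_raa G A : prv T (Not A :: G) Bot -> prv T G A
| p_all_i G s A : prv T (map (fsubst (shift s)) G) A -> prv T G (All s A)
| p_all_e G s A (t : term s) : prv T G (All s A) -> prv T G (fsubst (inst t) A)
| p_ex_i G s A (t : term s) : prv T G (fsubst (inst t) A) -> prv T G (Ex s A)
| p_ex_e G s A B :
    prv T G (Ex s A) ->
    prv T (A :: map (fsubst (shift s)) G) (fsubst (shift s) B) -> prv T G B.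

(** * Writing formulas with named binders

   An [hterm] or [hform] waits for the number of enclosing quantifiers of each
   sort. The variable bound by [hall] or [hex] is passed to its body as a de
   Bruijn level and becomes an index where it is used, so substituting an
   [hterm] under binders never captures. *)

Definition depth (L : language) := sort L -> nat.
Definition hterm (L : language) (s : sort L) := depth L -> term s.
Definition hform (L : language) := depth L -> form L.

Definition push L (s : sort L) (d : depth L) : depth L :=
  fun s' => if sort_dec s s' then S (d s') else d s'.

Definition level L (s : sort L) (l : nat) : hterm s :=
  fun d => Var s (d s - S l).

Definition hbot L : hform L := fun _ => Bot.
Definition himp L (A B : hform L) : hform L := fun d => Imp (A d) (B d).
Definition hand L (A B : hform L) : hform L := fun d => And (A d) (B d).
Definition hor L (A B : hform L) : hform L := fun d => Or (A d) (B d).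
Definition hall L (s : sort L) (A : hterm s -> hform L) : hform L :=
  fun d => All s (A (level s (d s)) (push s d)).
Definition hex L (s : sort L) (A : hterm s -> hform L) : hform L :=
  fun d => Ex s (A (level s (d s)) (push s d)).
Definition hconst L (s : sort L) (t : term s) : hterm s := fun _ => t.

Definition sentence L (A : hform L) : form L := A (fun _ => 0).

Definition provable L (T : form L -> Prop) (A : hform L) : Prop :=
  prv T nil (sentence A).

Declare Scope fml_scope.
Delimit Scope fml_scope with fml.
Bind Scope fml_scope with hform.
Open Scope fml_scope.

Notation "[~] A" := (himp A (@hbot _)) (at level 35, right associativity) : fml_scope.
Notation "A [/\] B" := (hand A B) (at level 41, right associativity) : fml_scope.
Notation "A [\/] B" := (hor A B) (at level 46, right associativity) : fml_scope.
Notation "A [->] B" := (himp A B) (at level 61, right associativity) : fml_scope.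
Notation "A [<->] B" := (hand (himp A B) (himp B A)) (at level 65, no associativity) : fml_scope.

(** * Arithmetical vocabulary

   The formulas below are written once and for all for any language with a sort
   of numbers and a sort of sets, so that they can be read both in the language
   of RCA_0 and in that of RCA_0^omega. *)

Class arith (L : language) := Arith {
  num : sort L;
  set : sort L;
  zero : hterm num;
  one : hterm num;
  plus : hterm num -> hterm num -> hterm num;
  times : hterm num -> hterm num -> hterm num;
  eqn : hterm num -> hterm num -> hform L;
  ltn : hterm num -> hterm num -> hform L;
  mem : hterm num -> hterm set -> hform L }.

Infix "[+]" := plus (at level 25, left associativity) : fml_scope.
Infix "[*]" := times (at level 23, left associativity) : fml_scope.
Infix "[=]" := eqn (at level 30, no associativity) : fml_scope.
Infix "[<]" := ltn (at level 30, no associativity) : fml_scope.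
Infix "[in]" := mem (at level 30, no associativity) : fml_scope.
(* Lower case quantifies over numbers, upper case over sets. *)
Notation "[all] x .. y , A" := (@hall _ num (fun x => .. (@hall _ num (fun y => A)) ..))
  (at level 200, x binder, y binder, right associativity) : fml_scope.
Notation "[ex] x .. y , A" := (@hex _ num (fun x => .. (@hex _ num (fun y => A)) ..))
  (at level 200, x binder, y binder, right associativity) : fml_scope.
Notation "[ALL] X .. Y , A" := (@hall _ set (fun X => .. (@hall _ set (fun Y => A)) ..))
  (at level 200, X binder, Y binder, right associativity) : fml_scope.
Notation "[EX] X .. Y , A" := (@hex _ set (fun X => .. (@hex _ set (fun Y => A)) ..))
  (at level 200, X binder, Y binder, right associativity) : fml_scope.

Section Arithmetic.
Context {L : language} {V : arith L}.
Implicit Types x y z i n : hterm (num (L := L)).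
Implicit Types X Y Z F S : hterm (set (L := L)).

Definition two : hterm num := one [+] one.
Definition three : hterm num := two [+] one.

Definition le x y : hform L := x [<] y [+] one.

(* The pairing (x+y)^2 + x. *)
Definition pair x y : hterm num := (x [+] y) [*] (x [+] y) [+] x.

(* Goedel's beta function: x is the remainder of c modulo 1 + (i+1)d. *)
Definition beta c d i x : hform L :=
  x [<] one [+] (i [+] one) [*] d [/\]
  ([ex] q, c [=] q [*] (one [+] (i [+] one) [*] d) [+] x).

(* m = 2^n *)
Definition pow2 n m : hform L :=
  [ex] c d, beta c d zero one [/\]
    ([all] i x, i [<] n [->] beta c d i x [->] beta c d (i [+] one) (x [+] x)) [/\]
    beta c d n m.

(* F is (the graph of) a function from N to N. *)
Definition function F : hform L :=
  ([all] z, z [in] F [->] [ex] x y, z [=] pair x y) [/\]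
  ([all] x, [ex] y, pair x y [in] F [/\] ([all] z, pair x z [in] F [->] z [=] y)).

(** ** The principles *)

(* The code <p, q> stands for the rational p / (q+1). A set X codes a sequence
   of rationals in [0,1] if it is a function all of whose values are codes of
   such rationals. *)
Definition bw_instance X : hform L :=
  function X [/\]
  ([all] i c, pair i c [in] X [->]
     [ex] p q, c [=] pair p q [/\] le p (q [+] one)).

(* |p/(q+1) - p'/(q'+1)| < 2^-n *)
Definition rat_close n p q p' q' : hform L :=
  [ex] m, pow2 n m [/\]
    m [*] p [*] (q' [+] one) [<]
      m [*] p' [*] (q [+] one) [+] (q [+] one) [*] (q' [+] one) [/\]
    m [*] p' [*] (q [+] one) [<]
      m [*] p [*] (q' [+] one) [+] (q [+] one) [*] (q' [+] one).

Definition strictly_monotone F : hform L :=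
  [all] v w a b, v [<] w [->] pair v a [in] F [->] pair w b [in] F [->] a [<] b.

(* y_{f(v)} is the rational p/(q+1). *)
Definition subseq_value X F v p q : hform L :=
  [ex] a, pair v a [in] F [/\] pair a (pair p q) [in] X.

Definition bw_weak X : hform L :=
  [EX] F, function F [/\] strictly_monotone F [/\]
    [all] n, [ex] s, [all] v w, le s v [->] le s w [->]
      [all] p q p' q', subseq_value X F v p q [->] subseq_value X F w p' q' [->]
        rat_close n p q p' q'.

(* Any set Y codes a sequence of sets, with R_i = {j | <i,j> in Y}; every set is
   therefore an instance of StCOH. *)
Definition strongly_cohesive Y S : hform L :=
  [all] n, [ex] s, [all] i, i [<] n [->]
    ([all] j, le s j [->] j [in] S [->] pair i j [in] Y) [\/]
    ([all] j, le s j [->] j [in] S [->] [~] pair i j [in] Y).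

Definition infinite S : hform L := [all] m, [ex] j, m [<] j [/\] j [in] S.

Definition stcoh Y : hform L :=
  [EX] S, infinite S [/\] strongly_cohesive Y S.

(** ** Oracle Turing machines

   A machine has k two-way infinite work tapes over {0,1}, with 0 the blank, and
   a read-only one-way infinite oracle tape whose cell h carries the truth value
   of h in X. Every state acts on one tape. The program is the table
   P(j) = beta c d j, and the number of the machine is <k, <c, d>>:
   - P(3q) is the tape on which state q acts: 0 is the oracle tape and i+1 is
     the work tape i < k;
   - P(3q+1+s) = <<w, m>, q'> is the action of state q on scanned symbol s: print
     w, move the head left (m = 0), right (m = 1) or not at all (m > 1), and
     enter state q'.
   As remainders of c, all states q' are at most c, so the machine is finite.
   State 2 is the initial state, states 0 and 1 are the rejecting and accepting
   halting states.

   A work tape is represented by (l, r): the binary digits of r are the symbols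
   from the scanned cell on to the right, those of l the symbols from the cell
   left of the head on to the left. A run is a beta-coded table (a, b) with, at
   time t, the state in slot 0, the oracle head in slot 1 and (l, r) of the work
   tape i in the slots 2i+2 and 2i+3. *)

Definition slot a b t j x : hform L := beta a b (pair t j) x.
Definition lslot i : hterm num := two [*] i [+] two.
Definition rslot i : hterm num := two [*] i [+] three.

Definition unchanged a b t j : hform L :=
  [ex] x, slot a b t j x [/\] slot a b (t [+] one) j x.

Definition oracle_step c d k X a b t : hform L :=
  [ex] q h s w m q' h',
    slot a b t zero q [/\] beta c d (three [*] q) zero [/\]
    slot a b t one h [/\]
    (h [in] X [/\] s [=] one [\/] ([~] h [in] X) [/\] s [=] zero) [/\]
    beta c d (three [*] q [+] one [+] s) (pair (pair w m) q') [/\]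
    slot a b (t [+] one) zero q' [/\]
    slot a b (t [+] one) one h' [/\]
    (m [=] zero [/\] (h [=] h' [+] one [\/] h [=] zero [/\] h' [=] zero) [\/]
     m [=] one [/\] h' [=] h [+] one [\/]
     one [<] m [/\] h' [=] h) [/\]
    ([all] i, i [<] k [->]
       unchanged a b t (lslot i) [/\] unchanged a b t (rslot i)).

Definition work_step c d k a b t : hform L :=
  [ex] q i l r s w m q' l' r',
    slot a b t zero q [/\] beta c d (three [*] q) (i [+] one) [/\] i [<] k [/\]
    slot a b t (lslot i) l [/\]
    slot a b t (rslot i) (two [*] r [+] s) [/\] s [<] two [/\]
    beta c d (three [*] q [+] one [+] s) (pair (pair w m) q') [/\] w [<] two [/\]
    slot a b (t [+] one) zero q' [/\]
    slot a b (t [+] one) (lslot i) l' [/\]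
    slot a b (t [+] one) (rslot i) r' [/\]
    (m [=] zero [/\]
       ([ex] x, x [<] two [/\] l [=] two [*] l' [+] x [/\]
          r' [=] two [*] (two [*] r [+] w) [+] x) [\/]
     m [=] one [/\] l' [=] two [*] l [+] w [/\] r' [=] r [\/]
     one [<] m [/\] l' [=] l [/\] r' [=] two [*] r [+] w) [/\]
    unchanged a b t one [/\]
    ([all] j, j [<] k [->] ([~] j [=] i) [->]
       unchanged a b t (lslot j) [/\] unchanged a b t (rslot j)).

(* On input n the heads are at the origin, the work tape 0 carries a block of n
   ones from the scanned cell on (r = 2^n - 1), and the other work tapes are
   blank. *)
Definition initial k n a b : hform L :=
  slot a b zero zero two [/\] slot a b zero one zero [/\]
  ([all] i, i [<] k [->] slot a b zero (lslot i) zero [/\]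
     [ex] x, slot a b zero (rslot i) x [/\]
       (i [=] zero [/\] pow2 n (x [+] one) [\/] ([~] i [=] zero) [/\] x [=] zero)).

(* Machine e with oracle X halts on input n in state v, for v in {0,1}. *)
Definition halts e X n v : hform L :=
  [ex] k c d, e [=] pair k (pair c d) [/\]
    [ex] T a b, initial k n a b [/\]
      ([all] t, t [<] T [->]
         ([ex] q, slot a b t zero q [/\] one [<] q) [/\]
         (oracle_step c d k X a b t [\/] work_step c d k a b t)) [/\]
      slot a b T zero v.

(* {e}^X is total and is the set Z. *)
Definition computes e X Z : hform L :=
  [all] n, (n [in] Z [->] halts e X n one) [/\]
           (([~] n [in] Z) [->] halts e X n zero).

End Arithmetic.

(** * RCA_0 *)

Inductive sort2 := Num | Set2.
Inductive fsym2 := FZero | FOne | FPlus | FTimes.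
Inductive rsym2 := REq | RLt | RIn.

Definition sort2_dec (s s' : sort2) : {s = s'} + {s <> s'}.
Proof. decide equality. Defined.

Definition L2 : language := {|
  sort := sort2;
  sort_dec := sort2_dec;
  fsym := fsym2;
  fdom f := match f with FZero | FOne => [] | FPlus | FTimes => [Num; Num] end;
  fcod f := Num;
  rsym := rsym2;
  rdom r := match r with REq | RLt => [Num; Num] | RIn => [Num; Set2] end |}.

Notation nterm := (@term L2 Num).
Notation sterm := (@term L2 Set2).

Definition Zero : nterm := Fun (FZero : fsym L2) ANil.
Definition One : nterm := Fun (FOne : fsym L2) ANil.
Definition Plus (t u : nterm) : nterm :=
  Fun (FPlus : fsym L2) (ACons t (ACons u ANil)).
Definition Times (t u : nterm) : nterm :=
  Fun (FTimes : fsym L2) (ACons t (ACons u ANil)).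
Definition Eq2 (t u : nterm) : form L2 :=
  Rel (REq : rsym L2) (ACons t (ACons u ANil)).
Definition Lt2 (t u : nterm) : form L2 :=
  Rel (RLt : rsym L2) (ACons t (ACons u ANil)).
Definition In2 (t : nterm) (X : sterm) : form L2 :=
  Rel (RIn : rsym L2) (ACons t (ACons X ANil)).

#[export] Instance arith2 : arith L2 := {|
  num := Num : sort L2;
  set := Set2 : sort L2;
  zero := fun _ => Zero;
  one := fun _ => One;
  plus t u := fun d => Plus (t d) (u d);
  times t u := fun d => Times (t d) (u d);
  eqn t u := fun d => Eq2 (t d) (u d);
  ltn t u := fun d => Lt2 (t d) (u d);
  mem t X := fun d => In2 (t d) (X d) |}.

Definition shift_num : sub L2 := shift (Num : sort L2).
Definition shift_set : sub L2 := shift (Set2 : sort L2).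

Inductive bounded : form L2 -> Prop :=
| b_rel r a : bounded (Rel r a)
| b_bot : bounded Bot
| b_imp A B : bounded A -> bounded B -> bounded (Imp A B)
| b_and A B : bounded A -> bounded B -> bounded (And A B)
| b_or A B : bounded A -> bounded B -> bounded (Or A B)
| b_all (t : nterm) A : bounded A ->
    bounded (All (Num : sort L2) (Imp (Lt2 (Var _ 0) (tsubst shift_num t)) A))
| b_ex (t : nterm) A : bounded A ->
    bounded (Ex (Num : sort L2) (And (Lt2 (Var _ 0) (tsubst shift_num t)) A)).

Inductive sigma1 : form L2 -> Prop :=
| sigma1_ex A : bounded A -> sigma1 (Ex (Num : sort L2) A).
Inductive pi1 : form L2 -> Prop :=
| pi1_all A : bounded A -> pi1 (All (Num : sort L2) A).

Definition x0 : nterm := @Var L2 Num 0.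
Definition X0 : sterm := @Var L2 Set2 0.

Inductive RCA0 : form L2 -> Prop :=
| eq_refl2 (t : nterm) : RCA0 (Eq2 t t)
| eq_leibniz2 (t u : nterm) A :
    RCA0 (Imp (Eq2 t u) (Imp (fsubst (inst t) A) (fsubst (inst u) A)))
| ax_succ_neq0 : RCA0 (sentence ([all] n, [~] n [+] one [=] zero))
| ax_succ_inj : RCA0 (sentence ([all] m n, m [+] one [=] n [+] one [->] m [=] n))
| ax_add0 : RCA0 (sentence ([all] m, m [+] zero [=] m))
| ax_addS : RCA0 (sentence ([all] m n, m [+] (n [+] one) [=] m [+] n [+] one))
| ax_mul0 : RCA0 (sentence ([all] m, m [*] zero [=] zero))
| ax_mulS : RCA0 (sentence ([all] m n, m [*] (n [+] one) [=] m [*] n [+] m))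
| ax_lt0 : RCA0 (sentence ([all] m, [~] m [<] zero))
| ax_ltS : RCA0 (sentence
    ([all] m n, m [<] n [+] one [<->] m [<] n [\/] m [=] n))
| sigma1_induction A : sigma1 A ->
    RCA0 (Imp (And (fsubst (inst Zero) A)
                   (All (Num : sort L2) (Imp A (fsubst (repl (Plus x0 One)) A))))
              (All (Num : sort L2) A))
| delta1_comprehension A B : sigma1 A -> pi1 B ->
    RCA0 (Imp (All (Num : sort L2) (Iff A B))
              (Ex (Set2 : sort L2)
                 (All (Num : sort L2) (Iff (In2 x0 X0) (fsubst shift_set A))))).

(** * RCA_0^omega

   The restricted extensional arithmetic in all finite types (only the recursor
   R_0 of type 0 and quantifier-free induction) together with QF-AC^{1,0}. Its
   closed terms denote the primitive recursive functionals in the sense of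
   Kleene. The only primitive equality is that of numbers. *)

Inductive ty := N0 | Arr (s t : ty).
Notation "s ~> t" := (Arr s t) (at level 55, right associativity).
Notation N1 := (N0 ~> N0).

Inductive fsymw :=
| WZero | WSucc
| WPi (s t : ty)
| WSigma (r s t : ty)
| WRec
| WApp (s t : ty).

Inductive rsymw := WEq.

Definition ty_dec (s t : ty) : {s = t} + {s <> t}.
Proof. decide equality. Defined.

Definition Lw : language := {|
  sort := ty;
  sort_dec := ty_dec;
  fsym := fsymw;
  fdom f := match f with WApp s t => [s ~> t; s] | _ => [] end;
  fcod f :=
    match f with
    | WZero => N0
    | WSucc => N1
    | WPi s t => s ~> t ~> s
    | WSigma r s t => (r ~> s ~> t) ~> (r ~> s) ~> r ~> t
    | WRec => N0 ~> N0 ~> (N0 ~> N0 ~> N0) ~> N0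
    | WApp s t => t
    end;
  rsym := rsymw;
  rdom _ := [N0; N0] |}.

Notation wterm := (@term Lw).
Notation whterm := (@hterm Lw).

Definition App (s t : ty) (f : wterm (s ~> t)) (x : wterm s) : wterm t :=
  Fun (WApp s t : fsym Lw) (ACons f (ACons x ANil)).
Definition Eqw (t u : wterm N0) : form Lw :=
  Rel (WEq : rsym Lw) (ACons t (ACons u ANil)).

Definition happ (s t : ty) (f : whterm (s ~> t)) (x : whterm s) : whterm t :=
  fun d => App (f d) (x d).
Infix "[@]" := happ (at level 20, left associativity) : fml_scope.

Definition wzero : whterm N0 := fun _ => Fun (WZero : fsym Lw) ANil.
Definition wsucc : whterm N1 := fun _ => Fun (WSucc : fsym Lw) ANil.
Definition wpi (s t : ty) : whterm (s ~> t ~> s) :=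
  fun _ => Fun (WPi s t : fsym Lw) ANil.
Definition wsigma (r s t : ty) :
    whterm ((r ~> s ~> t) ~> (r ~> s) ~> r ~> t) :=
  fun _ => Fun (WSigma r s t : fsym Lw) ANil.
Definition wrec : whterm (N0 ~> N0 ~> (N0 ~> N0 ~> N0) ~> N0) :=
  fun _ => Fun (WRec : fsym Lw) ANil.
Definition weq (t u : whterm N0) : hform Lw := fun d => Eqw (t d) (u d).

Definition wcomp (r s t : ty) (g : whterm (s ~> t)) (f : whterm (r ~> s)) :
    whterm (r ~> t) :=
  wsigma r s t [@] (wpi (s ~> t) r [@] g) [@] f.

(* \x y. f x *)
Definition wweak (f : whterm N1) : whterm (N0 ~> N0 ~> N0) :=
  wcomp (wpi N0 N0) f.

(* x + y = R y x (\a b. S a) *)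
Definition wplus (x y : whterm N0) : whterm N0 :=
  wrec [@] y [@] x [@] wweak wsucc.

(* \a. a + x *)
Definition wadd (x : whterm N0) : whterm N1 :=
  wsigma N0 (N0 ~> N0 ~> N0) N0 [@] (wrec [@] x) [@]
    (wpi (N0 ~> N0 ~> N0) N0 [@] wweak wsucc).

(* x * y = R y 0 (\a b. a + x) *)
Definition wtimes (x y : whterm N0) : whterm N0 :=
  wrec [@] y [@] wzero [@] wweak (wadd x).

(* A function of type 1 represents the set of the numbers where it does not
   vanish. *)
#[export] Instance arithw : arith Lw := {|
  num := N0 : sort Lw;
  set := N1 : sort Lw;
  zero := wzero;
  one := wsucc [@] wzero;
  plus := wplus;
  times := wtimes;
  eqn := weq;
  ltn t u := hex (L := Lw) (s := N0) (fun z => weq (wplus t (wsucc [@] z)) u);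
  mem t X := himp (weq (X [@] t) wzero) (@hbot Lw) |}.

(* Extensional equality at all types. *)
Fixpoint weq_at (s : ty) : whterm s -> whterm s -> hform Lw :=
  match s with
  | N0 => weq
  | Arr r t => fun f g =>
      hall (L := Lw) (s := r) (fun x => weq_at (f [@] x) (g [@] x))
  end.

Definition wall (s : ty) (A : whterm s -> hform Lw) : hform Lw :=
  hall (L := Lw) (s := s) A.

Inductive qfree : form Lw -> Prop :=
| q_rel r a : qfree (Rel r a)
| q_bot : qfree Bot
| q_imp A B : qfree A -> qfree B -> qfree (Imp A B)
| q_and A B : qfree A -> qfree B -> qfree (And A B)
| q_or A B : qfree A -> qfree B -> qfree (Or A B).

Definition wvar (s : ty) (n : nat) : wterm s := @Var Lw s n.

Inductive RCA0w : form Lw -> Prop :=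
| eq_reflw (t : wterm N0) : RCA0w (Eqw t t)
| eq_leibnizw (t u : wterm N0) A :
    RCA0w (Imp (Eqw t u) (Imp (fsubst (inst t) A) (fsubst (inst u) A)))
| ax_wsucc_neq0 : RCA0w (sentence
    (wall (fun x : whterm N0 => [~] weq (wsucc [@] x) wzero)))
| ax_wsucc_inj : RCA0w (sentence
    (wall (fun x : whterm N0 => wall (fun y : whterm N0 =>
       weq (wsucc [@] x) (wsucc [@] y) [->] weq x y))))
| ax_wpi s t : RCA0w (sentence
    (wall (fun x : whterm s => wall (fun y : whterm t =>
       weq_at (wpi s t [@] x [@] y) x))))
| ax_wsigma r s t : RCA0w (sentence
    (wall (fun x : whterm (r ~> s ~> t) => wall (fun y : whterm (r ~> s) =>
     wall (fun z : whterm r =>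
       weq_at (wsigma r s t [@] x [@] y [@] z) (x [@] z [@] (y [@] z)))))))
| ax_wrec0 : RCA0w (sentence
    (wall (fun y : whterm N0 => wall (fun z : whterm (N0 ~> N0 ~> N0) =>
       weq (wrec [@] wzero [@] y [@] z) y))))
| ax_wrecS : RCA0w (sentence
    (wall (fun x : whterm N0 => wall (fun y : whterm N0 =>
     wall (fun z : whterm (N0 ~> N0 ~> N0) =>
       weq (wrec [@] (wsucc [@] x) [@] y [@] z)
           (z [@] (wrec [@] x [@] y [@] z) [@] x))))))
| extensionality s t : RCA0w (sentence
    (wall (fun z : whterm (s ~> t) => wall (fun x : whterm s =>
     wall (fun y : whterm s =>
       weq_at x y [->] weq_at (z [@] x) (z [@] y))))))
| qf_induction A : qfree A ->
    RCA0w (Imp (And (fsubst (inst (wzero (fun _ => 0))) A)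
                    (All (N0 : sort Lw)
                       (Imp A (fsubst (repl (App (wsucc (fun _ => 0)) (wvar N0 0))) A))))
               (All (N0 : sort Lw) A))
(* forall f^1 exists x^0 A(f,x) -> exists F^2 forall f^1 A(f, F f) *)
| qf_ac10 A : qfree A ->
    RCA0w (Imp (All (N1 : sort Lw) (Ex (N0 : sort Lw) A))
               (Ex (N1 ~> N0 : sort Lw) (All (N1 : sort Lw)
                  (fsubst (inst (App (wvar (N1 ~> N0) 0) (wvar N1 0)))
                     (fsubst (shift (N1 ~> N0 : sort Lw)) A))))).

(* The closed terms of type 1 -> 1. *)
Definition primrec_functional (t : wterm (N1 ~> N1)) : Prop := closed_term t.

(* Main.v *)
(* By completeness it suffices to argue in an arbitrary model.

   Given a sequence y of rationals coded by X, put u into R_<b,c> if the value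
   y_i found in the largest element <i, y_i> of X up to u is less than b/(c+1).
   A set that is strongly cohesive for these R decides, from some stage on, the
   comparisons with all a/2^n for a <= 2^n, hence yields indices along which y
   stays in an interval of length 2^-n; this gives a Cauchy subsequence. The set
   R is computed by a bounded search, which is why only largest elements of
   initial segments of X are used.

   Conversely, given sets R_i, let y_j be the rational with the base 4 digits
   [j in R_0], ..., [j in R_(j-1)]. Since the digits are 0 and 1, two such
   numbers at distance less than 4^-n / 2 agree in the first n digits, so the
   range of a Cauchy subsequence is strongly cohesive.

   Both instances are computed by counter programs, which are compiled into
   machines. In a model of RCA_0^omega the objects of type 1 are the sets of a
   model of RCA_0, with Sigma_1 induction and Delta_1 comprehension coming from
   QF-AC; since both instances are primitive recursive in the given set, they
   are the values of closed terms that do not depend on the model. *)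
From Stdlib Require Import List Arith Lia Eqdep_dec Cantor ClassicalEpsilon FunctionalExtensionality PropExtensionality ProofIrrelevance Ring.
From HB Require Import structures.
From mathcomp Require Import ssreflect ssrfun ssrbool eqtype choice order ssralg ssrnum lra.
Require Import Defs.
Import ListNotations.
Set Implicit Arguments.
Unset Strict Implicit.
Unset Printing Implicit Defensive.

(** * Completeness of many-sorted natural deduction *)

(* The models may be nonstandard, and every count made inside one of them, such as the running time
   of a machine or the number of rounds of a loop, is an arbitrary element of the model. The counter
   programs are finite objects of the metatheory, but their runs have to be coded by the beta
   function and established by Sigma-1 induction inside the model. This is why functions of the
   metatheory come with proofs that their graphs are Sigma-1. The bounded search of the first
   reduction is forced: from the graph X no primitive recursive functional can find y_i, because
   nothing bounds the denominators. Looking back from u to the last entry met replaces the lookup,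
   at the price that a member u of the cohesive set stands for some index and not for a prescribed
   one. For the functionals the order of the quantifiers is the obstacle: the term comes before the
   model. Arithmetic is therefore rebuilt with combinators over the family of all models at once,
   and functions that were obtained by choice inside a model are recognized in it through their
   recursion equations. *)
Scheme term_mut := Induction for term Sort Prop
  with args_mut := Induction for args Sort Prop.
Combined Scheme term_args_ind from term_mut, args_mut.

(** * Substitution calculus and supports of formulas *)

Section Syntax.
Variable L : language.
Implicit Types (u v w : sub L) (A B : form L) (G : list (form L)).

Lemma sort_dec_refl (s : sort L) : sort_dec s s = left Logic.eq_refl.
Proof.
case: (sort_dec s s) => [e|//]; f_equal; apply: UIP_dec; exact: sort_dec.
Qed.

Lemma sub_ext u v : (forall s n, u s n = v s n) -> u = v.
Proof.
move=> H; apply: functional_extensionality_dep => s.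
by apply: functional_extensionality => n.
Qed.

Definition ids : sub L := fun s n => Var s n.
Definition comp u v : sub L := fun s n => tsubst u (v s n).
Definition scons (s : sort L) (t : term s) u : sub L :=
  fun s' n =>
    match sort_dec s s' with
    | left e => match n with 0 => cast e t | S m => u s' m end
    | right _ => u s' n
    end.

Lemma subst_comp_mut u v :
  (forall s (t : term s), tsubst u (tsubst v t) = tsubst (comp u v) t) /\
  (forall l (a : args l), asubst u (asubst v a) = asubst (comp u v) a).
Proof. apply: term_args_ind => //= [f a ->|s l t -> a ->] //. Qed.

Lemma tsubst_comp u v s (t : term s) :
  tsubst u (tsubst v t) = tsubst (comp u v) t.
Proof. exact: (proj1 (subst_comp_mut u v)). Qed.
Lemma asubst_comp u v l (a : args l) :
  asubst u (asubst v a) = asubst (comp u v) a.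
Proof. exact: (proj2 (subst_comp_mut u v)). Qed.

Lemma subst_id_mut :
  (forall s (t : term s), tsubst ids t = t) /\
  (forall l (a : args l), asubst ids a = a).
Proof. apply: term_args_ind => //= [f a ->|s l t -> a ->] //. Qed.

Lemma up_shift u s : comp (up s u) (shift s) = comp (shift s) u.
Proof.
apply: sub_ext => s' n; rewrite /comp /shift /= /up.
by case: (sort_dec s s') => e; case: n.
Qed.

Lemma up_comp u v s : comp (up s u) (up s v) = up s (comp u v).
Proof.
apply: sub_ext => s' n; rewrite {1}/comp /up /=.
case: n => [|n]; case E: (sort_dec s s') => [e|e] /=; rewrite ?E //.
all: by rewrite !tsubst_comp up_shift.
Qed.

Lemma up_id s : up s ids = ids.
Proof.
apply: sub_ext => s' n; rewrite /up /ids /= /shift.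
by case: n => [|n]; case: (sort_dec s s').
Qed.

Lemma fsubst_comp A : forall u v, fsubst u (fsubst v A) = fsubst (comp u v) A.
Proof.
elim: A => //= [r a|A IA B IB|A IA B IB|A IA B IB|s A IA|s A IA] u v.
- by rewrite asubst_comp.
- by rewrite IA IB.
- by rewrite IA IB.
- by rewrite IA IB.
- by rewrite IA up_comp.
- by rewrite IA up_comp.
Qed.

Lemma fsubst_id A : fsubst ids A = A.
Proof.
elim: A => //= [r a|A -> B ->|A -> B ->|A -> B ->|s A IA|s A IA] //.
- by rewrite (proj2 subst_id_mut).
- by rewrite up_id IA.
- by rewrite up_id IA.
Qed.

Lemma comp_ids u : comp u ids = u.
Proof. by apply: sub_ext. Qed.
Lemma ids_comp u : comp ids u = u.
Proof. by apply: sub_ext => s n; exact: (proj1 subst_id_mut). Qed.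

Lemma inst_scons s (t : term s) : inst t = scons t ids.
Proof. by []. Qed.

Lemma cast_tsubst u s s' (e : s = s') (t : term s) :
  tsubst u (cast e t) = cast e (tsubst u t).
Proof. by case: _ / e. Qed.

Lemma comp_scons u s (t : term s) v :
  comp u (scons t v) = scons (tsubst u t) (comp u v).
Proof.
apply: sub_ext => s' n; rewrite /comp /scons.
case: (sort_dec s s') => e //; case: n => // ; exact: cast_tsubst.
Qed.

Lemma scons_up s (t : term s) u v :
  comp (scons t u) (up s v) = scons t (comp u v).
Proof.
have H : comp (scons t u) (shift s) = u.
  by apply: sub_ext => s' n; rewrite /comp /shift /= /scons; case: (sort_dec s s').
apply: sub_ext => s' n; rewrite /comp /up /=.
case: n => [|n]; rewrite {2}/scons; case E: (sort_dec s s') => [e|e].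
- by rewrite /= /scons E.
- by rewrite tsubst_comp H.
- by rewrite tsubst_comp H.
- by rewrite tsubst_comp H.
Qed.

Lemma scons_shift s (t : term s) u : comp (scons t u) (shift s) = u.
Proof.
by apply: sub_ext => s' n; rewrite /comp /shift /= /scons; case: (sort_dec s s').
Qed.

Lemma inst_up s (t : term s) u A :
  fsubst (inst t) (fsubst (up s u) A) = fsubst (scons t u) A.
Proof. by rewrite fsubst_comp inst_scons scons_up ids_comp. Qed.

Lemma subst_inst s (t : term s) u A :
  fsubst u (fsubst (inst t) A) = fsubst (inst (tsubst u t)) (fsubst (up s u) A).
Proof. by rewrite inst_up fsubst_comp inst_scons comp_scons comp_ids. Qed.

Lemma scons_Var0 s : scons (Var s 0) (shift s) = ids.
Proof.
apply: sub_ext => s' n; rewrite /scons /shift /ids.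
by case: (sort_dec s s') => e //; case: _ / e; case: n.
Qed.

(** A support, a finite list of sorts with one common index bound, over-approximates the free
    variables. It can be kept unchanged under a binder, because lifting preserves agreement. *)
Definition agree (l : list (sort L)) b u v :=
  forall s n, In s l -> n < b -> u s n = v s n.
Definition tsupp s (t : term s) l b :=
  forall u v, agree l b u v -> tsubst u t = tsubst v t.
Definition asupp k (a : args k) l b :=
  forall u v, agree l b u v -> asubst u a = asubst v a.
Definition supp A l b := forall u v, agree l b u v -> fsubst u A = fsubst v A.

Lemma agree_mono l b l' b' u v :
  agree l' b' u v -> incl l l' -> b <= b' -> agree l b u v.
Proof. by move=> H i h s n hs hn; apply: H; [exact: i|lia]. Qed.

Lemma supp_exists_mut :
  (forall s (t : term s), exists l b, tsupp t l b) /\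
  (forall k (a : args k), exists l b, asupp a l b).
Proof.
apply: term_args_ind => [s n|f a [l [b H]]||s k t [l [b H]] a [l' [b' H']]].
- by exists [s], (S n) => u v H /=; apply: H; [left|lia].
- by exists l, b => u v h /=; rewrite (H _ _ h).
- by exists [], 0.
- exists (l ++ l'), (b + b') => u v h /=; rewrite (H u v) ?(H' u v) //.
  + by apply: agree_mono h _ _; [exact: incl_appr (incl_refl _)|lia].
  + by apply: agree_mono h _ _; [exact: incl_appl (incl_refl _)|lia].
Qed.

Lemma agree_up l b u v s : agree l b u v -> agree l b (up s u) (up s v).
Proof.
move=> H s' n hs hn; rewrite /up; case: n hn => [|n] hn.
- by case: (sort_dec s s') => // _; rewrite H.
- by rewrite H //; case: (sort_dec s s') => _; lia.
Qed.

Lemma supp_exists A : exists l b, supp A l b.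
Proof.
elim: A => [r a||A [l [b H]] B [l' [b' H']]|A [l [b H]] B [l' [b' H']]
  |A [l [b H]] B [l' [b' H']]|s A [l [b H]]|s A [l [b H]]].
- have [l [b H]] := proj2 supp_exists_mut _ a.
  by exists l, b => u v h /=; rewrite (H _ _ h).
- by exists [], 0.
1-3: exists (l ++ l'), (b + b') => u v h /=; rewrite (H u v) ?(H' u v) //;
  apply: agree_mono h _ _; try lia;
  first [exact: incl_appl (incl_refl _)|exact: incl_appr (incl_refl _)].
- by exists l, b => u v h /=; rewrite (H _ _ (agree_up s h)).
- by exists l, b => u v h /=; rewrite (H _ _ (agree_up s h)).
Qed.

Lemma supp_exists_list G : exists l b, forall A, In A G -> supp A l b.
Proof.
elim: G => [|A G [l [b H]]]; first by exists [], 0.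
have [l' [b' H']] := supp_exists A.
exists (l ++ l'), (b + b') => C [<-|hC] u v h.
- by apply: H'; apply: agree_mono h _ _; [exact: incl_appr (incl_refl _)|lia].
- by apply: (H _ hC); apply: agree_mono h _ _; [exact: incl_appl (incl_refl _)|lia].
Qed.

(** * Derivability under weakening and substitution *)

Section Derivations.
Variable T : form L -> Prop.

Lemma prv_weaken G A : prv T G A -> forall G', incl G G' -> prv T G' A.
Proof.
have inclS : forall B G G', incl G G' -> incl (B :: G) (B :: G').
  by move=> B G1 G2 h; apply: incl_cons; [left|exact: incl_tl].
have inclM : forall (f : form L -> form L) G G', incl G G' -> incl (map f G) (map f G').
  by move=> f G1 G2 h; exact: incl_map.
elim => {G A}.
- by move=> G A ? ? ?; apply: p_ax.
- by move=> G A ? ? h; apply: p_hyp; exact: h.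
- by move=> G A B _ IH G' h; apply: p_imp_i; apply: IH; exact: inclS.
- by move=> G A B _ IH _ IH' G' h; apply: p_imp_e (IH _ h) (IH' _ h).
- by move=> G A B _ IH _ IH' G' h; apply: p_and_i (IH _ h) (IH' _ h).
- by move=> G A B _ IH G' h; apply: p_and_e1 (IH _ h).
- by move=> G A B _ IH G' h; apply: p_and_e2 (IH _ h).
- by move=> G A B _ IH G' h; apply: p_or_i1 (IH _ h).
- by move=> G A B _ IH G' h; apply: p_or_i2 (IH _ h).
- move=> G A B C _ IH _ IH' _ IH'' G' h.
  by apply: p_or_e (IH _ h) _ _; [apply: IH'|apply: IH'']; exact: inclS.
- by move=> G A _ IH G' h; apply: p_raa; apply: IH; exact: inclS.
- by move=> G s A _ IH G' h; apply: p_all_i; apply: IH; exact: inclM.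
- by move=> G s A t _ IH G' h; apply: p_all_e; exact: IH.
- by move=> G s A t _ IH G' h; apply: (p_ex_i (t := t)); exact: IH.
- move=> G s A B _ IH _ IH' G' h.
  by apply: p_ex_e (IH _ h) _; apply: IH'; apply: inclS; exact: inclM.
Qed.

Fixpoint alls (l : list (sort L)) A :=
  match l with [] => A | s :: l => All s (alls l A) end.
Fixpoint cnt (s : sort L) (l : list (sort L)) :=
  match l with
  | [] => 0
  | s' :: l =>
      match sort_dec s' s with left _ => S (cnt s l) | right _ => cnt s l end
  end.

Lemma prv_alls A l : prv T [] A -> prv T [] (alls l A).
Proof. by elim: l => //= s l IH h; apply: p_all_i; exact: IH. Qed.

Lemma prv_alls_inst u A l : forall w, prv T [] (fsubst w (alls l A)) ->
  exists v, prv T [] (fsubst v A) /\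
    (forall s n, n < cnt s l -> v s n = u s n) /\
    (forall s m, v s (cnt s l + m) = w s m).
Proof.
elim: l => [|s l IH] w /= h; first by exists w; split=> //; split=> // s n; lia.
(* The outermost quantifier over [s] binds the index [cnt s l] of the matrix, the highest one still
   bound. *)
have h' := p_all_e (u s (cnt s l)) h.
rewrite inst_up in h'; have [v [h1 [h2 h3]]] := IH _ h'.
exists v; split=> //; split=> s' n /=.
- case E: (sort_dec s s') => [e|e]; last exact: h2.
  subst s'; move=> hn.
  have [hn'|->] : n < cnt s l \/ n = cnt s l by lia.
    exact: h2.
  have := h3 s 0; rewrite Nat.add_0_r => ->.
  by rewrite /scons sort_dec_refl.
- case E: (sort_dec s s') => [e|e].
  + have -> : S (cnt s' l) + n = cnt s' l + S n by lia.
    by rewrite h3 /scons E.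
  + by rewrite h3 /scons E.
Qed.

(** The axioms need not be closed under substitution, so a substitution cannot be pushed through
    [p_ax]. Instead the variables of the support are generalized and then instantiated. *)
Lemma prv_subst_closed A u : prv T [] A -> prv T [] (fsubst u A).
Proof.
move=> h; have [ls [b H]] := supp_exists A.
(* With [b] quantifiers over each sort of the support, every index that matters gets bound. *)
pose l := flat_map (fun s => repeat s b) ls.
have hl : forall s, In s ls -> b <= cnt s l.
  move=> s; rewrite /l; elim: (ls) => //= s' ls' IH.
  have happ : forall l1 l2, cnt s (l1 ++ l2) = cnt s l1 + cnt s l2.
    by elim=> //= x l1 E l2; case: (sort_dec x s) => _; rewrite E.
  rewrite happ => -[e|/IH]; last lia.
  subst s'; suff -> : cnt s (repeat s b) = b by lia.
  by elim: (b) => //= k ->; rewrite sort_dec_refl.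
have := @prv_alls_inst u A l ids; rewrite fsubst_id.
case; first exact: prv_alls.
move=> v [hv [h1 _]]; rewrite (H u v) // => s n hs hn.
by rewrite h1 //; have := hl _ hs; lia.
Qed.

Lemma prv_subst G A : prv T G A -> forall u, prv T (map (fsubst u) G) (fsubst u A).
Proof.
have mapup : forall s u G, map (fsubst (up s u)) (map (fsubst (shift s)) G) =
    map (fsubst (shift s)) (map (fsubst u) G).
  move=> s u G0; rewrite !map_map; apply: map_ext => B.
  by rewrite !fsubst_comp up_shift.
elim => {G A} /=.
- move=> G A h u; apply: (@prv_weaken [] (fsubst u A)); last by move=> x [].
  by apply: prv_subst_closed; exact: p_ax.
- by move=> G A h u; apply: p_hyp; exact: in_map.
- by move=> G A B _ IH u; apply: p_imp_i; exact: IH.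
- by move=> G A B _ IH _ IH' u; apply: p_imp_e (IH _) (IH' _).
- by move=> G A B _ IH _ IH' u; apply: p_and_i (IH _) (IH' _).
- by move=> G A B _ IH u; apply: p_and_e1 (IH _).
- by move=> G A B _ IH u; apply: p_and_e2 (IH _).
- by move=> G A B _ IH u; apply: p_or_i1 (IH _).
- by move=> G A B _ IH u; apply: p_or_i2 (IH _).
- by move=> G A B C _ IH _ IH' _ IH'' u; apply: p_or_e (IH _) (IH' _) (IH'' _).
- by move=> G A _ IH u; apply: p_raa; exact: IH.
- by move=> G s A _ IH u; apply: p_all_i; rewrite -mapup; exact: IH.
- by move=> G s A t _ IH u; rewrite subst_inst; apply: p_all_e; exact: IH.
- move=> G s A t _ IH u; apply: (p_ex_i (t := tsubst u t)).
  by rewrite -subst_inst; exact: IH.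
- move=> G s A B _ IH _ IH' u; apply: p_ex_e (IH u) _.
  by have := IH' (up s u); rewrite mapup !fsubst_comp up_shift.
Qed.

Lemma ex_falso G A : prv T G Bot -> prv T G A.
Proof. by move=> h; apply: p_raa; apply: prv_weaken h _ _; exact: incl_tl (incl_refl _). Qed.

(* An eigenvariable beyond the support of [G] and [A] can be renamed to the
   fresh index 0 that the rule [p_ex_e] expects. *)
Lemma fresh_witness G s A : In (Ex s A) G -> ~ prv T G Bot ->
  exists y, ~ prv T (fsubst (inst (Var s y)) A :: G) Bot.
Proof.
move=> hin hcon; have [l [b H]] := supp_exists_list (A :: G).
exists b => h; apply: hcon.
pose u : sub L := fun s' n =>
  match sort_dec s s' with
  | left _ => if Nat.eqb n b then Var s' 0 else Var s' (S n)
  | right _ => Var s' n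
  end.
have uE : forall B, In B G -> fsubst u B = fsubst (shift s) B.
  move=> B hB; apply: (H _ (or_intror hB)) => s' n _ hn; rewrite /u /shift.
  case: (sort_dec s s') => // e; case: (Nat.eqb_spec n b) => // ?; lia.
have := prv_subst h u => /= {}h.
apply: p_ex_e (p_hyp _ hin) _; move: h => /=.
have -> : map (fsubst u) G = map (fsubst (shift s)) G by apply: map_ext_in.
suff -> : fsubst u (fsubst (inst (Var s b)) A) = A by [].
rewrite -{2}(fsubst_id A) fsubst_comp; apply: (H _ (or_introl erefl)) => s' n _ hn.
rewrite /comp /inst /u /ids; case E: (sort_dec s s') => [e|e] /=; last by rewrite E.
case: n hn => [|n] hn /=.
- by case: _ / e {E} => /=; rewrite sort_dec_refl Nat.eqb_refl.
- by rewrite E; case: (Nat.eqb_spec n b) => //; lia.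
Qed.

End Derivations.
End Syntax.

(** * Interpretations and satisfaction *)

Fixpoint hl (S : Type) (X : S -> Type) (l : list S) : Type :=
  match l with [] => unit | s :: l => (X s * hl X l)%type end.

Record interp (L : language) := Interp {
  dom : sort L -> Type;
  ifun : forall f : fsym L, hl dom (fdom f) -> dom (fcod f);
  irel : forall r : rsym L, hl dom (rdom r) -> Prop }.

Definition env L (I : interp L) := forall s : sort L, nat -> dom I s.

Definition econs L (I : interp L) (s : sort L) (x : dom I s) (r : env I) : env I :=
  fun s' n =>
    match sort_dec s s' with
    | left e =>
        match n with
        | 0 => match e in _ = s0 return dom I s0 with Logic.eq_refl => x end
        | S m => r s' m
        end
    | right _ => r s' n
    end.

Fixpoint eval L (I : interp L) (r : env I) (s : sort L) (t : term s) : dom I s :=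
  match t with
  | Var s n => r s n
  | Fun f a => ifun (evals r a)
  end
with evals L (I : interp L) (r : env I) (l : list (sort L)) (a : args l) : hl (dom I) l :=
  match a with
  | ANil => tt
  | ACons _ _ t a => (eval r t, evals r a)
  end.

Fixpoint sat L (I : interp L) (r : env I) (A : form L) : Prop :=
  match A with
  | Rel _ a => irel (evals r a)
  | Bot => False
  | Imp A B => sat r A -> sat r B
  | And A B => sat r A /\ sat r B
  | Or A B => sat r A \/ sat r B
  | All s A => forall x : dom I s, sat (econs x r) A
  | Ex s A => exists x : dom I s, sat (econs x r) A
  end.

Section Semantics.
Variables (L : language) (I : interp L).
Implicit Types (r : env I) (u : sub L) (A : form L).

Lemma env_ext (r r' : env I) : (forall s n, r s n = r' s n) -> r = r'.
Proof.
move=> H; apply: functional_extensionality_dep => s.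
by apply: functional_extensionality => n.
Qed.

Lemma eval_subst_mut r u :
  (forall s (t : term s), eval r (tsubst u t) = eval (fun s n => eval r (u s n)) t) /\
  (forall l (a : args l), evals r (asubst u a) = evals (fun s n => eval r (u s n)) a).
Proof. apply: term_args_ind => //= [f a ->|s l t -> a ->] //. Qed.

Lemma eval_subst r u s (t : term s) :
  eval r (tsubst u t) = eval (fun s n => eval r (u s n)) t.
Proof. exact: (proj1 (eval_subst_mut r u)). Qed.

Lemma eval_shift r s (x : dom I s) s' (t : term s') :
  eval (econs x r) (tsubst (shift s) t) = eval r t.
Proof.
rewrite eval_subst; congr (eval _ t); apply: env_ext => s0 n.
by rewrite /shift /= /econs; case: (sort_dec s s0).
Qed.

Lemma econs_up r u s (x : dom I s) :
  (fun s' n => eval (econs x r) (up s u s' n)) =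
  econs x (fun s' n => eval r (u s' n)).
Proof.
apply: env_ext => s' n; rewrite /up.
case: n => [|n]; rewrite {2}/econs; case E: (sort_dec s s') => [e|e];
  rewrite ?eval_shift //= /econs E //.
Qed.

Lemma sat_subst A : forall r u,
  sat r (fsubst u A) <-> sat (fun s n => eval r (u s n)) A.
Proof.
elim: A => [k a||A IA B IB|A IA B IB|A IA B IB|s A IA|s A IA] r u /=.
- by rewrite (proj2 (eval_subst_mut r u)).
- by [].
- by rewrite IA IB.
- by rewrite IA IB.
- by rewrite IA IB.
- by split=> h x; have := h x; rewrite IA econs_up.
- by split=> -[x h]; exists x; move: h; rewrite IA econs_up.
Qed.

Lemma sat_inst r s (t : term s) A :
  sat r (fsubst (inst t) A) <-> sat (econs (eval r t) r) A.
Proof.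
rewrite sat_subst.
have -> : (fun s' n => eval r (inst t s' n)) = econs (eval r t) r; last by [].
apply: env_ext => s' n; rewrite /inst /econs; case: (sort_dec s s') => // e.
by case: n => //; case: _ / e.
Qed.

End Semantics.

Definition models L (T : form L -> Prop) (I : interp L) :=
  forall A, T A -> forall r : env I, sat r A.

(** The logic has no primitive equality. In models where indiscernible elements coincide, a relation
    with a Leibniz scheme becomes the identity. *)
Definition indiscernible L (I : interp L) (s : sort L) (a b : dom I s) :=
  forall (A : form L) (r : env I), sat (econs a r) A -> sat (econs b r) A.

(** Countability as an increasing chain of finite lists, which avoids numeric codes for sorts,
    symbols and terms. *)
Definition lists_all X (e : nat -> list X) :=
  (forall n m, n <= m -> incl (e n) (e m)) /\ (forall x, exists n, In x (e n)).

(** * Enumeration of the formulas of a countable language *)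

Section Enumeration.
Variable L : language.
Variables (es : nat -> list (sort L)) (ef : nat -> list (fsym L)) (er : nat -> list (rsym L)).
Hypotheses (Hs : lists_all es) (Hf : lists_all ef) (Hr : lists_all er).

Fixpoint enum_args (eT : forall s : sort L, list (term s)) (l : list (sort L)) : list (args l) :=
  match l with
  | [] => [ANil]
  | s :: l => flat_map (fun t => map (ACons t) (enum_args eT l)) (eT s)
  end.

Fixpoint enum_term (n : nat) (s : sort L) : list (term s) :=
  match n with
  | 0 => []
  | S n =>
      Var s n :: enum_term n s ++
      flat_map (fun f =>
        match sort_dec (fcod f) s with
        | left e => map (fun a => cast e (Fun f a)) (enum_args (enum_term n) (fdom f))
        | right _ => []
        end) (ef n)
  end.

Lemma enum_term_mono n m s : n <= m -> incl (enum_term n s) (enum_term m s).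
Proof.
elim=> [|k _ IH]; first exact: incl_refl.
by apply: incl_tran IH _ => t ht /=; right; apply/in_or_app; left.
Qed.

Lemma enum_args_mono eT eT' l : (forall s, incl (eT s) (eT' s)) ->
  incl (enum_args eT l) (enum_args eT' l).
Proof.
move=> H; elim: l => [|s l IH] /=; first exact: incl_refl.
move=> a /in_flat_map [t [ht /in_map_iff [a' [<- ha']]]].
apply/in_flat_map; exists t; split; first exact: H.
by apply/in_map_iff; exists a'; split=> //; exact: IH.
Qed.

Lemma enum_term_all :
  (forall s (t : term s), exists n, In t (enum_term n s)) /\
  (forall l (a : args l), exists n, In a (enum_args (enum_term n) l)).
Proof.
apply: term_args_ind => [s n|f a [n H]||s l t [n H] a [m H']].
- by exists (S n); left.
- have [k hk] := proj2 Hf f; exists (S (n + k)); right; apply/in_or_app; right.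
  apply/in_flat_map; exists f; split; first by apply: (proj1 Hf k); [lia|].
  rewrite sort_dec_refl; apply/in_map_iff; exists a; split=> //.
  by apply: enum_args_mono H => s; apply: enum_term_mono; lia.
- by exists 0; left.
- exists (n + m) => /=; apply/in_flat_map; exists t; split.
    by apply: enum_term_mono H; lia.
  apply/in_map_iff; exists a; split=> //.
  by apply: enum_args_mono H' => s'; apply: enum_term_mono; lia.
Qed.

Fixpoint enum_forms (n : nat) : list (form L) :=
  match n with
  | 0 => [Bot]
  | S n =>
      let F := enum_forms n in
      F ++ flat_map (fun r => map (@Rel L r) (enum_args (enum_term n) (rdom r))) (er n)
        ++ flat_map (fun A => flat_map (fun B => [Imp A B; And A B; Or A B]) F) F
        ++ flat_map (fun s => flat_map (fun A => [All s A; Ex s A]) F) (es n)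
  end.

Lemma enum_forms_mono n m : n <= m -> incl (enum_forms n) (enum_forms m).
Proof.
elim=> [|k _ IH]; first exact: incl_refl.
by apply: incl_tran IH _ => t ht /=; apply/in_or_app; left.
Qed.

Lemma enum_forms_all A : exists n, In A (enum_forms n).
Proof.
have bin : forall A B n m, In A (enum_forms n) -> In B (enum_forms m) ->
    exists k, In (Imp A B) (enum_forms k) /\ In (And A B) (enum_forms k) /\
      In (Or A B) (enum_forms k).
  move=> {}A B n m hA hB; exists (S (n + m)).
  have H : forall C, In C [Imp A B; And A B; Or A B] -> In C (enum_forms (S (n + m))).
    move=> C hC; apply/in_or_app; right; apply/in_or_app; right; apply/in_or_app; left.
    apply/in_flat_map; exists A; split; first by apply: enum_forms_mono hA; lia.
    by apply/in_flat_map; exists B; split=> //; apply: enum_forms_mono hB; lia.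
  by split; [|split]; apply: H; [left|right; left|right; right; left].
have qu : forall A s n, In A (enum_forms n) ->
    exists k, In (All s A) (enum_forms k) /\ In (Ex s A) (enum_forms k).
  move=> {}A s n hA; have [k hk] := proj2 Hs s; exists (S (n + k)).
  have H : forall C, In C [All s A; Ex s A] -> In C (enum_forms (S (n + k))).
    move=> C hC; apply/in_or_app; right; apply/in_or_app; right; apply/in_or_app; right.
    apply/in_flat_map; exists s; split; first by apply: (proj1 Hs k); [lia|].
    by apply/in_flat_map; exists A; split=> //; apply: enum_forms_mono hA; lia.
  by split; apply: H; [left|right; left].
elim: A => [r a||A [n hA] B [m hB]|A [n hA] B [m hB]|A [n hA] B [m hB]|s A [n hA]|s A [n hA]].
- have [k hk] := proj2 Hr r; have [m hm] := proj2 enum_term_all _ a.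
  exists (S (k + m)); apply/in_or_app; right; apply/in_or_app; left.
  apply/in_flat_map; exists r; split; first by apply: (proj1 Hr k); [lia|].
  apply/in_map_iff; exists a; split=> //.
  by apply: enum_args_mono hm => s; apply: enum_term_mono; lia.
- by exists 0; left.
- by have [k [h _]] := bin _ _ _ _ hA hB; exists k.
- by have [k [_ [h _]]] := bin _ _ _ _ hA hB; exists k.
- by have [k [_ [_ h]]] := bin _ _ _ _ hA hB; exists k.
- by have [k [h _]] := qu _ s _ hA; exists k.
- by have [k [_ h]] := qu _ s _ hA; exists k.
Qed.

Definition enum_form (k : nat) : form L :=
  let (n, i) := Cantor.of_nat k in nth i (enum_forms n) Bot.

Lemma enum_form_surj A : exists k, enum_form k = A.
Proof.
have [n /(In_nth _ _ Bot) [i [_ hi]]] := enum_forms_all A.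
by exists (Cantor.to_nat (n, i)); rewrite /enum_form Cantor.cancel_of_to.
Qed.
End Enumeration.

Lemma sig_ext X (P : X -> Prop) (a b : sig P) : proj1_sig a = proj1_sig b -> a = b.
Proof.
case: a b => a pa [b pb] /= e; subst b.
by rewrite (proof_irrelevance _ pa pb).
Qed.

(** * Henkin's construction of a term model *)

Section Henkin.
Variables (L : language) (T : form L -> Prop).
Variables (enum : nat -> form L) (enumP : forall A, exists k, enum k = A).
Variable (G0 : list (form L)) (G0_con : ~ prv T G0 Bot).

Definition is_ext (A : form L) (G G' : list (form L)) :=
  incl G G' /\ (~ prv T G Bot -> ~ prv T G' Bot) /\
  (~ prv T (A :: G) Bot -> In A G' /\
     forall s B, A = Ex s B -> exists t : term s, In (fsubst (inst t) B) G').

Lemma ext_exists A G : exists G', is_ext A G G'.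
Proof.
case: (classic (prv T (A :: G) Bot)) => [h|h].
  by exists G; split; [exact: incl_refl|split].
have hG : incl G (A :: G) by apply: incl_tl (incl_refl _).
case: (classic (exists s B, A = Ex s B)) => [[s [B e]]|hn]; last first.
  exists (A :: G); split=> //; split=> // _; split; first by left.
  by move=> s B e; case: hn; exists s, B.
have [|y hy] := @fresh_witness _ T (A :: G) s B _ h; first by rewrite e; left.
exists (fsubst (inst (Var s y)) B :: A :: G); split; first by apply: incl_tl.
split=> // _; split; first by right; left.
move=> s' B'; rewrite e => e'; case: e' => es eB.
by subst s' B'; exists (Var s y); left.
Qed.

Definition ext A G := proj1_sig (constructive_indefinite_description _ (ext_exists A G)).
Lemma extP A G : is_ext A G (ext A G).
Proof. exact: (proj2_sig (constructive_indefinite_description _ (ext_exists A G))). Qed.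

Fixpoint stage n := match n with 0 => G0 | S n => ext (enum n) (stage n) end.

Lemma stage_con n : ~ prv T (stage n) Bot.
Proof. by elim: n => //= n IH; have [_ [h _]] := extP (enum n) (stage n); exact: h. Qed.

Lemma stage_mono n m : n <= m -> incl (stage n) (stage m).
Proof.
elim=> [|k _ IH]; first exact: incl_refl.
by apply: incl_tran IH _; have [h _] := extP (enum k) (stage k).
Qed.

Definition thy A := exists n, prv T (stage n) A.

Lemma thy_prv A B : (forall G, prv T G A -> prv T G B) -> thy A -> thy B.
Proof. by move=> H [n h]; exists n; exact: H. Qed.

Lemma thy_prv2 A B C :
  (forall G, prv T G A -> prv T G B -> prv T G C) -> thy A -> thy B -> thy C.
Proof.
move=> H [n h] [m h']; exists (n + m); apply: H.
- by apply: prv_weaken h _ _; apply: stage_mono; lia.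
- by apply: prv_weaken h' _ _; apply: stage_mono; lia.
Qed.

Lemma thy_con : ~ thy Bot.
Proof. by move=> [n]; exact: stage_con. Qed.

Lemma thy_not A : thy (Not A) <-> ~ thy A.
Proof.
split=> [hn h|h].
  by apply: thy_con; apply: thy_prv2 hn h => G; exact: p_imp_e.
have [k ek] := enumP A; have [_ [_ hk]] := extP (enum k) (stage k).
case: (classic (prv T (A :: stage k) Bot)) => [hb|hb].
  by exists k; exact: p_imp_i.
case: h; exists (S k); apply: p_hyp => /=; rewrite ek in hk *.
by case: (hk hb).
Qed.

Lemma thy_imp A B : thy (Imp A B) <-> (thy A -> thy B).
Proof.
split=> [h hA|h]; first by apply: thy_prv2 h hA => G; exact: p_imp_e.
case: (classic (thy A)) => [/h hx|/thy_not hx]; apply: thy_prv hx => G hG; apply: p_imp_i.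
- by apply: prv_weaken hG _ _; exact: incl_tl (incl_refl _).
- apply: ex_falso; apply: (p_imp_e (A := A)); last by apply: p_hyp; left.
  by apply: prv_weaken hG _ _; exact: incl_tl (incl_refl _).
Qed.

Lemma thy_and A B : thy (And A B) <-> thy A /\ thy B.
Proof.
split=> [h|[h h']]; last by apply: thy_prv2 h h' => G; exact: p_and_i.
by split; apply: thy_prv h => G; [exact: p_and_e1|exact: p_and_e2].
Qed.

Lemma thy_or A B : thy (Or A B) <-> thy A \/ thy B.
Proof.
split=> [h|[h|h]]; [|by apply: thy_prv h => G; exact: p_or_i1|
  by apply: thy_prv h => G; exact: p_or_i2].
apply: NNPP => /Classical_Prop.not_or_and [/thy_not hA /thy_not hB]; apply: thy_con.
have hAB : thy (And (Not A) (Not B)) by apply/thy_and.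
apply: thy_prv2 h hAB => G h1 h2; apply: p_or_e h1 _ _.
- apply: (p_imp_e (A := A)); last by apply: p_hyp; left.
  by apply: p_and_e1; apply: prv_weaken h2 _ _; exact: incl_tl (incl_refl _).
- apply: (p_imp_e (A := B)); last by apply: p_hyp; left.
  by apply: p_and_e2; apply: prv_weaken h2 _ _; exact: incl_tl (incl_refl _).
Qed.

Lemma thy_ex s A : thy (Ex s A) <-> exists t : term s, thy (fsubst (inst t) A).
Proof.
split=> [h|[t h]]; last by apply: thy_prv h => G; exact: p_ex_i.
have [k ek] := enumP (Ex s A); have [_ [_ hk]] := extP (enum k) (stage k).
rewrite {1}ek in hk; case: hk => [hb|_ hk].
  by apply: (proj1 (thy_not (Ex s A))) h; exists k; exact: p_imp_i.
have [t ht] := hk _ _ ek.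
by exists t, (S k); exact: p_hyp.
Qed.

Lemma thy_all s A : thy (All s A) <-> forall t : term s, thy (fsubst (inst t) A).
Proof.
split=> [h t|h]; first by apply: thy_prv h => G; exact: p_all_e.
apply: NNPP => /thy_not hn.
have : thy (Ex s (Not A)).
  apply: thy_prv hn => G hG; apply: p_raa.
  apply: (p_imp_e (A := All s A)).
    by apply: prv_weaken hG _ _; exact: incl_tl (incl_refl _).
  apply: p_all_i; apply: p_raa.
  apply: (p_imp_e (A := Ex s (fsubst (up s (shift s)) (Not A)))).
    by apply: p_hyp; right; left.
  apply: (p_ex_i (t := Var s 0)); rewrite inst_up scons_Var0 fsubst_id.
  by apply: p_hyp; left.
move/thy_ex => [t /thy_not]; exact.
Qed.

Lemma thy_ax A u : T A -> thy (fsubst u A).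
Proof.
move=> h; exists 0; apply: (@prv_weaken _ _ [] _); last by move=> x [].
by apply: prv_subst_closed; exact: p_ax.
Qed.

(** Terms that the theory cannot separate by any formula are identified, so that indiscernible
    elements of the quotient are equal whatever the axioms say about equality. *)
Definition eqv s (t t' : term s) : Prop :=
  forall A, thy (fsubst (inst t) A) <-> thy (fsubst (inst t') A).

Definition cls s := { c : term s -> Prop | exists t, c = @eqv s t }.
Definition class s (t : term s) : cls s := exist _ (@eqv s t) (ex_intro _ t erefl).
Definition rep s (c : cls s) : term s :=
  proj1_sig (constructive_indefinite_description _ (proj2_sig c)).

Lemma classP s (t t' : term s) : class t = class t' <-> eqv t t'.
Proof.
split=> [[e]|h].
- by have : eqv t' t' by []; rewrite -e.
- have e : @eqv s t = @eqv s t'.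
    apply: functional_extensionality => x; apply: propositional_extensionality.
    by split=> hx A; [rewrite -(h A)|rewrite (h A)]; exact: hx.
  exact: sig_ext.
Qed.

Lemma class_rep s (c : cls s) : class (rep c) = c.
Proof.
case: c => c p; rewrite /rep /=.
case: constructive_indefinite_description => t /= e.
by apply: sig_ext.
Qed.

Fixpoint reps l : hl cls l -> args l :=
  match l with
  | [] => fun _ => ANil
  | s :: l => fun v => ACons (rep v.1) (reps v.2)
  end.

Fixpoint classes l (a : args l) : hl cls l :=
  match a with
  | ANil => tt
  | ACons _ _ t a => (class t, classes a)
  end.

(* [K] commutes with substitution, as [a => A(f a)] or [a => R a] do. *)
Definition natural l (K : args l -> form L) :=
  forall s, exists K' : args l -> form L,
    forall (t : term s) a, fsubst (inst t) (K' a) = K (asubst (inst t) a).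

(** The arguments are replaced one at a time. Naturality presents [K] as a substitution instance in
    the argument under replacement, the form of context that [eqv] speaks of. *)
Lemma eqv_natural l (a : args l) : forall K, natural K ->
  thy (K a) <-> thy (K (reps (classes a))).
Proof.
elim: a => [//|s k t a IH] K HK /=.
have [K' hK'] := HK s.
have ash : forall (x : term s) b, asubst (inst x) (asubst (shift s) b) = b.
  move=> x j b; rewrite asubst_comp inst_scons scons_shift.
  exact: (proj2 (subst_id_mut L)).
have E : forall (x : term s) b, K (ACons x b) =
    fsubst (inst x) (K' (ACons (Var s 0) (asubst (shift s) b))).
  by move=> x b; rewrite hK' /= ash /inst sort_dec_refl.
have e : eqv t (rep (class t)) by apply/classP; rewrite class_rep.
rewrite (E t) (e _) -E; apply: (IH (fun b => K (ACons (rep (class t)) b))).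
move=> s'; have [K2 hK2] := HK s'.
exists (fun b => K2 (ACons (tsubst (shift s') (rep (class t))) b)) => x b.
rewrite hK2 /=; congr (K (ACons _ _)).
by rewrite tsubst_comp inst_scons scons_shift (proj1 (subst_id_mut L)).
Qed.

Definition term_model : interp L := {|
  dom := cls;
  ifun f v := class (Fun f (reps v));
  irel r v := thy (Rel r (reps v)) |}.

Notation cenv u := ((fun s n => class (u s n)) : env term_model).

Lemma eval_term_model u :
  (forall s (t : term s), eval (cenv u) t = class (tsubst u t)) /\
  (forall l (a : args l), evals (cenv u) a = classes (asubst u a)).
Proof.
apply: term_args_ind => //= [f a ->|s l t -> a ->] //.
apply/classP => A; apply: iff_sym.
apply: (@eqv_natural _ _ (fun b => fsubst (inst (Fun f b)) A)) => s.
exists (fun b => fsubst (inst (Fun f b)) (fsubst (up (fcod f) (shift s)) A)) => t b.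
rewrite subst_inst; congr (fsubst _ _).
by rewrite fsubst_comp up_comp inst_scons scons_shift up_id fsubst_id.
Qed.

Lemma sat_term_model A : forall u, sat (cenv u) A <-> thy (fsubst u A).
Proof.
have cc : forall s (t : term s) u, econs (class t : dom term_model s) (cenv u) = cenv (scons t u).
  move=> s t u; apply: env_ext => s' n; rewrite /econs /scons.
  by case: (sort_dec s s') => // e; case: n => //; case: _ / e.
elim: A => [r a||A IA B IB|A IA B IB|A IA B IB|s A IA|s A IA] u /=.
- rewrite (proj2 (eval_term_model u)); apply: iff_sym.
  apply: (@eqv_natural _ _ (fun b => Rel r b)) => s; by exists (fun b => Rel r b).
- by split=> // /thy_con.
- by rewrite thy_imp IA IB.
- by rewrite thy_and IA IB.
- by rewrite thy_or IA IB.
- rewrite thy_all; split=> [h t|h x]; first by rewrite inst_up -IA -cc; exact: h.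
  by rewrite -(class_rep x) cc IA -inst_up.
- rewrite thy_ex; split=> [[x]|[t h]].
    by rewrite -(class_rep x) cc IA -inst_up => h; exists (rep x).
  by exists (class t); rewrite cc IA -inst_up.
Qed.

Lemma term_model_models : models T term_model.
Proof.
move=> A hA r.
have -> : r = cenv (fun s n => rep (r s n)) by apply: env_ext => s n; rewrite class_rep.
by apply/sat_term_model; exact: thy_ax.
Qed.

Lemma term_model_indiscernible s (a b : dom term_model s) :
  indiscernible a b -> a = b.
Proof.
rewrite -(class_rep a) -(class_rep b) => h; apply/classP.
have cc : forall t : term s, econs (class t : dom term_model s) (cenv (@ids L)) = cenv (inst t).
  move=> t; apply: env_ext => s' n; rewrite /econs /inst.
  by case: (sort_dec s s') => // e; case: n => //; case: _ / e.
have H : forall A, thy (fsubst (inst (rep a)) A) -> thy (fsubst (inst (rep b)) A).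
  by move=> A /sat_term_model; rewrite -cc => /h; rewrite cc => /sat_term_model.
move=> A; split; first exact: H.
move=> hb; apply: NNPP => /thy_not ha.
by have /thy_not := H (Not A) ha; exact.
Qed.

Lemma term_model_G0 A : In A G0 -> sat (cenv (@ids L)) A.
Proof. by move=> h; apply/sat_term_model; rewrite fsubst_id; exists 0; exact: p_hyp. Qed.
End Henkin.

Theorem completeness (L : language) (T : form L -> Prop)
    (es : nat -> list (sort L)) (ef : nat -> list (fsym L)) (er : nat -> list (rsym L)) :
  lists_all es -> lists_all ef -> lists_all er ->
  forall A : form L,
  (forall I : interp L, models T I ->
     (forall s (a b : dom I s), indiscernible a b -> a = b) ->
     forall r : env I, sat r A) ->
  prv T [] A.
Proof.
move=> Hs Hf Hr A H; apply: NNPP => hA.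
have con : ~ prv T [Not A] Bot by move=> h; apply: hA; exact: p_raa.
have eP := enum_form_surj Hs Hf Hr.
apply: (term_model_G0 eP con (A := Not A)); first by left.
apply: H; [exact: term_model_models|exact: term_model_indiscernible].
Qed.

(** * Arithmetic in models of RCA_0 *)

(** Structures whose equality is the identity, the kind of model that completeness leaves to
    consider. *)
Record struc := Struc {
  sd : sort2 -> Type;
  zr : sd Num;
  on : sd Num;
  ad : sd Num -> sd Num -> sd Num;
  ml : sd Num -> sd Num -> sd Num;
  ltt : sd Num -> sd Num -> Prop;
  inn : sd Num -> sd Set2 -> Prop }.

Definition struc_interp (A : struc) : interp L2 :=
  @Interp L2 (sd A)
    (fun f => match f return hl (sd A) (@fdom L2 f) -> sd A (@fcod L2 f) with
     | FZero => fun _ => zr A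
     | FOne => fun _ => on A
     | FPlus => fun v => ad v.1 v.2.1
     | FTimes => fun v => ml v.1 v.2.1
     end)
    (fun r => match r return hl (sd A) (@rdom L2 r) -> Prop with
     | REq => fun v => v.1 = v.2.1
     | RLt => fun v => ltt v.1 v.2.1
     | RIn => fun v => inn v.1 v.2.1
     end).

Definition numcons (A : struc) (x : sd A Num) (r : env (struc_interp A)) :
  env (struc_interp A) := econs (L := L2) (s := Num) (x : dom (struc_interp A) Num) r.

(* Induction and comprehension are needed only for formulas [Ex y B] with [B]
   bounded; variable 0 is y and variable 1 the argument. *)
Record isrca (A : struc) : Prop := IsRCA {
  rca_set : exists X : sd A Set2, True;
  rca_succ_neq0 : forall n : sd A Num, ad n (on A) <> zr A;
  rca_succ_inj : forall m n : sd A Num, ad m (on A) = ad n (on A) -> m = n;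
  rca_add0 : forall m : sd A Num, ad m (zr A) = m;
  rca_addS : forall m n : sd A Num, ad m (ad n (on A)) = ad (ad m n) (on A);
  rca_mul0 : forall m : sd A Num, ml m (zr A) = zr A;
  rca_mulS : forall m n : sd A Num, ml m (ad n (on A)) = ad (ml m n) m;
  rca_lt0 : forall m : sd A Num, ~ ltt m (zr A);
  rca_ltS : forall m n : sd A Num, ltt m (ad n (on A)) <-> ltt m n \/ m = n;
  rca_ind : forall B, bounded B -> forall r : env (struc_interp A),
    (exists y, sat (numcons y (numcons (zr A) r)) B) ->
    (forall x, (exists y, sat (numcons y (numcons x r)) B) ->
       exists y, sat (numcons y (numcons (ad x (on A)) r)) B) ->
    forall x, exists y, sat (numcons y (numcons x r)) B;
  rca_ca : forall B C, bounded B -> bounded C -> forall r : env (struc_interp A),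
    (forall x, (exists y, sat (numcons y (numcons x r)) B) <->
       (forall y, sat (numcons y (numcons x r)) C)) ->
    exists Z, forall x, inn x Z <-> exists y, sat (numcons y (numcons x r)) B }.

Definition ncons X (x : X) (e : nat -> X) (i : nat) : X :=
  match i with 0 => x | S i => e i end.
Definition tl X (e : nat -> X) (i : nat) : X := e (S i).
(** Interleaving provides unlimited variables and unlimited parameters side by side, so that
    parameters can be merged without counting those in use. *)
Definition mix X (e r : nat -> X) (n : nat) : X :=
  if Nat.even n then e (Nat.div2 n) else r (Nat.div2 n).

Lemma even_double i : Nat.even (2 * i) = true.
Proof. by apply (proj2 (Nat.even_spec _)); exists i. Qed.
Lemma even_succ_double i : Nat.even (S (2 * i)) = false.
Proof. by rewrite Nat.even_succ -Nat.negb_even even_double. Qed.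

Lemma mix_even X (e r : nat -> X) i : mix e r (2 * i) = e i.
Proof. by rewrite /mix even_double Nat.div2_double. Qed.
Lemma mix_odd X (e r : nat -> X) i : mix e r (S (2 * i)) = r i.
Proof. by rewrite /mix even_succ_double Nat.div2_succ_double. Qed.
Lemma parity_cases n : (exists i, n = 2 * i) \/ (exists i, n = S (2 * i)).
Proof. by case: (Nat.Even_or_Odd n) => -[i ->]; [left|right]; exists i; lia. Qed.

Definition ren (f g : nat -> nat) : sub L2 := fun s =>
  match s with Num => fun n => Var (Num : sort L2) (f n) | Set2 => fun n => Var (Set2 : sort L2) (g n) end.

Lemma bounded_subst B : bounded B -> forall u, bounded (fsubst u B).
Proof.
elim => {B} /=.
- by move=> r a u; exact: b_rel.
- by move=> u; exact: b_bot.
- by move=> B C _ IB _ IC u; apply: b_imp.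
- by move=> B C _ IB _ IC u; apply: b_and.
- by move=> B C _ IB _ IC u; apply: b_or.
- move=> t B _ IB u; rewrite -/(shift (Num : sort L2)) /shift_num tsubst_comp up_shift -tsubst_comp.
  exact: b_all.
- move=> t B _ IB u; rewrite -/(shift (Num : sort L2)) /shift_num tsubst_comp up_shift -tsubst_comp.
  exact: b_ex.
Qed.

(** * Bounded and Sigma-1 predicates with parameters *)

Section Definability.
Variable A : struc.
Hypothesis HA : isrca A.
Notation N := (sd A Num).
Notation Sets := (sd A Set2).
Notation "0" := (zr A).
Notation "1" := (on A).
Notation "x + y" := (@ad A x y).
Notation "x * y" := (@ml A x y).
Notation "x < y" := (@ltt A x y).
Notation Env := (nat -> N).
Implicit Types (x y z : N) (e r : Env) (E : nat -> Sets).

Definition mkenv e E : env (struc_interp A) :=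
  fun s => match s with Num => e | Set2 => E end.

Lemma numcons_mkenv x e E : numcons x (mkenv e E) = mkenv (ncons x e) E.
Proof. by apply: env_ext => -[] n //; case: n. Qed.

Lemma sat_ren f g e E B :
  sat (mkenv e E) (fsubst (ren f g) B) <->
  sat (mkenv (fun i => e (f i)) (fun i => E (g i))) B.
Proof.
rewrite sat_subst; suff -> : (fun s n => eval (mkenv e E) (ren f g s n)) =
  mkenv (fun i => e (f i)) (fun i => E (g i)) by [].
by apply: env_ext => -[].
Qed.

Lemma eval_ren f g e E (t : nterm) :
  eval (mkenv e E) (tsubst (ren f g) t) =
  eval (mkenv (fun i => e (f i)) (fun i => E (g i))) t.
Proof.
rewrite eval_subst; suff -> : (fun s n => eval (mkenv e E) (ren f g s n)) =
  mkenv (fun i => e (f i)) (fun i => E (g i)) by [].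
by apply: env_ext => -[].
Qed.

(* [P] is given by a bounded formula whose even variables are [e] and whose odd
   variables and set variables are parameters. *)
Definition Bd (P : Env -> Prop) :=
  exists B r E, bounded B /\ forall e, P e <-> sat (mkenv (mix e r) E) B.
Definition Tm (T : Env -> N) :=
  exists (t : nterm) r, forall e E, T e = eval (mkenv (mix e r) E) t.

(** Renamings that keep the even variables and send the parameters of two formulas to the two halves
    of a common parameter list. *)
Definition f1 n := if Nat.even n then n else S (2 * (2 * Nat.div2 n)).
Definition f2 n := if Nat.even n then n else S (2 * S (2 * Nat.div2 n)).

Lemma mix_f1 e r1 r2 : (fun i => mix e (mix r1 r2) (f1 i)) = mix e r1.
Proof.
apply: functional_extensionality => n; rewrite /f1.
case E: (Nat.even n); first by rewrite /mix E.
by rewrite mix_odd mix_even /mix E.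
Qed.
Lemma mix_f2 e r1 r2 : (fun i => mix e (mix r1 r2) (f2 i)) = mix e r2.
Proof.
apply: functional_extensionality => n; rewrite /f2.
case E: (Nat.even n); first by rewrite /mix E.
by rewrite mix_odd mix_odd /mix E.
Qed.
Lemma mix_g1 X (E1 E2 : nat -> X) : (fun i => mix E1 E2 (2 * i)) = E1.
Proof. by apply: functional_extensionality => n; rewrite mix_even. Qed.
Lemma mix_g2 X (E1 E2 : nat -> X) : (fun i => mix E1 E2 (S (2 * i))) = E2.
Proof. by apply: functional_extensionality => n; rewrite mix_odd. Qed.

Definition r1 := ren f1 (fun i => Nat.mul 2 i).
Definition r2 := ren f2 (fun i => S (Nat.mul 2 i)).

Lemma sat_r1 e ra rb Ea Eb B :
  sat (mkenv (mix e (mix ra rb)) (mix Ea Eb)) (fsubst r1 B) <-> sat (mkenv (mix e ra) Ea) B.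
Proof. by rewrite sat_ren mix_f1 mix_g1. Qed.
Lemma sat_r2 e ra rb Ea Eb B :
  sat (mkenv (mix e (mix ra rb)) (mix Ea Eb)) (fsubst r2 B) <-> sat (mkenv (mix e rb) Eb) B.
Proof. by rewrite sat_ren mix_f2 mix_g2. Qed.
Lemma eval_r1 e ra rb Ea (t : nterm) :
  eval (mkenv (mix e (mix ra rb)) Ea) (tsubst r1 t) = eval (mkenv (mix e ra) (fun i => Ea (Nat.mul 2 i))) t.
Proof. by rewrite eval_ren mix_f1. Qed.
Lemma eval_r2 e ra rb Ea (t : nterm) :
  eval (mkenv (mix e (mix ra rb)) Ea) (tsubst r2 t) = eval (mkenv (mix e rb) (fun i => Ea (S (Nat.mul 2 i)))) t.
Proof. by rewrite eval_ren mix_f2. Qed.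

Lemma Bd_ext (P Q : Env -> Prop) : (forall e, P e <-> Q e) -> Bd Q -> Bd P.
Proof. by move=> H [B [r [E [b h]]]]; exists B, r, E; split=> // e; rewrite H. Qed.

Lemma Tm_var i : Tm (fun e => e i).
Proof.
by exists (Var (Num : sort L2) (2 * i)), (fun _ => 0) => e E /=; rewrite -/(2 * i)%nat mix_even.
Qed.
Lemma Tm_const x : Tm (fun _ => x).
Proof. by exists (Var (Num : sort L2) 1), (fun _ => x) => e E. Qed.
Lemma Tm_add T1 T2 : Tm T1 -> Tm T2 -> Tm (fun e => T1 e + T2 e).
Proof.
move=> [t [ra h]] [t' [rb h']].
exists (Plus (tsubst r1 t) (tsubst r2 t')), (mix ra rb) => e E /=.
by rewrite eval_r1 eval_r2 -h -h'.
Qed.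
Lemma Tm_mul T1 T2 : Tm T1 -> Tm T2 -> Tm (fun e => T1 e * T2 e).
Proof.
move=> [t [ra h]] [t' [rb h']].
exists (Times (tsubst r1 t) (tsubst r2 t')), (mix ra rb) => e E /=.
by rewrite eval_r1 eval_r2 -h -h'.
Qed.

Lemma Bd_rel2 (R : N -> N -> Prop) (k : nterm -> nterm -> form L2) T1 T2 :
  (forall t t', bounded (k t t')) ->
  (forall (r : env (struc_interp A)) t t', sat r (k t t') <-> R (eval r t) (eval r t')) ->
  Tm T1 -> Tm T2 -> Bd (fun e => R (T1 e) (T2 e)).
Proof.
move=> hb hk [t [ra h]] [t' [rb h']]; have [X _] := rca_set HA.
exists (k (tsubst r1 t) (tsubst r2 t')), (mix ra rb), (fun _ => X); split=> [|e]; first exact: hb.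
by rewrite hk eval_r1 eval_r2 -h -h'.
Qed.

Lemma Bd_eq T1 T2 : Tm T1 -> Tm T2 -> Bd (fun e => T1 e = T2 e).
Proof. by apply: (@Bd_rel2 eq Eq2) => // t t'; exact: b_rel. Qed.
Lemma Bd_lt T1 T2 : Tm T1 -> Tm T2 -> Bd (fun e => T1 e < T2 e).
Proof. by apply: (@Bd_rel2 (fun x y => x < y) Lt2) => // t t'; exact: b_rel. Qed.
Lemma Bd_in T X : Tm T -> Bd (fun e => inn (T e) X).
Proof.
move=> [t [r h]].
exists (In2 t (Var (Set2 : sort L2) 0)), r, (fun _ => X); split=> [|e]; first exact: b_rel.
by rewrite /= -h.
Qed.

Lemma Bd_bin (k : form L2 -> form L2 -> form L2) (K : Prop -> Prop -> Prop) P Q :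
  (forall B C, bounded B -> bounded C -> bounded (k B C)) ->
  (forall (r : env (struc_interp A)) B C, sat r (k B C) <-> K (sat r B) (sat r C)) ->
  Bd P -> Bd Q -> Bd (fun e => K (P e) (Q e)).
Proof.
move=> hb hk [B [ra [Ea [b h]]]] [C [rb [Eb [c h']]]].
exists (k (fsubst r1 B) (fsubst r2 C)), (mix ra rb), (mix Ea Eb); split=> [|e].
  by apply: hb; exact: bounded_subst.
rewrite hk (propositional_extensionality _ _ (sat_r1 e ra rb Ea Eb B)).
rewrite (propositional_extensionality _ _ (sat_r2 e ra rb Ea Eb C)).
by rewrite -(propositional_extensionality _ _ (h e)) -(propositional_extensionality _ _ (h' e)).
Qed.
Lemma Bd_and P Q : Bd P -> Bd Q -> Bd (fun e => P e /\ Q e).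
Proof. by apply: (@Bd_bin (@And L2) and) => //; exact: b_and. Qed.
Lemma Bd_or P Q : Bd P -> Bd Q -> Bd (fun e => P e \/ Q e).
Proof. by apply: (@Bd_bin (@Or L2) or) => //; exact: b_or. Qed.
Lemma Bd_imp P Q : Bd P -> Bd Q -> Bd (fun e => P e -> Q e).
Proof. by apply: (@Bd_bin (@Imp L2) (fun a b => a -> b)) => //; exact: b_imp. Qed.
Lemma Bd_false : Bd (fun _ => False).
Proof.
have [X _] := rca_set HA.
by exists Bot, (fun _ => 0), (fun _ => X); split=> //; exact: b_bot.
Qed.
Lemma Bd_not P : Bd P -> Bd (fun e => ~ P e).
Proof. by move=> h; apply: Bd_imp => //; exact: Bd_false. Qed.

(* Inside the quantifier, index 0 is the new variable and index n+1 the old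
   variable n. *)
Definition fq n := match n with 0%nat => 0%nat | S m => if Nat.even n then m else S n end.

Lemma mix_fq x e r : (fun i => ncons x (mix e r) (fq i)) = mix (ncons x e) r.
Proof.
apply: functional_extensionality => n.
case: (parity_cases n) => -[i ->].
- rewrite mix_even; case: i => [//|i]; rewrite /fq even_double.
  have -> : (2 * S i = S (S (2 * i)))%nat by lia.
  by rewrite /ncons; exact: mix_even.
- rewrite mix_odd /fq.
  by rewrite even_succ_double /ncons -/(mix e r) mix_odd.
Qed.

Lemma sat_fq x e r E B :
  sat (numcons x (mkenv (mix e r) E)) (fsubst (ren fq (fun i => i)) B) <->
  sat (mkenv (mix (ncons x e) r) E) B.
Proof. by rewrite numcons_mkenv sat_ren mix_fq. Qed.

Lemma eval_bound x e r E i :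
  eval (numcons x (mkenv (mix e r) E)) (tsubst shift_num (Var (Num : sort L2) (Nat.mul 2 i))) = e i.
Proof. by rewrite /shift_num eval_shift /eval /mkenv mix_even. Qed.

Lemma lt_bound x e r E i :
  sat (numcons x (mkenv (mix e r) E))
    (Lt2 (Var _ 0) (tsubst shift_num (Var (Num : sort L2) (Nat.mul 2 i)))) <-> x < e i.
Proof. by rewrite -(eval_bound x e r E i). Qed.

Lemma Bd_ball (P : Env -> N -> Prop) i :
  Bd (fun e => P (tl e) (e 0%nat)) -> Bd (fun e => forall x, x < e i -> P e x).
Proof.
move=> [B [r [E [b h]]]].
exists (All (Num : sort L2) (Imp (Lt2 (Var _ 0) (tsubst shift_num (Var (Num : sort L2) (2 * i))))
  (fsubst (ren fq (fun i => i)) B))), r, E; split=> [|e].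
  by apply: b_all; exact: bounded_subst.
split=> H x hx.
- apply/sat_fq/h; apply: H; exact: (proj1 (lt_bound x e r E i)).
- apply: (proj2 (h (ncons x e))); apply: (proj1 (sat_fq x e r E B)).
  by apply: (H x); exact: (proj2 (lt_bound x e r E i)).
Qed.

Lemma Bd_bex (P : Env -> N -> Prop) i :
  Bd (fun e => P (tl e) (e 0%nat)) -> Bd (fun e => exists x, x < e i /\ P e x).
Proof.
move=> [B [r [E [b h]]]].
exists (Ex (Num : sort L2) (And (Lt2 (Var _ 0) (tsubst shift_num (Var (Num : sort L2) (2 * i))))
  (fsubst (ren fq (fun i => i)) B))), r, E; split=> [|e].
  by apply: b_ex; exact: bounded_subst.
split=> -[x [hx H]]; exists x; split.
- exact: (proj2 (lt_bound x e r E i)).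
- exact/sat_fq/h.
- exact: (proj1 (lt_bound x e r E i)).
- apply: (proj2 (h (ncons x e))); exact: (proj1 (sat_fq x e r E B)).
Qed.

Lemma Bd_ren f P : Bd P -> Bd (fun e => P (fun i => e (f i))).
Proof.
move=> [B [r [E [b h]]]].
pose g n := if Nat.even n then (2 * f (Nat.div2 n))%nat else n.
exists (fsubst (ren g (fun i => i)) B), r, E; split=> [|e]; first exact: bounded_subst.
rewrite h sat_ren.
suff -> : (fun i => mix e r (g i)) = mix (fun i => e (f i)) r by [].
apply: functional_extensionality => n; rewrite /g.
case: (parity_cases n) => -[i ->].
- by rewrite even_double Nat.div2_double !mix_even.
- by rewrite even_succ_double !mix_odd.
Qed.

Definition Sg (P : Env -> Prop) :=
  exists Q, Bd Q /\ forall e, P e <-> exists y, Q (ncons y e).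

Lemma Sg_ext (P Q : Env -> Prop) : (forall e, P e <-> Q e) -> Sg Q -> Sg P.
Proof. by move=> H [R [h h']]; exists R; split=> // e; rewrite H. Qed.

Lemma Bd_Sg P : Bd P -> Sg P.
Proof.
move=> h; exists (fun e => P (tl e)); split; first exact: (Bd_ren S).
by move=> e; split=> [H|[y H]] //; exists 0.
Qed.

Lemma Sg_ren f P : Sg P -> Sg (fun e => P (fun i => e (f i))).
Proof.
move=> [Q [h h']].
exists (fun e => Q (fun i => e (match i with 0 => 0 | S i => S (f i) end)%nat)); split.
  exact: Bd_ren.
have E : forall y e, (fun i => ncons y e (match i with 0 => 0 | S i => S (f i) end)%nat) =
    ncons y (fun i => e (f i)) by move=> y e; apply: functional_extensionality => -[].
by move=> e; rewrite h'; split=> -[y hy]; exists y; move: hy; rewrite E.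
Qed.

Lemma Sg_exB (P : Env -> N -> Prop) :
  Bd (fun e => P (tl e) (e 0%nat)) -> Sg (fun e => exists x, P e x).
Proof. by move=> h; exists (fun e => P (tl e) (e 0%nat)). Qed.

(* The witness becomes variable 0 and the argument variable 1. *)
Definition fi n :=
  if Nat.even n then match n with 0%nat => 0%nat | _ => 1%nat end else S (S (Nat.div2 n)).

Lemma sat_fi y x r E B :
  sat (numcons y (numcons x (mkenv r E))) (fsubst (ren fi (fun i => i)) B) <->
  sat (mkenv (mix (ncons y (fun _ => x)) r) E) B.
Proof.
rewrite !numcons_mkenv sat_ren.
suff -> : (fun i => ncons y (ncons x r) (fi i)) = mix (ncons y (fun _ => x)) r by [].
apply: functional_extensionality => n; rewrite /fi.
case: (parity_cases n) => -[i ->].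
- by rewrite even_double mix_even; case: i.
- by rewrite even_succ_double Nat.div2_succ_double mix_odd.
Qed.

(** Induction for predicates of the metatheory, provided they have a Sigma-1 definition. An argument
    about all numbers of the model must pass through it, since external induction reaches only the
    standard ones. *)
Lemma sg_ind (P : N -> Prop) : Sg (fun e => P (e 0%nat)) ->
  P 0 -> (forall x, P x -> P (x + 1)) -> forall x, P x.
Proof.
move=> [Q [[B [r [E [b hB]]]] hQ]].
have HP : forall x, P x <-> exists y,
    sat (numcons y (numcons x (mkenv r E))) (fsubst (ren fi (fun i => i)) B).
  move=> x; rewrite (hQ (fun _ => x)).
  by split=> -[y hy]; exists y; move: hy; rewrite sat_fi hB.
move=> h0 hS x; apply/HP; move: x; apply: (rca_ind HA); first exact: bounded_subst.
- exact/HP.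
- by move=> x /HP h; apply/HP; exact: hS.
Qed.

Lemma sg_ca (P : N -> Prop) :
  Sg (fun e => P (e 0%nat)) -> Sg (fun e => ~ P (e 0%nat)) ->
  exists Z, forall x, inn x Z <-> P x.
Proof.
move=> [Q [[B [ra [Ea [b hB]]]] hQ]] [R [[C [rb [Eb [c hC]]]] hR]].
pose B' := fsubst (ren fi (fun i => i)) (fsubst r1 B).
pose C' := fsubst (ren fi (fun i => i)) (fsubst r2 C).
have HP : forall x, P x <-> exists y,
    sat (numcons y (numcons x (mkenv (mix ra rb) (mix Ea Eb)))) B'.
  move=> x; rewrite (hQ (fun _ => x)).
  by split=> -[y hy]; exists y; move: hy; rewrite /B' sat_fi sat_r1 hB.
have HR : forall x, ~ P x <-> exists y,
    sat (numcons y (numcons x (mkenv (mix ra rb) (mix Ea Eb)))) C'.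
  move=> x; rewrite (hR (fun _ => x)).
  by split=> -[y hy]; exists y; move: hy; rewrite /C' sat_fi sat_r2 hC.
(* Negating the Sigma-1 form of the complement yields the Pi-1 form of [P] that comprehension asks
   for. *)
have [|||Z hZ] := @rca_ca _ HA B' (Imp C' Bot) _ _ (mkenv (mix ra rb) (mix Ea Eb)).
- by do 2!apply: bounded_subst.
- by apply: b_imp; [do 2!apply: bounded_subst|exact: b_bot].
- move=> x; rewrite -HP; split=> [hP y hy|h].
    by have : ~ P x by apply/HR; exists y.
  by apply: NNPP => /HR [y hy]; apply: (h y).
by exists Z => x; rewrite hZ HP.
Qed.

End Definability.

Ltac tm := repeat first [apply: Tm_add | apply: Tm_mul | apply: Tm_var | apply: Tm_const].
Ltac bd := repeat first
  [ apply: Bd_and | apply: Bd_or | apply: Bd_not | apply: Bd_imp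
  | apply: Bd_eq | apply: Bd_lt | apply: Bd_in | progress tm
  | (apply: Bd_ball; rewrite /tl /=) | (apply: Bd_bex; rewrite /tl /=) ]; try assumption.

(** * The ordered commutative semiring of numbers *)

Section Semiring.
Variable A : struc.
Hypothesis HA : isrca A.
Notation N := (sd A Num).
Notation "0" := (zr A).
Notation "1" := (on A).
Notation "x + y" := (@ad A x y).
Notation "x * y" := (@ml A x y).
Notation "x < y" := (@ltt A x y).
Implicit Types x y z : N.

Lemma bd_ind (P : N -> Prop) : Bd (fun e => P (e 0%nat)) ->
  P 0 -> (forall x, P x -> P (x + 1)) -> forall x, P x.
Proof. by move=> h; apply: sg_ind => //; exact: Bd_Sg. Qed.

Lemma ad0 x : x + 0 = x. Proof. exact: rca_add0. Qed.
Lemma adS x y : x + (y + 1) = x + y + 1. Proof. exact: rca_addS. Qed.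
Lemma adA x y z : x + (y + z) = x + y + z.
Proof.
move: z; apply: bd_ind; [by bd|by rewrite !ad0|move=> z IH].
by rewrite !adS IH.
Qed.
Lemma ad0n x : 0 + x = x.
Proof. by move: x; apply: bd_ind; [by bd|rewrite ad0|move=> x IH; rewrite adS IH]. Qed.
Lemma adSn x y : x + 1 + y = x + y + 1.
Proof. by move: y; apply: bd_ind; [by bd|rewrite !ad0|move=> y IH; rewrite !adS IH]. Qed.
Lemma adC x y : x + y = y + x.
Proof.
by move: y; apply: bd_ind; [by bd|rewrite ad0 ad0n|move=> y IH; rewrite adS adSn IH].
Qed.
Lemma ml0 x : x * 0 = 0. Proof. exact: rca_mul0. Qed.
Lemma mlS x y : x * (y + 1) = x * y + x. Proof. exact: rca_mulS. Qed.
Lemma ml0n x : 0 * x = 0.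
Proof. by move: x; apply: bd_ind; [by bd|rewrite ml0|move=> x IH; rewrite mlS ad0 IH]. Qed.
Lemma mlSn x y : (x + 1) * y = x * y + y.
Proof.
move: y; apply: bd_ind; [by bd|by rewrite !ml0 ad0|move=> y IH].
rewrite !mlS IH !adS; congr (_ + 1); rewrite -!adA; congr (_ + _); exact: adC.
Qed.
Lemma mlC x y : x * y = y * x.
Proof.
by move: y; apply: bd_ind; [by bd|rewrite ml0 ml0n|move=> y IH; rewrite mlS mlSn IH].
Qed.
Lemma mlDl x y z : (x + y) * z = x * z + y * z.
Proof.
move: z; apply: bd_ind; [by bd|by rewrite !ml0 ad0|move=> z IH].
rewrite !mlS IH -!adA; congr (_ + _); rewrite !adA; congr (_ + _); exact: adC.
Qed.
Lemma mlA x y z : x * (y * z) = x * y * z.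
Proof.
move: z; apply: bd_ind; [by bd|by rewrite !ml0|move=> z IH].
by rewrite !mlS -IH mlC mlDl [y * z * x]mlC [y * x]mlC.
Qed.
Lemma ml1n x : 1 * x = x.
Proof. by rewrite -(ad0n 1) mlSn ml0n ad0n. Qed.

Lemma N_semiring : semi_ring_theory (zr A) (on A) (@ad A) (@ml A) eq.
Proof.
constructor; [exact: ad0n|exact: adC|exact: adA|exact: ml1n|exact: ml0n|exact: mlC|
  exact: mlA|exact: mlDl].
Qed.
Add Ring Nring : N_semiring.

Lemma adI x y z : x + z = y + z -> x = y.
Proof.
move: z; apply: bd_ind; [by bd|by rewrite !ad0|move=> z IH].
by rewrite !adS => /(rca_succ_inj HA).
Qed.

Lemma zero_or_succ x : x = 0 \/ exists y, x = y + 1.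
Proof.
(* The disjunction is moved under one existential quantifier, so that the induction predicate is
   visibly Sigma-1. *)
suff [y] : exists y, x = 0 \/ x = y + 1 by case; [left|right; exists y].
move: x; apply: sg_ind => //.
- by apply: Sg_exB; bd.
- by exists 0; left.
- by move=> x _; exists x; right.
Qed.

Lemma ltE x y : x < y <-> exists z, y = x + z + 1.
Proof.
split.
- suff [z] : exists z, x < y -> y = x + z + 1 by move=> h /h ->; exists z.
  move: y; apply: sg_ind => //.
  + by apply: Sg_exB; bd.
  + by exists 0 => /(rca_lt0 HA).
  + move=> y [z IH].
    case: (classic (x < y)) => [/IH ->|h]; first by exists (z + 1) => _; ring.
    by exists 0 => /(rca_ltS HA) [//|->]; ring.
- move=> [z ->]; move: z; apply: bd_ind; first by bd.
  + by rewrite ad0; apply/(rca_ltS HA); right.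
  + by move=> z IH; apply/(rca_ltS HA); left; rewrite adS.
Qed.

Lemma trichotomy x y : exists z, y = x + z \/ x = y + z.
Proof.
move: y; apply: sg_ind => //.
- by apply: Sg_exB; bd.
- by exists x; right; ring.
- move=> y [z [->|->]]; first by exists (z + 1); left; ring.
  case: (zero_or_succ z) => [->|[w ->]].
    by exists 1; left; ring.
  by exists w; right; ring.
Qed.

Lemma ad_eq0 x y : x + y = 0 -> x = 0.
Proof.
by case: (zero_or_succ x) => [//|[z ->]]; rewrite adSn => /(rca_succ_neq0 HA).
Qed.
Lemma ml_eq0 x y : x * y = 0 -> x = 0 \/ y = 0.
Proof.
case: (zero_or_succ y) => [->|[z ->]]; first by right.
by rewrite mlS adC => /ad_eq0; left.
Qed.
End Semiring.

(* The ring of differences of the numbers of [A], in normal form: an integer is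
   a pair (a, b), one of which is zero, and stands for a - b. *)
Definition zz (A : struc) (HA : isrca A) : Type :=
  { p : sd A Num * sd A Num | p.1 = zr A \/ p.2 = zr A }.

(** * The ordered integral domain of differences *)

Section Differences.
Variable A : struc.
Hypothesis HA : isrca A.
Notation N := (sd A Num).
Notation "0" := (zr A).
Notation "1" := (on A).
Notation "x + y" := (@ad A x y).
Notation "x * y" := (@ml A x y).
Add Ring Nring' : (N_semiring HA).
Notation Z := (zz HA).
Implicit Types (p q : N * N) (x y z : Z).

Definition eqd p q := p.1 + q.2 = q.1 + p.2.

Lemma eqd_trans p q s : eqd p q -> eqd q s -> eqd p s.
Proof.
rewrite /eqd => h1 h2; apply: (adI HA (z := q.2 + q.1)).
transitivity ((p.1 + q.2) + (q.1 + s.2)); first by ring.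
by rewrite h1 h2; ring.
Qed.

Lemma znorm_exists p : exists z : Z, eqd (proj1_sig z) p.
Proof.
have [c [h|h]] := trichotomy HA p.1 p.2.
- exists (exist _ (0, c) (or_introl erefl)); rewrite /eqd /= h; ring.
- exists (exist _ (c, 0) (or_intror erefl)); rewrite /eqd /= h; ring.
Qed.
Definition znorm p : Z := proj1_sig (constructive_indefinite_description _ (znorm_exists p)).
Lemma znormP p : eqd (proj1_sig (znorm p)) p.
Proof. exact: (proj2_sig (constructive_indefinite_description _ (znorm_exists p))). Qed.

Lemma zz_eq x y : eqd (proj1_sig x) (proj1_sig y) -> x = y.
Proof.
move=> h; apply: sig_ext; move: h; rewrite /eqd.
case: x y => -[a b] /= ha [[c d] /= hc] /=.
have P : forall u v w : N, 0 + 0 = u + v -> u = 0 /\ v = 0.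
  move=> u v _; rewrite (ad0 HA) => /esym h; split; first exact: (ad_eq0 HA h).
  by move: h; rewrite adC // => /(ad_eq0 HA).
case: ha => ->; case: hc => -> h.
- by move: h; rewrite !ad0n // => ->.
- by case: (P _ _ 0 h) => -> ->.
- have [-> ->] : a = 0 /\ d = 0.
    by apply: (P _ _ 0); rewrite -h; ring.
  by [].
- by move: h; rewrite !ad0 // => ->.
Qed.

Lemma znorm_eq p q : eqd p q -> znorm p = znorm q.
Proof.
move=> h; apply: zz_eq; apply: eqd_trans (znormP p) _; apply: eqd_trans h _.
by rewrite /eqd (znormP q).
Qed.
Lemma znorm_val x : znorm (proj1_sig x) = x.
Proof. by apply: zz_eq; exact: znormP. Qed.

Definition zadd x y : Z :=
  let p := proj1_sig x in let q := proj1_sig y in znorm (p.1 + q.1, p.2 + q.2).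
Definition zmul x y : Z :=
  let p := proj1_sig x in let q := proj1_sig y in
  znorm (p.1 * q.1 + p.2 * q.2, p.1 * q.2 + p.2 * q.1).
Definition zopp x : Z := znorm ((proj1_sig x).2, (proj1_sig x).1).
Definition zemb (n : N) : Z := znorm (n, 0).

Lemma zaddE p q : zadd (znorm p) (znorm q) = znorm (p.1 + q.1, p.2 + q.2).
Proof.
apply: znorm_eq; move: (znormP p) (znormP q); rewrite /eqd /=.
move: (proj1_sig (znorm p)) (proj1_sig (znorm q)) => p' q' h1 h2.
transitivity ((p'.1 + p.2) + (q'.1 + q.2)); first by ring.
by rewrite h1 h2; ring.
Qed.

Lemma zmulE p q : zmul (znorm p) (znorm q) =
  znorm (p.1 * q.1 + p.2 * q.2, p.1 * q.2 + p.2 * q.1).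
Proof.
apply: znorm_eq; move: (znormP p) (znormP q).
move: (proj1_sig (znorm p)) (proj1_sig (znorm q)) => p' q' h1 h2.
apply: (@eqd_trans _ (p.1 * q'.1 + p.2 * q'.2, p.1 * q'.2 + p.2 * q'.1)).
- move: h1; rewrite /eqd /= => h.
  transitivity ((p'.1 + p.2) * q'.1 + (p.1 + p'.2) * q'.2); first by ring.
  transitivity ((p.1 + p'.2) * q'.1 + (p'.1 + p.2) * q'.2); last by ring.
  by rewrite h.
- move: h2; rewrite /eqd /= => h.
  transitivity (p.1 * (q'.1 + q.2) + p.2 * (q.1 + q'.2)); first by ring.
  transitivity (p.1 * (q.1 + q'.2) + p.2 * (q'.1 + q.2)); last by ring.
  by rewrite h.
Qed.

Lemma zoppE p : zopp (znorm p) = znorm (p.2, p.1).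
Proof.
apply: znorm_eq; move: (znormP p); rewrite /eqd /= => h.
by rewrite [LHS]adC // -h; exact: adC.
Qed.

Ltac zz_law := intros;
  repeat match goal with x : zz HA |- _ => rewrite -(znorm_val x); move: (proj1_sig x); clear x; intros x end;
  rewrite ?/zemb;
  repeat match goal with
  | |- context [zopp (znorm ?p)] => rewrite (zoppE p)
  | |- context [zadd (znorm ?p) (znorm ?q)] => rewrite (zaddE p q)
  | |- context [zmul (znorm ?p) (znorm ?q)] => rewrite (zmulE p q)
  end;
  apply: znorm_eq; rewrite /eqd /=; ring.

Lemma zaddA : associative zadd.
Proof. move=> x y z; zz_law. Qed.
Lemma zaddC : commutative zadd.
Proof. move=> x y; zz_law. Qed.
Lemma zadd0 : left_id (zemb 0) zadd.
Proof. move=> x; zz_law. Qed.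
Lemma zaddN : left_inverse (zemb 0) zopp zadd.
Proof. move=> x; zz_law. Qed.
Lemma zmulA : associative zmul.
Proof. move=> x y z; zz_law. Qed.
Lemma zmulC : commutative zmul.
Proof. move=> x y; zz_law. Qed.
Lemma zmul1 : left_id (zemb 1) zmul.
Proof. move=> x; zz_law. Qed.
Lemma zmulD : left_distributive zmul zadd.
Proof. move=> x y z; zz_law. Qed.

Lemma zemb_inj m n : zemb m = zemb n -> m = n.
Proof.
move=> e; have : eqd (m, 0) (n, 0).
  apply: (@eqd_trans _ (proj1_sig (zemb m))); first by rewrite /eqd -(znormP (m, 0)).
  by rewrite e; exact: znormP.
by rewrite /eqd /= !ad0.
Qed.

Lemma zz_cases x : exists n, x = zemb n \/ x = zopp (zemb n).
Proof.
case: x => -[a b] /= [h|h]; subst.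
- exists b; right; rewrite /zemb zoppE; apply: zz_eq; rewrite /eqd /=.
  by rewrite (znormP (0, b)).
- exists a; left; apply: zz_eq; rewrite /eqd /=; by rewrite (znormP (a, 0)).
Qed.

(** Equality, choice, inverses and order are supplied classically, because the algebraic hierarchy
    asks for Boolean tests and total operations on the carrier. *)
Definition zeqb x y : bool := if excluded_middle_informative (x = y) then true else false.
Lemma zeqbP : eq_axiom zeqb.
Proof. by move=> x y; rewrite /zeqb; case: excluded_middle_informative => h; constructor. Qed.

Definition zfind (P : pred Z) (n : nat) : option Z :=
  match excluded_middle_informative (exists x, P x) with
  | left h => Some (proj1_sig (constructive_indefinite_description _ h))
  | right _ => None
  end.
Lemma zfind_correct P n x : zfind P n = Some x -> P x.
Proof.
rewrite /zfind; case: excluded_middle_informative => // h [<-].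
exact: (proj2_sig (constructive_indefinite_description _ h)).
Qed.
Lemma zfind_complete (P : pred Z) : (exists x, P x) -> exists n, zfind P n.
Proof. by move=> h; exists O; rewrite /zfind; case: excluded_middle_informative. Qed.
Lemma zfind_ext (P Q : pred Z) : P =1 Q -> zfind P =1 zfind Q.
Proof. by move=> h; have -> : P = Q by apply: functional_extensionality. Qed.

Definition zunit : pred Z := fun x =>
  if excluded_middle_informative (exists y, zmul y x = zemb 1) then true else false.
Definition zinv x : Z :=
  match excluded_middle_informative (exists y, zmul y x = zemb 1) with
  | left h => proj1_sig (constructive_indefinite_description _ h)
  | right _ => x
  end.
Definition zle x y : bool :=
  if excluded_middle_informative (exists n, zadd y (zopp x) = zemb n) then true else false.
Lemma zleP x y : reflect (exists n, zadd y (zopp x) = zemb n) (zle x y).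
Proof. by rewrite /zle; case: excluded_middle_informative => h; constructor. Qed.
Definition zlt x y : bool := ~~ zeqb y x && zle x y.
Definition zabs x : Z := if zle (zemb 0) x then x else zopp x.

HB.instance Definition _ := hasDecEq.Build Z zeqbP.
HB.instance Definition _ := hasChoice.Build Z zfind_correct zfind_complete zfind_ext.
HB.instance Definition _ := GRing.isZmodule.Build Z zaddA zaddC zadd0 zaddN.

Lemma zone_neq0 : zemb 1 != zemb 0 :> Z.
Proof.
apply/eqP => /zemb_inj e; apply: (rca_succ_neq0 HA (n := 0)).
by rewrite ad0n.
Qed.
HB.instance Definition _ := GRing.Zmodule_isComNzRing.Build Z zmulA zmulC zmul1 zmulD zone_neq0.

Lemma zmulV : {in zunit, left_inverse (zemb 1) zinv zmul}.
Proof.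
move=> x; rewrite unfold_in /zunit /zinv; case: excluded_middle_informative => // h _.
exact: (proj2_sig (constructive_indefinite_description _ h)).
Qed.
Lemma zunitPl x y : zmul y x = zemb 1 -> zunit x.
Proof. by move=> h; rewrite /zunit; case: excluded_middle_informative => // -[]; exists y. Qed.
Lemma zinv_out : {in [predC zunit], zinv =1 id}.
Proof.
by move=> x; rewrite inE /= unfold_in /zunit /zinv; case: excluded_middle_informative.
Qed.
HB.instance Definition _ := GRing.ComNzRing_hasMulInverse.Build Z zmulV zunitPl zinv_out.

Lemma zemb_mul m n : zmul (zemb m) (zemb n) = zemb (m * n).
Proof. zz_law. Qed.
Lemma zemb_add m n : zadd (zemb m) (zemb n) = zemb (m + n).
Proof. zz_law. Qed.
Lemma zoppK x : zopp (zopp x) = x.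
Proof. zz_law. Qed.
Lemma zopp_eq0 x : zopp x = zemb 0 -> x = zemb 0.
Proof.
by move=> h; rewrite -(zoppK x) h; zz_law.
Qed.

Lemma zdomain (x y : Z) : zmul x y = zemb 0 -> (x == zemb 0) || (y == zemb 0).
Proof.
have [m hm] := zz_cases x; have [n hn] := zz_cases y => h.
suff : zemb (m * n) = zemb 0.
  move/zemb_inj => /(ml_eq0 HA) [e|e]; apply/orP; [left|right]; apply/eqP; subst.
  - by case: hm => ->; rewrite // /zemb zoppE.
  - by case: hn => ->; rewrite // /zemb zoppE.
case: hm => hm; case: hn => hn; subst; move: h; rewrite -zemb_mul //.
- by move=> h; apply: zopp_eq0; rewrite -h; zz_law.
- by move=> h; apply: zopp_eq0; rewrite -h; zz_law.
- by move=> <-; zz_law.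
Qed.
HB.instance Definition _ := GRing.ComUnitRing_isIntegral.Build Z zdomain.

Lemma zle0E x : zle (zemb 0) x <-> exists n, x = zemb n.
Proof.
have e : zadd x (zopp (zemb 0)) = x by zz_law.
by split=> [/zleP|h]; [rewrite e|apply/zleP; rewrite e].
Qed.
Lemma zle0_add x y : zle (zemb 0) x -> zle (zemb 0) y -> zle (zemb 0) (zadd x y).
Proof. by move=> /zle0E [m ->] /zle0E [n ->]; apply/zle0E; exists (m + n); exact: zemb_add. Qed.
Lemma zle0_mul x y : zle (zemb 0) x -> zle (zemb 0) y -> zle (zemb 0) (zmul x y).
Proof. by move=> /zle0E [m ->] /zle0E [n ->]; apply/zle0E; exists (m * n); exact: zemb_mul. Qed.
Lemma zopp_sub0 x : zopp (zadd (zemb 0) (zopp x)) = x.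
Proof. zz_law. Qed.
Lemma zle_opp x : zle x (zemb 0) <-> exists n, x = zopp (zemb n).
Proof.
split=> [/zleP [n h]|[n ->]].
- by exists n; rewrite -h zopp_sub0.
- by apply/zleP; exists n; zz_law.
Qed.
Lemma zle0_anti x : zle (zemb 0) x -> zle x (zemb 0) -> x = zemb 0.
Proof.
move=> /zle0E [m ->] /zle_opp [n e].
have : zemb (m + n) = zemb 0 by rewrite -zemb_add e; zz_law.
by move/zemb_inj => /(ad_eq0 HA) ->.
Qed.
Lemma zsub_ge0 x y : zle (zemb 0) (zadd y (zopp x)) = zle x y.
Proof. by apply/idP/idP => [/zle0E h|/zleP h]; [exact/zleP|exact/zle0E]. Qed.
Lemma zle0_total x : zle (zemb 0) x || zle x (zemb 0).
Proof.
apply/orP; have [n [h|h]] := zz_cases x; [left; apply/zle0E|right; apply/zle_opp];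
  by exists n.
Qed.
Lemma zabsN x : zabs (zopp x) = zabs x.
Proof.
rewrite /zabs; have [n [->|->]] := zz_cases x.
- case: ifP => [/zle0E [m h]|_].
    have e : zopp (zemb n) = zemb 0.
      by apply: zle0_anti; [apply/zle0E; exists m|apply/zle_opp; exists n].
    by rewrite e (zopp_eq0 e); case: ifP => //; rewrite -{2}e; move: (zopp_eq0 e) => ->.
  have -> : zle (zemb 0) (zemb n) by apply/zle0E; exists n.
  by zz_law.
- have e : zopp (zopp (zemb n)) = zemb n by zz_law.
  rewrite e; have -> : zle (zemb 0) (zemb n) by apply/zle0E; exists n.
  case: ifP => // /zle0E [m h].
  suff e0 : zopp (zemb n) = zemb 0 by rewrite e0 -e e0; zz_law.
  by apply: zle0_anti; [apply/zle0E; exists m|apply/zle_opp; exists n].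
Qed.
Lemma zabs_ge0 x : zle (zemb 0) x -> zabs x = x.
Proof. by rewrite /zabs => ->. Qed.
Lemma zlt_def x y : zlt x y = (y != x) && zle x y.
Proof. by []. Qed.
HB.instance Definition _ := Num.IntegralDomain_isLeReal.Build Z zle0_add zle0_mul
  zle0_anti zsub_ge0 zle0_total zabsN zabs_ge0 zlt_def.
End Differences.

(** * Transfer of arithmetic to the ring of differences *)

Section Embedding.
Variable A : struc.
Hypothesis HA : isrca A.
Notation i := (zemb HA).
Implicit Types x y : sd A Num.

Lemma zembD x y : i (ad x y) = (i x + i y)%R.
Proof. by rewrite -zemb_add. Qed.
Lemma zembM x y : i (ml x y) = (i x * i y)%R.
Proof. by rewrite -zemb_mul. Qed.
Lemma zemb0 : i (zr A) = 0%R. Proof. by []. Qed.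
Lemma zemb1 : i (on A) = 1%R. Proof. by []. Qed.
Lemma zemb_ge0 x : (0 <= i x)%R.
Proof. by apply/zle0E; exists x. Qed.
Lemma zemb_le x y : (i x <= i y)%R <-> ~ ltt y x.
Proof.
have zN : forall z, zopp (i z) = (- i z)%R by [].
split=> [/zleP [n h] /(ltE HA) [m e]|h].
- have h' : (i y - i x = i n)%R by [].
  have := zemb_ge0 m; have := zemb_ge0 n; move: h'; rewrite e !zembD zemb1; lra.
- have [n [->|e]] := trichotomy HA x y.
    by rewrite zembD; have := zemb_ge0 n; lra.
  have [e0|[m em]] := zero_or_succ HA n; first by rewrite e e0 zembD zemb0; lra.
  by case: h; apply/(ltE HA); exists m; rewrite e em adS.
Qed.
(** Translating a strict inequality with a gap of one preserves the discreteness of the numbers,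
    which linear arithmetic over an ordered ring would lose. *)
Lemma zemb_lt x y : ltt x y <-> (i x + 1 <= i y)%R.
Proof.
split=> [/(ltE HA) [n ->]|h].
  by rewrite !zembD zemb1; have := zemb_ge0 n; lra.
by apply: NNPP => /zemb_le; lra.
Qed.
Lemma zemb_nlt x y : ~ ltt x y -> (i y <= i x)%R.
Proof. by move/zemb_le. Qed.
Lemma zemb_eq x y : x = y -> i x = i y. Proof. by move=> ->. Qed.
End Embedding.

(** Facts about numbers are carried into the ring, each atom together with its nonnegativity; real
    arithmetic tactics then apply to arbitrary models. *)
Ltac toz HA :=
  repeat match goal with
  | H : @eq (sd ?A Num) ?x ?y |- _ => apply (zemb_eq HA) in H
  | H : ltt ?x ?y |- _ => apply (proj1 (zemb_lt HA x y)) in H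
  | H : ~ ltt ?x ?y |- _ => apply (zemb_nlt HA) in H
  end;
  try match goal with
  | |- @eq (sd ?A Num) ?x ?y => apply (@zemb_inj _ HA)
  | |- ltt ?x ?y => apply (proj2 (zemb_lt HA x y))
  | |- ~ ltt ?x ?y => apply (proj1 (zemb_le HA y x))
  end;
  repeat match goal with
  | H : @eq (zz HA) _ _ |- _ => revert H
  | H : is_true (@Order.le _ _ _ _) |- _ => revert H
  end;
  rewrite ?(zembD, zembM, zemb0, zemb1);
  repeat match goal with
  | |- context [zemb HA ?t] => generalize (zemb_ge0 HA t); generalize (zemb HA t)
  end;
  repeat match goal with
  | H : _ /\ _ |- _ => clear H
  | H : _ <-> _ |- _ => clear H
  | H : ~ _ |- _ => clear H
  end; intros.
Ltac zlra HA := toz HA; lra.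
Ltac znra HA := toz HA; nra.

(** * Closure properties of Sigma-1 predicates and functions *)

Section Sigma1.
Variable A : struc.
Hypothesis HA : isrca A.
Notation N := (sd A Num).
Notation "0" := (zr A).
Notation "1" := (on A).
Notation "x + y" := (@ad A x y).
Notation "x * y" := (@ml A x y).
Notation "x < y" := (@ltt A x y).
Notation Env := (nat -> N).
Implicit Types (x y z : N) (e r : Env).

Lemma lt_irr x : ~ x < x. Proof. by move=> h; zlra HA. Qed.

Lemma lt_cases x y : x < y \/ x = y \/ y < x.
Proof.
case: (classic (x < y)) => h1; first by left.
case: (classic (y < x)) => h2; first by right; right.
by right; left; zlra HA.
Qed.
Lemma lt_succ x y : x < y + 1 <-> x < y \/ x = y.
Proof. exact: rca_ltS. Qed.
Lemma lt_zero x : ~ x < 0. Proof. exact: rca_lt0. Qed.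
Lemma zero_lt x : x <> 0 -> 0 < x.
Proof. by case: (zero_or_succ HA x) => // -[y ->] _; zlra HA. Qed.

Lemma Sg_ex (P : Env -> N -> Prop) :
  Sg (fun e => P (tl e) (e 0%nat)) -> Sg (fun e => exists x, P e x).
Proof.
move=> [Q [hb h]].
apply: (@Sg_ext _ _ (fun e => exists z, exists x, x < z /\ exists y, y < z /\ Q (ncons y (ncons x e)))).
  move=> e; split=> [[x /(h (ncons x e)) [y hy]]|[z [x [_ [y [_ hy]]]]]].
    (* A common bound for both witnesses merges two unbounded quantifiers into one. *)
    exists (x + y + 1); exists x; split; first by zlra HA.
    by exists y; split=> //; zlra HA.
  by exists x; apply/(h (ncons x e)); exists y.
apply: (Sg_exB (P := fun e z => exists x, x < z /\ exists y, y < z /\ Q (ncons y (ncons x e)))).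
apply: (Bd_bex (P := fun e x => exists y, y < e 0%nat /\ Q (ncons y (ncons x (tl e))))).
apply: (Bd_bex (P := fun e y => Q (ncons y (ncons (e 0%nat) (tl (tl e))))) (1%nat)).
have := Bd_ren (fun j => match j with 0 => 0 | 1 => 1 | S (S j) => S (S (S j)) end)%nat hb.
apply: Bd_ext => e; suff -> : ncons (e 0%nat) (ncons (tl e 0%nat) (tl (tl (tl e)))) =
  (fun j => e (match j with 0 => 0 | 1 => 1 | S (S j) => S (S (S j)) end)%nat) by [].
by apply: functional_extensionality => -[|[|j]].
Qed.

Lemma Bd_drop1 (Q : Env -> Prop) : Bd Q -> Bd (fun e => Q (ncons (e 0%nat) (tl (tl e)))).
Proof.
move=> h; have := Bd_ren (fun j => match j with 0 => 0 | S j => S (S j) end)%nat h.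
apply: Bd_ext => e; suff -> : ncons (e 0%nat) (tl (tl e)) =
  (fun j => e (match j with 0 => 0 | S j => S (S j) end)%nat) by [].
by apply: functional_extensionality => -[].
Qed.

Lemma Sg_and P Q : Sg P -> Sg Q -> Sg (fun e => P e /\ Q e).
Proof.
move=> [P' [hP h]] [Q' [hQ h']].
apply: (@Sg_ext _ _ (fun e => exists x, exists y, P' (ncons x e) /\ Q' (ncons y e))).
  move=> e; rewrite h h'; split=> [[[x hx] [y hy]]|[x [y [hx hy]]]].
    by exists x, y.
  by split; [exists x|exists y].
apply: (Sg_ex (P := fun e x => exists y, P' (ncons x e) /\ Q' (ncons y e))).
apply: (Sg_exB (P := fun e y => P' (ncons (e 0%nat) (tl e)) /\ Q' (ncons y (tl e)))).
apply: Bd_and => //; last exact: Bd_drop1.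
have := Bd_ren S hP; apply: Bd_ext => e.
suff -> : ncons (tl e 0%nat) (tl (tl e)) = (fun j => e (S j)) by [].
by apply: functional_extensionality => -[].
Qed.

Lemma Sg_or P Q : Sg P -> Sg Q -> Sg (fun e => P e \/ Q e).
Proof.
move=> [P' [hP h]] [Q' [hQ h']].
exists (fun e => P' e \/ Q' e); split; first exact: Bd_or.
move=> e; rewrite h h'; split=> [[[x hx]|[x hx]]|[x [hx|hx]]].
- by exists x; left.
- by exists x; right.
- by left; exists x.
- by right; exists x.
Qed.

(** Freezes the variables from index [k] on at the values [e]. Collection is an induction during
    which the surrounding variables are parameters. *)
Lemma Bd_par (Q : Env -> Prop) e (k : nat) : Bd Q ->
  Bd (fun e' => Q (fun j => if Nat.ltb j k then e' j else e (j - k)%nat)).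
Proof.
move=> [B [r [E [b h]]]].
pose g n := if Nat.even n then (if Nat.ltb (Nat.div2 n) k then n
  else S (2 * (2 * (Nat.div2 n - k)))%nat) else S (2 * (S (2 * Nat.div2 n)))%nat.
exists (fsubst (ren g (fun j => j)) B), (mix e r), E; split=> [|e']; first exact: bounded_subst.
rewrite h sat_ren.
suff -> : (fun j => mix e' (mix e r) (g j)) =
  mix (fun j => if Nat.ltb j k then e' j else e (j - k)%nat) r by [].
apply: functional_extensionality => n; rewrite /g.
case: (parity_cases n) => -[j ->].
- rewrite even_double Nat.div2_double mix_even; case: Nat.ltb; first by rewrite mix_even.
  by rewrite mix_odd mix_even.
- by rewrite even_succ_double Nat.div2_succ_double !mix_odd.
Qed.

(** Collection by Sigma-1 induction along the initial segment; the guard [k < m + 1] confines the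
    induction to the range where witnesses are known to exist. It closes the Sigma-1 predicates
    under bounded universal quantification. *)
Lemma collectB (R : N -> N -> Prop) m : Bd (fun e => R (e 1%nat) (e 0%nat)) ->
  (forall x, x < m -> exists y, R x y) ->
  exists z, forall x, x < m -> exists y, y < z /\ R x y.
Proof.
move=> hR H.
suff [z hz] : exists z, m < m + 1 -> forall x, x < m -> exists y, y < z /\ R x y.
  by exists z; apply: hz; zlra HA.
suff K : forall k, exists z, k < m + 1 -> forall x, x < k -> exists y, y < z /\ R x y.
  exact: K.
apply: (sg_ind HA).
- apply: (Sg_exB (P := fun e z => e 0%nat < m + 1 -> forall x, x < e 0%nat -> exists y, y < z /\ R x y)).
  apply: Bd_imp => //; first by bd.
  apply: (Bd_ball (P := fun e x => exists y, y < e 0%nat /\ R x y) (1%nat)).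
  apply: (Bd_bex (P := fun e y => R (e 0%nat) y) (1%nat)).
  by [].
- by exists 0 => _ x /lt_zero.
- move=> k [z hz]; case: (classic (k < m)) => hk; last first.
    by exists 0 => h; case: hk; zlra HA.
  have [y hy] := H _ hk; exists (z + y + 1) => h x /lt_succ [hx|->].
    have [|y' [hy' h']] := hz _ _ hx; first by zlra HA.
    by exists y'; split=> //; zlra HA.
  by exists y; split=> //; zlra HA.
Qed.

Lemma Sg_ball (P : Env -> N -> Prop) i :
  Sg (fun e => P (tl e) (e 0%nat)) -> Sg (fun e => forall x, x < e i -> P e x).
Proof.
move=> [Q [hb h]].
apply: (@Sg_ext _ _ (fun e => exists z, forall x, x < e i -> exists y, y < z /\ Q (ncons y (ncons x e)))).
  move=> e; split=> [H|[z H] x hx]; last first.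
    by have [y [_ hy]] := H _ hx; apply/(h (ncons x e)); exists y.
  apply: (collectB (R := fun x y => Q (ncons y (ncons x e)))).
  - have := Bd_par e 2 hb; apply: Bd_ext => e'.
    suff -> : ncons (e' 0%nat) (ncons (e' 1%nat) e) =
      (fun j => if Nat.ltb j 2 then e' j else e (j - 2)%nat) by [].
    by apply: functional_extensionality => -[|[|j]] //=; rewrite Nat.sub_0_r.
  - by move=> x /H /(h (ncons x e)).
apply: (Sg_exB (P := fun e z => forall x, x < e i -> exists y, y < z /\ Q (ncons y (ncons x e)))).
apply: (Bd_ball (P := fun e x => exists y, y < e 0%nat /\ Q (ncons y (ncons x (tl e)))) (S i)).
apply: (Bd_bex (P := fun e y => Q (ncons y (ncons (e 0%nat) (tl (tl e))))) (1%nat)).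
have := Bd_ren (fun j => match j with 0 => 0 | 1 => 1 | S (S j) => S (S (S j)) end)%nat hb.
apply: Bd_ext => e; suff -> : ncons (e 0%nat) (ncons (tl e 0%nat) (tl (tl (tl e)))) =
  (fun j => e (match j with 0 => 0 | 1 => 1 | S (S j) => S (S (S j)) end)%nat) by [].
by apply: functional_extensionality => -[|[|j]].
Qed.

(** Functions of the metatheory with a Sigma-1 graph, the value being variable 0. Since they are
    total, they may be substituted into Sigma-1 predicates. *)
Definition Sf (F : Env -> N) := Sg (fun e => e 0%nat = F (tl e)).
Definition Sf1 (f : N -> N) := Sf (fun e => f (e 0%nat)).
Definition Sf2 (f : N -> N -> N) := Sf (fun e => f (e 0%nat) (e 1%nat)).
Definition Sf3 (f : N -> N -> N -> N) := Sf (fun e => f (e 0%nat) (e 1%nat) (e 2%nat)).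

Lemma Sf_tm T : Tm T -> Sf T.
Proof.
move=> [t [r h]]; apply: Bd_Sg => //; apply: Bd_eq => //; first exact: Tm_var.
pose g n := if Nat.even n then S (S n) else n.
exists (tsubst (ren g (fun j => j)) t), r => e E; rewrite (h _ E) eval_ren.
congr (eval (mkenv _ _) t).
apply: functional_extensionality => n; rewrite /g.
case: (parity_cases n) => -[j ->].
- rewrite even_double; have -> : S (S (2 * j)) = (2 * S j)%nat by lia.
  by rewrite !mix_even.
- by rewrite even_succ_double !mix_odd.
Qed.

Lemma Sg_comp (P : Env -> N -> Prop) F :
  Sg (fun e => P (tl e) (e 0%nat)) -> Sf F -> Sg (fun e => P e (F e)).
Proof.
move=> hP hF; apply: (@Sg_ext _ _ (fun e => exists x, x = F e /\ P e x)).
  by move=> e; split=> [h|[x [-> //]]]; exists (F e).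
by apply: Sg_ex; apply: Sg_and.
Qed.

Lemma Sg_comp1 (P : N -> Prop) F : Sg (fun e => P (e 0%nat)) -> Sf F -> Sg (fun e => P (F e)).
Proof. by move=> hP; apply: (Sg_comp (P := fun _ x => P x)). Qed.
Lemma Sf_tl F : Sf F -> Sf (fun e => F (tl e)).
Proof. exact: (Sg_ren (fun j => match j with 0 => 0 | S j => S (S j) end)%nat). Qed.
Lemma Sg_comp2 (P : N -> N -> Prop) F G :
  Sg (fun e => P (e 0%nat) (e 1%nat)) -> Sf F -> Sf G -> Sg (fun e => P (F e) (G e)).
Proof.
move=> hP hF hG; apply: (Sg_comp (P := fun e x => P (F e) x)) => //.
apply: (Sg_comp (P := fun e x => P x (e 0%nat)) (F := fun e => F (tl e))); last exact: Sf_tl.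
exact: hP.
Qed.
Lemma Sg_comp3 (P : N -> N -> N -> Prop) F G H :
  Sg (fun e => P (e 0%nat) (e 1%nat) (e 2%nat)) -> Sf F -> Sf G -> Sf H ->
  Sg (fun e => P (F e) (G e) (H e)).
Proof.
move=> hP hF hG hH; apply: (Sg_comp (P := fun e x => P (F e) (G e) x)) => //.
apply: (Sg_comp (P := fun e x => P (F (tl e)) x (e 0%nat)) (F := fun e => G (tl e))); last exact: Sf_tl.
apply: (Sg_comp (P := fun e x => P x (e 0%nat) (e 1%nat)) (F := fun e => F (tl (tl e)))).
  exact: hP.
exact: (Sf_tl (Sf_tl hF)).
Qed.

Lemma Sf_var j : Sf (fun e => e j). Proof. exact/Sf_tm/Tm_var. Qed.
Lemma Sf_const x : Sf (fun _ => x). Proof. exact/Sf_tm/Tm_const. Qed.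
Lemma Sf_comp1 f F : Sf1 f -> Sf F -> Sf (fun e => f (F e)).
Proof.
move=> hf hF; apply: (Sg_comp2 (P := fun x y => y = f x) (F := fun e => F (tl e)) (G := fun e => e 0%nat)).
- exact: (Sg_ren (fun j => match j with 0 => 1 | _ => 0 end)%nat hf).
- exact: Sf_tl.
- exact: Sf_var.
Qed.
Lemma Sf_comp2 f F G : Sf2 f -> Sf F -> Sf G -> Sf (fun e => f (F e) (G e)).
Proof.
move=> hf hF hG; apply: (Sg_comp3 (P := fun x y z => z = f x y) (F := fun e => F (tl e))
  (G := fun e => G (tl e)) (H := fun e => e 0%nat)).
- exact: (Sg_ren (fun j => match j with 0 => 2 | 1 => 0 | _ => 1 end)%nat hf).
- exact: Sf_tl.
- exact: Sf_tl.
- exact: Sf_var.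
Qed.
Lemma Sf_comp3 f F G H : Sf3 f -> Sf F -> Sf G -> Sf H -> Sf (fun e => f (F e) (G e) (H e)).
Proof.
move=> hf hF hG hH.
apply: (@Sg_ext _ _ (fun e => exists x, x = F (tl e) /\ exists y, y = G (tl e) /\ exists z, z = H (tl e) /\
  e 0%nat = f x y z)).
  move=> e; split=> [->|[x [-> [y [-> [z [-> ->]]]]]]] //.
  by exists (F (tl e)); split=> //; exists (G (tl e)); split=> //; exists (H (tl e)).
apply: Sg_ex; apply: Sg_and; first exact: (Sf_tl hF).
apply: Sg_ex; apply: Sg_and; first exact: (Sf_tl (Sf_tl hG)).
apply: Sg_ex; apply: Sg_and; first exact: (Sf_tl (Sf_tl (Sf_tl hH))).
exact: (Sg_ren (fun j => match j with 0 => 3 | 1 => 2 | 2 => 1 | _ => 0 end)%nat hf).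
Qed.

Lemma Sf_add F G : Sf F -> Sf G -> Sf (fun e => F e + G e).
Proof. by apply: Sf_comp2; apply: Sf_tm; tm. Qed.
Lemma Sf_mul F G : Sf F -> Sf G -> Sf (fun e => F e * G e).
Proof. by apply: Sf_comp2; apply: Sf_tm; tm. Qed.

Lemma Sg_eq F G : Sf F -> Sf G -> Sg (fun e => F e = G e).
Proof. by apply: (Sg_comp2 (P := eq)); apply: Bd_Sg => //; bd. Qed.
Lemma Sg_neq F G : Sf F -> Sf G -> Sg (fun e => F e <> G e).
Proof. by apply: (Sg_comp2 (P := fun x y => x <> y)); apply: Bd_Sg => //; bd. Qed.
Lemma Sg_lt F G : Sf F -> Sf G -> Sg (fun e => F e < G e).
Proof. by apply: (Sg_comp2 (P := fun x y => x < y)); apply: Bd_Sg => //; bd. Qed.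
Lemma Sg_nlt F G : Sf F -> Sf G -> Sg (fun e => ~ F e < G e).
Proof. by apply: (Sg_comp2 (P := fun x y => ~ x < y)); apply: Bd_Sg => //; bd. Qed.
Lemma Sg_in X F : Sf F -> Sg (fun e => inn (F e) X).
Proof. by apply: (Sg_comp1 (P := fun x => inn x X)); apply: Bd_Sg => //; bd. Qed.
Lemma Sg_nin X F : Sf F -> Sg (fun e => ~ inn (F e) X).
Proof. by apply: (Sg_comp1 (P := fun x => ~ inn x X)); apply: Bd_Sg => //; bd. Qed.
Lemma Sg_false : Sg (fun _ : Env => False).
Proof. by apply: Bd_Sg => //; exact: Bd_false. Qed.
Lemma Sg_true : Sg (fun _ : Env => True).
Proof. by apply: (@Sg_ext _ _ (fun e => 0 = 0)) => //; apply: Sg_eq; exact: Sf_const. Qed.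
Lemma Sg_const (p : Prop) : Sg (fun _ : Env => p).
Proof.
case: (classic p) => h; first by apply: Sg_ext Sg_true.
by apply: Sg_ext Sg_false.
Qed.

Lemma Sg_imp P Q : Sg (fun e => ~ P e) -> Sg Q -> Sg (fun e => P e -> Q e).
Proof.
move=> h h'; apply: Sg_ext (Sg_or h h') => e; split; last by case.
by move=> H; case: (classic (P e)) => hp; [right; apply: H|left].
Qed.
Lemma Sg_nimp P Q : Sg P -> Sg (fun e => ~ Q e) -> Sg (fun e => ~ (P e -> Q e)).
Proof.
move=> h h'; apply: Sg_ext (Sg_and h h') => e; split; last by case=> a b c; apply: b; exact: c.
by move=> H; split; [apply: NNPP => a; apply: H|move=> a; apply: H].
Qed.
Lemma Sg_nand P Q : Sg (fun e => ~ P e) -> Sg (fun e => ~ Q e) -> Sg (fun e => ~ (P e /\ Q e)).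
Proof.
move=> h h'; apply: Sg_ext (Sg_or h h') => e.
by split=> [/Classical_Prop.not_and_or //|[a|a] [b c]].
Qed.
Lemma Sg_nor P Q : Sg (fun e => ~ P e) -> Sg (fun e => ~ Q e) -> Sg (fun e => ~ (P e \/ Q e)).
Proof. by move=> h h'; apply: Sg_ext (Sg_and h h') => e; split=> [/Classical_Prop.not_or_and //|[a b] [c|c]]; [exact: a|exact: b].
Qed.
Lemma Sg_nn P : Sg P -> Sg (fun e => ~ ~ P e).
Proof. by apply: Sg_ext => e; split=> [/NNPP //|h h']. Qed.

Lemma Sg_all (P : Env -> N -> Prop) F :
  Sf F -> Sg (fun e => P (tl e) (e 0%nat)) -> Sg (fun e => forall x, x < F e -> P e x).
Proof.
move=> hF hP; apply: (Sg_comp (P := fun e m => forall x, x < m -> P e x)) => //.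
apply: (Sg_ball (P := fun e x => P (tl e) x) (0%nat)).
exact: (Sg_ren (fun j => match j with 0 => 0 | S j => S (S j) end)%nat hP).
Qed.
Lemma Sg_nall (P : Env -> N -> Prop) F :
  Sf F -> Sg (fun e => ~ P (tl e) (e 0%nat)) -> Sg (fun e => ~ forall x, x < F e -> P e x).
Proof.
move=> hF hP; apply: (@Sg_ext _ _ (fun e => exists x, x < F e /\ ~ P e x)).
  move=> e; split=> [h|[x [h1 h2]] h]; last by apply: h2; exact: h.
  by apply: NNPP => H; apply: h => x hx; apply: NNPP => hp; apply: H; exists x.
by apply: Sg_ex; apply: Sg_and => //; apply: Sg_lt; [exact: Sf_var|exact: Sf_tl].
Qed.
Lemma Sg_nbex (P : Env -> N -> Prop) F :
  Sf F -> Sg (fun e => ~ P (tl e) (e 0%nat)) -> Sg (fun e => ~ exists x, x < F e /\ P e x).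
Proof.
move=> hF hP; apply: (Sg_ext (Q := fun e => forall x, x < F e -> ~ P e x)).
  move=> e; split=> [h x hx hp|h [x [hx hp]]]; first by apply: h; exists x.
  exact: (h x).
exact: Sg_all.
Qed.

Definition ite (p : Prop) x y : N := if excluded_middle_informative p then x else y.
Lemma ite_t (p : Prop) x y : p -> ite p x y = x.
Proof. by rewrite /ite; case: excluded_middle_informative. Qed.
Lemma ite_f (p : Prop) x y : ~ p -> ite p x y = y.
Proof. by rewrite /ite; case: excluded_middle_informative. Qed.
Lemma Sf_ite P F G : Sg P -> Sg (fun e => ~ P e) -> Sf F -> Sf G ->
  Sf (fun e => ite (P e) (F e) (G e)).
Proof.
move=> h h' hF hG.
apply: (@Sg_ext _ _ (fun e => P (tl e) /\ e 0%nat = F (tl e) \/ ~ P (tl e) /\ e 0%nat = G (tl e))).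
  move=> e; case: (classic (P (tl e))) => p; [rewrite (ite_t _ _ p)|rewrite (ite_f _ _ p)].
    by split=> [->|[[]|[]]] //; left.
  by split=> [->|[[]|[]]] //; right.
by apply: Sg_or; apply: Sg_and => //; [exact: (Sg_ren S h)|exact: (Sg_ren S h')].
Qed.
End Sigma1.

Ltac sf_user := fail.

Ltac sg_user := fail.
Ltac sg := rewrite /Sf1 /Sf2 /Sf3; repeat first
  [ assumption
  | apply: Sf_var | apply: Sf_const
  | sf_user | apply: Sf_add | apply: Sf_mul
  | match goal with |- Sf (fun e => ite _ _ _) => apply: Sf_ite end
  | match goal with |- Sg (fun e => _ = _) => apply: Sg_eq end
  | match goal with |- Sg (fun e => _ <> _) => apply: Sg_neq end
  | match goal with |- Sg (fun e => ltt _ _) => apply: Sg_lt end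
  | match goal with |- Sg (fun e => ~ ltt _ _) => apply: Sg_nlt end
  | match goal with |- Sg (fun e => inn _ _) => apply: Sg_in end
  | match goal with |- Sg (fun e => ~ inn _ _) => apply: Sg_nin end
  | match goal with |- Sg (fun e => False) => apply: Sg_false end
  | match goal with |- Sg (fun e => True) => apply: Sg_true end
  | sg_user
  | match goal with |- Sg (fun e => ~ ~ _) => apply: Sg_nn end
  | match goal with |- Sg (fun e => ~ (_ /\ _)) => apply: Sg_nand end
  | match goal with |- Sg (fun e => ~ (_ \/ _)) => apply: Sg_nor end
  | match goal with |- Sg (fun e => ~ exists x, ltt x _ /\ _) => apply: Sg_nbex; rewrite /tl /= end
  | match goal with |- Sg (fun e => ~ forall x, ltt x _ -> _) => apply: Sg_nall; rewrite /tl /= end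
  | match goal with |- Sg (fun e => ~ (_ -> _)) => apply: Sg_nimp end
  | match goal with |- Sg (fun e => _ /\ _) => apply: Sg_and end
  | match goal with |- Sg (fun e => _ \/ _) => apply: Sg_or end
  | match goal with |- Sg (fun e => exists x, _) => apply: Sg_ex; rewrite /tl /= end
  | match goal with |- Sg (fun e => forall x, ltt x _ -> _) => apply: Sg_all; rewrite /tl /= end
  | match goal with |- Sg (fun e => _ -> _) => apply: Sg_imp end
  | apply: Sg_const ].

(** * Minimization, the beta function and primitive recursion *)

Section Recursion.
Variable A : struc.
Hypothesis HA : isrca A.
Notation N := (sd A Num).
Notation "0" := (zr A).
Notation "1" := (on A).
Notation "x + y" := (@ad A x y).
Notation "x * y" := (@ml A x y).
Notation "x < y" := (@ltt A x y).
Notation Env := (nat -> N).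
Implicit Types (x y z : N).
Add Ring Nring1 : (N_semiring HA).

Lemma least (P : N -> Prop) : Sg (fun e => P (e 0%nat)) -> Sg (fun e => ~ P (e 0%nat)) ->
  (exists x, P x) -> exists x, P x /\ forall y, y < x -> ~ P y.
Proof.
move=> h h' [x hx].
suff K : forall n, (exists y, y < n /\ (P y /\ forall z, z < y -> ~ P z)) \/ forall y, y < n -> ~ P y.
  case: (K (x + 1)) => [[y [_ hy]]|H]; first by exists y.
  by case: (H x) => //; zlra HA.
apply: (sg_ind HA); first by sg; apply: (Sg_comp1 HA (P := fun x => ~ P x)) => //; sg.
- by right=> y /(lt_zero HA).
- move=> n [[y [h1 h2]]|H].
    by left; exists y; split=> //; zlra HA.
  case: (classic (P n)) => hn; last by right=> y /(lt_succ HA) [/H //|->].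
  by left; exists n; split; [zlra HA|split].
Qed.

(** Choosing the least value makes the choice function definable: its graph is [P] with a bounded
    quantifier over the complement of [P]. *)
Lemma min_choice (P : N -> N -> Prop) :
  Sg (fun e => P (e 0%nat) (e 1%nat)) -> Sg (fun e => ~ P (e 0%nat) (e 1%nat)) ->
  (forall x, exists y, P x y) ->
  exists f, Sf1 f /\ forall x, P x (f x) /\ forall y, y < f x -> ~ P x y.
Proof.
move=> h h' H.
have H1 : forall x, exists y, P x y /\ forall z, z < y -> ~ P x z.
  by move=> x; apply: least => //; [apply: (Sg_comp2 HA (P := P))|apply: (Sg_comp2 HA (P := fun x y => ~ P x y))]; sg.
pose f x := proj1_sig (constructive_indefinite_description _ (H1 x)).
have hf : forall x, P x (f x) /\ forall y, y < f x -> ~ P x y.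
  by move=> x; exact: (proj2_sig (constructive_indefinite_description _ (H1 x))).
exists f; split=> //.
apply: (@Sg_ext _ _ (fun e => P (e 1%nat) (e 0%nat) /\ forall z, z < e 0%nat -> ~ P (e 1%nat) z)).
  move=> e; rewrite /tl; have [h1 h2] := hf (e 1%nat); split=> [->//|[h3 h4]].
  by case: (lt_cases HA (e 0%nat) (f (e 1%nat))) => [/h2|[//|/h4]].
by sg; [apply: (Sg_comp2 HA (P := P))|apply: (Sg_comp2 HA (P := fun x y => ~ P x y))]; sg.
Qed.

Lemma fun_choice (P : N -> N -> N -> Prop) :
  Sg (fun e => P (e 0%nat) (e 1%nat) (e 2%nat)) ->
  (forall x y, exists z, P x y z) -> (forall x y z w, P x y z -> P x y w -> z = w) ->
  exists f, Sf2 f /\ forall x y z, z = f x y <-> P x y z.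
Proof.
move=> h H U.
pose f x y := proj1_sig (constructive_indefinite_description _ (H x y)).
have hf x y : P x y (f x y) := proj2_sig (constructive_indefinite_description _ (H x y)).
have hf2 x y z : z = f x y <-> P x y z by split=> [->//|h']; apply: U h' (hf x y).
exists f; split=> //.
apply: (@Sg_ext _ _ (fun e => P (e 1%nat) (e 2%nat) (e 0%nat))); first by move=> e; rewrite hf2.
by apply: (Sg_comp3 HA (P := P)); sg.
Qed.

Lemma bound_fun f n : Sf1 f -> exists m, forall x, x < n -> f x < m.
Proof.
move=> hf; move: n; apply: (sg_ind HA); first by sg; apply: (Sf_comp1 HA (f := f)); sg.
- by exists 0 => x /(lt_zero HA).
- move=> n [m hm]; exists (m + f n + 1) => x /(lt_succ HA) [/hm h|->]; zlra HA.
Qed.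

Lemma division c m : 0 < m -> exists r, r < m /\ exists q, c = q * m + r.
Proof.
move=> hm; move: c; apply: (sg_ind HA); first by sg.
- by exists 0; split=> //; exists 0; ring.
- move=> c [r [hr [q ->]]].
  case: (classic (r + 1 < m)) => h.
    by exists (r + 1); split=> //; exists q; ring.
  have e : m = r + 1 by zlra HA.
  by exists 0; split=> //; exists (q + 1); rewrite e; ring.
Qed.
Lemma division_unique m r r' q q' : r < m -> r' < m -> q * m + r = q' * m + r' -> r = r'.
Proof.
move=> h h' e; case: (lt_cases HA q q') => [hq|[hq|hq]].
- by exfalso; znra HA.
- by subst; zlra HA.
- by exfalso; znra HA.
Qed.

Definition sbeta c d i x := x < 1 + (i + 1) * d /\ exists q, c = q * (1 + (i + 1) * d) + x.

Lemma sbeta_exists c d i : exists x, sbeta c d i x.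
Proof. by apply: division; znra HA. Qed.
Lemma sbeta_fun c d i x y : sbeta c d i x -> sbeta c d i y -> x = y.
Proof. by move=> [h [q e]] [h' [q' e']]; apply: (@division_unique _ x y q q' h h'); rewrite -e -e'. Qed.
Lemma Sg_sbeta F G H K : Sf F -> Sf G -> Sf H -> Sf K ->
  Sg (fun e : Env => sbeta (F e) (G e) (H e) (K e)).
Proof.
move=> hF hG hH hK; rewrite /sbeta.
by sg; apply: Sf_tl.
Qed.

(** Takes the place of the factorial in the beta lemma, since defining the factorial by recursion
    would already require coded sequences. *)
Lemma common_multiple n : exists b, 0 < b /\
  forall d, d < n + 1 -> d = 0 \/ exists e, b = d * e.
Proof.
move: n; apply: (sg_ind HA); first by sg.
- exists 1; split; first by zlra HA.
  by move=> d /(lt_succ HA) [/(lt_zero HA)//|]; left.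
- move=> n [b [hb H]]; exists (b * (n + 1)); split; first by znra HA.
  move=> d /(lt_succ HA) [/H [->|[e ->]]|->]; first by left.
    by right; exists (e * (n + 1)); ring.
  by right; exists b; ring.
Qed.

Lemma beta_coprime d u v t e : 0 < d -> v = u + t -> 0 < t -> d = t * e ->
  exists a b, (1 + (u + 1) * d) * a = (1 + (v + 1) * d) * b + 1.
Proof.
move=> hd hv ht hde.
have [p hp] : exists p, (v + 1) * d = p + 1.
  case: (zero_or_succ HA ((v + 1) * d)) => // h0; exfalso; znra HA.
(* Modulo [1 + (v + 1) * d] the number [(v + 1) * d] is -1, so the other modulus is [- t * d], and
   since [t * e = d] its inverse is minus e (v+1)^2. The sign is written as a further factor
   [(v + 1) * d]. *)
exists (e * (v + 1) * (v + 1) * ((v + 1) * d)), ((v + 1) * (v + 1) * d * e * (u + 1) + p).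
apply: (adI HA (z := 1 + (v + 1) * d)).
transitivity ((1 + (v + 1) * d) * ((v + 1) * (v + 1) * d * e * (u + 1) + (v + 1) * d) + 1).
  by subst d v; ring.
by rewrite hp; ring.
Qed.

(** Chinese remaindering by Sigma-1 induction. Besides a solution [c] for the first [k] moduli the
    invariant keeps a common multiple [P] of them that is invertible modulo each remaining one. *)
Lemma beta_lemma f n : Sf1 f -> exists c d, forall i, i < n -> sbeta c d i (f i).
Proof.
move=> hf; have [m hm] := bound_fun n hf; have [b [hb Hb]] := common_multiple n.
(* The factor [b] makes the moduli coprime, the factor [m + 1] makes them exceed the values of
   [f]. *)
pose d := b * (m + 1).
have hd : 0 < d by rewrite /d; znra HA.
have hdm i : i < n -> f i < 1 + (i + 1) * d.
  by move=> /hm h; rewrite /d; znra HA.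
suff K : forall k, k < n + 1 -> exists c P,
    ((forall i, i < k -> exists q, c = q * (1 + (i + 1) * d) + f i) /\
    (forall i, i < k -> exists t, P = t * (1 + (i + 1) * d))) /\
    (forall j, j < n -> j < k \/ exists s t, P * s = (1 + (j + 1) * d) * t + 1).
  have [|c [P [[h1 _] _]]] := K n; first by zlra HA.
  by exists c, d => i hi; split; [exact: hdm|exact: h1].
apply: (sg_ind HA).
- by sg; apply: (Sf_comp1 HA (f := f)); sg.
- move=> _; exists 0, 1; split; first by split=> i /(lt_zero HA).
  by move=> j _; right; exists 1, 0; ring.
- move=> k IH hk; have [|c [P [[h1 h2] h3]]] := IH; first by zlra HA.
  have hkn : k < n by zlra HA.
  have [/(lt_irr HA)//|[s [t est]]] := h3 _ hkn.
  (* Since [(k + 1) * d] is -1 for the modulus at hand, [y] is congruent to f k - c, expressed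
     without subtraction. *)
  pose y := f k + c * ((k + 1) * d).
  exists (c + P * (s * y)), (P * (1 + (k + 1) * d)); split; first split.
  + move=> i /(lt_succ HA) [hi|->]; last first.
      exists (c + t * y).
      transitivity (c + (P * s) * y); first by ring.
      by rewrite est /y; ring.
    have [q hq] := h1 _ hi; have [t' ht'] := h2 _ hi.
    by exists (q + t' * (s * y)); rewrite {1}hq ht'; ring.
  + move=> i /(lt_succ HA) [hi|->]; last by exists P.
    by have [t' ->] := h2 _ hi; exists (t' * (1 + (k + 1) * d)); ring.
  + move=> j hj; case: (classic (j < k + 1)) => hjk; [by left|right].
    have [hjk'|[s' [t' est']]] := h3 _ hj; first by exfalso; zlra HA.
    have [w hw] : exists w, j = k + (w + 1).
      have /(ltE HA) [w ->] : k < j by zlra HA.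
      by exists w; ring.
    have [e he] : exists e, d = (w + 1) * e.
      case: (Hb (w + 1)) => [|h0|[e he]].
      - by subst j; zlra HA.
      - by exfalso; zlra HA.
      - by exists (e * (m + 1)); rewrite /d he; ring.
    have [|a [b' hab]] := beta_coprime hd hw _ he; first by zlra HA.
    exists (s' * a), (t' * ((1 + (j + 1) * d) * b' + 1) + b').
    transitivity ((P * s') * ((1 + (k + 1) * d) * a)); first by ring.
    by rewrite est' hab; ring.
Qed.

Section PrimitiveRecursion.
Variables (a : N -> N) (f : N -> N -> N -> N).
Hypotheses (ha : Sf1 a) (hf : Sf3 f).

Definition recseq z x c d := sbeta c d 0 (a z) /\
  forall i, i < x -> exists y, sbeta c d i y /\ sbeta c d (i + 1) (f z i y).
Definition recgraph z x y := exists c d, recseq z x c d /\ sbeta c d x y.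

Lemma Sg_recgraph : Sg (fun e => recgraph (e 0%nat) (e 1%nat) (e 2%nat)).
Proof.
rewrite /recgraph /recseq; sg; try apply: Sg_sbeta; sg.
- by apply: (Sf_comp1 HA (f := a)); sg.
- by apply: (Sf_comp3 HA (f := f)); sg.
Qed.

Lemma recgraph_exists z x : exists y, recgraph z x y.
Proof.
move: x; apply: (sg_ind HA).
- by apply: Sg_ex => //; apply: (Sg_comp3 HA (P := recgraph)); [exact: Sg_recgraph|sg..].
- have [c [d h]] := @beta_lemma (fun _ => a z) 1 (Sf_const HA _).
  have h0 : sbeta c d 0 (a z) by apply: h; zlra HA.
  by exists (a z), c, d; split=> //; split=> // i /(lt_zero HA).
- move=> x [y [c [d [[h0 hS] hx]]]].
  have [bv hbv] : exists bv : N -> N, forall i, sbeta c d i (bv i).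
    exists (fun i => proj1_sig (constructive_indefinite_description _ (sbeta_exists c d i))).
    by move=> i; exact: (proj2_sig (constructive_indefinite_description _ (sbeta_exists c d i))).
  have Sbv : Sf1 bv.
    apply: (@Sg_ext _ _ (fun e => sbeta c d (e 1%nat) (e 0%nat))); last by apply: Sg_sbeta; sg.
    by move=> e; split=> [->|h]; [exact: hbv|exact: sbeta_fun h (hbv _)].
  (* A beta code cannot be lengthened in place; the old values and the new one are coded afresh. *)
  have [|c' [d' H]] := @beta_lemma (fun i => ite (i < x + 1) (bv i) (f z x y)) (x + 1 + 1).
    by sg; apply: (Sf_comp1 HA (f := bv)); sg.
  have H1 i w : i < x + 1 -> sbeta c d i w -> sbeta c' d' i w.
    move=> hi hw; have <- : bv i = w by exact: sbeta_fun (hbv i) hw.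
    by have := H i; rewrite ite_t //; apply; zlra HA.
  have H2 : sbeta c' d' (x + 1) (f z x y).
    by have := H (x + 1); rewrite ite_f; [apply; zlra HA|exact: lt_irr].
  exists (f z x y), c', d'; split=> //; split; first by apply: H1 => //; zlra HA.
  move=> i /(lt_succ HA) [hi|->].
    have [w [hw hw']] := hS _ hi; exists w.
    by split; apply: H1 => //; zlra HA.
  by exists y; split=> //; apply: H1 => //; zlra HA.
Qed.

Lemma recgraph_fun z x y y' : recgraph z x y -> recgraph z x y' -> y = y'.
Proof.
move=> [c [d [[h0 hS] hx]]] [c' [d' [[h0' hS'] hx']]].
suff K : forall i, i < x + 1 -> exists w, sbeta c d i w /\ sbeta c' d' i w.
  have [|w [h h']] := K x; first by zlra HA.
  by rewrite (sbeta_fun hx h) (sbeta_fun hx' h').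
apply: (sg_ind HA).
- by sg; apply: Sg_sbeta; sg.
- by move=> _; exists (a z).
- move=> i IH hi; have [|w [h h']] := IH; first by zlra HA.
  have hi' : i < x by zlra HA.
  have [v [hv hv1]] := hS _ hi'; have [v' [hv' hv1']] := hS' _ hi'.
  exists (f z i w); rewrite {1}(sbeta_fun h hv) (sbeta_fun h' hv') .
  by rewrite -{1}(sbeta_fun h hv) (sbeta_fun h' hv') -{1}(sbeta_fun h' hv') (sbeta_fun h hv) in hv1 hv1' *.
Qed.
End PrimitiveRecursion.
End Recursion.

Definition the X (P : X -> Prop) (h : exists x, P x) : X :=
  proj1_sig (constructive_indefinite_description _ h).
Lemma theP X (P : X -> Prop) (h : exists x, P x) : P (the h).
Proof. exact: (proj2_sig (constructive_indefinite_description _ h)). Qed.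

Section Vocabulary.
Variable A : struc.
Notation N := (sd A Num).
Notation "0" := (zr A).
Notation "1" := (on A).
Notation "x + y" := (@ad A x y).
Notation "x * y" := (@ml A x y).
Notation "x < y" := (@ltt A x y).
Implicit Types x y z : N.

(** The definitions prefixed with s are what the formulas of the statement denote in a structure.
    They are written so that satisfaction unfolds to them by conversion. *)
Definition spair x y := (x + y) * (x + y) + x.
Definition spow2 n m := exists c d, sbeta c d 0 1 /\
  (forall i x, i < n -> sbeta c d i x -> sbeta c d (i + 1) (x + x)) /\ sbeta c d n m.
End Vocabulary.

(** * Powers of two, truncated subtraction, square roots and unpairing *)

Section Functions.
Variable A : struc.
Hypothesis HA : isrca A.
Notation N := (sd A Num).
Notation "0" := (zr A).
Notation "1" := (on A).
Notation "x + y" := (@ad A x y).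
Notation "x * y" := (@ml A x y).
Notation "x < y" := (@ltt A x y).
Implicit Types (x y z : N).
Add Ring Nring2 : (N_semiring HA).

Lemma prim_rec2 (a : N -> N) (f : N -> N -> N -> N) : Sf1 a -> Sf3 f ->
  exists g, Sf2 g /\ forall z, g z 0 = a z /\ forall x, g z (x + 1) = f z x (g z x).
Proof.
move=> ha hf.
have [|||g [hg H]] := fun_choice HA (P := recgraph a f).
- exact: Sg_recgraph.
- by move=> z x; exact: recgraph_exists.
- by move=> z x y y'; exact: recgraph_fun.
exists g; split=> // z; split.
  apply/esym/H; have [|c [d h]] := @beta_lemma _ HA (fun _ => a z) 1.
    exact: (Sf_const HA).
  have h0 : sbeta c d 0 (a z) by apply: h; zlra HA.
  by exists c, d; split=> //; split=> // i /(lt_zero HA).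
move=> x; have /H [c [d [[h0 hS] hx]]] := erefl (g z (x + 1)).
have [|y [hy hy1]] := hS x; first by zlra HA.
have -> : g z x = y.
  apply/esym/H; exists c, d; split=> //; split=> // i hi; apply: hS; zlra HA.
exact: sbeta_fun hx hy1.
Qed.

Lemma prim_rec (a : N) (f : N -> N -> N) : Sf2 f ->
  exists g, Sf1 g /\ g 0 = a /\ forall x, g (x + 1) = f x (g x).
Proof.
move=> hf; have [||g [hg H]] := @prim_rec2 (fun _ => a) (fun _ => f).
- exact: Sf_const.
- by rewrite /Sf3; apply: (Sf_comp2 HA (f := f)); sg.
exists (g 0); split; last exact: H.
by rewrite /Sf1; apply: (Sf_comp2 HA (f := g)); sg.
Qed.

Lemma pw_exists : exists g, Sf1 g /\ g 0 = 1 /\ forall x, g (x + 1) = g x + g x.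
Proof. by apply: (@prim_rec 1 (fun _ y => y + y)); sg. Qed.
Definition pw := the pw_exists.
Lemma pw_Sf : Sf1 pw. Proof. by have [] := theP pw_exists. Qed.
Lemma pw0 : pw 0 = 1. Proof. by have [_ []] := theP pw_exists. Qed.
Lemma pwS x : pw (x + 1) = pw x + pw x. Proof. by have [_ []] := theP pw_exists. Qed.
Lemma pw_pos x : 0 < pw x.
Proof.
move: x; apply: (sg_ind HA); first by sg; apply: (Sf_comp1 HA pw_Sf); sg.
- by rewrite pw0; zlra HA.
- by move=> x; rewrite pwS => h; zlra HA.
Qed.

Lemma spow2E n m : spow2 n m <-> m = pw n.
Proof.
split=> [[c [d [h0 [hS hn]]]]|->].
- suff K : forall i, i < n + 1 -> sbeta c d i (pw i).
    by apply: (sbeta_fun HA hn); apply: K; zlra HA.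
  apply: (sg_ind HA); first by sg; apply: Sg_sbeta; sg; apply: (Sf_comp1 HA pw_Sf); sg.
    by move=> _; rewrite pw0.
  by move=> i IH hi; rewrite pwS; apply: hS; [|apply: IH]; zlra HA.
- have [c [d h]] := beta_lemma HA (n + 1) pw_Sf; exists c, d; split; last split.
  + by rewrite -pw0; apply: h; zlra HA.
  + move=> i x hi hx.
    have -> : x = pw i by apply: (sbeta_fun HA hx); apply: h; zlra HA.
    by rewrite -pwS; apply: h; zlra HA.
  + by apply: h; zlra HA.
Qed.

Lemma bv_exists c d i : exists x, sbeta c d i x. Proof. exact: sbeta_exists. Qed.
Definition bv c d i := the (bv_exists c d i).
Lemma bvP c d i x : sbeta c d i x <-> x = bv c d i.
Proof.
split=> [h|->]; last exact: (theP (bv_exists c d i)).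
exact: (sbeta_fun HA h (theP (bv_exists c d i))).
Qed.
Lemma bv_Sf : Sf3 bv.
Proof.
apply: (@Sg_ext _ _ (fun e => sbeta (e 1%nat) (e 2%nat) (e 3%nat) (e 0%nat))).
  by move=> e; rewrite bvP.
by apply: Sg_sbeta; sg.
Qed.

Lemma sb_exists x y : exists z, x = y + z \/ x < y /\ z = 0.
Proof.
have [z [->|->]] := trichotomy HA y x; first by exists z; left.
case: (zero_or_succ HA z) => [->|[w ->]]; first by exists 0; left; ring.
by exists 0; right; split=> //; zlra HA.
Qed.
(** Truncated subtraction. *)
Definition sb x y := the (sb_exists x y).
Lemma sbP x y : x = y + sb x y \/ x < y /\ sb x y = 0. Proof. exact: (theP (sb_exists x y)). Qed.
Lemma sb_Sf : Sf2 sb.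
Proof.
apply: (@Sg_ext _ _ (fun e => e 1%nat = e 2%nat + e 0%nat \/ e 1%nat < e 2%nat /\ e 0%nat = 0)).
  move=> e; rewrite /tl /=; have := sbP (e 1%nat) (e 2%nat).
  move: (sb (e 1%nat) (e 2%nat)) (e 0%nat) (e 1%nat) (e 2%nat) => u v w z H.
  split=> [->//|h].
  by case: H => [H|[H H']]; case: h => [h|[h h']]; zlra HA.
by sg.
Qed.
Lemma sb_ge x y : y < x + 1 -> x = y + sb x y.
Proof. by move=> h; case: (sbP x y) => // -[h' _]; zlra HA. Qed.
Lemma sb_eq x y z : x = y + z -> sb x y = z.
Proof. by move=> e; have := sbP x y => -[h|[h ->]]; zlra HA. Qed.
Lemma sb_le x y : x < y + 1 -> sb x y = 0.
Proof. by move=> h; case: (sbP x y) => [h'|[]//]; zlra HA. Qed.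

Lemma sq_exists z : exists s, ~ z < s * s /\ z < (s + 1) * (s + 1).
Proof.
have [|||s [h H]] := least HA (P := fun s => z < (s + 1) * (s + 1)); try by sg.
  by exists z; znra HA.
exists s; split=> //; case: (zero_or_succ HA s) => [->|[w e]]; first by znra HA.
by subst s; apply: H; zlra HA.
Qed.
Definition sq z := the (sq_exists z).
Lemma sqP z : ~ z < sq z * sq z /\ z < (sq z + 1) * (sq z + 1).
Proof. exact: (theP (sq_exists z)). Qed.
Lemma sq_unique z s : ~ z < s * s -> z < (s + 1) * (s + 1) -> sq z = s.
Proof.
have [] := sqP z; move: (sq z) => t h1 h2 h3 h4.
case: (lt_cases HA t s) => [h|[//|h]]; exfalso; znra HA.
Qed.
Lemma sq_Sf : Sf1 sq.
Proof.
apply: (@Sg_ext _ _ (fun e => ~ e 1%nat < e 0%nat * e 0%nat /\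
  e 1%nat < (e 0%nat + 1) * (e 0%nat + 1))); last by sg.
move=> e; rewrite /tl; split=> [->|[h h']]; first exact: sqP.
by rewrite (sq_unique h h').
Qed.

(** Because [x] is at most 2(x + y), the pair code lies between the squares of x + y and x + y + 1:
    its integer root is x + y and the remainder is [x]. The pairing is not onto; on other numbers
    truncated subtraction still gives [sn] a value. *)
Definition fs z := sb z (sq z * sq z).
Definition sn z := sb (sq z) (fs z).
Lemma fsE z : z = sq z * sq z + fs z.
Proof. by apply: sb_ge; have [h _] := sqP z; zlra HA. Qed.
Lemma fs_le z : fs z < sq z + sq z + 1.
Proof. by have := fsE z; have [_ h] := sqP z => e; znra HA. Qed.

Lemma sq_pair x y : sq (spair x y) = x + y.
Proof. by rewrite /spair; apply: sq_unique; znra HA. Qed.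
Lemma fs_pair x y : fs (spair x y) = x.
Proof. by have := fsE (spair x y); rewrite sq_pair /spair => e; zlra HA. Qed.
Lemma sn_pair x y : sn (spair x y) = y.
Proof. by rewrite /sn sq_pair fs_pair; apply: sb_eq. Qed.
Lemma pair_inj x y x' y' : spair x y = spair x' y' -> x = x' /\ y = y'.
Proof. by move=> e; rewrite -(fs_pair x y) -{2}(sn_pair x y) e fs_pair sn_pair. Qed.
Lemma fst_le_pair x y : x < spair x y + 1.
Proof. rewrite /spair; znra HA. Qed.
Lemma snd_le_pair x y : y < spair x y + 1.
Proof.
rewrite /spair; case: (zero_or_succ HA y) => [->|[w ->]]; first by znra HA.
by znra HA.
Qed.
Lemma pair_mono x y x' y' : x < x' + 1 -> y < y' + 1 -> spair x y < spair x' y' + 1.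
Proof. by move=> h h'; rewrite /spair; znra HA. Qed.
Lemma fs_le_self z : fs z < z + 1.
Proof. by have := fsE z; move: (fs z) (sq z) => u v e; znra HA. Qed.

End Functions.

Lemma fs_Sf A (HA : isrca A) : Sf1 (fs HA).
Proof.
rewrite /fs /Sf1; apply: (Sf_comp2 HA (sb_Sf HA)); first by sg.
by apply: (Sf_mul HA); apply: (Sf_comp1 HA (sq_Sf HA)); sg.
Qed.
Lemma sn_Sf A (HA : isrca A) : Sf1 (sn HA).
Proof.
rewrite /sn /Sf1; apply: (Sf_comp2 HA (sb_Sf HA)); first by apply: (Sf_comp1 HA (sq_Sf HA)); sg.
by apply: (Sf_comp1 HA (fs_Sf HA)); sg.
Qed.
Lemma spair_Sf A (HA : isrca A) : Sf2 (@spair A).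
Proof. by rewrite /spair; sg. Qed.

Ltac sf_hook := fail.
Ltac sf_user ::=
  match goal with
  | |- Sf (fun e => pw ?H _) => apply: (Sf_comp1 H (pw_Sf H))
  | |- Sf (fun e => sq ?H _) => apply: (Sf_comp1 H (sq_Sf H))
  | |- Sf (fun e => fs ?H _) => apply: (Sf_comp1 H (fs_Sf H))
  | |- Sf (fun e => sn ?H _) => apply: (Sf_comp1 H (sn_Sf H))
  | |- Sf (fun e => sb ?H _ _) => apply: (Sf_comp2 H (sb_Sf H))
  | |- Sf (fun e => bv ?H _ _ _) => apply: (Sf_comp3 H (bv_Sf H))
  | H : isrca _ |- Sf (fun e => spair _ _) => apply: (Sf_comp2 H (spair_Sf H))
  | H : isrca _, h : Sf (fun e => ?f (e 0%nat)) |- Sf (fun e => ?f _) => apply: (Sf_comp1 H (f := f))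
  | H : isrca _, h : Sf1 ?f |- Sf (fun e => ?f _) => apply: (Sf_comp1 H h)
  | H : isrca _, h : Sf2 ?f |- Sf (fun e => ?f _ _) => apply: (Sf_comp2 H h)
  | _ => sf_hook
  end.
Ltac sg_user ::= match goal with |- Sg (fun e => sbeta _ _ _ _) => apply: Sg_sbeta end.

(** * Oracle machines and counter programs *)

Section Machines.
Variable A : struc.
Notation N := (sd A Num).
Notation "0" := (zr A).
Notation "1" := (on A).
Notation "x + y" := (@ad A x y).
Notation "x * y" := (@ml A x y).
Notation "x < y" := (@ltt A x y).
Implicit Types (x y z a b c d t k q h s w m i j l r n v T : N) (X : sd A Set2).

Definition stwo : N := 1 + 1.
Definition sthree : N := stwo + 1.
Definition sslot a b t j x := sbeta a b (spair t j) x.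
Definition slslot i := stwo * i + stwo.
Definition srslot i := stwo * i + sthree.
Definition sunchanged a b t j := exists x, sslot a b t j x /\ sslot a b (t + 1) j x.

Definition soracle_step c d k X a b t :=
  exists q h s w m q' h',
    sslot a b t 0 q /\ sbeta c d (sthree * q) 0 /\
    sslot a b t 1 h /\
    (inn h X /\ s = 1 \/ (inn h X -> False) /\ s = 0) /\
    sbeta c d (sthree * q + 1 + s) (spair (spair w m) q') /\
    sslot a b (t + 1) 0 q' /\
    sslot a b (t + 1) 1 h' /\
    (m = 0 /\ (h = h' + 1 \/ h = 0 /\ h' = 0) \/
     m = 1 /\ h' = h + 1 \/
     1 < m /\ h' = h) /\
    (forall i, i < k -> sunchanged a b t (slslot i) /\ sunchanged a b t (srslot i)).

Definition swork_step c d k a b t :=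
  exists q i l r s w m q' l' r',
    sslot a b t 0 q /\ sbeta c d (sthree * q) (i + 1) /\ i < k /\
    sslot a b t (slslot i) l /\
    sslot a b t (srslot i) (stwo * r + s) /\ s < stwo /\
    sbeta c d (sthree * q + 1 + s) (spair (spair w m) q') /\ w < stwo /\
    sslot a b (t + 1) 0 q' /\
    sslot a b (t + 1) (slslot i) l' /\
    sslot a b (t + 1) (srslot i) r' /\
    (m = 0 /\
       (exists x, x < stwo /\ l = stwo * l' + x /\
          r' = stwo * (stwo * r + w) + x) \/
     m = 1 /\ l' = stwo * l + w /\ r' = r \/
     1 < m /\ l' = l /\ r' = stwo * r + w) /\
    sunchanged a b t 1 /\
    (forall j, j < k -> (j = i -> False) ->
       sunchanged a b t (slslot j) /\ sunchanged a b t (srslot j)).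

Definition sgood c d k X a b t :=
  (exists q, sslot a b t 0 q /\ 1 < q) /\
  (soracle_step c d k X a b t \/ swork_step c d k a b t).

Definition sinitial k n a b :=
  sslot a b 0 0 stwo /\ sslot a b 0 1 0 /\
  (forall i, i < k -> sslot a b 0 (slslot i) 0 /\
     exists x, sslot a b 0 (srslot i) x /\
       (i = 0 /\ spow2 n (x + 1) \/ (i = 0 -> False) /\ x = 0)).

Definition shalts e X n v :=
  exists k c d, e = spair k (spair c d) /\
    exists T a b, sinitial k n a b /\
      (forall t, t < T -> sgood c d k X a b t) /\
      sslot a b T 0 v.

Definition scomputes e X Z :=
  forall n, (inn n Z -> shalts e X n 1) /\ ((inn n Z -> False) -> shalts e X n 0).
End Machines.

(** * Runs of a machine and their concatenation *)

Section Runs.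
Variable A : struc.
Hypothesis HA : isrca A.
Notation N := (sd A Num).
Notation "0" := (zr A).
Notation "1" := (on A).
Notation "x + y" := (@ad A x y).
Notation "x * y" := (@ml A x y).
Notation "x < y" := (@ltt A x y).
Notation two := (stwo A).
Notation three := (sthree A).
Implicit Types (x y z a b t q h s w m i j l r n v T : N).
Add Ring Nring3 : (N_semiring HA).
Variables (c d k : N) (X : sd A Set2).
Notation good := (sgood c d k X).

Lemma two_lt x : x < two <-> x = 0 \/ x = 1.
Proof.
rewrite /stwo; split=> [/(lt_succ HA) [h|]|[->|->]]; [left|by right|..]; zlra HA.
Qed.

(** Only these slots of a row are constrained by a run; a beta table may carry anything in the
    others. *)
Definition rel j := j = 0 \/ j = 1 \/ exists i, i < k /\ (j = slslot i \/ j = srslot i).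

Lemma rel_bound j : rel j -> j < two * k + two + two.
Proof.
rewrite /slslot /srslot /sthree /stwo.
by move=> [->|[->|[i [hi [->|->]]]]]; zlra HA.
Qed.

(** The step conditions mention the contents of slots only positively, so a step survives copying
    its two rows to another table or another time. *)
Lemma good_mono a b t a' b' t' :
  (forall j x, rel j -> sslot a b t j x -> sslot a' b' t' j x) ->
  (forall j x, rel j -> sslot a b (t + 1) j x -> sslot a' b' (t' + 1) j x) ->
  good a b t -> good a' b' t'.
Proof.
move=> H H'.
have r0 : rel 0 by left.
have r1 : rel 1 by right; left.
have rl i : i < k -> rel (slslot i) by right; right; exists i; split=> //; left.
have rr i : i < k -> rel (srslot i) by right; right; exists i; split=> //; right.
have U j : rel j -> sunchanged a b t j -> sunchanged a' b' t' j.
  by move=> hj [x [h h']]; exists x; split; [apply: H|apply: H'].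
move=> [[q [hq hq1]] hs]; split; first by exists q; split=> //; apply: H.
case: hs => [hs|hs]; [left|right].
- case: hs => [q0 [h [s [w [m [q' [h' [s1 [s2 [s3 [s4 [s5 [s6 [s7 [s8 s9]]]]]]]]]]]]]]].
  exists q0, h, s, w, m, q', h'.
  do 8!(split; first by first [assumption | apply: H; auto; fail | apply: H'; auto; fail]).
  by move=> i hi; have [u1 u2] := s9 _ hi; split; apply: U; auto.
- case: hs => [q0 [i [l [r [s [w [m [q' [l' [r' hs]]]]]]]]]].
  case: hs => [s1 [s2 [s3 [s4 [s5 [s6 [s7 [s8 [s9 [s10 [s11 [s12 [s13 s14]]]]]]]]]]]]].
  exists q0, i, l, r, s, w, m, q', l', r'.
  do 13!(split; first by first [assumption | apply: H; auto; fail | apply: H'; auto; fail | apply: U; auto]).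
  by move=> j hj hji; have [u1 u2] := s14 _ hj hji; split; apply: U; auto.
Qed.

(** The tape contents are functions of the metatheory. Coding a configuration as a row of a table
    takes Sigma-1 graphs, which [cfg_Sf] demands. *)
Record cfg := Cfg { cq : N; ch : N; cl : N -> N; cr : N -> N }.
Implicit Types C D E : cfg.

Definition holds a b t C :=
  sslot a b t 0 (cq C) /\ sslot a b t 1 (ch C) /\
  forall i, i < k -> sslot a b t (slslot i) (cl C i) /\ sslot a b t (srslot i) (cr C i).

Definition reach C D := exists T a b,
  holds a b 0 C /\ (forall t, t < T -> good a b t) /\ holds a b T D.

Lemma holds_transfer a b t a' b' t' C : holds a b t C -> holds a' b' t' C ->
  forall j x, rel j -> sslot a b t j x -> sslot a' b' t' j x.
Proof.
move=> [h0 [h1 h2]] [h0' [h1' h2']] j x.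
case=> [->|[->|[i [hi [->|->]]]]] h.
- by rewrite (sbeta_fun HA h h0).
- by rewrite (sbeta_fun HA h h1).
- by rewrite (sbeta_fun HA h (proj1 (h2 _ hi))); exact: (proj1 (h2' _ hi)).
- by rewrite (sbeta_fun HA h (proj2 (h2 _ hi))); exact: (proj2 (h2' _ hi)).
Qed.

Lemma holds_mono a b t a' b' t' C :
  (forall j x, rel j -> sslot a b t j x -> sslot a' b' t' j x) ->
  holds a b t C -> holds a' b' t' C.
Proof.
move=> H [h0 [h1 h2]]; split; [|split].
- by apply: H => //; left.
- by apply: H => //; right; left.
- move=> i hi; have [hl hr] := h2 _ hi.
  by split; (apply: H => //; right; right; exists i; split=> //); [left|right].
Qed.

Lemma reach_trans C D E : reach C D -> reach D E -> reach C E.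
Proof.
move=> [T1 [a1 [b1 [s1 [g1 e1]]]]] [T2 [a2 [b2 [s2 [g2 e2]]]]].
pose J := two * k + two + two.
(* Row [T1] is taken from the second table; the last row of the first run and the first row of the
   second agree on all relevant slots. *)
have [|a [b H]] := @beta_lemma _ HA (fun u => ite (fs HA u < T1)
   (bv HA a1 b1 (spair (fs HA u) (sn HA u)))
   (bv HA a2 b2 (spair (sb HA (fs HA u) T1) (sn HA u)))) (spair (T1 + T2) J + 1).
  by sg.
have L1 t j x : t < T1 -> j < J -> sslot a1 b1 t j x -> sslot a b t j x.
  move=> ht hj /(bvP HA) hx; have := H (spair t j).
  rewrite !(fs_pair HA) !(sn_pair HA) ite_t // -hx; apply.
  by apply: pair_mono => //; zlra HA.
have L2 t j x : t < T2 + 1 -> j < J -> sslot a2 b2 t j x -> sslot a b (T1 + t) j x.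
  move=> ht hj /(bvP HA) hx; have := H (spair (T1 + t) j).
  rewrite !(fs_pair HA) !(sn_pair HA) ite_f; last by zlra HA.
  rewrite (sb_eq HA (z := t)) // -hx; apply.
  by apply: pair_mono => //; zlra HA.
have L3 t j x : t < T1 + 1 -> rel j -> sslot a1 b1 t j x -> sslot a b t j x.
  move=> /(lt_succ HA) [ht|->] hj hx; first by apply: L1 => //; exact: rel_bound.
  have := holds_transfer e1 s2 hj hx => /L2; rewrite (ad0 HA); apply; first by zlra HA.
  exact: rel_bound.
have L4 t j x : t < T2 + 1 -> rel j -> sslot a2 b2 t j x -> sslot a b (T1 + t) j x.
  by move=> ht hj; apply: L2 => //; exact: rel_bound.
exists (T1 + T2), a, b; split; [|split].
- by apply: holds_mono s1 => j x hj; apply: L3 => //; zlra HA.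
- move=> t ht; have [z [e|e]] := trichotomy HA T1 t.
  + subst t; apply: good_mono (g2 z _); last by zlra HA.
    * by move=> j x hj; apply: L4 => //; zlra HA.
    * by move=> j x hj h; rewrite -(adA HA); apply: L4 => //; zlra HA.
  + case: (classic (t < T1)) => htT.
      apply: good_mono (g1 t _) => //; by move=> j x hj; apply: L3 => //; zlra HA.
    have ez : t = T1 + 0 by zlra HA.
    rewrite ez; apply: good_mono (g2 0 _); last by zlra HA.
    * by move=> j x hj; apply: L4 => //; zlra HA.
    * by move=> j x hj h; rewrite -(adA HA); apply: L4 => //; zlra HA.
- by apply: holds_mono e2 => j x hj; apply: L4 => //; zlra HA.
Qed.

Lemma half_exists j : exists i, exists e, e < two /\ j = two * i + e.
Proof.
have [|e [he [i hi]]] := division HA j (m := two); first by rewrite /stwo; zlra HA.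
by exists i, e; split=> //; rewrite hi; ring.
Qed.
Definition half j := the (half_exists j).
Lemma halfE i e : e < two -> half (two * i + e) = i.
Proof.
move=> he; have [e' [he' h]] := theP (half_exists (two * i + e)).
rewrite -/(half _) in h; move: (half _) h => u h.
move: he he' => /two_lt he /two_lt he'; rewrite /stwo in h.
case: (lt_cases HA u i) => [hu|[//|hu]]; exfalso; case: he => he; case: he' => he'; zlra HA.
Qed.
Lemma half_Sf : Sf1 half.
Proof.
apply: (@Sg_ext _ _ (fun e => exists r, r < two /\ e 1%nat = two * e 0%nat + r)); last by sg.
move=> e; rewrite /tl; split=> [->|[r [hr ->]]]; first exact: (theP (half_exists (e 1%nat))).
by rewrite halfE.
Qed.

(** Inverts the slot numbering: a tape slot is 2i + 2 or 2i + 3, so half of j - 2 is the tape. *)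
Definition cval C j :=
  ite (j = 0) (cq C) (ite (j = 1) (ch C)
    (ite (j = slslot (half (sb HA j two))) (cl C (half (sb HA j two))) (cr C (half (sb HA j two))))).

Lemma cval0 C : cval C 0 = cq C. Proof. by rewrite /cval ite_t. Qed.
Lemma cval1 C : cval C 1 = ch C.
Proof. by rewrite /cval ite_f ?ite_t // => h; zlra HA. Qed.
Lemma cvall C i : cval C (slslot i) = cl C i.
Proof.
have e : half (sb HA (slslot i) two) = i.
  rewrite (sb_eq HA (z := two * i + 0)); last by rewrite /slslot; ring.
  by rewrite halfE //; apply/two_lt; left.
rewrite /cval e ite_f; last by rewrite /slslot /stwo => h; zlra HA.
rewrite ite_f; last by rewrite /slslot /stwo => h; zlra HA.
by rewrite ite_t.
Qed.
Lemma cvalr C i : cval C (srslot i) = cr C i.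
Proof.
have e : half (sb HA (srslot i) two) = i.
  rewrite (sb_eq HA (z := two * i + 1)); last by rewrite /srslot /sthree; ring.
  by rewrite halfE //; apply/two_lt; right.
rewrite /cval e ite_f; last by rewrite /srslot /sthree /stwo => h; zlra HA.
rewrite ite_f; last by rewrite /srslot /sthree /stwo => h; zlra HA.
by rewrite ite_f // /srslot /slslot /sthree /stwo => h; zlra HA.
Qed.

Definition cfg_Sf C := Sf1 (cl C) /\ Sf1 (cr C).

Lemma two_rows C D : cfg_Sf C -> cfg_Sf D -> exists a b, holds a b 0 C /\ holds a b 1 D.
Proof.
move=> [h1 h2] [h3 h4]; pose J := two * k + two + two.
have := half_Sf => hSf.
have [|a [b Hab]] := @beta_lemma _ HA (fun u => ite (fs HA u = 0) (cval C (sn HA u)) (cval D (sn HA u)))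
  (spair 1 J + 1).
  by rewrite /cval /slslot; sg.
have K t E : t < 1 + 1 ->
    (forall j, ite (fs HA (spair t j) = 0) (cval C (sn HA (spair t j))) (cval D (sn HA (spair t j))) =
     cval E j) -> holds a b t E.
  move=> ht hE; have S j : j < J + 1 -> sslot a b t j (cval E j).
    move=> hj; rewrite -hE; apply: Hab; apply: pair_mono => //; zlra HA.
  have S' j : rel j -> sslot a b t j (cval E j) by move/rel_bound => hj; apply: S; zlra HA.
  split; [|split].
  - by rewrite -cval0; apply: S'; left.
  - by rewrite -cval1; apply: S'; right; left.
  - move=> i hi; rewrite -{1}cvall -cvalr.
    by split; (apply: S'; right; right; exists i; split=> //); [left|right].
have hC : holds a b 0 C.
  by apply: K; [zlra HA|move=> j; rewrite (fs_pair HA) (sn_pair HA) ite_t].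
have hD : holds a b 1 D.
  apply: K; [zlra HA|move=> j; rewrite (fs_pair HA) (sn_pair HA) ite_f //].
  by move=> h; zlra HA.
by exists a, b.
Qed.

Lemma reach1 C D : cfg_Sf C -> cfg_Sf D ->
  (forall a b, holds a b 0 C -> holds a b (0 + 1) D -> good a b 0) -> reach C D.
Proof.
move=> hC hD H; have [a [b [h h']]] := two_rows hC hD.
exists 1, a, b; split=> //; split=> // t ht.
have -> : t = 0 by zlra HA.
by apply: H => //; rewrite ad0n.
Qed.

Lemma reach_refl C : cfg_Sf C -> reach C C.
Proof.
move=> hC; have [a [b [h h']]] := two_rows hC hC.
by exists 0, a, b; split=> //; split=> // t /(lt_zero HA).
Qed.

(** Makes reachability a Sigma-1 predicate, so that [sg_ind] can handle loops whose number of rounds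
    is nonstandard. *)
Lemma Sg_good F G H : Sf F -> Sf G -> Sf H -> Sg (fun e => good (F e) (G e) (H e)).
Proof.
move=> hF hG hH; apply: (Sg_comp3 HA (P := fun a b t => good a b t)) => //.
by rewrite /sgood /soracle_step /swork_step /sunchanged /sslot /slslot /srslot; sg.
Qed.

End Runs.

Section Update.
Variable A : struc.
Hypothesis HA : isrca A.
Notation N := (sd A Num).
Implicit Types (i j x y : N) (v : N -> N).

Definition upd i x v : N -> N := fun j => ite (j = i) x (v j).

Lemma upd_eq i x v : upd i x v i = x.
Proof. by rewrite /upd ite_t. Qed.
Lemma upd_neq i j x v : j <> i -> upd i x v j = v j.
Proof. by move=> h; rewrite /upd ite_f. Qed.
Lemma upd_id i v : upd i (v i) v = v.
Proof.
apply: functional_extensionality => j.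
by case: (classic (j = i)) => [->|h]; [rewrite upd_eq|rewrite upd_neq].
Qed.
Lemma upd_upd i x y v : upd i x (upd i y v) = upd i x v.
Proof.
apply: functional_extensionality => j.
by case: (classic (j = i)) => [->|h]; [rewrite !upd_eq|rewrite !upd_neq].
Qed.

Lemma upd_Sf i x v : Sf1 v -> Sf1 (upd i x v).
Proof. by move=> h; rewrite /upd; sg. Qed.
End Update.

(** * Counter instructions as machine states *)

Section Instructions.
Variable A : struc.
Hypothesis HA : isrca A.
Notation N := (sd A Num).
Notation "0" := (zr A).
Notation "1" := (on A).
Notation "x + y" := (@ad A x y).
Notation "x * y" := (@ml A x y).
Notation "x < y" := (@ltt A x y).
Notation two := (stwo A).
Notation three := (sthree A).
Implicit Types (x y z a b t q h s w m i j l r n : N) (v : N -> N).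
Add Ring Nring4 : (N_semiring HA).
Variables (c d k : N) (X : sd A Set2).
Notation reach := (reach c d k X).
Implicit Types C D : cfg A.

Definition act w m q := spair (spair w m) q.
Definition instr q tape a0 a1 := sbeta c d (three * q) tape /\
  sbeta c d (three * q + 1 + 0) a0 /\ sbeta c d (three * q + 1 + 1) a1.

Lemma work_reach C D i r s w m : cfg_Sf C -> cfg_Sf D ->
  1 < cq C -> sbeta c d (three * cq C) (i + 1) -> i < k ->
  cr C i = two * r + s -> s < two ->
  sbeta c d (three * cq C + 1 + s) (act w m (cq D)) -> w < two ->
  (m = 0 /\ (exists x, x < two /\ cl C i = two * cl D i + x /\
          cr D i = two * (two * r + w) + x) \/
     m = 1 /\ cl D i = two * cl C i + w /\ cr D i = r \/
     1 < m /\ cl D i = cl C i /\ cr D i = two * r + w) ->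
  ch D = ch C -> (forall j, j < k -> j <> i -> cl D j = cl C j /\ cr D j = cr C j) ->
  reach C D.
Proof.
move=> hC hD hq ht hi hr hs hact hw hm hh hj.
apply: (reach1 HA) => // a b [C0 [C1 CL]] [D0 [D1 DL]].
split; first by exists (cq C).
have [CLi CRi] := CL _ hi; have [DLi DRi] := DL _ hi.
right; exists (cq C), i, (cl C i), r, s, w, m, (cq D), (cl D i), (cr D i).
rewrite -hr; do 12!(split; first by []).
split; first by exists (ch C); rewrite -{2}hh.
move=> j hjk hji; have [e e'] := hj _ hjk hji; have [u u'] := CL _ hjk; have [w1 w2] := DL _ hjk.
by split; [exists (cl C j); rewrite -{2}e|exists (cr C j); rewrite -{2}e'].
Qed.

Lemma oracle_reach C D s w m : cfg_Sf C -> cfg_Sf D ->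
  1 < cq C -> sbeta c d (three * cq C) 0 ->
  (inn (ch C) X /\ s = 1 \/ ~ inn (ch C) X /\ s = 0) ->
  sbeta c d (three * cq C + 1 + s) (act w m (cq D)) ->
  (m = 1 /\ ch D = ch C + 1 \/ 1 < m /\ ch D = ch C) ->
  cl D = cl C -> cr D = cr C -> reach C D.
Proof.
move=> hC hD hq ht hs hact hm hl hr.
apply: (reach1 HA) => // a b [C0 [C1 CL]] [D0 [D1 DL]].
split; first by exists (cq C).
left; exists (cq C), (ch C), s, w, m, (cq D), (ch D).
do 7!(split; first by []); split; first by case: hm; [right; left|right; right].
move=> j hjk; have [u u'] := CL _ hjk; have [w1 w2] := DL _ hjk.
by split; [exists (cl C j); rewrite -{2}hl|exists (cr C j); rewrite -{2}hr].
Qed.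

(** 2^x - 1, the number whose binary digits are [x] ones. *)
Definition ones x := sb HA (pw HA x) 1.
Lemma onesE x : pw HA x = 1 + ones x.
Proof. by apply: sb_ge; have := pw_pos HA x => h; zlra HA. Qed.
Lemma ones0 : ones 0 = 0.
Proof. by apply: (adI HA (z := 1)); have := onesE 0; rewrite pw0 => h; zlra HA. Qed.
Lemma onesS x : ones (x + 1) = two * ones x + 1.
Proof.
by have := onesE (x + 1); have := onesE x; rewrite pwS /stwo; move: (pw HA x) => u h h'; zlra HA.
Qed.
Lemma ones_Sf : Sf1 ones.
Proof. by rewrite /ones; sg. Qed.

(* A counter with value x is a tape carrying x ones left of a head that scans a
   blank. *)
Definition mk q h v : cfg A := Cfg q h (fun i => ones (v i)) (fun _ => 0).
Definition RC q h v q' h' v' := reach (mk q h v) (mk q' h' v').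

Lemma mk_Sf q h v : Sf1 v -> cfg_Sf (mk q h v).
Proof. by have := ones_Sf => hS hv; split; rewrite /= ; sg. Qed.

Lemma RC_trans q h v q' h' v' q'' h'' v'' :
  RC q h v q' h' v' -> RC q' h' v' q'' h'' v'' -> RC q h v q'' h'' v''.
Proof. exact: reach_trans. Qed.

Lemma zero_lt_two : 0 < two. Proof. rewrite /stwo; zlra HA. Qed.
Lemma one_lt_two : 1 < two. Proof. rewrite /stwo; zlra HA. Qed.

Lemma RC_inc q q' h v i : Sf1 v -> 1 < q -> i < k ->
  instr q (i + 1) (act 1 1 q') (act 1 1 q') -> RC q h v q' h (upd i (v i + 1) v).
Proof.
move=> hv hq hi [i1 [i2 i3]].
apply: (@work_reach _ _ i 0 0 1 1) => //=; try exact: mk_Sf.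
- by apply: mk_Sf; exact: upd_Sf.
- by ring.
- exact: zero_lt_two.
- exact: one_lt_two.
- by right; left; rewrite upd_eq onesS.
- by move=> j _ hj; rewrite upd_neq.
Qed.

(** The head steps left and tests the cell it finds. A one is erased, and the head then scans a
    blank with one fewer one to its left; if the tape is blank, stepping left has changed
    nothing. *)
Definition dec_block q i nz zq :=
  instr q (i + 1) (act 0 0 (q + 1)) (act 0 0 (q + 1)) /\
  instr (q + 1) (i + 1) (act 0 two zq) (act 0 two nz).

Lemma RC_dec_pos q h v i nz zq x : Sf1 v -> 1 < q -> i < k -> dec_block q i nz zq ->
  v i = x + 1 -> RC q h v nz h (upd i x v).
Proof.
move=> hv hq hi [[i1 [i2 i3]] [j1 [j2 j3]]] hx.
have hS := ones_Sf.
pose M := Cfg (q + 1) h (upd i (ones x) (fun j => ones (v j))) (upd i 1 (fun _ => 0)).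
have hM : cfg_Sf M by split; rewrite /=; apply: upd_Sf => //; sg.
apply: (reach_trans HA (D := M)).
- apply: (@work_reach _ M i 0 0 0 0) => //=.
  + exact: mk_Sf.
  + by ring.
  + exact: zero_lt_two.
  + exact: zero_lt_two.
  + left; split=> //; exists 1; split; first exact: one_lt_two.
    by rewrite !upd_eq hx onesS; split=> //; ring.
  + by move=> j _ hj; rewrite !upd_neq.
- apply: (@work_reach M _ i 0 1 0 two) => //=.
  + by apply: mk_Sf; exact: upd_Sf.
  + by zlra HA.
  + by rewrite upd_eq; ring.
  + exact: one_lt_two.
  + exact: zero_lt_two.
  + right; right; split; first exact: one_lt_two.
    by rewrite !upd_eq; split=> //; ring.
  + by move=> j _ hj; rewrite !upd_neq.
Qed.

Lemma RC_dec_zero q h v i nz zq : Sf1 v -> 1 < q -> i < k -> dec_block q i nz zq ->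
  v i = 0 -> RC q h v zq h v.
Proof.
move=> hv hq hi [[i1 [i2 i3]] [j1 [j2 j3]]] hx.
have hM := mk_Sf (q + 1) h hv.
apply: (reach_trans HA (D := mk (q + 1) h v)).
- apply: (@work_reach _ _ i 0 0 0 0) => //=; try exact: mk_Sf.
  + by ring.
  + exact: zero_lt_two.
  + exact: zero_lt_two.
  + left; split=> //; exists 0; split; first exact: zero_lt_two.
    by rewrite hx ones0; split; ring.
- apply: (@work_reach _ _ i 0 0 0 two) => //=; try exact: mk_Sf.
  + by zlra HA.
  + by ring.
  + exact: zero_lt_two.
  + exact: zero_lt_two.
  + right; right; split; first exact: one_lt_two.
    by split=> //; ring.
Qed.

(** A jump is an oracle query whose two answers lead to the same state. *)
Lemma RC_goto q h v q' : Sf1 v -> 1 < q ->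
  instr q 0 (act 0 two q') (act 0 two q') -> RC q h v q' h v.
Proof.
move=> hv hq [i1 [i2 i3]].
case: (classic (inn h X)) => hX.
- apply: (@oracle_reach _ _ 1 0 two) => //=; try exact: mk_Sf; first by left.
  by right; split=> //; exact: one_lt_two.
- apply: (@oracle_reach _ _ 0 0 two) => //=; try exact: mk_Sf; first by right.
  by right; split=> //; exact: one_lt_two.
Qed.

Lemma RC_oinc q h v q' : Sf1 v -> 1 < q ->
  instr q 0 (act 0 1 q') (act 0 1 q') -> RC q h v q' (h + 1) v.
Proof.
move=> hv hq [i1 [i2 i3]].
case: (classic (inn h X)) => hX.
- by apply: (@oracle_reach _ _ 1 0 1) => //=; try exact: mk_Sf; left.
- by apply: (@oracle_reach _ _ 0 0 1) => //=; try exact: mk_Sf; [right|left].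
Qed.

Lemma RC_query q h v q0 q1 : Sf1 v -> 1 < q ->
  instr q 0 (act 0 two q0) (act 0 two q1) ->
  (inn h X -> RC q h v q1 h v) /\ (~ inn h X -> RC q h v q0 h v).
Proof.
move=> hv hq [i1 [i2 i3]]; split=> hX.
- apply: (@oracle_reach _ _ 1 0 two) => //=; try exact: mk_Sf; first by left.
  by right; split=> //; exact: one_lt_two.
- apply: (@oracle_reach _ _ 0 0 two) => //=; try exact: mk_Sf; first by right.
  by right; split=> //; exact: one_lt_two.
Qed.

(* The input is a block of ones from the scanned cell on: state q moves the head
   of tape 0 to its right end. *)
Lemma reach_input q q' n : 1 < q -> 0 < k -> instr q (0 + 1) (act 0 two q') (act 1 1 q) ->
  reach (Cfg q 0 (fun _ => 0) (upd 0 (ones n) (fun _ => 0))) (mk q' 0 (upd 0 n (fun _ => 0))).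
Proof.
move=> hq hk [i1 [i2 i3]]; have hS := ones_Sf.
pose F x := Cfg q 0 (upd 0 (ones x) (fun _ => 0)) (upd 0 (ones (sb HA n x)) (fun _ => 0)).
have FS x : cfg_Sf (F x) by split; rewrite /=; apply: upd_Sf => //; sg.
have K : forall x, x < n + 1 -> reach (F 0) (F x).
  apply: (sg_ind HA).
  - rewrite /reach /holds /F /= /sslot /slslot /srslot /upd; sg.
    by apply: (Sg_good HA); sg.
  - by move=> _; exact: (reach_refl HA).
  - move=> x IH hx; apply: (reach_trans HA (D := F x)); first by apply: IH; zlra HA.
    have e : sb HA n x = sb HA n (x + 1) + 1.
      by apply: sb_eq; rewrite adC //; have := sb_ge HA (x := n) (y := x + 1) hx => h; zlra HA.
    apply: (@work_reach _ _ 0 (ones (sb HA n (x + 1))) 1 1 1) => //=.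
    + by rewrite upd_eq e onesS.
    + exact: one_lt_two.
    + exact: one_lt_two.
    + by right; left; rewrite !upd_eq onesS.
    + by move=> j _ hj; rewrite !upd_neq.
have e0 : sb HA n 0 = n by apply: sb_eq; rewrite ad0n.
have en : sb HA n n = 0 by apply: sb_le; zlra HA.
apply: (reach_trans HA (D := F n)).
  have := K n; rewrite /F ones0 e0.
  have -> : upd 0 0 (fun _ => 0) = (fun _ : N => 0) := upd_id 0 (fun _ => 0).
  by apply; zlra HA.
apply: (@work_reach _ _ 0 0 0 0 two) => //=.
- by apply: mk_Sf; apply: upd_Sf => //; exact: Sf_const.
- by rewrite upd_eq en ones0; ring.
- exact: zero_lt_two.
- exact: zero_lt_two.
- right; right; split; first exact: one_lt_two.
  by rewrite !upd_eq; split=> //; ring.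
- by move=> j _ hj; rewrite !upd_neq // ones0.
Qed.
End Instructions.

(** * Counter programs and their compilation *)

Section Programs.
Variable A : struc.
Notation N := (sd A Num).
Notation "0" := (zr A).
Notation "1" := (on A).
Notation "x + y" := (@ad A x y).
Notation two := (stwo A).
Implicit Types (i s : N).

(* Counters are numbered by elements of N; [PQ p q] branches on whether the
   oracle holds at the head, [PIf i p q] decrements counter i when it is positive. *)
Inductive prog :=
| PNop
| PInc (i : N)
| POInc
| PIf (i : N) (p q : prog)
| PQ (p q : prog)
| PSeq (p q : prog)
| PLoop (i : N) (p : prog).

Fixpoint size (p : prog) : N :=
  match p with
  | PNop => 0
  | PInc _ | POInc => 1
  | PIf _ p q => two + size p + 1 + size q
  | PQ p q => 1 + size p + 1 + size q
  | PSeq p q => size p + size q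
  | PLoop _ p => two + size p + 1
  end.

Definition row : Type := N * N * N.
Definition goto s : row := (0, act 0 two s, act 0 two s).
Definition dec_rows i s nz zq : list row :=
  [(i + 1, act 0 0 (s + 1), act 0 0 (s + 1)); (i + 1, act 0 two zq, act 0 two nz)].

(** Jumps are absolute, so the code depends on its first state [s]. Every program leaves by entering
    state [s + size p], which makes sequencing a concatenation. *)
Fixpoint code (p : prog) s : list row :=
  match p with
  | PNop => []
  | PInc i => [(i + 1, act 1 1 (s + 1), act 1 1 (s + 1))]
  | POInc => [(0, act 0 1 (s + 1), act 0 1 (s + 1))]
  | PIf i p q =>
      dec_rows i s (s + two) (s + (two + size p + 1)) ++ code p (s + two) ++
      [goto (s + (two + size p + 1 + size q))] ++ code q (s + (two + size p + 1))
  | PQ p q =>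
      [(0, act 0 two (s + (1 + size p + 1)), act 0 two (s + 1))] ++ code p (s + 1) ++
      [goto (s + (1 + size p + 1 + size q))] ++ code q (s + (1 + size p + 1))
  | PSeq p q => code p s ++ code q (s + size p)
  | PLoop i p =>
      dec_rows i s (s + two) (s + (two + size p + 1)) ++ code p (s + two) ++ [goto s]
  end.

Fixpoint len (l : list row) : N := match l with [] => 0 | _ :: l => len l + 1 end.

Fixpoint wf (k : N) (p : prog) : Prop :=
  match p with
  | PNop | POInc => True
  | PInc i => ltt i k
  | PIf i p q => ltt i k /\ wf k p /\ wf k q
  | PQ p q | PSeq p q => wf k p /\ wf k q
  | PLoop i p => ltt i k /\ wf k p
  end.
End Programs.
Arguments PNop {A}.
Arguments POInc {A}.

Section Execution.
Variable A : struc.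
Hypothesis HA : isrca A.
Notation N := (sd A Num).
Notation "0" := (zr A).
Notation "1" := (on A).
Notation "x + y" := (@ad A x y).
Notation "x * y" := (@ml A x y).
Notation "x < y" := (@ltt A x y).
Notation two := (stwo A).
Implicit Types (x y z h s i j n : N) (v f : N -> N) (p q : prog A).
Add Ring Nring5 : (N_semiring HA).
Variables (c d k : N) (X : sd A Set2).
Notation RC := (RC HA c d k X).

Fixpoint has_code s (l : list (row A)) : Prop :=
  match l with
  | [] => True
  | (t, a0, a1) :: l => instr c d s t a0 a1 /\ has_code (s + 1) l
  end.

Lemma has_code_app l l' : forall s, has_code s (l ++ l') <-> has_code s l /\ has_code (s + len l) l'.
Proof.
elim: l => [|[[t a0] a1] l IH] s /=; first by rewrite ad0; tauto.
rewrite IH; have -> : s + 1 + len l = s + (len l + 1) by ring.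
tauto.
Qed.

Lemma len_app (l l' : list (row A)) : len (l ++ l') = len l + len l'.
Proof. by elim: l => [|a l IH] /=; [rewrite ad0n|rewrite IH; ring]. Qed.

Lemma len_code p : forall s, len (code p s) = size p.
Proof.
elim: p => //= [i||i p IH q IH'|p IH q IH'|p IH q IH'|i p IH] s;
  rewrite ?len_app /= ?len_app /= ?IH ?IH' /stwo; ring.
Qed.

(** The run is claimed for every placement of the code above the halting states 0 and 1, and for
    counter contents with a Sigma-1 graph, which are the ones that can be coded in a table. *)
Definition exec p h v h' v' := wf k p -> Sf1 v -> Sf1 v' /\
  forall s, 1 < s -> has_code s (code p s) -> RC s h v (s + size p) h' v'.

Lemma exec_nop h v : exec PNop h v h v.
Proof.
move=> _ hv; split=> // s hs _; rewrite /= ad0 //.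
by apply: (reach_refl HA); exact: mk_Sf.
Qed.

Lemma exec_inc i h v : exec (PInc i) h v h (upd i (v i + 1) v).
Proof.
move=> hw hv; split; first exact: upd_Sf.
by move=> s hs [hc _]; apply: RC_inc.
Qed.

Lemma exec_oinc h v : exec POInc h v (h + 1) v.
Proof. by move=> hw hv; split=> // s hs [hc _]; apply: RC_oinc. Qed.

Lemma exec_seq p q h v h' v' h'' v'' :
  exec p h v h' v' -> exec q h' v' h'' v'' -> exec (PSeq p q) h v h'' v''.
Proof.
move=> H H' [w1 w2] hv; have [hv' R] := H w1 hv; have [hv'' R'] := H' w2 hv'.
split=> // s hs /has_code_app [c1 c2].
rewrite len_code in c2.
apply: (RC_trans (R s hs c1)) => /=.
by have := R' (s + size p); rewrite -adA //; apply=> //; zlra HA.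
Qed.

Lemma dec_code i s nz zq : has_code s (dec_rows i s nz zq) -> dec_block c d s i nz zq.
Proof. by move=> [h1 [h2 _]]. Qed.

Lemma exec_if_pos i p q h v x h' v' : v i = x + 1 ->
  exec p h (upd i x v) h' v' -> exec (PIf i p q) h v h' v'.
Proof.
move=> hx H [hi [w1 w2]] hv; have [hv' R] := H w1 (upd_Sf HA _ _ hv); split=> // s hs.
move=> /has_code_app [/dec_code c1 /has_code_app [c2 /has_code_app [[c3 _] _]]].
apply: (RC_trans (RC_dec_pos HA X h hv hs hi c1 hx)).
have e2 : s + len (dec_rows i s (s + two) (s + (two + size p + 1))) = s + two.
  by rewrite /= /stwo; ring.
rewrite e2 in c2 c3; apply: (RC_trans (R _ _ c2)); first by rewrite /stwo; zlra HA.
rewrite len_code in c3; apply: RC_goto => //.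
by rewrite /stwo; zlra HA.
Qed.

Lemma exec_if_zero i p q h v h' v' : v i = 0 ->
  exec q h v h' v' -> exec (PIf i p q) h v h' v'.
Proof.
move=> hx H [hi [w1 w2]] hv; have [hv' R] := H w2 hv; split=> // s hs.
move=> /has_code_app [/dec_code c1 /has_code_app [c2 /has_code_app [_ c3]]].
apply: (RC_trans (RC_dec_zero HA X h hv hs hi c1 hx)).
have e3 : s + len (dec_rows i s (s + two) (s + (two + size p + 1))) + len (code p (s + two)) +
    len [goto (s + (two + size p + 1 + size q))] = s + (two + size p + 1).
  by rewrite len_code /= /stwo; ring.
rewrite e3 in c3; have := R _ _ c3.
have -> : s + (two + size p + 1) + size q = s + (two + size p + 1 + size q) by ring.
by apply; rewrite /stwo; zlra HA.
Qed.

Lemma exec_q_in p q h v h' v' : inn h X -> exec p h v h' v' -> exec (PQ p q) h v h' v'.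
Proof.
move=> hX H [w1 w2] hv; have [hv' R] := H w1 hv; split=> // s hs.
move=> /has_code_app [[c1 _] /has_code_app [c2 /has_code_app [[c3 _] _]]].
have [/(_ hX) r _] := RC_query HA k X h hv hs c1; apply: (RC_trans r).
have e2 : s + len [(0, act 0 two (s + (1 + size p + 1)), act 0 two (s + 1))] = s + 1.
  by rewrite /=; ring.
rewrite e2 in c2 c3; apply: (RC_trans (R _ _ c2)); first by zlra HA.
rewrite len_code in c3; apply: RC_goto => //; zlra HA.
Qed.

Lemma exec_q_out p q h v h' v' : ~ inn h X -> exec q h v h' v' -> exec (PQ p q) h v h' v'.
Proof.
move=> hX H [w1 w2] hv; have [hv' R] := H w2 hv; split=> // s hs.
move=> /has_code_app [[c1 _] /has_code_app [_ /has_code_app [_ c3]]].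
have [_ /(_ hX) r] := RC_query HA k X h hv hs c1; apply: (RC_trans r).
rewrite len_code /= in c3.
have e3 : s + (0 + 1) + size p + (0 + 1) = s + (1 + size p + 1) by ring.
rewrite e3 in c3; have := R _ _ c3.
have -> : s + (1 + size p + 1) + size q = s + (1 + size p + 1 + size q) by ring.
by apply; zlra HA.
Qed.

(** The number of rounds is an element of the model, so external induction does not suffice. The
    contents [f y] and the head [hd y] after [y] rounds are given by Sigma-1 functions, which makes
    the invariant a Sigma-1 statement. *)
Lemma exec_loop i p n (f : N -> N -> N) (hd : N -> N) : Sf2 f -> Sf1 hd ->
  (forall x y, y < n -> exec p (hd y) (upd i x (f y)) (hd (y + 1)) (upd i x (f (y + 1)))) ->
  exec (PLoop i p) (hd 0) (upd i n (f 0)) (hd n) (upd i 0 (f n)).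
Proof.
move=> hf hhd H [hi w1] hv.
have fS x y : Sf1 (upd i x (f y)) by rewrite /upd; sg.
split; first exact: fS.
move=> s hs /has_code_app [/dec_code c1 /has_code_app [c2 [c3 _]]].
have e2 : s + len (dec_rows i s (s + two) (s + (two + size p + 1))) = s + two.
  by rewrite /= /stwo; ring.
rewrite e2 in c2 c3; rewrite len_code in c3.
have K : forall y, y < n + 1 -> RC s (hd 0) (upd i n (f 0)) s (hd y) (upd i (sb HA n y) (f y)).
  have oS := ones_Sf HA.
  apply: (sg_ind HA).
  - rewrite /RC /reach /holds /= /sslot /slslot /srslot /upd; sg.
    by apply: (Sg_good HA); sg.
  - move=> _; have -> : sb HA n 0 = n by apply: sb_eq; rewrite ad0n.
    by apply: (reach_refl HA); apply: mk_Sf.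
  - move=> y IH hy.
    have e : sb HA n y = sb HA n (y + 1) + 1.
      by apply: sb_eq; have := sb_ge HA (x := n) (y := y + 1) hy => h; zlra HA.
    have hyn : y < n by zlra HA.
    apply: (RC_trans (IH _)); first by zlra HA.
    have hx : upd i (sb HA n y) (f y) i = sb HA n (y + 1) + 1 by rewrite upd_eq.
    apply: (RC_trans (RC_dec_pos HA X (hd y) (fS _ _) hs hi c1 hx)); rewrite upd_upd.
    have [_ R] := H (sb HA n (y + 1)) y hyn w1 (fS _ _).
    apply: (RC_trans (R (s + two) _ c2)); first by rewrite /stwo; zlra HA.
    by apply: RC_goto => //; rewrite /stwo; zlra HA.
have en : sb HA n n = 0 by apply: sb_le; zlra HA.
apply: (RC_trans (K n _)); first by zlra HA.
rewrite en /=; apply: (RC_dec_zero HA X _ _ hs hi c1); [exact: fS|exact: upd_eq].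
Qed.
End Execution.

(** * From counter programs to machines deciding sets *)

Section Deciders.
Variable A : struc.
Hypothesis HA : isrca A.
Notation N := (sd A Num).
Notation Sets := (sd A Set2).
Notation "0" := (zr A).
Notation "1" := (on A).
Notation "x + y" := (@ad A x y).
Notation "x * y" := (@ml A x y).
Notation "x < y" := (@ltt A x y).
Notation two := (stwo A).
Notation three := (sthree A).
Implicit Types (x y z h s i j n k o : N) (v : N -> N) (p q : prog A) (X Z : Sets).
Add Ring Nring6 : (N_semiring HA).

Definition runs k X p h v h' v' := forall c d, exec HA c d k X p h v h' v'.

Fixpoint table (l : list (row A)) : N -> N :=
  match l with
  | [] => fun _ => 0
  | (t, a0, a1) :: l => fun u =>
      ite (u = 0) t (ite (u = 1) a0 (ite (u = two) a1 (table l (sb HA u three))))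
  end.

Lemma table_Sf l : Sf1 (table l).
Proof. by elim: l => [|[[t a0] a1] l IH] /=; [apply: Sf_const|sg]. Qed.

Lemma has_code_table c d l : forall s,
  (forall u, u < three * len l -> sbeta c d (three * s + u) (table l u)) -> has_code c d s l.
Proof.
elim: l => [//|[[t a0] a1] l IH] s /= H; split.
- have H0 := H 0; have H1 := H 1; have H2 := H two.
  rewrite ite_t // in H0; rewrite ite_f in H1; last by move=> h; zlra HA.
  rewrite ite_t // in H1.
  rewrite ite_f in H2; last by rewrite /stwo => h; zlra HA.
  rewrite ite_f in H2; last by rewrite /stwo => h; zlra HA.
  rewrite ite_t // in H2.
  have e : three * (len l + 1) = three * len l + three by ring.
  rewrite e in H0 H1 H2; rewrite /instr; split; [|split].
  + have := H0; rewrite ad0 //; apply; rewrite /sthree /stwo; zlra HA.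
  + by rewrite ad0 //; apply: H1; rewrite /sthree /stwo; zlra HA.
  + have -> : three * s + 1 + 1 = three * s + two by rewrite /stwo; ring.
    by apply: H2; rewrite /sthree /stwo; zlra HA.
- apply: IH => u hu; have := H (u + three).
  rewrite !ite_f; [|by rewrite /sthree /stwo => h; zlra HA..].
  have -> : sb HA (u + three) three = u by apply: sb_eq; ring.
  have -> : three * (s + 1) + u = three * s + (u + three) by ring.
  apply.
  have -> : three * (len l + 1) = three * len l + three by ring.
  by zlra HA.
Qed.

Lemma code_exists l : exists c d, has_code c d 0 l.
Proof.
have [c [d H]] := beta_lemma HA (three * len l) (table_Sf l).
exists c, d; apply: has_code_table => u hu; have -> : three * 0 + u = u by ring.
exact: H.
Qed.

(** The rows of the halting states 0 and 1 are placeholders. State 2 turns the unary input into a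
    counter, the program starts in state 3, and the closing block halts in 1 or 0 according to
    whether counter [o] is positive. *)
Definition decider_rows p o : list (row A) :=
  [goto 0; goto 0; (0 + 1, act 0 two three, act 1 1 two)] ++ code p three ++
  dec_rows o (three + size p) 1 0.

Theorem decider k p o : wf k p -> 0 < k -> o < k -> exists e, forall X Z,
  (forall n, exists h v, runs k X p 0 (upd 0 n (fun _ => 0)) h v /\
     (inn n Z <-> v o <> 0)) ->
  scomputes e X Z.
Proof.
move=> hw hk ho; have [c [d hc]] := code_exists (decider_rows p o).
exists (spair k (spair c d)) => X Z H n.
have [h [v [R hZ]]] := H n.
move: hc => /(has_code_app HA) [[_ [_ [hin _]]] /(has_code_app HA) [hcode hfin]].
have e3 : 0 + len [goto 0; goto 0; (0 + 1, act 0 two three, act 1 1 two)] = three.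
  by rewrite /= /sthree /stwo; ring.
rewrite e3 in hcode hfin; rewrite len_code // in hfin.
have e2 : 0 + 1 + 1 = two by rewrite /stwo; ring.
rewrite e2 in hin.
have v0S : Sf1 (upd 0 n (fun _ => 0)) by apply: upd_Sf => //; exact: Sf_const.
have [hv R'] := R c d hw v0S.
have h12 : 1 < two by rewrite /stwo; zlra HA.
have h13 : 1 < three by rewrite /sthree /stwo; zlra HA.
have h1f : 1 < three + size p by zlra HA.
have r1 := reach_input HA X n h12 hk hin.
have r2 := reach_trans HA r1 (R' _ h13 hcode).
have K (w : N) v' : RC HA c d k X (three + size p) h v w h v' -> shalts (spair k (spair c d)) X n w.
  move=> r3; have [T [a [b [[s0 [s1 sL]] [g [t0 _]]]]]] := reach_trans HA r2 r3.
  exists k, c, d; split=> //; exists T, a, b; split; last by split.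
  split=> //; split=> // i hi; have [sl sr] := sL _ hi; split=> //.
  exists (upd 0 (ones HA n) (fun _ => 0) i); split=> //.
  case: (classic (i = 0)) => [->|hi0]; [left|right].
    split=> //; rewrite upd_eq; apply/(spow2E HA).
    by rewrite (onesE HA n); ring.
  by rewrite upd_neq.
have hfin' := dec_code hfin.
case: (zero_or_succ HA (v o)) => [hz|[x hx]].
- have r3 := RC_dec_zero HA X h hv h1f ho hfin' hz.
  split=> hn; last exact: K r3.
  by move/hZ: hn; rewrite hz.
- have r3 := RC_dec_pos HA X h hv h1f ho hfin' hx.
  split=> hn; first exact: K r3.
  case: hn; apply/hZ; rewrite hx => h0.
  exact: (rca_succ_neq0 HA h0).
Qed.
End Deciders.

(** * Counters with standard indices *)

Section Registers.
Variable A : struc.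
Hypothesis HA : isrca A.
Notation N := (sd A Num).
Notation "0" := (zr A).
Notation "1" := (on A).
Notation "x + y" := (@ad A x y).
Notation "x * y" := (@ml A x y).
Notation "x < y" := (@ltt A x y).
Notation two := (stwo A).
Implicit Types (x y z h s n : N) (v : N -> N) (i j : nat) (l : list N).
Add Ring Nring7 : (N_semiring HA).

Fixpoint num (i : nat) : N := match i with 0%nat => 0 | S i => num i + 1 end.

Lemma num_lt i j : (i < j)%nat -> num i < num j.
Proof.
elim=> [|j' _ IH] /=; first by zlra HA.
by move: IH => /=; move: (num i) (num j') => u w h; zlra HA.
Qed.
Lemma num_inj i j : num i = num j -> i = j.
Proof.
move=> e; case: (Nat.lt_total i j) => [h|[//|h]].
- by exfalso; have := num_lt h; rewrite e => /(lt_irr HA).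
- by exfalso; have := num_lt h; rewrite e => /(lt_irr HA).
Qed.
Lemma num_neq i j : Nat.eqb i j = false -> num i <> num j.
Proof. by move=> /Nat.eqb_neq h e; apply: h; exact: num_inj. Qed.

(** The values belong to the model but the indices are standard. Keeping the counters in a list lets
    [nth] and [lset] compute the effect of an instruction during symbolic execution. *)
Fixpoint st l : N -> N :=
  match l with
  | [] => fun _ => 0
  | x :: l => fun j : N => ite (j = 0) x (st l (sb HA j 1))
  end.
Fixpoint lset i x l : list N :=
  match l, i with
  | [], _ => []
  | _ :: l, 0%nat => x :: l
  | y :: l, S i => y :: lset i x l
  end.

Lemma sb_succ x : sb HA (x + 1) 1 = x.
Proof. by apply: sb_eq; ring. Qed.
Lemma st_succ x l y : st (x :: l) (y + 1) = st l y.
Proof. by rewrite /= ite_f ?sb_succ // => h; zlra HA. Qed.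
Lemma st_num l : forall i, st l (num i) = nth i l 0.
Proof.
elim: l => [|x l IH] [|i] //; first by rewrite /= ite_t.
by rewrite [num _]/= st_succ IH.
Qed.
Lemma upd_st l : forall i x, (i < length l)%nat -> upd (num i) x (st l) = st (lset i x l).
Proof.
elim: l => [|y l IH] [|i] x /= hi; try lia; apply: functional_extensionality => j.
- case: (classic (j = 0)) => [->|h]; first by rewrite upd_eq ite_t.
  by rewrite upd_neq // !ite_f.
- case: (zero_or_succ HA j) => [->|[w ->]].
    rewrite upd_neq; first by rewrite !ite_t.
    by move=> h; zlra HA.
  rewrite ite_f; last by move=> h; zlra HA.
  rewrite sb_succ -IH; last by lia.
  case: (classic (w = num i)) => [->|h]; first by rewrite !upd_eq.
  have h2 : w + 1 <> num i + 1 by move=> h'; apply: h; zlra HA.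
  rewrite (upd_neq _ _ h) (upd_neq _ _ h2).
  by rewrite ite_f ?sb_succ // => h'; zlra HA.
Qed.
Lemma st_zeros i : st (repeat 0 i) = fun _ => 0.
Proof.
elim: i => //= i ->; apply: functional_extensionality => j.
by case: (classic (j = 0)) => h; [rewrite ite_t|rewrite ite_f].
Qed.
Lemma st_Sf l : Sf1 (st l).
Proof. by elim: l => [|x l IH] /=; [exact: Sf_const|sg]. Qed.
End Registers.

Ltac updv := rewrite /upd /ite;
  repeat match goal with
  | |- context [excluded_middle_informative ?P] => destruct (excluded_middle_informative P)
  end; rewrite /=; try congruence.
Ltac updeq := apply: functional_extensionality; intro; updv.

(** * Macros for copying, multiplication and subtraction *)

Section Macros.
Variable A : struc.
Hypothesis HA : isrca A.
Notation N := (sd A Num).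
Notation "0" := (zr A).
Notation "1" := (on A).
Notation "x + y" := (@ad A x y).
Notation "x * y" := (@ml A x y).
Notation "x < y" := (@ltt A x y).
Notation two := (stwo A).
Implicit Types (x y z h s n i j t o : N) (v : N -> N) (p q : prog A).
Add Ring Nring8 : (N_semiring HA).
Variables (k : N) (X : sd A Set2).
Notation runs := (runs HA k X).

Lemma runs_nop h v : runs PNop h v h v.
Proof. by move=> c d; exact: exec_nop. Qed.
Lemma runs_inc i h v : runs (PInc i) h v h (upd i (v i + 1) v).
Proof. by move=> c d; exact: exec_inc. Qed.
Lemma runs_oinc h v : runs POInc h v (h + 1) v.
Proof. by move=> c d; exact: exec_oinc. Qed.
Lemma runs_seq p q h v h' v' h'' v'' :
  runs p h v h' v' -> runs q h' v' h'' v'' -> runs (PSeq p q) h v h'' v''.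
Proof. by move=> H H' c d; apply: exec_seq (H c d) (H' c d). Qed.
Lemma runs_if_pos i p q h v x h' v' : v i = x + 1 ->
  runs p h (upd i x v) h' v' -> runs (PIf i p q) h v h' v'.
Proof. by move=> e H c d; apply: exec_if_pos e (H c d). Qed.
Lemma runs_if_zero i p q h v h' v' : v i = 0 ->
  runs q h v h' v' -> runs (PIf i p q) h v h' v'.
Proof. by move=> e H c d; apply: exec_if_zero e (H c d). Qed.
Lemma runs_q_in p q h v h' v' : inn h X -> runs p h v h' v' -> runs (PQ p q) h v h' v'.
Proof. by move=> e H c d; apply: exec_q_in e (H c d). Qed.
Lemma runs_q_out p q h v h' v' : ~ inn h X -> runs q h v h' v' -> runs (PQ p q) h v h' v'.
Proof. by move=> e H c d; apply: exec_q_out e (H c d). Qed.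
Lemma runs_loop i p n (f : N -> N -> N) (hd : N -> N) h v h' v' : Sf2 f -> Sf1 hd ->
  (forall x y, y < n -> runs p (hd y) (upd i x (f y)) (hd (y + 1)) (upd i x (f (y + 1)))) ->
  h = hd 0 -> v = upd i n (f 0) -> h' = hd n -> v' = upd i 0 (f n) ->
  runs (PLoop i p) h v h' v'.
Proof.
move=> hf hhd H -> -> -> -> c d; apply: exec_loop => // x y hy; exact: H.
Qed.

Definition clear i := PLoop i (PNop (A := A)).
Definition move_to i j := PLoop i (PInc j).
(** A loop empties the counter it runs on; [t] collects a second copy, from which [i] is
    restored. *)
Definition copy_to i j t := PSeq (PLoop i (PSeq (PInc j) (PInc t))) (move_to t i).
Definition mul_to i j o t := PLoop i (copy_to j o t).
Definition dec i := PIf i (PNop (A := A)) PNop.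
Definition sub_from i j := PLoop i (dec j).

Lemma runs_clear i h v : Sf1 v -> runs (clear i) h v h (upd i 0 v).
Proof.
move=> hv; apply: (@runs_loop i _ (v i) (fun _ => v) (fun _ => h)) => //; try by sg.
- by move=> x y _; exact: runs_nop.
- by rewrite upd_id.
Qed.

Lemma runs_move i j h v : Sf1 v -> i <> j ->
  runs (move_to i j) h v h (upd i 0 (upd j (v j + v i) v)).
Proof.
move=> hv hij; apply: (@runs_loop i _ (v i) (fun y => upd j (v j + y) v) (fun _ => h)) => //.
- by rewrite /upd; sg.
- by sg.
- move=> x y _; have := @runs_inc j h (upd i x (upd j (v j + y) v)).
  rewrite upd_neq; last by congruence.
  rewrite upd_eq; congr (runs _ _ _ _ _).
  by updeq; rewrite adA.
- by rewrite ad0 // !upd_id.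
Qed.

Lemma runs_copy i j t h v : Sf1 v -> i <> j -> i <> t -> j <> t -> v t = 0 ->
  runs (copy_to i j t) h v h (upd j (v j + v i) v).
Proof.
move=> hv hij hit hjt ht.
apply: (@runs_seq _ _ _ _ h (upd i 0 (upd t (v i) (upd j (v j + v i) v)))).
- apply: (@runs_loop i _ (v i) (fun y => upd t y (upd j (v j + y) v)) (fun _ => h)) => //.
  + by rewrite /upd; sg.
  + by sg.
  + move=> x y _; apply: runs_seq (@runs_inc _ _ _) _.
    have := @runs_inc t h (upd j (v j + y + 1) (upd i x (upd t y (upd j (v j + y) v)))).
    have -> : upd j (v j + y + 1) (upd i x (upd t y (upd j (v j + y) v))) t = y.
      by updv.
    have -> : upd i x (upd t y (upd j (v j + y) v)) j = v j + y.
      by updv.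
    congr (runs _ _ _ _ _); by updeq; rewrite adA.
  + by rewrite ad0 // upd_id -{1}ht upd_id upd_id.
- have := @runs_move t i h (upd i 0 (upd t (v i) (upd j (v j + v i) v))) _ _.
  rewrite upd_eq upd_neq; last by congruence.
  rewrite upd_eq ad0n //; move=> H.
  have e : upd t 0 (upd i (v i) (upd i 0 (upd t (v i) (upd j (v j + v i) v)))) = upd j (v j + v i) v.
    by updeq.
  rewrite e in H; apply: H; last by congruence.
  by do 3!apply: upd_Sf => //.
Qed.

Lemma runs_mul i j o t h v : Sf1 v -> i <> j -> i <> o -> i <> t -> j <> o -> j <> t -> o <> t ->
  v t = 0 -> runs (mul_to i j o t) h v h (upd i 0 (upd o (v o + v i * v j) v)).
Proof.
move=> hv hij hio hit hjo hjt hot ht.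
apply: (@runs_loop i _ (v i) (fun y => upd o (v o + y * v j) v) (fun _ => h)) => //.
- by rewrite /upd; sg.
- by sg.
- move=> x y _.
  have := @runs_copy j o t h (upd i x (upd o (v o + y * v j) v)).
  have -> : upd i x (upd o (v o + y * v j) v) t = 0 by updv.
  have -> : upd i x (upd o (v o + y * v j) v) j = v j by updv.
  have -> : upd i x (upd o (v o + y * v j) v) o = v o + y * v j.
    by updv.
  have -> : upd o (v o + y * v j + v j) (upd i x (upd o (v o + y * v j) v)) =
    upd i x (upd o (v o + (y + 1) * v j) v) by updeq; ring.
  by apply=> //; do 2!apply: upd_Sf => //.
- by rewrite ml0n // ad0 // !upd_id.
Qed.

Lemma runs_dec i h v : runs (dec i) h v h (upd i (sb HA (v i) 1) v).
Proof.
case: (zero_or_succ HA (v i)) => [e|[x e]].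
- apply: runs_if_zero => //; rewrite sb_le; last by rewrite e; zlra HA.
  by rewrite -e upd_id; exact: runs_nop.
- by apply: runs_if_pos (e) _; rewrite e sb_succ; exact: runs_nop.
Qed.

Lemma sb_sb1 x y : sb HA (sb HA x y) 1 = sb HA x (y + 1).
Proof.
apply/esym; case: (classic (y < x)) => h.
  have [w e] := proj1 (ltE HA y x) h.
  rewrite (sb_eq HA (x := x) (y := y + 1) (z := w)); last by rewrite e; ring.
  by rewrite (sb_eq HA (x := x) (y := y) (z := w + 1)) ?sb_succ // e; ring.
rewrite (sb_le HA (x := x) (y := y)); last by zlra HA.
by rewrite !sb_le //; zlra HA.
Qed.

Lemma runs_sub i j h v : Sf1 v -> i <> j ->
  runs (sub_from i j) h v h (upd i 0 (upd j (sb HA (v j) (v i)) v)).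
Proof.
move=> hv hij; apply: (@runs_loop i _ (v i) (fun y => upd j (sb HA (v j) y) v) (fun _ => h)) => //.
- by rewrite /upd; sg.
- by sg.
- move=> x y _; have := @runs_dec j h (upd i x (upd j (sb HA (v j) y) v)).
  rewrite upd_neq; last by congruence.
  rewrite upd_eq sb_sb1; congr (runs _ _ _ _ _); by updeq.
- by rewrite (sb_eq HA (z := v j)) ?ad0n // !upd_id.
Qed.
End Macros.

Section ListStates.
Variable A : struc.
Hypothesis HA : isrca A.
Notation N := (sd A Num).
Notation "0" := (zr A).
Notation "1" := (on A).
Notation "x + y" := (@ad A x y).
Notation "x * y" := (@ml A x y).
Notation "x < y" := (@ltt A x y).
Notation two := (stwo A).
Implicit Types (x y z h s n : N) (v : N -> N) (i j t o : nat) (p q : prog A) (l : list N).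
Add Ring Nring9 : (N_semiring HA).
Variables (k : N) (X : sd A Set2).
Notation runs := (runs HA k X).
Notation st := (st HA).
Notation num := (num A).
Notation "l !! i" := (nth i l 0) (at level 8, format "l !! i").

Lemma st_inc i h l : (i < length l)%nat ->
  runs (PInc (num i)) h (st l) h (st (lset i (l!!i + 1) l)).
Proof. by move=> hi; rewrite -upd_st // -st_num; exact: runs_inc. Qed.
Lemma st_dec i h l : (i < length l)%nat ->
  runs (dec (num i)) h (st l) h (st (lset i (sb HA l!!i 1) l)).
Proof. by move=> hi; rewrite -upd_st // -st_num; exact: runs_dec. Qed.
Lemma st_clear i h l : (i < length l)%nat ->
  runs (clear (num i)) h (st l) h (st (lset i 0 l)).
Proof. by move=> hi; rewrite -upd_st //; apply: runs_clear; exact: st_Sf. Qed.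
Lemma length_lset i x l : length (lset i x l) = length l.
Proof. by elim: l i => [|y l IH] [|i] //=; rewrite IH. Qed.
Lemma st_move i j h l : Nat.eqb i j = false -> (i < length l)%nat -> (j < length l)%nat ->
  runs (move_to (num i) (num j)) h (st l) h (st (lset i 0 (lset j (l!!j + l!!i) l))).
Proof.
move=> e hi hj; rewrite -upd_st ?length_lset // -upd_st // -!(st_num HA).
by apply: runs_move; [exact: st_Sf|exact: num_neq].
Qed.
Lemma st_sub i j h l : Nat.eqb i j = false -> (i < length l)%nat -> (j < length l)%nat ->
  runs (sub_from (num i) (num j)) h (st l) h (st (lset i 0 (lset j (sb HA l!!j l!!i) l))).
Proof.
move=> e hi hj; rewrite -upd_st ?length_lset // -upd_st // -!(st_num HA).
by apply: runs_sub; [exact: st_Sf|exact: num_neq].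
Qed.
Lemma st_copy i j t h l : Nat.eqb i j = false -> Nat.eqb i t = false -> Nat.eqb j t = false ->
  (j < length l)%nat -> l!!t = 0 ->
  runs (copy_to (num i) (num j) (num t)) h (st l) h (st (lset j (l!!j + l!!i) l)).
Proof.
move=> e e' e'' hj ht; rewrite -upd_st // -!(st_num HA).
by apply: runs_copy; rewrite ?st_num //; solve [exact: st_Sf|exact: num_neq].
Qed.
Lemma st_mul i j o t h l : Nat.eqb i j = false -> Nat.eqb i o = false -> Nat.eqb i t = false ->
  Nat.eqb j o = false -> Nat.eqb j t = false -> Nat.eqb o t = false ->
  (i < length l)%nat -> (o < length l)%nat -> l!!t = 0 ->
  runs (mul_to (num i) (num j) (num o) (num t)) h (st l) h
    (st (lset i 0 (lset o (l!!o + l!!i * l!!j) l))).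
Proof.
move=> e1 e2 e3 e4 e5 e6 hi ho ht; rewrite -upd_st ?length_lset // -upd_st // -!(st_num HA).
by apply: runs_mul; rewrite ?st_num //; solve [exact: st_Sf|exact: num_neq].
Qed.
Lemma st_if_pos i p q h l x h' v' : l!!i = x + 1 -> (i < length l)%nat ->
  runs p h (st (lset i x l)) h' v' -> runs (PIf (num i) p q) h (st l) h' v'.
Proof.
by move=> e hi H; apply: (@runs_if_pos _ _ _ _ _ _ _ _ _ x); rewrite ?st_num // upd_st.
Qed.
Lemma st_if_zero i p q h l h' v' : l!!i = 0 ->
  runs q h (st l) h' v' -> runs (PIf (num i) p q) h (st l) h' v'.
Proof. by move=> e H; apply: runs_if_zero; rewrite ?st_num. Qed.
Lemma st_loop i p n (f : N -> list N) (hd : N -> N) l' h l h' : Sf2 (fun y => st (f y)) -> Sf1 hd ->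
  (forall y, i < length (f y))%nat ->
  (forall x y, y < n -> runs p (hd y) (st (lset i x (f y))) (hd (y + 1)) (st (lset i x (f (y + 1))))) ->
  h = hd 0 -> l = lset i n (f 0) -> h' = hd n -> l' = lset i 0 (f n) ->
  runs (PLoop (num i) p) h (st l) h' (st l').
Proof.
move=> hf hhd hi H e1 e2 e3 e4.
apply: (@runs_loop _ _ _ _ _ _ n (fun y => st (f y)) hd) => //.
- by move=> x y hy; rewrite !upd_st //; exact: H.
- by rewrite e2 upd_st.
- by rewrite e4 upd_st.
Qed.
End ListStates.

Ltac sf_hook ::=
  match goal with
  | H : isrca ?A |- Sf (fun e => st ?H ?l _) => apply: (Sf_comp1 H (st_Sf H l))
  end.
Ltac close := solve [reflexivity | simpl; lia].
Ltac stp lem := eapply runs_seq; [apply: lem; close|cbn [lset nth]].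
Ltac stlast lem := apply: lem; close.

(** * A counter program for unpairing *)

Section Unpairing.
Variable A : struc.
Hypothesis HA : isrca A.
Notation N := (sd A Num).
Notation "0" := (zr A).
Notation "1" := (on A).
Notation "x + y" := (@ad A x y).
Notation "x * y" := (@ml A x y).
Notation "x < y" := (@ltt A x y).
Notation two := (stwo A).
Implicit Types (x y z h s n : N).
Add Ring Nring10 : (N_semiring HA).
Variables (k : N) (X : sd A Set2).
Notation runs := (runs HA k X).
Notation st := (st HA).
Notation "# i" := (num A i) (at level 1, format "# i").

Definition gap y := sb HA (sq HA y + sq HA y) (fs HA y).

Lemma gapE y : sq HA y + sq HA y = fs HA y + gap y.
Proof. by apply: sb_ge; exact: fs_le. Qed.
Lemma sq0 : sq HA 0 = 0.
Proof. by apply: sq_unique; zlra HA. Qed.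
Lemma gap0 : gap 0 = 0.
Proof. by rewrite /gap sq0; apply: sb_le; zlra HA. Qed.
Lemma gap_pos y x : gap y = x + 1 -> sq HA (y + 1) = sq HA y /\ gap (y + 1) = x.
Proof.
move=> e; have h := gapE y; rewrite e in h; have h' := fsE HA y.
have e' : sq HA (y + 1) = sq HA y.
  by apply: sq_unique; move: (sq HA y) (fs HA y) h h' => u w h h'; znra HA.
split=> //; have := gapE (y + 1); have := fsE HA (y + 1); rewrite e'.
by move: (sq HA y) (fs HA y) (fs HA (y + 1)) (gap (y + 1)) h h' => a b c d *; zlra HA.
Qed.
Lemma gap_zero y : gap y = 0 -> sq HA (y + 1) = sq HA y + 1 /\
  gap (y + 1) = (sq HA y + 1) + (sq HA y + 1).
Proof.
move=> e; have h := gapE y; rewrite e in h; have h' := fsE HA y.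
have e' : sq HA (y + 1) = sq HA y + 1.
  by apply: sq_unique; move: (sq HA y) (fs HA y) h h' => u w h h'; znra HA.
split=> //; have := gapE (y + 1); have := fsE HA (y + 1); rewrite e'.
by move: (sq HA y) (fs HA y) (fs HA (y + 1)) (gap (y + 1)) h h' => a b c d *; zlra HA.
Qed.
Lemma gap_Sf : Sf1 gap.
Proof. by rewrite /gap; sg. Qed.
(** If s is the root and f the remainder, the gap is 2s - f, so both sides are the truncated
    difference s - f. *)
Lemma sn_gap y : sb HA (gap y) (sq HA y) = sn HA y.
Proof.
rewrite /sn; have := gapE y; move: (sq HA y) (fs HA y) (gap y) => s f g e.
case: (sbP HA s f) => [h|[h ->]].
  by apply: sb_eq; zlra HA.
by apply: sb_le; zlra HA.
Qed.

(* Counting up to z, register 1 is the integer square root and register 2 the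
   distance to the last number with the same root. *)
Definition unpair_prog : prog A :=
  PSeq (PLoop #0 (PIf #2 PNop (PSeq (PInc #1) (PSeq (copy_to #1 #2 #3) (copy_to #1 #2 #3)))))
  (PSeq (copy_to #1 #4 #3) (PSeq (copy_to #1 #4 #3) (PSeq (copy_to #2 #5 #3)
  (PSeq (sub_from #2 #4) (sub_from #1 #5))))).

Lemma runs_unpair z h r :
  runs unpair_prog h (st (z :: 0 :: 0 :: 0 :: 0 :: 0 :: r)) h
    (st (0 :: 0 :: 0 :: 0 :: fs HA z :: sn HA z :: r)).
Proof.
have gS := gap_Sf.
apply: (@runs_seq _ _ _ _ _ _ _ _ h (st (0 :: sq HA z :: gap z :: 0 :: 0 :: 0 :: r))).
  apply: (@st_loop _ _ _ _ 0 _ z (fun y => 0 :: sq HA y :: gap y :: 0 :: 0 :: 0 :: r) (fun _ => h)) => //.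
  - by rewrite /=; sg.
  - by sg.
  - by move=> _ /=; lia.
  - move=> x y _; cbn [lset]; case: (zero_or_succ HA (gap y)) => [e|[w e]].
      have [e1 e2] := gap_zero e.
      apply: st_if_zero => //.
      stp st_inc; stp st_copy; rewrite e e1 e2.
      have -> : (sq HA y + 1) + (sq HA y + 1) = 0 + (sq HA y + 1) + (sq HA y + 1) by ring.
      by stlast st_copy.
    have [e1 e2] := gap_pos e.
    apply: (@st_if_pos _ _ _ _ 2 _ _ _ _ w) => //; first by simpl; lia.
    by cbn [lset]; rewrite e1 e2; exact: runs_nop.
  - by cbn [lset]; rewrite sq0 gap0.
stp st_copy; stp st_copy; stp st_copy; stp st_sub.
have -> : 0 + sq HA z + sq HA z = fs HA z + gap z by rewrite -gapE; ring.
have -> : sb HA (fs HA z + gap z) (gap z) = fs HA z by apply: sb_eq; ring.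
by rewrite -sn_gap -{2}(ad0n HA (gap z)); stlast st_sub.
Qed.
End Unpairing.

(** * The largest element of an initial segment *)

Section LastElement.
Variable A : struc.
Hypothesis HA : isrca A.
Notation N := (sd A Num).
Notation "0" := (zr A).
Notation "1" := (on A).
Notation "x + y" := (@ad A x y).
Notation "x * y" := (@ml A x y).
Notation "x < y" := (@ltt A x y).
Implicit Types (u w x y z : N) (X : sd A Set2).
Add Ring Nring11 : (N_semiring HA).
Variable X : sd A Set2.

(** Counts the positions passed since the last member of [X]. A scan maintains this with a reset and
    an increment, whereas storing each member found would mean copying its position. *)
Lemma since_exists : exists g, Sf1 g /\ g 0 = 0 /\
  forall y, g (y + 1) = ite (inn y X) 0 (g y + 1).
Proof. by apply: (prim_rec HA 0 (f := fun y g => ite (inn y X) 0 (g + 1))); sg. Qed.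
Definition since := the since_exists.
Lemma since_Sf : Sf1 since. Proof. by have [] := theP since_exists. Qed.
Lemma since0 : since 0 = 0. Proof. by have [_ []] := theP since_exists. Qed.
Lemma sinceS y : since (y + 1) = ite (inn y X) 0 (since y + 1).
Proof. by have [_ []] := theP since_exists. Qed.

(** If no member occurs up to [u], the count is [u + 1] and the truncated difference is the default
    0. *)
Definition last u := sb HA u (since (u + 1)).
Lemma last_Sf : Sf1 last.
Proof. by have := since_Sf => h; rewrite /last; sg. Qed.

Definition is_last u w :=
  inn w X /\ w < u + 1 /\ (forall x, x < u + 1 -> w < x -> ~ inn x X) \/
  (forall x, x < u + 1 -> ~ inn x X) /\ w = 0.

Lemma sinceP y : since y < y + 1 /\
  (forall x, x < y -> y < x + since y + 1 -> ~ inn x X) /\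
  (forall w, w < y -> y = w + 1 + since y -> inn w X).
Proof.
have h := since_Sf.
move: y; apply: (sg_ind HA); first by sg.
- rewrite since0; split; first by zlra HA.
  by split=> x /(lt_zero HA).
- move=> y [h1 [h2 h3]]; rewrite sinceS.
  case: (classic (inn y X)) => hy; [rewrite ite_t //|rewrite ite_f //].
    split; first by zlra HA.
    split=> [x hx hx'|w hw e]; first by exfalso; zlra HA.
    by have -> : w = y by zlra HA.
  split; first by zlra HA.
  split=> [x|w] /(lt_succ HA) [hx|->] // e.
  + by apply: h2 => //; zlra HA.
  + by apply: h3 => //; zlra HA.
  + by exfalso; zlra HA.
Qed.

Lemma lastP u : is_last u (last u).
Proof.
have [h1 [h2 h3]] := sinceP (u + 1); rewrite /last.
move: (since (u + 1)) h1 h2 h3 => g h1 h2 h3.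
case: (classic (g < u + 1)) => hg.
- have e := sb_ge HA hg; move: (sb HA u g) e => w e; left; split; last split.
  + by apply: h3; zlra HA.
  + by zlra HA.
  + by move=> x hx hw; apply: h2 => //; zlra HA.
- right; split; last by apply: sb_le; zlra HA.
  by move=> x hx; apply: h2 => //; zlra HA.
Qed.
End LastElement.

(** * The machine of the first reduction *)

Section Program1.
Variable A : struc.
Hypothesis HA : isrca A.
Notation N := (sd A Num).
Notation "0" := (zr A).
Notation "1" := (on A).
Notation "x + y" := (@ad A x y).
Notation "x * y" := (@ml A x y).
Notation "x < y" := (@ltt A x y).
Implicit Types (x y z h s n : N).
Add Ring Nring12 : (N_semiring HA).
Notation st := (st HA).
Notation "# i" := (num A i) (at level 1, format "# i").

(** The cells 0 to u take u + 1 rounds, with [since] in counter 7 and the number of cells read in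
    counter 8. The final decrement makes counter 8 equal to u before [since] is subtracted. *)
Definition scan_prog : prog A :=
  PSeq (PInc #5) (PSeq (PLoop #5 (PSeq (PQ (clear #7) (PInc #7)) (PSeq POInc (PInc #8))))
  (PSeq (dec #8) (sub_from #7 #8))).

(** Counter 10 ends as the truncated difference of b(q + 1) and p(c + 1), which is positive exactly
    when p/(q + 1) lies below b/(c + 1). *)
Definition prog1 : prog A :=
  PSeq (unpair_prog A) (PSeq (move_to #4 #6) (PSeq scan_prog
  (PSeq (move_to #8 #0) (PSeq (unpair_prog A)
  (PSeq (clear #4) (PSeq (move_to #5 #0) (PSeq (unpair_prog A)
  (PSeq (move_to #4 #7) (PSeq (move_to #5 #8) (PSeq (move_to #6 #0) (PSeq (unpair_prog A)
  (PSeq (PInc #5) (PSeq (PInc #8) (PSeq (mul_to #7 #5 #9 #1) (PSeq (mul_to #4 #8 #10 #1)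
  (sub_from #9 #10)))))))))))))))).

(* Reading w as <a, <p, q>> and i as <b, c>, this says p/(q+1) < b/(c+1). *)
Definition below1 i w :=
  fs HA (sn HA w) * (sn HA i + 1) < fs HA i * (sn HA (sn HA w) + 1).
Definition Z1 X n := below1 (fs HA n) (last HA X (sn HA n)).

Lemma runs_scan k X u i r :
  runs HA k X scan_prog 0 (st (0 :: 0 :: 0 :: 0 :: 0 :: u :: i :: 0 :: 0 :: r))
    (u + 1) (st (0 :: 0 :: 0 :: 0 :: 0 :: 0 :: i :: 0 :: last HA X u :: r)).
Proof.
have sS := since_Sf HA X.
stp st_inc.
apply: (@runs_seq _ _ _ _ _ _ _ _ (u + 1)
  (st (0 :: 0 :: 0 :: 0 :: 0 :: 0 :: i :: since HA X (u + 1) :: u + 1 :: r))).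
  apply: (@st_loop _ _ _ _ 5 _ (u + 1)
    (fun y => 0 :: 0 :: 0 :: 0 :: 0 :: 0 :: i :: since HA X y :: y :: r) (fun y => y)) => //.
  - by rewrite /=; sg.
  - by sg.
  - by move=> y /=; lia.
  - move=> x y _; cbn [lset].
    apply: (@runs_seq _ _ _ _ _ _ _ _ y
      (st (0 :: 0 :: 0 :: 0 :: 0 :: x :: i :: since HA X (y + 1) :: y :: r))).
      rewrite sinceS; case: (classic (inn y X)) => hy; [rewrite ite_t //|rewrite ite_f //].
        by apply: runs_q_in => //; stlast st_clear.
      by apply: runs_q_out => //; stlast st_inc.
    by apply: runs_seq (@runs_oinc _ _ _ _ _ _) _; stlast st_inc.
  - by cbn [lset]; rewrite since0.
stp st_dec; rewrite sb_succ.
by stlast st_sub.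
Qed.

Lemma sb_pos x y : sb HA x y <> 0 <-> y < x.
Proof.
case: (sbP HA x y) => [e|[h ->]].
- split=> [h|h e0]; last by rewrite e0 in e; zlra HA.
  by case: (zero_or_succ HA (sb HA x y)) => // -[w ew]; rewrite ew in e; zlra HA.
- by split=> // h'; exfalso; zlra HA.
Qed.

Lemma runs_prog1 k X n : exists h v,
  runs HA k X prog1 0 (upd 0 n (fun _ => 0)) h v /\ (v #10 <> 0 <-> Z1 X n).
Proof.
have -> : upd 0 n (fun _ => 0) = st (n :: repeat 0 10).
  by rewrite -(st_zeros HA 11); apply: (@upd_st _ HA (repeat 0 11) 0 n); simpl; lia.
cbn [repeat].
(* The final state is left open and determined by executing the program symbolically. *)
eexists; eexists; split.
  rewrite /prog1.
  eapply runs_seq; first exact: runs_unpair.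
  stp st_move; rewrite !(ad0n HA).
  eapply runs_seq; first exact: runs_scan.
  stp st_move; rewrite !(ad0n HA).
  eapply runs_seq; first exact: runs_unpair.
  stp st_clear; stp st_move; rewrite !(ad0n HA).
  eapply runs_seq; first exact: runs_unpair.
  stp st_move; rewrite !(ad0n HA).
  stp st_move; rewrite !(ad0n HA).
  stp st_move; rewrite !(ad0n HA).
  eapply runs_seq; first exact: runs_unpair.
  stp st_inc; stp st_inc; stp st_mul; stp st_mul; rewrite !(ad0n HA).
  stlast st_sub.
rewrite (st_num HA) [nth _ _ _]/= /Z1 /below1.
exact: sb_pos.
Qed.

Lemma wf_prog1 : wf #11 prog1.
Proof. by cbn -[num]; repeat split; apply: (num_lt HA); lia. Qed.

Theorem machine1 : exists e, forall X Z, (forall n, inn n Z <-> Z1 X n) -> scomputes e X Z.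
Proof.
have [|||e H] := @decider _ HA #11 prog1 #10.
- exact: wf_prog1.
- by apply: (num_lt HA (i := 0) (j := 11)); lia.
- by apply: (num_lt HA (i := 10) (j := 11)); lia.
exists e => X Z hZ; apply: H => n.
have [h [v [R hv]]] := runs_prog1 #11 X n.
by exists h, v; split=> //; rewrite hZ hv.
Qed.
End Program1.

(** * The machine of the second reduction *)

Section Program2.
Variable A : struc.
Hypothesis HA : isrca A.
Notation N := (sd A Num).
Notation "0" := (zr A).
Notation "1" := (on A).
Notation "x + y" := (@ad A x y).
Notation "x * y" := (@ml A x y).
Notation "x < y" := (@ltt A x y).
Implicit Types (x y z h s n j : N).
Add Ring Nring13 : (N_semiring HA).
Notation st := (st HA).
Notation "# i" := (num A i) (at level 1, format "# i").

Section Digits.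
Variable Y : sd A Set2.

Definition bit i j := ite (inn (spair i j) Y) 1 0.
Lemma bit_Sf : Sf2 bit.
Proof. by rewrite /bit; sg. Qed.

(* [digits j i] has the base 4 digits [bit 0 j], ..., [bit (i-1) j]. *)
Lemma digits_exists : exists g, Sf2 g /\ forall j, g j 0 = 0 /\
  forall i, g j (i + 1) = g j i + g j i + g j i + g j i + bit i j.
Proof.
have bS := bit_Sf.
by apply: (prim_rec2 HA (a := fun _ => 0) (f := fun j i p => p + p + p + p + bit i j)); sg.
Qed.
Definition digits := the digits_exists.
Lemma digits_Sf : Sf2 digits. Proof. by have [] := theP digits_exists. Qed.
Lemma digits0 j : digits j 0 = 0.
Proof. by have [_ /(_ j) []] := theP digits_exists. Qed.
Lemma digitsS j i : digits j (i + 1) =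
  digits j i + digits j i + digits j i + digits j i + bit i j.
Proof. by have [_ /(_ j) []] := theP digits_exists. Qed.
End Digits.

Definition pow4 i := pw HA i * pw HA i.
Lemma pow4_0 : pow4 0 = 1. Proof. by rewrite /pow4 pw0; ring. Qed.
Lemma pow4S i : pow4 (i + 1) = pow4 i + pow4 i + pow4 i + pow4 i.
Proof. by rewrite /pow4 pwS; ring. Qed.
Lemma pow4_Sf : Sf1 pow4. Proof. by rewrite /pow4; sg. Qed.

(** A rational <p, q> has denominator q + 1, whence 4^j - 1 for the denominator 4^j. *)
Definition code2 Y j := spair j (spair (digits Y j j) (sb HA (pow4 j) 1)).
Definition Z2 Y n := n = code2 Y (fs HA n).

Definition quad i t : prog A :=
  PSeq (move_to i t) (PLoop t (PSeq (PInc i) (PSeq (PInc i) (PSeq (PInc i) (PInc i))))).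
Definition square i : prog A :=
  PSeq (copy_to #2 #3 #1) (PSeq (mul_to #2 #3 i #1) (clear #3)).

(** Programs move the oracle head only to the right, so the cells [spair i j] are visited for
    increasing i: from j^2 = [spair 0 j] on, the next cell is 2(i + j) + 2 further, and counter 9
    holds i + j. The code assembled in counter 4 is compared with the input by a loop that lowers
    counter 6 while it is positive and raises counter 7 afterwards. *)
Definition prog2 : prog A :=
  PSeq (copy_to #0 #6 #1) (PSeq (unpair_prog A) (PSeq (clear #5)
  (PSeq (copy_to #4 #0 #1) (PSeq (PLoop #0 (PSeq (copy_to #4 #2 #1) (PLoop #2 POInc)))
  (PSeq (PInc #8) (PSeq (copy_to #4 #9 #1) (PSeq (copy_to #4 #0 #1)
  (PSeq (PLoop #0
    (PSeq (quad #7 #2) (PSeq (PQ (PInc #7) PNop) (PSeq (quad #8 #2)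
    (PSeq (copy_to #9 #2 #1) (PSeq (PLoop #2 (PSeq POInc POInc))
    (PSeq POInc (PSeq POInc (PInc #9)))))))))
  (PSeq (dec #8) (PSeq (copy_to #7 #2 #1) (PSeq (move_to #8 #2) (PSeq (square #7)
  (PSeq (copy_to #4 #2 #1) (PSeq (move_to #7 #2) (PSeq (square #4)
  (PSeq (PLoop #4 (PIf #6 PNop (PInc #7))) (PSeq (move_to #6 #7)
  (PIf #7 PNop (PInc #8))))))))))))))))))).

Lemma runs_quad7 k X h a0 a1 a3 a4 a5 a6 p r :
  runs HA k X (quad #7 #2) h (st (a0 :: a1 :: 0 :: a3 :: a4 :: a5 :: a6 :: p :: r)) h
    (st (a0 :: a1 :: 0 :: a3 :: a4 :: a5 :: a6 :: p + p + p + p :: r)).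
Proof.
stp st_move; rewrite (ad0n HA).
apply: (@st_loop _ _ _ _ 2 _ p
  (fun y => a0 :: a1 :: 0 :: a3 :: a4 :: a5 :: a6 :: y + y + y + y :: r) (fun _ => h)) => //.
- by rewrite /=; sg.
- by sg.
- by move=> y /=; lia.
- move=> x y _; cbn [lset]; do 3!stp st_inc.
  have -> : (y + 1) + (y + 1) + (y + 1) + (y + 1) = y + y + y + y + 1 + 1 + 1 + 1 by ring.
  by stlast st_inc.
- by cbn [lset]; have -> : 0 + 0 + 0 + 0 = 0 by ring.
Qed.

Lemma runs_quad8 k X h a0 a1 a3 a4 a5 a6 a7 p r :
  runs HA k X (quad #8 #2) h (st (a0 :: a1 :: 0 :: a3 :: a4 :: a5 :: a6 :: a7 :: p :: r)) h
    (st (a0 :: a1 :: 0 :: a3 :: a4 :: a5 :: a6 :: a7 :: p + p + p + p :: r)).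
Proof.
stp st_move; rewrite (ad0n HA).
apply: (@st_loop _ _ _ _ 2 _ p
  (fun y => a0 :: a1 :: 0 :: a3 :: a4 :: a5 :: a6 :: a7 :: y + y + y + y :: r) (fun _ => h)) => //.
- by rewrite /=; sg.
- by sg.
- by move=> y /=; lia.
- move=> x y _; cbn [lset]; do 3!stp st_inc.
  have -> : (y + 1) + (y + 1) + (y + 1) + (y + 1) = y + y + y + y + 1 + 1 + 1 + 1 by ring.
  by stlast st_inc.
- by cbn [lset]; have -> : 0 + 0 + 0 + 0 = 0 by ring.
Qed.

Lemma runs_square7 k X h a0 s a4 a5 a6 p r :
  runs HA k X (square #7) h (st (a0 :: 0 :: s :: 0 :: a4 :: a5 :: a6 :: p :: r)) h
    (st (a0 :: 0 :: 0 :: 0 :: a4 :: a5 :: a6 :: p + s * s :: r)).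
Proof. by stp st_copy; rewrite (ad0n HA); stp st_mul; stlast st_clear. Qed.
Lemma runs_square4 k X h a0 s a4 r :
  runs HA k X (square #4) h (st (a0 :: 0 :: s :: 0 :: a4 :: r)) h
    (st (a0 :: 0 :: 0 :: 0 :: a4 + s * s :: r)).
Proof. by stp st_copy; rewrite (ad0n HA); stp st_mul; stlast st_clear. Qed.

Lemma runs_advance k X h m a0 a1 r :
  runs HA k X (PLoop #2 POInc) h (st (a0 :: a1 :: m :: r)) (h + m) (st (a0 :: a1 :: 0 :: r)).
Proof.
apply: (@st_loop _ _ _ _ 2 _ m (fun y => a0 :: a1 :: 0 :: r) (fun y => h + y)) => //.
- by rewrite /=; sg.
- by sg.
- by move=> y /=; lia.
- by move=> x y _; rewrite adS //; exact: runs_oinc.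
- by rewrite ad0.
Qed.
Lemma runs_advance2 k X h m a0 a1 r :
  runs HA k X (PLoop #2 (PSeq POInc POInc)) h (st (a0 :: a1 :: m :: r)) (h + m + m)
    (st (a0 :: a1 :: 0 :: r)).
Proof.
apply: (@st_loop _ _ _ _ 2 _ m (fun y => a0 :: a1 :: 0 :: r) (fun y => h + y + y)) => //.
- by rewrite /=; sg.
- by sg.
- by move=> y /=; lia.
- move=> x y _; apply: runs_seq (@runs_oinc _ _ _ _ _ _) _.
  have -> : h + (y + 1) + (y + 1) = h + y + y + 1 + 1 by ring.
  exact: runs_oinc.
- by rewrite !ad0.
Qed.

Lemma runs_digits k Y j n :
  runs HA k Y (PLoop #0
    (PSeq (quad #7 #2) (PSeq (PQ (PInc #7) PNop) (PSeq (quad #8 #2)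
    (PSeq (copy_to #9 #2 #1) (PSeq (PLoop #2 (PSeq POInc POInc))
    (PSeq POInc (PSeq POInc (PInc #9))))))))) (j * j)
    (st [j; 0; 0; 0; j; 0; n; 0; 1; j]) (spair j j)
    (st [0; 0; 0; 0; j; 0; n; digits Y j j; pow4 j; j + j]).
Proof.
have dS := digits_Sf Y; have pS := pow4_Sf.
apply: (@st_loop _ _ _ _ 0 _ j
  (fun y => [0; 0; 0; 0; j; 0; n; digits Y j y; pow4 y; y + j]) (fun y => spair y j)) => //.
- by rewrite /=; sg.
- by sg.
- by move=> y /=; lia.
- move=> x y _; cbn [lset].
  eapply runs_seq; first exact: runs_quad7.
  apply: (@runs_seq _ _ _ _ _ _ _ _ (spair y j)
    (st [x; 0; 0; 0; j; 0; n; digits Y j (y + 1); pow4 y; y + j])).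
    rewrite digitsS /bit; case: (classic (inn (spair y j) Y)) => hy.
      by rewrite ite_t //; apply: runs_q_in => //; stlast st_inc.
    by rewrite ite_f // ad0 //; apply: runs_q_out => //; exact: runs_nop.
  eapply runs_seq; first exact: runs_quad8.
  rewrite -pow4S; stp st_copy; rewrite (ad0n HA).
  eapply runs_seq; first exact: runs_advance2.
  do 2!(eapply runs_seq; first exact: runs_oinc).
  have -> : spair y j + (y + j) + (y + j) + 1 + 1 = spair (y + 1) j by rewrite /spair; ring.
  have -> : y + 1 + j = y + j + 1 by ring.
  by stlast st_inc.
- by rewrite /spair; ring.
- by cbn [lset]; rewrite digits0 pow4_0 ad0n.
Qed.

Lemma runs_prog2 k Y n : exists h v,
  runs HA k Y prog2 0 (upd 0 n (fun _ => 0)) h v /\ (v #8 <> 0 <-> Z2 Y n).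
Proof.
have -> : upd 0 n (fun _ => 0) = st (n :: repeat 0 9).
  by rewrite -(st_zeros HA 10); apply: (@upd_st _ HA (repeat 0 10) 0 n); simpl; lia.
cbn [repeat].
set j := fs HA n; set c := code2 Y j.
(* The two truncated differences add up to the distance of [n] and [c], which is zero exactly when
   they are equal. *)
pose w := sb HA n c + sb HA c n.
exists (spair j j), (st [0; 0; 0; 0; 0; 0; 0; sb HA w 1; ite (w = 0) 1 0; j + j]); split; last first.
  rewrite (st_num HA) [nth _ _ _]/= /Z2 -/j -/c.
  have E : w = 0 <-> n = c.
    split=> [h|h]; last by rewrite /w h !sb_le //; [ring|zlra HA..].
    have h1 := ad_eq0 HA h; have h2 : sb HA c n = 0.
      by apply: (@ad_eq0 _ HA _ (sb HA n c)); rewrite adC.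
    case: (lt_cases HA n c) => [h3|[//|h3]].
    - by case: (proj2 (sb_pos HA c n) h3).
    - by case: (proj2 (sb_pos HA n c) h3).
  rewrite -E; case: (classic (w = 0)) => h; [rewrite ite_t //|rewrite ite_f //].
    by split=> // _ h'; zlra HA.
stp st_copy; rewrite (ad0n HA).
eapply runs_seq; first exact: runs_unpair.
stp st_clear; stp st_copy; rewrite (ad0n HA) -/j.
apply: (@runs_seq _ _ _ _ _ _ _ _ (j * j) (st [0; 0; 0; 0; j; 0; n; 0; 0; 0])).
  apply: (@st_loop _ _ _ _ 0 _ j (fun y => [0; 0; 0; 0; j; 0; n; 0; 0; 0]) (fun y => y * j)) => //.
  - by rewrite /=; sg.
  - by sg.
  - by move=> y /=; lia.
  - move=> x y _; cbn [lset]; stp st_copy; rewrite (ad0n HA) mlSn //.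
    exact: runs_advance.
  - by rewrite ml0n.
stp st_inc; stp st_copy; stp st_copy; rewrite !(ad0n HA).
eapply runs_seq; first exact: runs_digits.
stp st_dec; stp st_copy; stp st_move; rewrite (ad0n HA).
eapply runs_seq; first exact: runs_square7.
set d := digits Y j j; set p := sb HA (pow4 j) 1.
have -> : d + (d + p) * (d + p) = spair d p by rewrite /spair; ring.
stp st_copy; stp st_move; rewrite (ad0n HA).
eapply runs_seq; first exact: runs_square4.
have -> : j + (j + spair d p) * (j + spair d p) = c
  by rewrite /c /code2 -/d -/p; move: (spair d p) => e; rewrite /spair; ring.
apply: (@runs_seq _ _ _ _ _ _ _ _ (spair j j)
  (st [0; 0; 0; 0; 0; 0; sb HA n c; sb HA c n; 0; j + j])).
  apply: (@st_loop _ _ _ _ 4 _ c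
    (fun y => [0; 0; 0; 0; 0; 0; sb HA n y; sb HA y n; 0; j + j]) (fun y => spair j j)) => //.
  - by rewrite /=; sg.
  - by sg.
  - by move=> y /=; lia.
  - move=> x y _; cbn [lset]; case: (zero_or_succ HA (sb HA n y)) => [e|[u e]].
      have hny : n < y + 1.
        by case: (sbP HA n y) => [h|[h _]]; [rewrite e in h|]; zlra HA.
      have -> : sb HA (y + 1) n = sb HA y n + 1.
        by apply: sb_eq; have := sb_ge HA hny => h; zlra HA.
      have -> : sb HA n (y + 1) = sb HA n y by rewrite e; apply: sb_le; zlra HA.
      by apply: st_if_zero => //; stlast st_inc.
    have hyn : y < n by apply/sb_pos; rewrite e => h; exact: (rca_succ_neq0 HA h).
    have -> : sb HA (y + 1) n = sb HA y n by rewrite !sb_le //; zlra HA.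
    have -> : sb HA n (y + 1) = u.
      have e' : n = y + sb HA n y by apply: sb_ge; zlra HA.
      by apply: sb_eq; rewrite {1}e' e; ring.
    apply: (@st_if_pos _ _ _ _ 6 _ _ _ _ u) => //; first by simpl; lia.
    exact: runs_nop.
  - by cbn [lset]; rewrite (sb_eq HA (z := n)) ?(ad0n HA) // (sb_le HA (x := 0)) //; zlra HA.
stp st_move; rewrite adC // -/w.
case: (zero_or_succ HA w) => [e|[u e]].
- rewrite ite_t // (sb_le HA (x := w)); last by rewrite e; zlra HA.
  apply: st_if_zero => //; rewrite e.
  have := @st_inc _ HA k Y 8 (spair j j) [0; 0; 0; 0; 0; 0; 0; 0; 0; j + j].
  by cbn [lset nth]; rewrite ad0n //; apply; simpl; lia.
- rewrite ite_f; last by rewrite e => h; exact: (rca_succ_neq0 HA h).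
  apply: (@st_if_pos _ _ _ _ 7 _ _ _ _ u) => //; first by simpl; lia.
  by rewrite e sb_succ; exact: runs_nop.
Qed.

Lemma wf_prog2 : wf #10 prog2.
Proof. by cbn -[num]; repeat split; apply: (num_lt HA); lia. Qed.

Theorem machine2 : exists e, forall Y Z, (forall n, inn n Z <-> Z2 Y n) -> scomputes e Y Z.
Proof.
have [|||e H] := @decider _ HA #10 prog2 #8.
- exact: wf_prog2.
- by apply: (num_lt HA (i := 0) (j := 10)); lia.
- by apply: (num_lt HA (i := 8) (j := 10)); lia.
exists e => Y Z hZ; apply: H => n.
have [h [v [R hv]]] := runs_prog2 #10 Y n.
by exists h, v; split=> //; rewrite hZ hv.
Qed.
End Program2.

(** * The two reductions *)

Section Principles.
Variable A : struc.
Notation N := (sd A Num).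
Notation "0" := (zr A).
Notation "1" := (on A).
Notation "x + y" := (@ad A x y).
Notation "x * y" := (@ml A x y).
Notation "x < y" := (@ltt A x y).
Implicit Types (x y z i j c a b p q n m s v w : N) (X Y Z F S : sd A Set2).

Definition sle x y := x < y + 1.
Definition sfunction F :=
  (forall z, inn z F -> exists x y, z = spair x y) /\
  (forall x, exists y, inn (spair x y) F /\ (forall z, inn (spair x z) F -> z = y)).
Definition sbw_instance X := sfunction X /\
  (forall i c, inn (spair i c) X -> exists p q, c = spair p q /\ sle p (q + 1)).
Definition srat_close n p q p' q' := exists m, spow2 n m /\
  m * p * (q' + 1) < m * p' * (q + 1) + (q + 1) * (q' + 1) /\
  m * p' * (q + 1) < m * p * (q' + 1) + (q + 1) * (q' + 1).
Definition sstrictly_monotone F := forall v w a b,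
  v < w -> inn (spair v a) F -> inn (spair w b) F -> a < b.
Definition ssubseq_value X F v p q :=
  exists a, inn (spair v a) F /\ inn (spair a (spair p q)) X.
Definition sbw_weak X := exists F, sfunction F /\ sstrictly_monotone F /\
  forall n, exists s, forall v w, sle s v -> sle s w ->
    forall p q p' q', ssubseq_value X F v p q -> ssubseq_value X F w p' q' ->
      srat_close n p q p' q'.
Definition sstrongly_cohesive Y S := forall n, exists s, forall i, i < n ->
  (forall j, sle s j -> inn j S -> inn (spair i j) Y) \/
  (forall j, sle s j -> inn j S -> inn (spair i j) Y -> False).
Definition sinfinite S := forall m, exists j, m < j /\ inn j S.
Definition sstcoh Y := exists S, sinfinite S /\ sstrongly_cohesive Y S.
End Principles.

(** * From a strongly cohesive set to a Cauchy subsequence *)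

Section Cohesive.
Variable A : struc.
Hypothesis HA : isrca A.
Notation N := (sd A Num).
Notation "0" := (zr A).
Notation "1" := (on A).
Notation "x + y" := (@ad A x y).
Notation "x * y" := (@ml A x y).
Notation "x < y" := (@ltt A x y).
Implicit Types (x y z i j c a b p q n m s v w u k : N) (X Y Z F S : sd A Set2).
Add Ring Nring14 : (N_semiring HA).

Lemma cohesive_decides Z S n s :
  (forall i, i < n -> (forall j, sle s j -> inn j S -> inn (spair i j) Z) \/
     (forall j, sle s j -> inn j S -> inn (spair i j) Z -> False)) ->
  forall i u u', i < n -> sle s u -> sle s u' -> inn u S -> inn u' S ->
    inn (spair i u) Z -> inn (spair i u') Z.
Proof.
move=> H i u u' hi hu hu' hS hS' hZ; case: (H _ hi) => h; first exact: h.
by case: (h _ hu hS hZ).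
Qed.

(* Both fractions lie in [a/2^n, (a+1)/2^n). *)
Lemma close_of_comparisons n p q p' q' a :
  p * pw HA n < (a + 1) * (q + 1) -> ~ p * pw HA n < a * (q + 1) ->
  p' * pw HA n < (a + 1) * (q' + 1) -> ~ p' * pw HA n < a * (q' + 1) ->
  srat_close n p q p' q'.
Proof.
move: (@spow2E _ HA n (pw HA n)) => [_ /(_ erefl) hm] h1 h2 h3 h4.
exists (pw HA n); split=> //; move: (pw HA n) h1 h2 h3 h4 => m.
have mono x y z : x < y -> x * (z + 1) < y * (z + 1) by move=> h; znra HA.
have mono' x y z : ~ x < y -> ~ x * (z + 1) < y * (z + 1) by move=> h; znra HA.
move=> /(mono _ _ q') h1 /(mono' _ _ q') h2 /(mono _ _ q) h3 /(mono' _ _ q) h4.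
split; zlra HA.
Qed.

Section FromCohesive.
Variables X Z S : sd A Set2.
Hypothesis hX : sbw_instance X.
Hypothesis hZ : forall n, inn n Z <-> Z1 HA X n.
Hypothesis hS : sinfinite S.
Notation last := (last HA X).
Notation fs := (fs HA).
Notation sn := (sn HA).

Definition valX x : N := the (proj2 (proj1 hX) x).
Lemma valXP x y : inn (spair x y) X <-> y = valX x.
Proof.
have [h1 h2] := theP (proj2 (proj1 hX) x).
by split=> [/h2|->].
Qed.
Lemma valX_Sf : Sf1 valX.
Proof.
apply: (@Sg_ext _ _ (fun e => inn (spair (e 1%nat) (e 0%nat)) X)); last by sg.
by move=> e; rewrite valXP.
Qed.

Lemma inX_eq w : inn w X -> w = spair (fs w) (valX (fs w)).
Proof.
move=> h; have [x [y e]] := proj1 (proj1 hX) _ h.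
by rewrite e fs_pair; congr spair; apply/valXP; rewrite -e.
Qed.

(** The members of [X] with index below [x] are bounded by some [m]. Once [u] lies beyond a member
    of [X] whose code is at least [m], the largest member up to [u] no longer has such an index; the
    index [x + m] provides such a member. *)
Lemma next_exists x : exists u, inn u S /\ inn (last u) X /\ ~ fs (last u) < x.
Proof.
have vS := valX_Sf.
have [|m hm] := @bound_fun _ HA (fun a => spair a (valX a)) x; first by sg.
pose w := spair (x + m) (valX (x + m)).
have hw : inn w X by apply/valXP.
have [u [hu hus]] := hS w; exists u; split=> //.
have [[h1 [h2 h3]]|[h1 _]] := lastP HA X u; last by case: (h1 w) => //; zlra HA.
split=> //; move=> /hm; rewrite -(inX_eq h1) => h4.
have h5 : last u < w.
  by have := fst_le_pair HA (x + m) (valX (x + m)); rewrite -/w => h; zlra HA.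
by case: (h3 w) => //; zlra HA.
Qed.

(** Supplies the indices of the subsequence. Each [b k] is the index of the last entry seen by some
    [u] in [S], so the cohesiveness of [S] speaks about the values of the sequence at these
    indices. *)
Lemma monotone_enumeration : exists b : N -> N, Sf1 b /\ (forall k, b k < b (k + 1)) /\
  forall k, exists u, inn u S /\ inn (last u) X /\ b k = fs (last u).
Proof.
have lS := last_Sf HA X.
have [|||next [nS hn]] := @min_choice _ HA (fun x u => inn u S /\ inn (last u) X /\ ~ fs (last u) < x).
- by sg.
- by sg.
- exact: next_exists.
pose g x := fs (last (next x)).
have gS : Sf1 g by rewrite /g; sg.
have [|b [bS [b0 bstep]]] := @prim_rec _ HA (g 0) (fun _ y => g (y + 1)); first by sg.
exists b; split=> //; split=> [k|k].
  have [[_ [_ h]] _] := hn (b k + 1).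
  by rewrite bstep /g; zlra HA.
have [x ->] : exists x, b k = g x.
  case: (zero_or_succ HA k) => [->|[k' ->]]; first by exists 0.
  by exists (b k' + 1).
by have [[h1 [h2 _]] _] := hn x; exists (next x).
Qed.

Lemma increasing (b : N -> N) : Sf1 b -> (forall k, b k < b (k + 1)) ->
  (forall k, k < b k + 1) /\ forall v w, v < w -> b v < b w.
Proof.
move=> bS H; split.
- apply: (sg_ind HA); first by sg.
    by zlra HA.
  by move=> k IH; have := H k => h; zlra HA.
- move=> v w /(ltE HA) [d ->]; move: d; apply: (sg_ind HA); first by sg.
    by rewrite ad0.
  move=> d IH; have := H (v + d + 1); rewrite -(adA HA v) => h.
  have -> : v + (d + 1) + 1 = v + d + 1 + 1 by ring.
  have e : v + (d + 1) = v + d + 1 by ring.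
  by rewrite e in h *; zlra HA.
Qed.

Lemma bw_weak_of_cohesive : sstrongly_cohesive Z S -> sbw_weak X.
Proof.
move=> hcoh; have [b [bS [hb hu]]] := monotone_enumeration.
have [hid hmono] := increasing bS hb.
have [||F hF] := @sg_ca _ HA (fun z => z = spair (fs z) (b (fs z))); [by sg..|].
have hF' v a : inn (spair v a) F <-> a = b v.
  rewrite hF fs_pair; split=> [/(pair_inj HA) [_ //]|-> //].
exists F; split; [split|split].
- by move=> z /hF e; exists (fs z), (b (fs z)).
- by move=> x; exists (b x); split=> [|z] ; rewrite hF'.
- by move=> v w a c h /hF' -> /hF' ->; exact: hmono.
move=> n; set m := pw HA n.
(* With 2^n = m = m1 + 1, comparison with x/2^n is the set of index [spair x m1]. Pairing is
   monotone, so this bound covers all x up to m + 1. *)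
have [s hs] := hcoh (spair (m + 1) m + 1); exists s => v w hv hw p q p' q'.
move=> [a [/hF' -> hp]] [a' [/hF' -> hp']].
have [u [huS [huX hub]]] := hu v; have [u' [huS' [huX' hub']]] := hu w.
have eqlast x c y : inn (spair (b x) c) X -> inn (last y) X -> b x = fs (last y) ->
    last y = spair (b x) c.
  by move=> /valXP -> /inX_eq -> ->; rewrite fs_pair.
have e := eqlast _ _ _ hp huX hub; have e' := eqlast _ _ _ hp' huX' hub'.
(* The stage carries over from a position of the subsequence to the member of [S] behind it: [x] is
   at most [b x], hence at most [last y], hence at most [y]. *)
have su x y : sle s x -> inn (last y) X -> b x = fs (last y) -> sle s y.
  move=> h1 h2 h3; have h4 := hid x; have h5 := fs_le_self HA (last y).
  have [[_ [h6 _]]|[h6 e0]] := lastP HA X y.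
    by rewrite h3 /sle in h1 h4 *; zlra HA.
  case: (classic (last y < y + 1)) => [/h6 //|h7]; rewrite e0 in h7; case: h7; zlra HA.
have D i y y' : i < spair (m + 1) m + 1 -> sle s y -> sle s y' -> inn y S -> inn y' S ->
    below1 HA i (last y) -> below1 HA i (last y').
  move=> hi h1 h2 h3 h4 h5; have := cohesive_decides hs hi h1 h2 h3 h4.
  by rewrite !hZ /Z1 !fs_pair !sn_pair; apply.
have m_pos : 0 < m by exact: pw_pos.
have [m1 em] : exists m1, m = m1 + 1.
  by case: (zero_or_succ HA m) => // h; rewrite h in m_pos; case: (lt_irr HA m_pos).
(* [f] is the integer part of 2^n p/(q + 1). The comparisons with f and f + 1 locate the first value
   in a cell of length 2^-n, and cohesiveness puts the second value into the same cell. *)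
have [r [hr [f hf]]] := @division _ HA (p * m) (q + 1) ltac:(zlra HA).
have [p1 [q1 [e1 hpq]]] := proj2 hX _ _ hp; move/(pair_inj HA): e1 => [e1 e2]; subst p1 q1.
(* The value 1 lies in the cell f = m, which is why the comparisons have to go up to m + 1. *)
have hfm : f < m + 1 by rewrite /sle in hpq; apply: NNPP => h; znra HA.
have fm x : x < m + 1 + 1 -> spair x m1 < spair (m + 1) m + 1.
  by move=> h; apply: (pair_mono HA) => //; rewrite em; zlra HA.
have lu : fs (sn (last u)) = p /\ sn (sn (last u)) = q by rewrite e !sn_pair fs_pair.
have lu' : fs (sn (last u')) = p' /\ sn (sn (last u')) = q' by rewrite e' !sn_pair fs_pair.
have Du x : x < m + 1 + 1 -> (p * m < x * (q + 1) <-> p' * m < x * (q' + 1)).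
  move=> hx; have h1 := su _ _ hv huX hub; have h2 := su _ _ hw huX' hub'.
  have d1 := D _ u u' (fm _ hx) h1 h2 huS huS'; have d2 := D _ u' u (fm _ hx) h2 h1 huS' huS.
  move: d1 d2; rewrite /below1 fs_pair sn_pair -em.
  by move: lu lu' => [-> ->] [-> ->] d1 d2; split.
have g1 : p * m < (f + 1) * (q + 1) by rewrite hf; znra HA.
have g2 : ~ p * m < f * (q + 1) by rewrite hf => h; zlra HA.
apply: (@close_of_comparisons _ _ _ _ _ f) => //.
- by apply/Du => //; zlra HA.
- by move=> /Du h; apply: g2; apply: h; zlra HA.
Qed.
End FromCohesive.

Theorem stcoh_bw_weak X Z : sbw_instance X -> (forall n, inn n Z <-> Z1 HA X n) ->
  sstcoh Z -> sbw_weak X.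
Proof. by move=> hX hZ [S [hS hc]]; exact: (bw_weak_of_cohesive hX hZ hS hc). Qed.
End Cohesive.

(** * From a Cauchy subsequence to a strongly cohesive set *)

Section Converse.
Variable A : struc.
Hypothesis HA : isrca A.
Notation N := (sd A Num).
Notation "0" := (zr A).
Notation "1" := (on A).
Notation "x + y" := (@ad A x y).
Notation "x * y" := (@ml A x y).
Notation "x < y" := (@ltt A x y).
Implicit Types (x y z i j c a b p q n m s v w u k : N) (X Y Z F S : sd A Set2).
Add Ring Nring15 : (N_semiring HA).
Variables Y Z : sd A Set2.
Hypothesis hZ : forall n, inn n Z <-> Z2 HA Y n.
Notation digits := (digits HA Y).
Notation pow4 := (pow4 HA).
Notation pw := (pw HA).

Lemma inZ j c : inn (spair j c) Z <-> c = spair (digits j j) (sb HA (pow4 j) 1).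
Proof.
rewrite hZ /Z2 /code2 fs_pair; split=> [/(pair_inj HA) [_ ->]|->] //.
Qed.
Lemma pow4E j : pow4 j = sb HA (pow4 j) 1 + 1.
Proof.
rewrite [RHS]adC //; apply: sb_ge.
by rewrite /pow4; have := pw_pos HA j => h; znra HA.
Qed.

Lemma bit_le i j : bit Y i j = 0 \/ bit Y i j = 1.
Proof.
by rewrite /bit; case: (classic (inn (spair i j) Y)) => h; [rewrite ite_t //; right|
  rewrite ite_f //; left].
Qed.
Lemma bit_in i j : inn (spair i j) Y <-> bit Y i j = 1.
Proof.
rewrite /bit; case: (classic (inn (spair i j) Y)) => h; [rewrite ite_t //|rewrite ite_f //].
by split=> // e; exfalso; zlra HA.
Qed.

(** The [m] further digits are 0 or 1 and contribute at most (4^m - 1)/3; the factor 3 on both sides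
    avoids the division. *)
Lemma digits_prefix j n m : ~ digits j (n + m) < digits j n * pow4 m /\
  digits j (n + m) + digits j (n + m) + digits j (n + m) + 1 <
    (digits j n + digits j n + digits j n + 1) * pow4 m + 1.
Proof.
have dS := digits_Sf HA Y; have pS := pow4_Sf HA.
move: m; apply: (sg_ind HA); first by sg.
- by rewrite pow4_0 ad0 //; split=> [h|]; zlra HA.
- move=> m [h1 h2]; rewrite adS // digitsS pow4S.
  move: (bit_le (n + m) j) h1 h2; move: (digits j (n + m)) (digits j n) (pow4 m) (bit Y (n + m) j).
  by move=> d a M b [->|->] h1 h2; split=> [h|]; zlra HA.
Qed.

Lemma digits_bound j : digits j j < pow4 j.
Proof.
have [_] := digits_prefix j 0 j; rewrite digits0 ad0n // => h.
by have := pow4E j => e; zlra HA.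
Qed.

Lemma bw_instance_Z : sbw_instance Z.
Proof.
split; first split.
- by move=> z /hZ ->; exists (fs HA z), (spair (digits (fs HA z) (fs HA z)) (sb HA (pow4 (fs HA z)) 1)).
- move=> j; exists (spair (digits j j) (sb HA (pow4 j) 1)); split; first exact/inZ.
  by move=> z /inZ.
- move=> j c /inZ ->; exists (digits j j), (sb HA (pow4 j) 1); split=> //.
  by rewrite /sle -pow4E; have := digits_bound j => h; zlra HA.
Qed.

Lemma pw_add x y : pw (x + y) = pw x * pw y.
Proof.
move: y; apply: (sg_ind HA); first by sg.
- by rewrite ad0 // pw0; ring.
- by move=> y IH; rewrite adS // !pwS IH; ring.
Qed.

Lemma cancel_lt x y z : x * z < y * z -> x < y.
Proof. by move=> h; apply: NNPP => h'; znra HA. Qed.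

(** Precision 2n + 1 means a distance below half of 4^-n. A larger prefix raises the value by at
    least 4^-n, of which the later digits of the other number regain less than a third, and 2/3
    exceeds 1/2. Each of [j] and [j'] is large enough for its number to have [n] digits. *)
Lemma close_digits j j' n : n < j + 1 -> n < j' + 1 ->
  srat_close (n + n + 1) (digits j j) (sb HA (pow4 j) 1) (digits j' j') (sb HA (pow4 j') 1) ->
  ~ digits j n < digits j' n.
Proof.
move=> hj hj' [m [/(spow2E HA) -> [_ h]]] hlt.
rewrite pwS pw_add -/(pow4 n) -!pow4E in h.
have [c ec] : exists c, j = n + c by exists (sb HA j n); exact: sb_ge.
have [c' ec'] : exists c', j' = n + c' by exists (sb HA j' n); exact: sb_ge.
have [_ d1] := digits_prefix j n c; have [d2 _] := digits_prefix j' n c'.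
rewrite -ec in d1; rewrite -ec' in d2.
have e1 : pow4 j = pow4 n * pow4 c by rewrite ec /pow4 pw_add; ring.
have e2 : pow4 j' = pow4 n * pow4 c' by rewrite ec' /pow4 pw_add; ring.
rewrite e1 e2 in h.
have pos : 0 < pow4 c' by rewrite (pow4E c'); zlra HA.
move: (digits j j) (digits j' j') (digits j n) (digits j' n) (pow4 n) (pow4 c) (pow4 c')
  d1 d2 hlt h pos => d d' a a' P M M' d1 d2 hlt h pos.
(* The closeness condition cleared of denominators, with the square of 4^n cancelled. *)
have h1 : (d' + d') * M < (d + d) * M' + M * M'.
  apply: (@cancel_lt _ _ (P * P)).
  have -> : (d' + d') * M * (P * P) = (P + P) * d' * (P * M) by ring.
  by have -> : ((d + d) * M' + M * M') * (P * P) = (P + P) * d * (P * M') + P * M * (P * M') by ring.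
have h2 : ~ d' * M < (a + 1) * M' * M.
  have : ~ d' < (a + 1) * M' by znra HA.
  by move: ((a + 1) * M') => e h'; znra HA.
have h3 : (a + 1 + (a + 1)) * M < d + d + M.
  apply: (@cancel_lt _ _ M').
  by zlra HA.
by zlra HA.
Qed.

Lemma digits_agree j j' n m : digits j (n + m) = digits j' (n + m) -> digits j n = digits j' n.
Proof.
have dS := digits_Sf HA Y.
move: m; apply: (sg_ind HA); first by sg.
- by rewrite ad0.
- move=> m IH h; apply: IH; move: h; rewrite adS // !digitsS.
  move: (bit_le (n + m) j) (bit_le (n + m) j').
  move: (digits j (n + m)) (digits j' (n + m)) (bit Y (n + m) j) (bit Y (n + m) j').
  move=> d d' b b' hb hb' e; case: (lt_cases HA d d') => [h|[//|h]]; exfalso;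
    by case: hb => ?; case: hb' => ?; subst b b'; zlra HA.
Qed.
Lemma bits_agree j j' n i : i < n -> digits j n = digits j' n -> bit Y i j = bit Y i j'.
Proof.
move=> /(ltE HA) [m ->].
have -> : i + m + 1 = i + 1 + m by ring.
move=> /digits_agree e; have e0 : digits j i = digits j' i by apply: (@digits_agree _ _ _ 1).
by move: e; rewrite !digitsS e0 => e; zlra HA.
Qed.

Lemma stcoh_of_bw_weak : sbw_weak Z -> sstcoh Y.
Proof.
move=> [F [hF [hmono hcl]]].
(* The range of a strictly monotone function is Delta-1: k is at most the value at k, so a preimage
   of x can be sought up to x. *)
have [S hS] : exists S, forall x, inn x S <-> exists k, k < x + 1 /\ inn (spair k x) F.
  by apply: (sg_ca HA); sg.
have [f hf] : exists f : N -> N, forall k y, inn (spair k y) F <-> y = f k.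
  exists (fun k => the (proj2 hF k)) => k y; have [h1 h2] := theP (proj2 hF k).
  by split=> [/h2|->].
have fS : Sf1 f.
  apply: (@Sg_ext _ _ (fun e => inn (spair (e 1%nat) (e 0%nat)) F)); last by sg.
  by move=> e; rewrite hf.
have fmono v w : v < w -> f v < f w by move=> h; apply: (hmono v w) => //; apply/hf.
have [fid _] := @increasing _ HA f fS (fun k => fmono k (k + 1) ltac:(zlra HA)).
have inS x : inn x S <-> exists k, x = f k.
  rewrite hS; split=> [[k [_ /hf e]]|[k ->]]; first by exists k.
  by exists k; split; [exact: fid|apply/hf].
exists S; split.
  move=> m; exists (f (m + 1)); split; first by have := fid (m + 1) => h; zlra HA.
  by apply/inS; exists (m + 1).
(* Members of the range from [f s] on come from positions at or after [s]; the summand [n] ensures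
   that at least [n] digits are available. *)
move=> n; have [s hs] := hcl (n + n + 1); exists (f s + n).
have agree j j' i : i < n -> sle (f s + n) j -> sle (f s + n) j' -> inn j S -> inn j' S ->
    bit Y i j = bit Y i j'.
  rewrite /sle => hi h1 h2 /inS [v ej] /inS [w ej'].
  have late u : ~ f u < f s -> sle s u.
    move=> h; case: (lt_cases HA u s) => [/fmono //|[->|h']]; rewrite /sle; zlra HA.
  have hv : sle s v by apply: late; rewrite -ej => h; zlra HA.
  have hw : sle s w by apply: late; rewrite -ej' => h; zlra HA.
  have val u : ssubseq_value Z F u (digits (f u) (f u)) (sb HA (pow4 (f u)) 1).
    by exists (f u); split; [apply/hf|apply/inZ].
  have c1 := hs _ _ hv hw _ _ _ _ (val v) (val w).
  have c2 := hs _ _ hw hv _ _ _ _ (val w) (val v).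
  rewrite -ej -ej' in c1 c2.
  apply: (bits_agree hi); have l1 : n < j + 1 by zlra HA.
  have l2 : n < j' + 1 by zlra HA.
  case: (lt_cases HA (digits j n) (digits j' n)) => [h|[//|h]].
  - by case: (close_digits l1 l2 c1 h).
  - by case: (close_digits l2 l1 c2 h).
move=> i hi; case: (classic (exists j, sle (f s + n) j /\ inn j S /\ inn (spair i j) Y)).
- move=> [j [h1 [h2 /bit_in h3]]]; left=> j' h1' h2'; apply/bit_in; rewrite -h3.
  exact: agree.
- by move=> h; right=> j h1 h2 h3; apply: h; exists j.
Qed.
End Converse.

Section Reductions.
Variable A : struc.
Hypothesis HA : isrca A.
Notation Sets := (sd A Set2).
Implicit Types (X Y Z : Sets).

Theorem reduction1 : exists e, forall X Z, sbw_instance X ->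
  (forall n, inn n Z <-> Z1 HA X n) -> scomputes e X Z /\ (sstcoh Z -> sbw_weak X).
Proof.
have [e he] := machine1 HA; exists e => X Z hX hZ; split; first exact: he.
exact: (stcoh_bw_weak hX hZ).
Qed.
Theorem reduction2 : exists e, forall Y Z, (forall n, inn n Z <-> Z2 HA Y n) ->
  scomputes e Y Z /\ sbw_instance Z /\ (sbw_weak Z -> sstcoh Y).
Proof.
have [e he] := machine2 HA; exists e => Y Z hZ; split; first exact: he.
by split; [exact: (bw_instance_Z hZ)|exact: (stcoh_of_bw_weak hZ)].
Qed.

Lemma Z1_exists X : exists Z, forall n, inn n Z <-> Z1 HA X n.
Proof. by have lS := last_Sf HA X; apply: (sg_ca HA); rewrite /Z1 /below1; sg. Qed.
Lemma Z2_exists Y : exists Z, forall n, inn n Z <-> Z2 HA Y n.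
Proof.
have dS := digits_Sf HA Y; have pS := pow4_Sf HA.
by apply: (sg_ca HA); rewrite /Z2 /code2; sg.
Qed.
End Reductions.

(** * Equality as identity in models *)

Section Equality.
Variables (L : language) (T : form L -> Prop) (I : interp L) (s : sort L).
Variables (E : term s -> term s -> form L) (R : dom I s -> dom I s -> Prop).
Hypothesis HT : models T I.
Hypothesis HI : forall a b : dom I s, indiscernible a b -> a = b.
Hypothesis HE : forall r t u, sat r (E t u) <-> R (eval r t) (eval r u).
Hypothesis Erefl : forall t, T (E t t).
Hypothesis Eleib : forall t u A, T (Imp (E t u) (Imp (fsubst (inst t) A) (fsubst (inst u) A))).

Lemma equality_true (r0 : env I) a b : R a b <-> a = b.
Proof.
split=> [h|->].
- apply: HI => A r hA.
  pose r' : env I := econs a (econs b r).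
  (* Raising the variables of [A] by two makes room for [a] and [b] as variables 0 and 1, the terms
     to which the Leibniz axiom is applied. *)
  pose A' := fsubst (up s (comp (shift s) (shift s))) A.
  have hA' : forall x : dom I s, sat (econs x r') A' <-> sat (econs x r) A.
    move=> x; rewrite /A' sat_subst econs_up.
    suff -> : (fun s' n => eval r' (comp (shift s) (shift s) s' n)) = r by [].
    apply: env_ext => s' n; rewrite /comp /r' eval_shift.
    by rewrite -[shift s s' n]/(tsubst (shift s) (Var s' n)) eval_shift.
  have e0 : eval r' (Var s 0) = a by rewrite /= /r' /econs sort_dec_refl.
  have e1 : eval r' (Var s 1) = b by rewrite /= /r' /econs sort_dec_refl.
  have := HT (Eleib (Var s 0) (Var s 1) A') r'.
  rewrite [sat _ _]/= HE !sat_inst e0 e1 !hA'; exact.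
- have := HT (Erefl (Var s 0)) (econs b r0); rewrite HE.
  by rewrite /= /econs sort_dec_refl.
Qed.
End Equality.

(** * Models of the axioms as structures *)

Section ModelsOfRCA0.
Variable I : interp L2.
Hypothesis HT : models RCA0 I.
Hypothesis HI : forall s (a b : dom I s), indiscernible a b -> a = b.
Variable r0 : env I.

Definition struc_of : struc := {|
  sd := dom I;
  zr := @ifun L2 I FZero tt;
  on := @ifun L2 I FOne tt;
  ad x y := @ifun L2 I FPlus (x, (y, tt));
  ml x y := @ifun L2 I FTimes (x, (y, tt));
  ltt x y := @irel L2 I RLt (x, (y, tt));
  inn x Z := @irel L2 I RIn (x, (Z, tt)) |}.

Lemma struc_of_interp : I = struc_interp struc_of.
Proof.
have E := @equality_true L2 RCA0 I Num Eq2 (fun x y => @irel L2 I REq (x, (y, tt))) HT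
  (@HI Num) (fun _ _ _ => iff_refl _) eq_refl2 eq_leibniz2 r0.
have : @Interp L2 (dom I) (@ifun L2 I) (@irel L2 I) = struc_interp struc_of; last by case: (I).
rewrite /struc_interp /=; congr (@Interp L2 (dom I) _ _).
- apply: functional_extensionality_dep => -[] /=; apply: functional_extensionality;
    first [by case|by case=> x [y []]].
- apply: functional_extensionality_dep => -[] /=; apply: functional_extensionality => -[x [y []]];
    apply: propositional_extensionality => //=.
Qed.
End ModelsOfRCA0.

Lemma sat_repl (A : struc) (r : env (struc_interp A)) x B :
  sat (numcons x r) (fsubst (repl (Plus x0 One)) B) <-> sat (numcons (ad x (on A)) r) B.
Proof.
rewrite sat_subst.
suff -> : (fun s n => eval (numcons x r) (repl (Plus x0 One) s n)) = numcons (ad x (on A)) r by [].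
by apply: env_ext => -[] // [].
Qed.

Lemma sat_shift_set (A : struc) (r : env (struc_interp A)) x (Z : sd A Set2) B :
  sat (numcons x (econs (L := L2) (s := Set2) (Z : dom (struc_interp A) Set2) r)) (fsubst shift_set B) <->
  sat (numcons x r) B.
Proof.
rewrite sat_subst.
suff -> : (fun s n => eval (numcons x (econs (L := L2) (s := Set2) (Z : dom (struc_interp A) Set2) r))
  (shift_set s n)) = numcons x r by [].
by apply: env_ext => -[].
Qed.

Lemma isrca_of_model (A : struc) (r0 : env (struc_interp A)) :
  models RCA0 (struc_interp A) -> isrca A.
Proof.
move=> H; constructor.
- by exists (r0 Set2 0).
- exact: (H _ ax_succ_neq0 r0).
- exact: (H _ ax_succ_inj r0).
- exact: (H _ ax_add0 r0).
- exact: (H _ ax_addS r0).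
- exact: (H _ ax_mul0 r0).
- exact: (H _ ax_mulS r0).
- exact: (H _ ax_lt0 r0).
- exact: (H _ ax_ltS r0).
- move=> B hB r h0 hS x.
  have := H _ (sigma1_induction (sigma1_ex hB)) r.
  apply=> /=; split; first by apply/(@sat_inst L2 (struc_interp A) r Num Zero (Ex _ B)).
  by move=> y hy; apply/(@sat_repl A r y (Ex _ B)); exact: hS.
- move=> B C hB hC r h.
  have := H _ (delta1_comprehension (sigma1_ex hB) (pi1_all hC)) r.
  case=> [x|Z hZ]; first by split=> /(h x).
  exists Z => x; have [h1 h2] := hZ x; split.
  + by move=> hx; apply/(@sat_shift_set A r x Z (Ex _ B)); exact: h1.
  + by move=> hx; apply: h2; apply/(@sat_shift_set A r x Z (Ex _ B)).
Qed.

Definition fin_list X (l : list X) (n : nat) := l.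
Lemma lists_all_fin X (l : list X) : (forall x, In x l) -> lists_all (fin_list l).
Proof. by move=> h; split=> [n m _|x]; [exact: incl_refl|exists 0]. Qed.

Lemma RCA0_complete (A : hform L2) :
  (forall (S : struc) (r : env (struc_interp S)), isrca S -> sat r (sentence A)) ->
  provable RCA0 A.
Proof.
move=> H; apply: (@completeness L2 RCA0 (fin_list [Num; Set2]) (fin_list [FZero; FOne; FPlus; FTimes])
  (fin_list [REq; RLt; RIn])).
- by apply: lists_all_fin => -[] /=; tauto.
- by apply: lists_all_fin => -[] /=; tauto.
- by apply: lists_all_fin => -[] /=; tauto.
move=> I HT HI r; have e := struc_of_interp HT HI r.
rewrite e in r HT *; apply: H; exact: (isrca_of_model r).
Qed.

Lemma RCA0_reduction1 : provable RCA0
    ([ex] e1, [ALL] X, bw_instance X [->]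
       [EX] Z, computes e1 X Z [/\] (stcoh Z [->] bw_weak X)).
Proof.
apply: RCA0_complete => S r HS.
have [e he] := reduction1 HS.
suff : exists e : sd S Num, forall X, sbw_instance X ->
    exists Z, scomputes e X Z /\ (sstcoh Z -> sbw_weak X) by exact.
exists e => X hX; have [Z hZ] := Z1_exists HS X; exists Z; exact: he.
Qed.

Lemma RCA0_reduction2 : provable RCA0
    ([ex] e2, [ALL] Y,
       [EX] Z, computes e2 Y Z [/\] bw_instance Z [/\] (bw_weak Z [->] stcoh Y)).
Proof.
apply: RCA0_complete => S r HS.
have [e he] := reduction2 HS.
suff : exists e : sd S Num, forall Y,
    exists Z, scomputes e Y Z /\ sbw_instance Z /\ (sbw_weak Z -> sstcoh Y) by exact.
exists e => Y; have [Z hZ] := Z2_exists HS Y; exists Z; exact: he.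
Qed.

(** * Models of RCA_0^omega *)

Record wstruc := WStruc {
  wd : ty -> Type;
  wfun : forall f : fsym Lw, hl wd (fdom f) -> wd (fcod f) }.

Definition winterp (W : wstruc) : interp Lw :=
  @Interp Lw (wd W) (@wfun W) (fun r v => v.1 = v.2.1).

Section Applicative.
Variable W : wstruc.
Definition wap (s t : ty) (f : wd W (s ~> t)) (x : wd W s) : wd W t :=
  @wfun W (WApp s t) (f, (x, tt)).
Definition w0 : wd W N0 := @wfun W WZero tt.
Definition wS : wd W N1 := @wfun W WSucc tt.
Definition wK (s t : ty) : wd W (s ~> t ~> s) := @wfun W (WPi s t) tt.
Definition wSg (r s t : ty) : wd W ((r ~> s ~> t) ~> (r ~> s) ~> r ~> t) :=
  @wfun W (WSigma r s t) tt.
Definition wR : wd W (N0 ~> N0 ~> (N0 ~> N0 ~> N0) ~> N0) := @wfun W WRec tt.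

Fixpoint peq (s : ty) : wd W s -> wd W s -> Prop :=
  match s with
  | N0 => eq
  | Arr r t => fun f g => forall x : wd W r, peq (wap f x) (wap g x)
  end.
End Applicative.
Infix "$" := wap (at level 20, left associativity).

(** Two schemes are kept as single instances: induction for one Boolean shape of equations, enough
    to start arithmetic, and choice for a relation that reads a function only at 0 and 1, enough to
    encode a pair of numbers. *)
Record iswr (W : wstruc) : Prop := IsWR {
  wr_succ0 : forall x : wd W N0, wS W $ x <> w0 W;
  wr_succI : forall x y : wd W N0, wS W $ x = wS W $ y -> x = y;
  wr_K : forall s t (x : wd W s) (y : wd W t), peq (wK W s t $ x $ y) x;
  wr_Sg : forall r s t (x : wd W (r ~> s ~> t)) (y : wd W (r ~> s)) (z : wd W r),
    peq (wSg W r s t $ x $ y $ z) (x $ z $ (y $ z));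
  wr_rec0 : forall (y : wd W N0) z, wR W $ w0 W $ y $ z = y;
  wr_recS : forall (x y : wd W N0) z, wR W $ (wS W $ x) $ y $ z = z $ (wR W $ x $ y $ z) $ x;
  wr_ext : forall s t (z : wd W (s ~> t)) (x y : wd W s), peq x y -> peq (z $ x) (z $ y);
  wr_ind : forall c1 c2 c3 c4 c5 c6 : wd W N1,
    let P x := (c1 $ x = c2 $ x \/ c3 $ x = c4 $ x) /\ c5 $ x = c6 $ x in
    P (w0 W) -> (forall x, P x -> P (wS W $ x)) -> forall x, P x;
  wr_ac : forall c : wd W (N0 ~> N0 ~> N0 ~> N0),
    (forall f : wd W N1, exists x, c $ (f $ w0 W) $ (f $ (wS W $ w0 W)) $ x = w0 W) ->
    exists F : wd W (N1 ~> N0), forall f, c $ (f $ w0 W) $ (f $ (wS W $ w0 W)) $ (F $ f) = w0 W }.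

Section HTermValues.
Variable W : wstruc.
Notation I := (winterp W).
Notation state := (depth Lw * env I)%type.

Inductive extends (p : state) : state -> Prop :=
| ext_refl : extends p p
| ext_push q s (x : wd W s) : extends p q ->
    extends p (@push Lw s q.1, econs (L := Lw) (I := I) (s := s) x q.2).

(** For axioms schematic in the types, satisfaction does not unfold by conversion. The value of a
    term is therefore tracked through all extensions of the current depth and environment, that is,
    under further quantifiers. *)
Definition hval (s : ty) (f : whterm s) (p : state) (a : wd W s) :=
  forall q, extends p q -> eval q.2 (f q.1) = a.

Lemma hval_happ s t (f : whterm (s ~> t)) (x : whterm s) p a b :
  hval f p a -> hval x p b -> hval (happ f x) p (a $ b).
Proof. by move=> hf hx q hq; rewrite /= (hf q hq) (hx q hq). Qed.

Lemma hval_push s (f : whterm s) p a s' (x : wd W s') : hval f p a ->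
  hval f (@push Lw s' p.1, econs (L := Lw) (I := I) (s := s') x p.2) a.
Proof.
move=> hf q hq; apply: hf; elim: q / hq; first exact: ext_push (ext_refl _).
by move=> q s0 y _; exact: ext_push.
Qed.

Arguments hval_push [s f p a s'] x _.

Lemma hval_level s p (x : wd W s) :
  hval (@level Lw (s) (p.1 s)) (@push Lw s p.1, econs (L := Lw) (I := I) (s := s) x p.2) x.
Proof.
move=> q hq.
suff [h1 h2] : p.1 s < q.1 s /\ q.2 s (q.1 s - S (p.1 s)) = x by [].
elim: q / hq => [|q s' y _ [h1 h2]] /=.
- rewrite /push /econs sort_dec_refl; split; first by lia.
  by rewrite Nat.sub_diag.
- rewrite /push /econs; case: (@sort_dec Lw s' s) => e; last by [].
  split; first by lia.
  have -> : S (q.1 s) - S (p.1 s) = S (q.1 s - S (p.1 s)) by lia.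
  by [].
Qed.

Arguments hval_level [s] p x.

Lemma sat_weq_at s : forall (f g : whterm s) (p : state) a b,
  hval f p a -> hval g p b -> (sat p.2 (weq_at f g p.1) <-> peq a b).
Proof.
elim: s => [|r IHr t IHt] f g p a b hf hg.
- by rewrite /= (hf p (ext_refl _)) (hg p (ext_refl _)).
- have K x := IHt (happ f (@level Lw (r) (p.1 r))) (happ g (@level Lw (r) (p.1 r)))
    (@push Lw r p.1, econs (L := Lw) (I := I) (s := r) x p.2) (a $ x) (b $ x)
    (hval_happ (hval_push x hf) (hval_level p x)) (hval_happ (hval_push x hg) (hval_level p x)).
  by split=> H x; apply/K; exact: H.
Qed.

Hypothesis HM : models RCA0w I.
Variable r0 : env I.

Lemma hval_closed s (t : whterm s) a p : (forall d (r : env I), eval r (t d) = a) -> hval t p a.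
Proof. by move=> h q _. Qed.

Lemma iswr_of_model : iswr W.
Proof.
constructor.
- exact: (HM ax_wsucc_neq0 r0).
- exact: (HM ax_wsucc_inj r0).
- move=> s t x y; have := HM (ax_wpi s t) r0 => /(_ x y).
  pose p0 : state := (fun _ => 0, r0).
  pose p1 : state := (@push Lw s p0.1, econs (L := Lw) (I := I) (s := s) x p0.2).
  pose p2 : state := (@push Lw t p1.1, econs (L := Lw) (I := I) (s := t) y p1.2).
  have hx : hval (@level Lw (s) (p0.1 s)) p2 x := hval_push y (hval_level p0 x).
  have hy : hval (@level Lw (t) (p1.1 t)) p2 y := hval_level p1 y.
  apply: (proj1 (@sat_weq_at s _ _ p2 _ _ _ hx)).
  apply: hval_happ hy; apply: hval_happ hx; exact: hval_closed.
- move=> r s t x y z; have := HM (ax_wsigma r s t) r0 => /(_ x y z).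
  pose p0 : state := (fun _ => 0, r0).
  pose p1 : state := (@push Lw (r ~> s ~> t) p0.1, econs (L := Lw) (I := I) (s := r ~> s ~> t) x p0.2).
  pose p2 : state := (@push Lw (r ~> s) p1.1, econs (L := Lw) (I := I) (s := r ~> s) y p1.2).
  pose p3 : state := (@push Lw r p2.1, econs (L := Lw) (I := I) (s := r) z p2.2).
  have hx : hval (@level Lw (r ~> s ~> t) (p0.1 (r ~> s ~> t))) p3 x :=
    hval_push z (hval_push y (hval_level p0 x)).
  have hy : hval (@level Lw (r ~> s) (p1.1 (r ~> s))) p3 y := hval_push z (hval_level p1 y).
  have hz : hval (@level Lw (r) (p2.1 r)) p3 z := hval_level p2 z.
  apply: (proj1 (@sat_weq_at t _ _ p3 _ _ _ _)).
  + apply: hval_happ hz; apply: hval_happ hy; apply: hval_happ hx; exact: hval_closed.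
  + by apply: hval_happ; [exact: hval_happ hx hz|exact: hval_happ hy hz].
- exact: (HM ax_wrec0 r0).
- exact: (HM ax_wrecS r0).
- move=> s t z x y; have := HM (extensionality s t) r0 => /(_ z x y) H h.
  pose p0 : state := (fun _ => 0, r0).
  pose p1 : state := (@push Lw (s ~> t) p0.1, econs (L := Lw) (I := I) (s := s ~> t) z p0.2).
  pose p2 : state := (@push Lw s p1.1, econs (L := Lw) (I := I) (s := s) x p1.2).
  pose p3 : state := (@push Lw s p2.1, econs (L := Lw) (I := I) (s := s) y p2.2).
  have hz : hval (@level Lw (s ~> t) (p0.1 (s ~> t))) p3 z :=
    hval_push y (hval_push x (hval_level p0 z)).
  have hx : hval (@level Lw s (p1.1 s)) p3 x := hval_push y (hval_level p1 x).
  have hy : hval (@level Lw s (p2.1 s)) p3 y := hval_level p2 y.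
  apply: (proj1 (@sat_weq_at t _ _ p3 _ _ (hval_happ hz hx) (hval_happ hz hy))).
  exact/H/(proj2 (@sat_weq_at s _ _ p3 _ _ hx hy)).
- move=> c1 c2 c3 c4 c5 c6 P h0 hS.
  pose c i := App (wvar N1 i) (wvar N0 0).
  pose A := And (Or (Eqw (c 0) (c 1)) (Eqw (c 2) (c 3))) (Eqw (c 4) (c 5)).
  have hA : qfree A by repeat constructor.
  pose r : env I := fun s => match s with
    | Arr N0 N0 => fun n => match n with 0 => c1 | 1 => c2 | 2 => c3 | 3 => c4 | 4 => c5 | _ => c6 end
    | s => r0 s end.
  have hP : forall x : wd W N0, sat (econs (L := Lw) (I := I) (s := N0) x r) A <-> P x by [].
  have H := HM (qf_induction hA) r.
  move=> x; apply/hP; move: x; apply: H; split.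
  + by apply/(@sat_inst Lw I r N0 (wzero (fun _ => 0)) A)/hP.
  + move=> x /hP hx; apply (proj2 (sat_subst _ _ _)).
    have -> : (fun s n => eval (econs (L := Lw) (I := I) (s := N0) x r)
      (repl (L := Lw) (s := N0) (App (wsucc (fun _ => 0)) (wvar N0 0)) s n)) =
      econs (L := Lw) (I := I) (s := N0) (wS W $ x) r.
      apply: env_ext => s n; rewrite /repl /econs; case: (@sort_dec Lw _ s) => e //.
        by case: n => [|n]; case: _ / e => //=; rewrite /econs sort_dec_refl.
      by rewrite /=; move: e; clear; case: s => // e; case: e.
    exact: (proj2 (hP _) (hS x hx)).
- move=> c h.
  pose fz := App (wvar N1 0) (wzero (fun _ => 0)).
  pose fo := App (wvar N1 0) (App (wsucc (fun _ => 0)) (wzero (fun _ => 0))).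
  pose A := Eqw (App (App (App (wvar (N0 ~> N0 ~> N0 ~> N0) 0) fz) fo) (wvar N0 0)) (wzero (fun _ => 0)).
  have hA : qfree A by constructor.
  pose r : env I := fun s => match s with
    | Arr N0 (Arr N0 (Arr N0 N0)) => fun n => c
    | s => r0 s end.
  have [F hF] := HM (qf_ac10 hA) r h.
  by exists F.
Qed.
End HTermValues.

(** * Countability of the language of finite types *)

Fixpoint enum_ty (n : nat) : list ty :=
  match n with
  | 0 => [N0]
  | S n => enum_ty n ++ flat_map (fun s => map (Arr s) (enum_ty n)) (enum_ty n)
  end.
Lemma enum_ty_all : lists_all enum_ty.
Proof.
have M : forall n m, n <= m -> incl (enum_ty n) (enum_ty m).
  move=> n m; elim=> [|k _ IH]; first exact: incl_refl.
  by apply: incl_tran IH _ => t ht /=; apply/in_or_app; left.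
split=> //; elim=> [|s [n hn] t [m hm]]; first by exists 0; left.
exists (S (n + m)) => /=; apply/in_or_app; right; apply/in_flat_map; exists s; split.
  by apply: M hn; lia.
by apply/in_map_iff; exists t; split=> //; apply: M hm; lia.
Qed.

Definition enum_fsymw (n : nat) : list fsymw :=
  let T := enum_ty n in
  WZero :: WSucc :: WRec :: flat_map (fun s => map (WPi s) T) T ++ flat_map (fun s => map (WApp s) T) T ++
  flat_map (fun r => flat_map (fun s => map (WSigma r s) T) T) T.
Lemma enum_fsymw_all : lists_all enum_fsymw.
Proof.
have [M E] := enum_ty_all.
have F2 : forall (f : ty -> ty -> fsymw) n m, n <= m ->
    incl (flat_map (fun s => map (f s) (enum_ty n)) (enum_ty n))
      (flat_map (fun s => map (f s) (enum_ty m)) (enum_ty m)).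
  move=> f n m h x /in_flat_map [s [hs /in_map_iff [t [<- ht]]]].
  apply/in_flat_map; exists s; split; first exact: M hs.
  by apply/in_map_iff; exists t; split=> //; exact: M ht.
have G2 : forall (f : ty -> ty -> fsymw) s t n, In s (enum_ty n) -> In t (enum_ty n) ->
    In (f s t) (flat_map (fun s => map (f s) (enum_ty n)) (enum_ty n)).
  move=> f s t n hs ht; apply/in_flat_map; exists s; split=> //.
  by apply/in_map_iff; exists t.
split=> [n m h|].
- rewrite /enum_fsymw; do 3!(apply: incl_cons; first by simpl; tauto); do 3!apply: incl_tl; apply: incl_app_app; [exact: F2|apply: incl_app_app; [exact: F2|]].
  move=> x /in_flat_map [s [hs hx]]; apply/in_flat_map; exists s; split; first exact: M hs.
  exact: F2 hx.
- rewrite /enum_fsymw; case=> [||s t|r s t||s t].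
  + by exists 0; left.
  + by exists 0; right; left.
  + have [n hn] := E s; have [m hm] := E t; exists (n + m).
    do 3!right; apply/in_or_app; left; apply: (G2 WPi); [apply: M hn|apply: M hm]; lia.
  + have [k hk] := E r; have [n hn] := E s; have [m hm] := E t; exists (k + n + m).
    do 3!right; apply/in_or_app; right; apply/in_or_app; right.
    apply/in_flat_map; exists r; split; first by apply: M hk; lia.
    by apply: (G2 (WSigma r)); [apply: M hn|apply: M hm]; lia.
  + by exists 0; right; right; left.
  + have [n hn] := E s; have [m hm] := E t; exists (n + m).
    do 3!right; apply/in_or_app; right; apply/in_or_app; left; apply: (G2 WApp); [apply: M hn|apply: M hm]; lia.
Qed.

Lemma RCA0w_complete (A : hform Lw) :
  (forall (W : wstruc) (r : env (winterp W)), iswr W -> sat r (sentence A)) ->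
  provable RCA0w A.
Proof.
move=> H; apply: (@completeness Lw RCA0w enum_ty enum_fsymw (fin_list [WEq])).
- exact: enum_ty_all.
- exact: enum_fsymw_all.
- by apply: lists_all_fin => -[]; left.
move=> I HT HI r.
pose W := @WStruc (dom I) (@ifun Lw I).
have e : I = winterp W.
  have E := @equality_true Lw RCA0w I N0 Eqw (fun x y => @irel Lw I WEq (x, (y, tt))) HT
    (@HI N0) (fun _ _ _ => iff_refl _) eq_reflw eq_leibnizw r.
  have : @Interp Lw (dom I) (@ifun Lw I) (@irel Lw I) = winterp W; last by case: (I).
  rewrite /winterp /=; congr (@Interp Lw (dom I) _ _).
  apply: functional_extensionality_dep => -[]; apply: functional_extensionality => -[x [y []]].
  by apply: propositional_extensionality; exact: E.
move: r HT; rewrite e => r HT; apply: H; exact: (iswr_of_model HT r).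
Qed.

Lemma peq_refl W s (f : wd W s) : peq f f.
Proof. by elim: s f => //= r _ t IH f x. Qed.
Lemma peq_sym W s (f g : wd W s) : peq f g -> peq g f.
Proof. elim: s f g => [f g /= -> //|r _ t IH f g h x]; exact/IH/h. Qed.
Lemma peq_trans W s (f g h : wd W s) : peq f g -> peq g h -> peq f h.
Proof. elim: s f g h => [f g h /= -> //|r _ t IH f g h h1 h2 x]; exact: IH (h1 x) (h2 x). Qed.

Fixpoint ar (n : nat) (t : ty) : ty :=
  match n with 0 => N1 ~> t | S n => ar n (N0 ~> t) end.

(** The number arguments are passed with the highest index first and [e 0] last, so a new variable
    of index 0 only changes the result type. *)
Fixpoint apn (W : wstruc) (n : nat) : forall t, wd W (ar n t) -> wd W N1 -> (nat -> wd W N0) -> wd W t :=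
  match n return forall t, wd W (ar n t) -> wd W N1 -> (nat -> wd W N0) -> wd W t with
  | 0 => fun t c Y e => c $ Y
  | S n => fun t c Y e => @apn W n (N0 ~> t) c Y (tl e) $ e 0
  end.
Arguments apn {W} n {t} c Y e.

(* Functions are represented by combinators uniformly in a family of models.
   With a single model and no restriction on [adm] this gives definability with
   parameters; with all models and [adm] the values of closed terms it gives
   the functionals of the theorem. *)
Section Definable.
Variables (J : Type) (W : J -> wstruc).
Hypothesis HW : forall j, iswr (W j).
Definition elt t := forall j, wd (W j) t.
Definition eapp s t (f : elt (s ~> t)) (x : elt s) : elt t := fun j => f j $ x j.
Variable adm : forall t, elt t -> Prop.

Record admissible : Prop := {
  adm_0 : adm (fun j => w0 (W j));
  adm_S : adm (fun j => wS (W j));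
  adm_K : forall s t, adm (fun j => wK (W j) s t);
  adm_Sg : forall r s t, adm (fun j => wSg (W j) r s t);
  adm_R : adm (fun j => wR (W j));
  adm_app : forall s t (f : elt (s ~> t)) (x : elt s), adm f -> adm x -> adm (eapp f x) }.
Hypothesis HK : admissible.

Notation val t := (forall j, wd (W j) N1 -> (nat -> wd (W j) N0) -> wd (W j) t).

(** [lift] and [lapp] are the combinators K and S iterated over one argument of type 1 and [n]
    numbers: bracket abstraction carried out on values. *)
Fixpoint lift (n : nat) : forall t, elt t -> elt (ar n t) :=
  match n with
  | 0 => fun t x => eapp (fun j => wK (W j) t N1) x
  | S n => fun t x => lift n (eapp (fun j => wK (W j) t N0) x)
  end.
Fixpoint lapp (n : nat) : forall s t, elt (ar n (s ~> t)) -> elt (ar n s) -> elt (ar n t) :=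
  match n return forall s t, elt (ar n (s ~> t)) -> elt (ar n s) -> elt (ar n t) with
  | 0 => fun s t f x => eapp (eapp (fun j => wSg (W j) N1 s t) f) x
  | S n => fun s t f x => @lapp n (N0 ~> s) (N0 ~> t)
      (@lapp n (N0 ~> s ~> t) _ (lift n (fun j => wSg (W j) N0 s t)) f) x
  end.

Arguments lift n {t} x.
Arguments lapp n {s t} f x.

Lemma adm_lift n : forall t (x : elt t), adm x -> adm (lift n x).
Proof.
elim: n => [|n IH] t x hx /=; last apply: IH; by apply: (adm_app HK) => //; exact: (adm_K HK).
Qed.
Lemma adm_lapp n : forall s t (f : elt (ar n (s ~> t))) (x : elt (ar n s)), adm f -> adm x -> adm (lapp n f x).
Proof.
elim: n => [|n IH] s t f x hf hx /=.
- apply: (adm_app HK) => //; apply: (adm_app HK) => //; exact: (adm_Sg HK).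
- apply: (IH) => //; apply: (IH) => //; apply: adm_lift; exact: (adm_Sg HK).
Qed.

Lemma apn_lift n : forall t (x : elt t) j Y e, peq (apn n (lift n x j) Y e) (x j).
Proof.
elim: n => [|n IH] t x j Y e /=; first exact: wr_K.
apply: peq_trans; first exact: (IH (N0 ~> t) _ j Y (tl e) (e 0)).
exact: wr_K.
Qed.
Arguments apn_lift n [t] x j Y e.
Lemma apn_lapp n : forall s t (f : elt (ar n (s ~> t))) (x : elt (ar n s)) j Y e,
  peq (apn n (lapp n f x j) Y e) (apn n (f j) Y e $ apn n (x j) Y e).
Proof.
elim: n => [|n IH] s t f x j Y e /=; first exact: wr_Sg.
apply: peq_trans; first exact: (IH (N0 ~> s) (N0 ~> t) _ _ j Y (tl e) (e 0)).
apply: peq_trans; first exact: (IH (N0 ~> s ~> t) ((N0 ~> s) ~> N0 ~> t) _ _ j Y (tl e) _ (e 0)).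
apply: peq_trans; first exact: (apn_lift n (fun j => wSg (W j) N0 s t) j Y (tl e) _ _ (e 0)).
exact: wr_Sg.
Qed.

Arguments apn_lapp n [s t] f x j Y e.

Definition RT n t (v : val t) :=
  exists c : elt (ar n t), adm c /\ forall j Y e, peq (apn n (c j) Y e) (v j Y e).
Definition RF n (F : val N0) := RT n F.

Lemma RT_ext n t (v v' : val t) : (forall j Y e, peq (v j Y e) (v' j Y e)) -> RT n v' -> RT n v.
Proof. by move=> h [c [hc H]]; exists c; split=> // j Y e; apply: peq_trans (H j Y e) _; exact/peq_sym/h. Qed.
Lemma RF_ext n (F G : val N0) : (forall j Y e, F j Y e = G j Y e) -> RF n G -> RF n F.
Proof. by move=> h; exact: (@RT_ext n N0 F G h). Qed.

Lemma RT_const n t (x : elt t) : adm x -> RT n (fun j Y e => x j).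
Proof. by move=> h; exists (lift n x); split; [exact: adm_lift|move=> j Y e; exact: apn_lift]. Qed.
Lemma RT_app n s t (f : val (s ~> t)) (x : val s) : RT n f -> RT n x -> RT n (fun j Y e => f j Y e $ x j Y e).
Proof.
move=> [c [hc H]] [d [hd H']]; exists (lapp n c d); split; first exact: adm_lapp.
move=> j Y e; apply: peq_trans; first exact: apn_lapp.
by apply: peq_trans; [exact: H|apply: (wr_ext (HW j)); exact: H'].
Qed.
Lemma RT_weak n t (v : val t) : RT n v -> RT (S n) (fun j Y e => v j Y (tl e)).
Proof.
move=> [c [hc H]].
exists (lapp n (lift n (fun j => wK (W j) t N0)) c); split.
  by apply: (@adm_lapp n t (N0 ~> t)) => //; apply: adm_lift; exact: (adm_K HK).
move=> j Y e /=; apply: peq_trans; first exact: (@apn_lapp n t (N0 ~> t) _ _ j Y (tl e) (e 0)).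
apply: peq_trans; first exact: (apn_lift n (fun j => wK (W j) t N0) j Y (tl e) _ (e 0)).
by apply: peq_trans; [exact: wr_K|exact: H].
Qed.

Lemma id_exists s : exists i : elt (s ~> s), adm i /\ forall j (x : wd (W j) s), peq (i j $ x) x.
Proof.
exists (eapp (eapp (fun j => wSg (W j) s (s ~> s) s) (fun j => wK (W j) s (s ~> s))) (fun j => wK (W j) s s)).
split; first by apply: (adm_app HK); [apply: (adm_app HK); [exact: (adm_Sg HK)|]|]; exact: (adm_K HK).
by move=> j x; apply: peq_trans; [exact: wr_Sg|exact: wr_K].
Qed.

Lemma RF_var n i : i < n -> RF n (fun j Y e => e i).
Proof.
elim: n i => [|n IH] [|i] hi; try lia.
- have [c [hc H]] := id_exists N0; exists (lift n c); split; first exact: (@adm_lift n N1).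
  by move=> j Y e; exact: (@peq_trans _ N0 _ _ _ (apn_lift n c j Y (tl e) (e O)) (H j (e O))).
- by apply: (RT_weak (v := fun j Y e => e i)); apply: IH; lia.
Qed.
Lemma RT_Y n : RT n (fun j Y e => Y).
Proof.
elim: n => [|n IH]; last exact: (RT_weak IH).
have [c [hc H]] := id_exists N1; exists c; split=> // j Y e x; exact: H.
Qed.

Lemma RT_subst n m t (v : val t) (G : nat -> val N0) : RT m v -> (forall i, i < m -> RF n (G i)) ->
  RT n (fun j Y e => v j Y (fun i => G i j Y e)).
Proof.
move=> [c [hc H]] hG.
suff [d [hd H']] : RT n (fun j Y e => apn m (c j) Y (fun i => G i j Y e)).
  by exists d; split=> // j Y e; apply: peq_trans; [exact: H'|exact: H].
elim: m t {v H} c hc G hG => [|m IH] t c hc G hG.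
  move=> {hG}; elim: n => [|n [d [hd H]]]; first by exists c; split=> // j Y e; exact: peq_refl.
  by apply: (RT_weak (v := fun j Y e => c j $ Y)); exists d.
apply: (RT_app (f := fun j Y e => apn m (c j) Y (fun i => G (S i) j Y e))).
- by apply: IH => // i hi; apply: hG; lia.
- by apply: hG; lia.
Qed.

Definition RF1 (f : forall j, wd (W j) N1 -> wd (W j) N0 -> wd (W j) N0) :=
  RF 1 (fun j Y e => f j Y (e 0)).
Definition RF2 (f : forall j, wd (W j) N1 -> wd (W j) N0 -> wd (W j) N0 -> wd (W j) N0) :=
  RF 2 (fun j Y e => f j Y (e 0) (e 1)).
Definition RF3 (f : forall j, wd (W j) N1 -> wd (W j) N0 -> wd (W j) N0 -> wd (W j) N0 -> wd (W j) N0) :=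
  RF 3 (fun j Y e => f j Y (e 0) (e 1) (e 2)).

Lemma RF_comp1 n f (F : val N0) : RF1 f -> RF n F -> RF n (fun j Y e => f j Y (F j Y e)).
Proof. by move=> hf hF; apply: (@RT_subst n 1 N0 _ (fun _ => F) hf). Qed.
Lemma RF_comp2 n f (F G : val N0) : RF2 f -> RF n F -> RF n G ->
  RF n (fun j Y e => f j Y (F j Y e) (G j Y e)).
Proof.
move=> hf hF hG; apply: (@RT_subst n 2 N0 _ (fun i => match i with 0 => F | _ => G end) hf).
by case.
Qed.
Lemma RF_comp3 n f (F G H : val N0) : RF3 f -> RF n F -> RF n G -> RF n H ->
  RF n (fun j Y e => f j Y (F j Y e) (G j Y e) (H j Y e)).
Proof.
move=> hf hF hG hH.
apply: (@RT_subst n 3 N0 _ (fun i => match i with 0 => F | 1 => G | _ => H end) hf).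
by case=> [|[]].
Qed.

Lemma RF_rec2 a f : RF1 a -> RF3 f -> exists g, RF2 g /\
  forall j Y z, g j Y z (w0 (W j)) = a j Y z /\
    forall x, g j Y z (wS (W j) $ x) = f j Y z x (g j Y z x).
Proof.
move=> ha hf.
(* The arguments are permuted because the recursor hands its step the previous value first and the
   counter second. *)
have [b [hb H]] : RF 3 (fun j Y e => f j Y (e 2) (e 0) (e 1)).
  by apply: (RF_comp3 hf); apply: RF_var; lia.
exists (fun j Y z x => wR (W j) $ x $ a j Y z $ apn 1 (t := N0 ~> N0 ~> N0) (b j) Y (fun _ => z)); split.
- apply: (RT_app (s := N0 ~> N0 ~> N0) (t := N0)).
    apply: (RT_app (s := N0)); last by apply: (RF_comp1 ha); apply: RF_var; lia.
    apply: (RT_app (s := N0)); last by apply: RF_var; lia.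
    by apply: RT_const; exact: (adm_R HK).
  apply: (@RT_subst 2 1 (N0 ~> N0 ~> N0) (fun j Y e => apn 1 (t := N0 ~> N0 ~> N0) (b j) Y e) (fun _ j Y e => e 0)).
    by exists b; split=> // j Y e; exact: peq_refl.
  by move=> i _; apply: RF_var; lia.
- move=> j Y z; split=> [|x]; first exact: wr_rec0.
  rewrite wr_recS //; exact: (H j Y (ncons x (ncons _ (fun _ => z)))).
Qed.

Lemma RF_succ n F : RF n F -> RF n (fun j Y e => wS (W j) $ F j Y e).
Proof. by apply: (RT_app (s := N0)); apply: RT_const; exact: (adm_S HK). Qed.
Lemma RF_zero n : RF n (fun j Y e => w0 (W j)).
Proof. by apply: RT_const; exact: (adm_0 HK). Qed.
Lemma RF_Y n F : RF n F -> RF n (fun j Y e => Y $ F j Y e).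
Proof. by apply: (RT_app (s := N0)); exact: RT_Y. Qed.
End Definable.

(** * Elementary arithmetic from quantifier-free induction *)

Section Raw.
Variable W : wstruc.
Hypothesis HW : iswr W.
Notation M := (wd W N0).
Notation "0" := (w0 W).
Notation Su x := (wS W $ x).
Implicit Types (y z : M) (e : nat -> M).

Notation WW := (fun _ : unit => W).
Notation all := (fun t (_ : elt WW t) => True).
Let HWW : forall j, iswr (WW j). Proof. by []. Qed.
Let HK : admissible all. Proof. by []. Qed.

Definition DT n t (v : (nat -> M) -> wd W t) := RT all n (fun _ _ e => v e).
Definition D n (F : (nat -> M) -> M) := DT n F.
Definition D1 (f : M -> M) := D 1 (fun e => f (e 0%nat)).
Definition D2 (f : M -> M -> M) := D 2 (fun e => f (e 0%nat) (e 1%nat)).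
Definition D3 (f : M -> M -> M -> M) := D 3 (fun e => f (e 0%nat) (e 1%nat) (e 2%nat)).

Lemma D_var n i : i < n -> D n (fun e => e i).
Proof. exact: (RF_var HWW HK). Qed.
Lemma DT_const n t (x : wd W t) : DT n (fun _ => x).
Proof. exact: (RT_const HWW HK). Qed.
Lemma D_const n x : D n (fun _ => x). Proof. exact: DT_const. Qed.
Lemma DT_app n s t (f : (nat -> M) -> wd W (s ~> t)) x : DT n f -> DT n x -> DT n (fun e => f e $ x e).
Proof. exact: (RT_app HWW HK). Qed.
Lemma D_fun n (f : wd W N1) F : D n F -> D n (fun e => f $ F e).
Proof. by apply: (DT_app (s := N0)); exact: DT_const. Qed.
Lemma DT_subst n m t (v : (nat -> M) -> wd W t) (G : nat -> (nat -> M) -> M) :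
  DT m v -> (forall i, i < m -> D n (G i)) -> DT n (fun e => v (fun i => G i e)).
Proof. by move=> h h'; exact: (RT_subst HWW HK (G := fun i _ _ e => G i e) h h'). Qed.
Lemma D_comp1 n f F : D1 f -> D n F -> D n (fun e => f (F e)).
Proof. exact: (RF_comp1 HWW HK (f := fun _ _ => f)). Qed.
Lemma D_comp2 n f F G : D2 f -> D n F -> D n G -> D n (fun e => f (F e) (G e)).
Proof. exact: (RF_comp2 HWW HK (f := fun _ _ => f)). Qed.
Lemma D_comp3 n f F G H : D3 f -> D n F -> D n G -> D n H -> D n (fun e => f (F e) (G e) (H e)).
Proof. exact: (RF_comp3 HWW HK (f := fun _ _ => f)). Qed.
Lemma D_rec2 a f : D1 a -> D3 f -> exists g, D2 g /\
  forall z, g z 0 = a z /\ forall x, g z (Su x) = f z x (g z x).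
Proof.
move=> ha hf; have [g [hg H]] := RF_rec2 HWW HK (a := fun _ _ => a) (f := fun _ _ => f) ha hf.
have [c [_ hc]] := hg; exists (fun z x => g tt (wS W) z x); split=> [|z]; last exact: H.
(* The slot for the argument of type 1 is filled with the successor function, an object of this type
   that every model has. *)
have [] : RF all 2 (fun _ _ e => c tt $ wS W $ e 1%nat $ e 0%nat).
  apply: (DT_app (s := N0) (t := N0)); last by apply: D_var; lia.
  by apply: (DT_app (s := N0)); [exact: DT_const|apply: D_var; lia].
move=> d [_ hd]; exists d; split=> // j Y e.
by rewrite -(hc tt (wS W) e); exact: hd.
Qed.

Lemma DT_apn n t (c : wd W (ar n t)) : DT n (fun e => apn n c (wS W) e).
Proof.
elim: n t c => [|n IH] t d; first exact: DT_const.
apply: (DT_app (s := N0) (f := fun e => apn n (t := N0 ~> t) d (wS W) (tl e))).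
  exact: (RT_weak HWW HK (IH _ d)).
by apply: D_var; lia.
Qed.
Lemma D_elem n t (v : (nat -> M) -> wd W t) : DT n v ->
  exists c : wd W (ar n t), forall e, peq (apn n c (wS W) e) (v e).
Proof. by move=> [c [_ h]]; exists (c tt); exact: h. Qed.

Lemma D1_elem f : D1 f -> exists c : wd W N1, forall x, c $ x = f x.
Proof.
move=> /D_elem [c h]; exists (c $ wS W) => x; exact: (h (fun _ => x)).
Qed.

(** The disjunction in the induction predicate is what [zero_or_S] and [mon_cases] rest on. Only
    after them can disjunction and equality be replaced by characteristic functions, which reduces
    further inductions to a single equation. *)
Lemma ind6 f1 f2 f3 f4 f5 f6 : D1 f1 -> D1 f2 -> D1 f3 -> D1 f4 -> D1 f5 -> D1 f6 ->
  let P x := (f1 x = f2 x \/ f3 x = f4 x) /\ f5 x = f6 x in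
  P 0 -> (forall x, P x -> P (Su x)) -> forall x, P x.
Proof.
move=> /D1_elem [c1 h1] /D1_elem [c2 h2] /D1_elem [c3 h3] /D1_elem [c4 h4] /D1_elem [c5 h5] /D1_elem [c6 h6] P.
have E : P = fun x => (c1 $ x = c2 $ x \/ c3 $ x = c4 $ x) /\ c5 $ x = c6 $ x.
  by apply: functional_extensionality => x; rewrite h1 h2 h3 h4 h5 h6.
by rewrite E; exact: (wr_ind HW).
Qed.

Lemma ieq f g : D1 f -> D1 g -> f 0 = g 0 -> (forall x, f x = g x -> f (Su x) = g (Su x)) ->
  forall x, f x = g x.
Proof.
move=> hf hg h0 hS x.
have [] := @ind6 f g f g f f hf hg hf hg hf hf _ _ x; last by case.
- by split=> //; left.
- by move=> y [h _]; split=> //; left; apply: hS; case: h.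
Qed.

Ltac dd := rewrite /D1 /D2 /D3; repeat first
  [ by (apply: D_var; lia) | apply: D_const | apply: D_fun
  | match goal with
    | h : D1 ?f |- D _ (fun e => ?f _) => apply: (D_comp1 h)
    | h : D2 ?f |- D _ (fun e => ?f _ _) => apply: (D_comp2 h)
    | h : D3 ?f |- D _ (fun e => ?f _ _ _) => apply: (D_comp3 h)
    end ].

Lemma pred_exists : exists p, D1 p /\ p 0 = 0 /\ forall x, p (Su x) = x.
Proof.
have [||g [hg H]] := @D_rec2 (fun _ => 0) (fun z x y => x); try by dd.
by exists (g 0); split; [dd|exact: H].
Qed.
Definition pred := the pred_exists.
Lemma pred_D : D1 pred. Proof. by have [] := theP pred_exists. Qed.
Lemma pred0 : pred 0 = 0. Proof. by have [_ []] := theP pred_exists. Qed.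
Lemma predS x : pred (Su x) = x. Proof. by have [_ []] := theP pred_exists. Qed.

Lemma mon_exists : exists p, D2 p /\ forall x, p x 0 = x /\ forall y, p x (Su y) = pred (p x y).
Proof. by have hp := pred_D; apply: (@D_rec2 (fun z => z) (fun z x y => pred y)); dd. Qed.
Definition mon := the mon_exists.
Lemma mon_D : D2 mon. Proof. by have [] := theP mon_exists. Qed.
Lemma mon0 x : mon x 0 = x. Proof. by have [_ /(_ x) []] := theP mon_exists. Qed.
Lemma monS x y : mon x (Su y) = pred (mon x y). Proof. by have [_ /(_ x) []] := theP mon_exists. Qed.

(** [ad'] and [ml'] copy the terms [wplus] and [wtimes], so that the arithmetical vocabulary denotes
    them by conversion. *)
Definition stepS : wd W (N0 ~> N0 ~> N0) := wSg W N0 N0 (N0 ~> N0) $ (wK W (N0 ~> N0 ~> N0) N0 $ wK W N0 N0) $ wS W.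
Definition ad' x y : M := wR W $ y $ x $ stepS.

Lemma comp_weak (f : wd W N1) x y :
  wSg W N0 N0 (N0 ~> N0) $ (wK W (N0 ~> N0 ~> N0) N0 $ wK W N0 N0) $ f $ x $ y = f $ x.
Proof.
have h1 := wr_Sg HW (wK W (N0 ~> N0 ~> N0) N0 $ wK W N0 N0) f x y.
have h2 := wr_K HW (wK W N0 N0) x (f $ x) y.
have h3 := wr_K HW (f $ x) y.
exact: (Logic.eq_trans h1 (Logic.eq_trans h2 h3)).
Qed.

Lemma ad'_D : D2 ad'.
Proof.
apply: (DT_app (s := N0 ~> N0 ~> N0) (t := N0)); last exact: DT_const.
apply: (DT_app (s := N0)); last by dd.
by apply: (DT_app (s := N0)); [exact: DT_const|dd].
Qed.
Lemma ad'0 x : ad' x 0 = x. Proof. exact: (wr_rec0 HW). Qed.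
Lemma ad'S x y : ad' x (Su y) = Su (ad' x y).
Proof. by rewrite /ad' (wr_recS HW) comp_weak. Qed.

Definition stepM x : wd W N1 := wSg W N0 (N0 ~> N0 ~> N0) N0 $ (wR W $ x) $ (wK W (N0 ~> N0 ~> N0) N0 $ stepS).
Definition ml' x y : M := wR W $ y $ 0 $ (wSg W N0 N0 (N0 ~> N0) $ (wK W (N0 ~> N0 ~> N0) N0 $ wK W N0 N0) $ stepM x).
Lemma ml'0 x : ml' x 0 = 0. Proof. exact: (wr_rec0 HW). Qed.
Lemma ml'S x y : ml' x (Su y) = ad' (ml' x y) x.
Proof.
rewrite /ml' (wr_recS HW) comp_weak -/(ml' x y) /stepM.
have h1 := wr_Sg HW (wR W $ x) (wK W (N0 ~> N0 ~> N0) N0 $ stepS) (ml' x y).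
have h2 := wr_ext HW (wR W $ x $ ml' x y) (wr_K HW stepS (ml' x y)).
exact: (Logic.eq_trans h1 h2).
Qed.

Let hpred := pred_D.
Let hmon := mon_D.
Let had := ad'_D.

Lemma zero_or_S x : x = 0 \/ exists y, x = Su y.
Proof.
have [] := @ind6 (fun x => x) (fun _ => 0) (fun x => x) (fun x => Su (pred x)) (fun x => x) (fun x => x) _ _ _ _ _ _ _ _ x; try by dd.
- by split=> //; left.
- by move=> y _; split=> //; right; rewrite predS.
- by case=> [->|->] _; [left|right; exists (pred x)].
Qed.

Lemma monSS x y : mon (Su x) (Su y) = mon x y.
Proof.
move: y; apply: ieq; try by dd.
- by rewrite monS !mon0 predS.
- by move=> y h; rewrite monS h monS.
Qed.
Lemma monxx x : mon x x = 0.
Proof.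
move: x; apply: ieq; try by dd.
- by rewrite mon0.
- by move=> x h; rewrite monSS.
Qed.
Lemma monSx x : mon (Su x) x = Su 0.
Proof.
move: x; apply: ieq; try by dd.
- by rewrite mon0.
- by move=> x h; rewrite monSS.
Qed.
Lemma mon0x x : mon 0 x = 0.
Proof.
move: x; apply: ieq; try by dd.
- by rewrite mon0.
- by move=> x h; rewrite monS h pred0.
Qed.
Lemma ad'Sn x y : ad' (Su x) y = Su (ad' x y).
Proof.
move: y; apply: ieq; try by dd.
- by rewrite !ad'0.
- by move=> y h; rewrite !ad'S h.
Qed.
Lemma ad'0n y : ad' 0 y = y.
Proof.
move: y; apply: ieq; try by dd.
- by rewrite ad'0.
- by move=> y h; rewrite ad'S h.
Qed.
Lemma mon_ad y w : mon (ad' y w) y = w.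
Proof.
move: y; apply: ieq; try by dd.
- by rewrite ad'0n mon0.
- by move=> y h; rewrite ad'Sn monSS.
Qed.
Lemma mon_le x z : mon x (ad' x z) = 0.
Proof.
move: x; apply: ieq; try by dd.
- by rewrite mon0x.
- by move=> x h; rewrite ad'Sn monSS.
Qed.
Lemma mon_cases x y : ad' x (mon y x) = y \/ ad' y (mon x y) = x.
Proof.
have [] := @ind6 (fun x => ad' x (mon y x)) (fun _ => y) (fun x => ad' y (mon x y)) (fun x => x) (fun x => x) (fun x => x) _ _ _ _ _ _ _ _ x; try by dd.
- by split=> //; left; rewrite mon0 ad'0n.
- move=> {}x [h _]; split=> //; case: h => h; last first.
    right; have {1}-> : Su x = ad' y (Su (mon x y)) by rewrite ad'S h.
    by rewrite mon_ad ad'S h.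
  case: (zero_or_S (mon y x)) => [e|[w e]]; rewrite e ?ad'0 in h.
    by right; rewrite h monSx ad'S ad'0.
  by left; rewrite monS e predS ad'Sn -ad'S.
Qed.

Lemma S_neq0 x : Su x <> 0. Proof. exact: (wr_succ0 HW). Qed.

Definition DP n (P : (nat -> M) -> Prop) := exists F, D n F /\ forall e, P e <-> F e = 0.

Lemma DP_ext n P Q : (forall e, P e <-> Q e) -> DP n Q -> DP n P.
Proof. by move=> h [F [hF H]]; exists F; split=> // e; rewrite h. Qed.
Lemma DP_comp n m P (G : nat -> (nat -> M) -> M) : DP m P -> (forall i, i < m -> D n (G i)) ->
  DP n (fun e => P (fun i => G i e)).
Proof. by move=> [F [hF H]] hG; exists (fun e => F (fun i => G i e)); split=> [|e]; [exact: (DT_subst hF hG)|exact: H]. Qed.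

Lemma and_exists : exists g, D2 g /\ forall x y, g x y = 0 <-> x = 0 /\ y = 0.
Proof.
have [||g [hg H]] := @D_rec2 (fun z => z) (fun z x y => Su 0); try by dd.
exists g; split=> // x y; have [h0 hS] := H x.
case: (zero_or_S y) => [->|[w ->]]; first by rewrite h0; split=> [h|[h _]].
by rewrite hS; split=> [/S_neq0|[_ /S_neq0]].
Qed.
Lemma or_exists : exists g, D2 g /\ forall x y, g x y = 0 <-> x = 0 \/ y = 0.
Proof.
have [||g [hg H]] := @D_rec2 (fun z => 0) (fun z x y => z); try by dd.
exists g; split=> // x y; have [h0 hS] := H x.
case: (zero_or_S y) => [->|[w ->]]; first by rewrite h0; split=> // _; right.
by rewrite hS; split=> [|[//|/S_neq0]] //; left.
Qed.
Lemma not_exists : exists g, D1 g /\ forall y, g y = 0 <-> y <> 0.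
Proof.
have [||g [hg H]] := @D_rec2 (fun z => Su 0) (fun z x y => 0); try by dd.
exists (g 0); split=> [|y]; first by dd.
have [h0 hS] := H 0; case: (zero_or_S y) => [->|[w ->]].
  by rewrite h0; split=> [/S_neq0|].
by rewrite hS; split=> // _ /S_neq0.
Qed.

Lemma DP_and n P Q : DP n P -> DP n Q -> DP n (fun e => P e /\ Q e).
Proof.
move=> [F [hF H]] [G [hG H']]; have [g [hg Hg]] := and_exists.
by exists (fun e => g (F e) (G e)); split=> [|e]; [dd|rewrite Hg H H'].
Qed.
Lemma DP_or n P Q : DP n P -> DP n Q -> DP n (fun e => P e \/ Q e).
Proof.
move=> [F [hF H]] [G [hG H']]; have [g [hg Hg]] := or_exists.
by exists (fun e => g (F e) (G e)); split=> [|e]; [dd|rewrite Hg H H'].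
Qed.
Lemma DP_not n P : DP n P -> DP n (fun e => ~ P e).
Proof.
move=> [F [hF H]]; have [g [hg Hg]] := not_exists.
by exists (fun e => g (F e)); split=> [|e]; [dd|rewrite Hg H].
Qed.
Lemma DP_imp n P Q : DP n P -> DP n Q -> DP n (fun e => P e -> Q e).
Proof.
move=> hP hQ; apply: DP_ext (DP_or (DP_not hP) hQ) => e; split; last by case.
by move=> H; case: (classic (P e)) => hp; [right; apply: H|left].
Qed.
Lemma DP_eq n F G : D n F -> D n G -> DP n (fun e => F e = G e).
Proof.
move=> hF hG; have [g [hg Hg]] := and_exists.
exists (fun e => g (mon (F e) (G e)) (mon (G e) (F e))); split=> [|e]; first by dd.
rewrite Hg; split=> [->|[h h']]; first by rewrite monxx.
by have := mon_cases (F e) (G e); rewrite h h' !ad'0; case.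
Qed.

Definition lt' x y := exists z, ad' x (Su z) = y.
Lemma lt'E x y : lt' x y <-> mon (Su x) y = 0.
Proof.
split=> [[z <-]|h]; first by rewrite ad'S -ad'Sn mon_le.
have := mon_cases (Su x) y; rewrite h ad'0 => -[e|->].
- by exists (mon y (Su x)); rewrite ad'S -ad'Sn.
- by exists 0; rewrite ad'S ad'0.
Qed.
Lemma DP_lt n F G : D n F -> D n G -> DP n (fun e => lt' (F e) (G e)).
Proof. by move=> hF hG; exists (fun e => mon (Su (F e)) (G e)); split=> [|e]; [dd|exact: lt'E]. Qed.

Lemma lt'0 x : ~ lt' x 0. Proof. by case=> z; rewrite ad'S; exact: S_neq0. Qed.
Lemma lt'S x y : lt' x (Su y) <-> lt' x y \/ x = y.
Proof.
split=> [[z]|[[z <-]|<-]]; last by exists 0; rewrite ad'S ad'0.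
- rewrite ad'S => /(wr_succI HW); case: (zero_or_S z) => [->|[w ->]] <-; first by rewrite ad'0; right.
  by left; exists w.
- by exists (Su z); rewrite ad'S.
Qed.
Lemma lt'_cases x y : lt' x y \/ x = y \/ lt' y x.
Proof.
case: (mon_cases x y) => h.
- case: (zero_or_S (mon y x)) => [e|[w e]]; rewrite e ?ad'0 in h; first by right; left.
  by left; exists w.
- case: (zero_or_S (mon x y)) => [e|[w e]]; rewrite e ?ad'0 in h; first by right; left.
  by right; right; exists w.
Qed.

Lemma lt'_irr x : ~ lt' x x.
Proof. by move/lt'E; rewrite monSx => /S_neq0. Qed.
Lemma lt'_trans x y z : lt' x y -> lt' y z -> lt' x z.
Proof.
have adA : forall u v w, ad' (ad' u v) w = ad' u (ad' v w).
  move=> u v; apply: ieq; try by dd.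
  - by rewrite !ad'0.
  - by move=> w h; rewrite !ad'S h.
by move=> [a <-] [b <-]; exists (ad' a (Su b)); rewrite adA ad'Sn.
Qed.

Lemma dind (P : M -> Prop) : DP 1 (fun e => P (e 0%nat)) -> P 0 -> (forall x, P x -> P (Su x)) -> forall x, P x.
Proof.
move=> [F [hF H]].
have hf : D1 (fun x => F (fun _ => x)).
  by apply: (DT_subst (m := 1) (t := N0) (G := fun _ e => e 0%nat) hF) => i _; apply: D_var; lia.
have E x : P x <-> F (fun _ => x) = 0 := H (fun _ => x).
move=> h0 hS x; apply/E; move: x; apply: ieq; try by dd.
- exact/E.
- by move=> x /E h; apply/E; exact: hS.
Qed.

(** A bounded quantifier is a recursion along its bound with [g] as disjunction: the running value
    is 0 once a witness has been passed. Thus bounded formulas have characteristic functions in the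
    model. *)
Lemma DP_bex n (P : (nat -> M) -> Prop) B : DP (S n) P -> D n B ->
  DP n (fun e => exists x, lt' x (B e) /\ P (ncons x e)).
Proof.
move=> [F [hF H]] hB; have [g [hg Hg]] := or_exists.
have [c Hc] : exists c : wd W (ar n (N0 ~> N0 ~> N0)),
    forall e x y, apn n c (wS W) e $ y $ x = g y (F (ncons x e)).
  have h : D (S (S n)) (fun e => F (ncons (e 0%nat) (tl (tl e)))).
    apply: (DT_subst (G := fun i e => ncons (e 0%nat) (tl (tl e)) i) hF).
    by case=> [|i] hi; apply: D_var; lia.
  have h' : D (S (S n)) (fun e => g (e 1%nat) (F (ncons (e 0%nat) (tl (tl e))))) by dd.
  have [c Hc] := D_elem h'; exists c => e x y; exact: (Hc (ncons x (ncons y e))).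
pose G e k : M := wR W $ k $ Su 0 $ apn n c (wS W) e.
have G0 e : G e 0 = Su 0 := wr_rec0 HW _ _.
have GS e k : G e (Su k) = g (G e k) (F (ncons k e)) by rewrite -Hc; exact: (wr_recS HW).
exists (fun e => G e (B e)); split.
  apply: (DT_app (s := N0 ~> N0 ~> N0) (t := N0)); last exact: DT_apn.
  apply: (DT_app (s := N0)); last exact: DT_const.
  by apply: (DT_app (s := N0)); [exact: DT_const|].
move=> e.
have hG : D1 (G e).
  apply: (DT_app (s := N0 ~> N0 ~> N0) (t := N0)); last exact: DT_const.
  apply: (DT_app (s := N0)); last exact: DT_const.
  by apply: (DT_app (s := N0)); [exact: DT_const|apply: D_var; lia].
have [f hf] : exists f : wd W N1, forall x, f $ x = F (ncons x e).
  have [d Hd] := D_elem hF; exists (apn n (t := N1) d (wS W) e) => x; exact: (Hd (ncons x e)).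
have HP x : P (ncons x e) <-> f $ x = 0 by rewrite hf; exact: H.
have E : (exists x, lt' x (B e) /\ P (ncons x e)) <-> exists x, lt' x (B e) /\ f $ x = 0.
  by split=> -[x [h1 h2]]; exists x; split=> //; apply/HP.
rewrite E; move: (B e) => b {E}; split.
- move=> [a [hab ha]].
  suff K : forall k, lt' a k -> G e k = 0 by exact: K.
  apply: dind; first by apply: DP_imp; [apply: DP_lt|apply: DP_eq]; dd.
  + by move=> /lt'0.
  + move=> k IH /lt'S h; rewrite GS; apply/Hg; case: h => [h|h]; first by left; exact: IH.
    by right; rewrite -hf -h.
- move=> hb; apply: NNPP => N.
  suff K : forall k, lt' b k \/ G e k <> 0.
    by case: (K b) => // h; case: (lt'_irr h).
  apply: dind; first by apply: DP_or; [apply: DP_lt|apply/DP_not/DP_eq]; dd.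
  + by right; rewrite G0; exact: S_neq0.
  + move=> k IH; case: (lt'_cases k b) => h; last first.
      by left; apply/lt'S; case: h => [->|h]; [right|left].
    right; rewrite GS => /Hg [h'|h'].
      by case: IH => // h2; case: (lt'_irr (lt'_trans h h2)).
    by apply: N; exists k; rewrite hf.
Qed.
End Raw.

Definition wstruc_struc (W : wstruc) : struc := {|
  sd s := match s with Num => wd W N0 | Set2 => wd W N1 end;
  zr := w0 W : wd W N0;
  on := (wS W $ w0 W) : wd W N0;
  ad := @ad' W;
  ml := @ml' W;
  ltt := @lt' W;
  inn x X := X $ x = w0 W -> False |}.

(** * The type 1 objects as the sets of a model of RCA_0 *)

Section SecondOrderPart.
Variable W : wstruc.
Hypothesis HW : iswr W.
Notation A := (wstruc_struc W).
Notation M := (wd W N0).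
Notation "0" := (w0 W).
Notation Su x := (wS W $ x).
Implicit Types (e r : nat -> M) (E : nat -> wd W N1).

Lemma ml'_D : D2 (@ml' W).
Proof.
have cc n s (x : wd W s) := DT_const HW n x.
apply: (DT_app HW (s := N0 ~> N0 ~> N0) (t := N0)).
  by apply: (DT_app HW (s := N0)); [apply: (DT_app HW (s := N0)); [|apply: (D_var HW); lia]|].
apply: (DT_app HW (s := N1)); first exact: cc.
apply: (DT_app HW (s := N0 ~> N0 ~> N0 ~> N0)); last exact: cc.
apply: (DT_app HW (s := N0 ~> (N0 ~> N0 ~> N0) ~> N0)); first exact: cc.
by apply: (DT_app HW (s := N0)) => //; apply: (D_var HW); lia.
Qed.

Definition prefix n e r (i : nat) : M := if Nat.ltb i n then e i else r (i - n)%nat.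
Lemma prefix_ncons n e r x : ncons x (prefix n e r) = prefix (S n) (ncons x e) r.
Proof. by apply: functional_extensionality => -[|i]. Qed.

Definition okv n (s : sort2) : ((nat -> M) -> sd A s) -> Prop :=
  match s with
  | Num => fun v => D n v
  | Set2 => fun v => exists X, forall e, v e = X
  end.
Fixpoint okl n (l : list sort2) : ((nat -> M) -> hl (sd A) l) -> Prop :=
  match l with
  | [] => fun _ => True
  | s :: l => fun v => okv n (fun e => (v e).1) /\ okl n (fun e => (v e).2)
  end.

Lemma eval_D_mut n r E :
  (forall s (t : @term L2 s), @okv n s (fun e => eval (mkenv (A := A) (prefix n e r) E) t)) /\
  (forall l (a : @args L2 l), @okl n l (fun e => evals (mkenv (A := A) (prefix n e r) E) a)).
Proof.
apply: (@term_args_ind L2 (fun s t => @okv n s (fun e => eval (mkenv (A := A) (prefix n e r) E) t))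
  (fun l a => @okl n l (fun e => evals (mkenv (A := A) (prefix n e r) E) a))) => //=.
- case=> i /=; last by exists (E i).
  rewrite /prefix; case h: (Nat.ltb i n); last exact: (D_const HW).
  by apply: (D_var HW); exact/Nat.ltb_lt.
- case=> a /=.
  + by move=> _; exact: (D_const HW).
  + by move=> _; exact: (D_const HW).
  + by move=> [h1 [h2 _]]; exact: (D_comp2 HW (ad'_D HW) h1 h2).
  + by move=> [h1 [h2 _]]; exact: (D_comp2 HW ml'_D h1 h2).
Qed.

Lemma DP_ball n (P : (nat -> M) -> Prop) B : DP (S n) P -> D n B ->
  DP n (fun e => forall x, lt' x (B e) -> P (ncons x e)).
Proof.
move=> hP hB; apply: DP_ext (DP_not HW (DP_bex HW (DP_not HW hP) hB)) => e.
split=> [h [x [h1 h2]]|h x h1]; first by apply: h2; exact: h.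
by apply: NNPP => h2; apply: h; exists x.
Qed.

Lemma bounded_DP B : bounded B -> forall n r E,
  DP n (fun e => sat (mkenv (A := A) (prefix n e r) E) B).
Proof.
have bnd : forall (x : M) e n r E (t : nterm),
    eval (numcons (A := A) x (mkenv (A := A) (prefix n e r) E)) (tsubst shift_num t) =
    eval (mkenv (A := A) (prefix n e r) E) t.
  by move=> x e n r E t; rewrite /shift_num eval_shift.
have pre : forall (x : M) e n r E, mkenv (A := A) (prefix (S n) (ncons x e) r) E =
    numcons (A := A) x (mkenv (A := A) (prefix n e r) E).
  by move=> x e n r E; rewrite numcons_mkenv prefix_ncons.
elim=> {B} [k a|||||t B hB IB|t B hB IB].
- move=> n r E; have h := proj2 (eval_D_mut n r E) _ a.
  case: k a h => a [h1 [h2 _]].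
  + exact: (DP_eq HW h1 h2).
  + exact: (DP_lt HW h1 h2).
  + case: h2 => X hX.
    have := DP_not HW (DP_eq HW (D_fun HW X h1) (D_const HW n 0)).
    by apply: DP_ext => e; rewrite -(hX e).
- move=> n r E; have := DP_not HW (DP_eq HW (D_const HW n 0) (D_const HW n 0)).
  by apply: DP_ext => e; split=> // h; apply: h.
- by move=> B C _ IB _ IC n r E; exact: (DP_imp HW (IB n r E) (IC n r E)).
- by move=> B C _ IB _ IC n r E; exact: (DP_and HW (IB n r E) (IC n r E)).
- by move=> B C _ IB _ IC n r E; exact: (DP_or HW (IB n r E) (IC n r E)).
- move=> n r E; have ht := proj1 (eval_D_mut n r E) _ t.
  apply: DP_ext (DP_ball (IB (S n) r E) ht) => e /=.
  by split=> h x; have := h x; rewrite bnd pre.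
- move=> n r E; have ht := proj1 (eval_D_mut n r E) _ t.
  apply: DP_ext (DP_bex HW (IB (S n) r E) ht) => e /=.
  by split=> -[x h]; exists x; move: h; rewrite bnd pre.
Qed.

(** QF-AC chooses numbers for functions, so the pair of numbers is presented as a function, and the
    choice functional is composed with this presentation. *)
Lemma choice2 (R : M -> M -> M -> Prop) : DP 3 (fun e => R (e 2%nat) (e 1%nat) (e 0%nat)) ->
  (forall x y, exists z, R x y z) -> exists h, D2 h /\ forall x y, R x y (h x y).
Proof.
move=> [F [hF H]] hR; have [c Hc] := D_elem hF.
pose c' : wd W (N0 ~> N0 ~> N0 ~> N0) := c $ wS W.
have E : forall x y z, c' $ x $ y $ z = 0 <-> R x y z.
  move=> x y z; pose e := ncons z (ncons y (fun _ => x)).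
  by rewrite -[R _ _ _]/(R (e 2%nat) (e 1%nat) (e 0%nat)) H -(Hc e).
have [|Phi hPhi] := wr_ac HW (c := c').
  by move=> f; have [z hz] := hR (f $ 0) (f $ Su 0); exists z; exact/E.
(* [k => R k x (\ a b. y)] takes the values [x] at 0 and [y] at 1. *)
have [d Hd] : exists d : wd W (ar 2 N1), forall x y k,
    apn 2 d (wS W) (ncons y (fun _ => x)) $ k = wR W $ k $ x $ (wK W N1 N0 $ (wK W N0 N0 $ y)).
  have [|d Hd] := @D_elem W 3 N0
    (fun e => wR W $ e 0%nat $ e 2%nat $ (wK W N1 N0 $ (wK W N0 N0 $ e 1%nat))).
    apply: (DT_app HW (s := N0 ~> N0 ~> N0) (t := N0)).
      apply: (DT_app HW (s := N0)); last by apply: (D_var HW); lia.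
      apply: (DT_app HW (s := N0)); first exact: (DT_const HW).
      by apply: (D_var HW); lia.
    apply: (DT_app HW); first exact: (DT_const HW).
    apply: (DT_app HW (s := N0)); first exact: (DT_const HW).
    by apply: (D_var HW); lia.
  by exists d => x y k; exact: (Hd (ncons k (ncons y (fun _ => x)))).
exists (fun x y => Phi $ apn 2 (t := N1) d (wS W) (ncons y (fun _ => x))); split.
- apply: (DT_app HW (s := N1) (t := N0)); first exact: (DT_const HW).
  apply: (@DT_subst W HW 2 2 N1 (fun e => apn 2 d (wS W) e)
    (fun i e => match i with O => e 1%nat | _ => e 0%nat end)); first exact: (DT_apn HW).
  by case=> [|i] _; apply: (D_var HW); lia.
- move=> x y; apply/E; have := hPhi (apn 2 (t := N1) d (wS W) (ncons y (fun _ => x))).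
  rewrite !Hd (wr_rec0 HW) (wr_recS HW).
  have h1 := wr_K HW (wK W N0 N0 $ y) (wR W $ 0 $ x $ (wK W N1 N0 $ (wK W N0 N0 $ y))) 0.
  have h2 := wr_K HW y 0.
  by rewrite (Logic.eq_trans h1 h2).
Qed.

Lemma choice1 (R : M -> M -> Prop) : DP 2 (fun e => R (e 1%nat) (e 0%nat)) ->
  (forall x, exists z, R x z) -> exists h, D1 h /\ forall x, R x (h x).
Proof.
move=> hR H; have [|h [hh Hh]] := @choice2 (fun x y z => R x z) _ (fun x _ => H x).
  apply: (@DP_comp W HW 3 2 _ (fun i e => match i with O => e 0%nat | _ => e 2%nat end) hR).
  by case=> [|i] _; apply: (D_var HW); lia.
exists (fun x => h x x); split=> [|x]; last exact: Hh.
by apply: (D_comp2 HW hh); apply: (D_var HW); lia.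
Qed.

Lemma sat2 r E B x y : sat (numcons (A := A) y (numcons (A := A) x (mkenv (A := A) r E))) B <->
  sat (mkenv (A := A) (prefix 2 (ncons y (fun _ => x)) r) E) B.
Proof.
rewrite !numcons_mkenv; suff -> : ncons y (ncons x r) = prefix 2 (ncons y (fun _ => x)) r by [].
by apply: functional_extensionality => -[|[|i]] //=; rewrite /prefix /= Nat.sub_0_r.
Qed.

Lemma DP2_bounded B r E : bounded B ->
  DP 2 (fun e => sat (numcons (A := A) (e 0%nat) (numcons (A := A) (e 1%nat) (mkenv (A := A) r E))) B).
Proof.
move=> /bounded_DP /(_ 2 r E); apply: DP_ext => e; rewrite sat2.
suff -> : prefix 2 (ncons (e 0%nat) (fun _ => e 1%nat)) r = prefix 2 e r by [].
by apply: functional_extensionality => -[|[|i]].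
Qed.

Theorem wstruc_isrca : isrca A.
Proof.
have env_mkenv : forall r : env (struc_interp A), r = mkenv (A := A) (r Num) (r Set2).
  by move=> r; apply: env_ext => -[].
have adS x : ad' x (Su 0) = Su x by rewrite (ad'S HW) (ad'0 HW).
constructor.
- by exists (wS W).
- by move=> x /=; rewrite adS; exact: (S_neq0 HW).
- by move=> x y /=; rewrite !adS; exact: (wr_succI HW).
- exact: (ad'0 HW).
- by move=> x y /=; rewrite !adS; exact: (ad'S HW).
- exact: (ml'0 HW).
- by move=> x y /=; rewrite !adS; exact: (ml'S HW).
- exact: (lt'0 HW).
- by move=> x y /=; rewrite adS; exact: (lt'S HW).
- move=> B hB r; rewrite (env_mkenv r); move: (r Num) (r Set2) => {}r E [y0 h0] hS.
  have hP := DP2_bounded r E hB.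
  (* [R] says that if [y] is a witness at x then [z] is one at x + 1. Choice turns it into a step
     function; iterating this from [y0] gives a witness function, and what remains is induction for
     a decidable predicate. *)
  pose R (x y z : M) := sat (numcons (A := A) y (numcons (A := A) x (mkenv (A := A) r E))) B ->
    sat (numcons (A := A) z (numcons (A := A) (Su x) (mkenv (A := A) r E))) B.
  have [||h [hh Hh]] := @choice2 R.
  + apply: (DP_imp HW).
      apply: (@DP_comp W HW 3 2 _ (fun i e => match i with O => e 1%nat | _ => e 2%nat end) hP).
      by case=> [|i] _; apply: (D_var HW); lia.
    apply: (@DP_comp W HW 3 2 _ (fun i e => match i with O => e 0%nat | _ => Su (e 2%nat) end) hP).
    by case=> [|i] _; [|apply: (D_fun HW)]; apply: (D_var HW); lia.
  + move=> x y; rewrite /R; case: (classic (sat (numcons (A := A) y (numcons (A := A) x (mkenv (A := A) r E))) B)) => h.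
      have [|z] := hS x; first by exists y.
      by rewrite /= adS => hz; exists z.
    by exists y.
  have [||g [hg Hg]] := @D_rec2 W HW (fun _ => y0) (fun _ x y => h x y).
  + exact: (D_const HW).
  + by apply: (D_comp2 HW hh); apply: (D_var HW); lia.
  have [g0 gS] := Hg 0.
  suff K : forall x, sat (numcons (A := A) (g 0 x) (numcons (A := A) x (mkenv (A := A) r E))) B.
    by move=> x; exists (g 0 x).
  apply: (dind HW).
  + apply: (@DP_comp W HW 1 2 _ (fun i e => match i with O => g 0 (e 0%nat) | _ => e 0%nat end) hP).
    case=> [|i] _; last by apply: (D_var HW); lia.
    by apply: (D_comp2 HW hg); [exact: (D_const HW)|apply: (D_var HW); lia].
  + by rewrite g0.
  + by move=> x IH; rewrite gS; exact: Hh.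
- move=> B C hB hC r; rewrite (env_mkenv r); move: (r Num) (r Set2) => {}r E H.
  have hP := DP2_bounded r E hB; have hQ := DP2_bounded r E hC.
  (* For each x some number confirms the Sigma-1 form or refutes the Pi-1 form; after one is chosen,
     checking the Sigma-1 form at it decides membership. *)
  have [||h [hh Hh]] := @choice1 (fun x y => sat (numcons (A := A) y (numcons (A := A) x (mkenv (A := A) r E))) B \/
    ~ sat (numcons (A := A) y (numcons (A := A) x (mkenv (A := A) r E))) C).
  + by apply: (DP_or HW hP); exact: (DP_not HW).
  + move=> x; case: (classic (exists y, sat (numcons (A := A) y (numcons (A := A) x (mkenv (A := A) r E))) B)).
      by move=> [y hy]; exists y; left.
    move=> N; apply: NNPP => N'; apply/N/H => y; apply: NNPP => hy; apply: N'.
    by exists y; right.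
  have [F [hF HF]] : DP 1 (fun e => ~ sat (numcons (A := A) (h (e 0%nat)) (numcons (A := A) (e 0%nat) (mkenv (A := A) r E))) B).
    apply: (DP_not HW).
    apply: (@DP_comp W HW 1 2 _ (fun i e => match i with O => h (e 0%nat) | _ => e 0%nat end) hP).
    by case=> [|i] _; [apply: (D_comp1 HW hh)|]; apply: (D_var HW); lia.
  have [Z HZ] := @D_elem W 1 N0 F hF.
  exists (Z $ wS W) => x.
  have e : Z $ wS W $ x = F (fun _ => x) := HZ (fun _ => x).
  rewrite /= e -(HF (fun _ => x)); split=> [/NNPP h1|hx h1]; first by exists (h x).
  case: (Hh x) => // h2; apply: h2; exact: (proj1 (H x) hx).
Qed.
End SecondOrderPart.

(** * The functionals as closed terms *)

(** Sigma-1 formulas take sets and not functions as parameters, so the graph of [f] is made into a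
    set of pairs. The components of a pair do not exceed it, which bounds the search for them. *)
Lemma wfun_Sf (W : wstruc) (HW : iswr W) (f : wd W N1) : Sf1 (A := wstruc_struc W) (fun x => f $ x).
Proof.
pose A := wstruc_struc W; have HA : isrca A := wstruc_isrca HW.
have [Z HZ] : exists Z : sd A Set2, forall n : sd A Num, inn n Z <->
    exists x, lt' x (wS W $ n) /\ exists y, lt' y (wS W $ n) /\ (n = spair (A := A) x y /\ f $ x = y).
  have [F [hF HF]] : DP 1 (fun e => ~ exists x, lt' x (wS W $ e 0) /\
      exists y, lt' y (wS W $ e 0) /\ (e 0 = spair (A := A) x y /\ f $ x = y)).
    have v n i : i < n -> D n (fun e => e i) := @D_var W HW n i.
    have s n i : i < n -> D n (fun e => wS W $ e i) by move=> h; exact: (D_fun HW _ (v n i h)).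
    have ha n F G (h : D n F) (h' : D n G) : D n (fun e => ad' (F e) (G e)) := D_comp2 HW (ad'_D HW) h h'.
    have hm n F G (h : D n F) (h' : D n G) : D n (fun e => ml' (F e) (G e)) := D_comp2 HW (ml'_D HW) h h'.
    apply: (DP_not HW).
    apply: (@DP_bex W HW 1 (fun e => exists y, lt' y (wS W $ e 1) /\ (e 1 = spair (A := A) (e 0) y /\ f $ e 0 = y))); last by apply: (s); lia.
    apply: (@DP_bex W HW 2 (fun e => e 2 = spair (A := A) (e 1) (e 0) /\ f $ e 1 = e 0)); last by apply: (s); lia.
    apply: (DP_and HW); apply: (DP_eq HW).
    + by apply: (v); lia.
    + by rewrite /spair /=; apply: (ha); [apply: (hm); apply: (ha)|]; apply: (v); lia.
    + by apply: (D_fun HW); apply: (v); lia.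
    + by apply: (v); lia.
  have [Z HZ] := @D_elem W 1 N0 F hF.
  exists (Z $ wS W) => n.
  have e : Z $ wS W $ n = F (fun _ => n) := HZ (fun _ => n).
  by rewrite /= e -(HF (fun _ => n)); split=> [/NNPP|h h'] //; exact: h'.
have HP : forall x y : wd W N0, inn (spair (A := A) x y) Z <-> y = f $ x.
  have adS x : @ad A x (on A) = wS W $ x by rewrite /= (ad'S HW) (ad'0 HW).
  move=> x y; rewrite HZ -(adS (spair (A := A) x y)); split=> [[x' [_ [y' [_ [/(pair_inj HA) [<- <-] ->]]]]]|->] //.
  exists x; split; first exact: (fst_le_pair HA).
  by exists (f $ x); split=> //; exact: (snd_le_pair HA).
apply: (@Sg_ext _ _ (fun e => inn (spair (e 1) (e 0)) Z)); first by move=> e; rewrite HP.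
by sg.
Qed.

(** * Primitive recursive functions represented uniformly in all models *)

Section ClosedTerms.
Variables (J : Type) (W : J -> wstruc).
Hypothesis HW : forall j, iswr (W j).
Variable adm : forall t, elt W t -> Prop.
Hypothesis HK : admissible adm.
Notation A j := (wstruc_struc (W j)).
Notation HA j := (wstruc_isrca (HW j)).
Notation RF := (RF adm).
Notation RF1 := (RF1 adm).
Notation RF2 := (RF2 adm).
Notation RF3 := (RF3 adm).
Notation num j := (sd (A j) Num).
Notation val := (forall j : J, wd (W j) N1 -> (nat -> wd (W j) N0) -> wd (W j) N0).

(** Functions of a model obtained by choice are identified with values of the recursor through their
    recursion equations. Uniqueness is a Sigma-1 induction, so both functions need Sigma-1
    graphs. *)
Lemma prim_rec_RF a f (g : forall j, wd (W j) N1 -> num j -> num j -> num j) :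
  RF1 a -> RF3 f -> (forall j Y z, Sf1 (A := A j) (g j Y z)) ->
  (forall j Y z, g j Y z (zr (A j)) = a j Y z) ->
  (forall j Y z x, g j Y z (ad x (on (A j))) = f j Y z x (g j Y z x)) -> RF2 g.
Proof.
move=> ha hf hg h0 hS; have [g' [hg' H]] := RF_rec2 HW HK ha hf.
have K : forall j Y z (x : num j), g j Y z x = g' j Y z x; last first.
  by have := hg'; apply: RF_ext => j Y e; exact: K.
move=> j Y z.
have [c [_ Hc]] : RF 2 (fun j Y e => g' j Y (e 1) (e 0)).
  by apply: (RF_comp2 HW HK hg'); apply: (RF_var HW HK); lia.
have hs : Sf1 (A := A j) (g' j Y z).
  have -> : g' j Y z = fun x => c j $ Y $ z $ x.
    apply: functional_extensionality => y.
    exact: Logic.eq_sym (Hc j Y (fun i => match i with 0 => y | _ => z end)).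
  exact: wfun_Sf.
have adS y : @ad (A j) y (on (A j)) = wS (W j) $ y by rewrite /= (ad'S (HW j)) (ad'0 (HW j)).
have hz := hg j Y z; have Hj := HA j.
apply: (sg_ind Hj); first by sg.
- by rewrite h0; have [-> _] := H j Y z.
- by move=> y IH; rewrite hS IH adS; have [_ ->] := H j Y z.
Qed.

Lemma prim_rec1_RF a f (g : forall j, wd (W j) N1 -> num j -> num j) :
  RF 0 (fun j Y _ => a j Y) -> RF2 f -> (forall j Y, Sf1 (A := A j) (g j Y)) ->
  (forall j Y, g j Y (zr (A j)) = a j Y) ->
  (forall j Y x, g j Y (ad x (on (A j))) = f j Y x (g j Y x)) -> RF1 g.
Proof.
move=> ha hf hg h0 hS.
have h : RF2 (fun j Y (z : num j) x => g j Y x).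
  apply: (@prim_rec_RF (fun j Y z => a j Y) (fun j Y z x y => f j Y x y)) => //.
  - exact: (RT_weak HW HK ha).
  - by apply: (RF_comp2 HW HK hf); apply: (RF_var HW HK); lia.
apply: (RF_comp2 HW HK (F := fun j Y e => e 0) (G := fun j Y e => e 0) h).
all: by apply: (RF_var HW HK); lia.
Qed.

Lemma RF_on n : RF n (fun j Y e => on (A j)).
Proof. by apply: (RF_succ HW HK); exact: (RF_zero HW HK). Qed.

Ltac rf0 := repeat first [assumption | apply: RF_on | apply: (RF_zero HW HK) | by (apply: (RF_var HW HK); lia) | apply: (RF_Y HW HK)].

Lemma add_RF : RF2 (fun j Y => @ad (A j)).
Proof.
apply: (prim_rec_RF (a := fun j Y z => z) (f := fun j Y z x y => wS (W j) $ y)).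
- by rf0.
- by apply: (RF_succ HW HK); rf0.
- by move=> j Y z; have Hj := HA j; sg.
- by move=> j Y z; exact: (ad'0 (HW j)).
- move=> j Y z x; rewrite (rca_addS (HA j)) /=.
  by rewrite (ad'S (HW j)) (ad'0 (HW j)).
Qed.
Lemma RF_add n (F G : val) : RF n F -> RF n G -> RF n (fun j Y e => @ad (A j) (F j Y e) (G j Y e)).
Proof. exact: (RF_comp2 HW HK add_RF). Qed.

Lemma mul_RF : RF2 (fun j Y => @ml (A j)).
Proof.
apply: (prim_rec_RF (a := fun j Y z => zr (A j)) (f := fun j Y z x y => @ad (A j) y z)).
- by rf0.
- by apply: RF_add; rf0.
- by move=> j Y z; have Hj := HA j; sg.
- by move=> j Y z; exact: (rca_mul0 (HA j)).
- by move=> j Y z x; exact: (rca_mulS (HA j)).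
Qed.
Lemma RF_mul n (F G : val) : RF n F -> RF n G -> RF n (fun j Y e => @ml (A j) (F j Y e) (G j Y e)).
Proof. exact: (RF_comp2 HW HK mul_RF). Qed.

Lemma pred_RF : RF1 (fun j Y x => sb (HA j) x (on (A j))).
Proof.
apply: (prim_rec1_RF (a := fun j Y => zr (A j)) (f := fun j Y x y => x)).
- by rf0.
- by rf0.
- by move=> j Y; have Hj := HA j; sg.
- by move=> j Y; apply: sb_le; zlra (HA j).
- by move=> j Y x; apply: sb_eq; zlra (HA j).
Qed.
Lemma sb_RF : RF2 (fun j Y => sb (HA j)).
Proof.
apply: (prim_rec_RF (a := fun j Y z => z) (f := fun j Y z x y => sb (HA j) y (on (A j)))).
- by rf0.
- by apply: (RF_comp1 HW HK pred_RF); rf0.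
- by move=> j Y z; have Hj := HA j; sg.
- by move=> j Y z; apply: sb_eq; zlra (HA j).
- move=> j Y z x; case: (sbP (HA j) z x) => [e|[h ->]].
  + case: (zero_or_succ (HA j) (sb (HA j) z x)) => [e0|[w ew]].
      by rewrite e0 !sb_le //; rewrite e0 in e; zlra (HA j).
    rewrite ew (_ : sb (HA j) (ad w (on (A j))) (on (A j)) = w).
      by apply: sb_eq; rewrite ew in e; zlra (HA j).
    by apply: sb_eq; zlra (HA j).
  + by rewrite !sb_le //; zlra (HA j).
Qed.
Lemma RF_sb n (F G : val) : RF n F -> RF n G -> RF n (fun j Y e => sb (HA j) (F j Y e) (G j Y e)).
Proof. exact: (RF_comp2 HW HK sb_RF). Qed.

Ltac rf := rewrite /RF1 /RF2 /RF3; repeat first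
  [ assumption | by (apply: (RF_var HW HK); lia) | apply: RF_on | apply: (RF_zero HW HK)
  | apply: RF_add | apply: RF_mul | apply: RF_sb ].

(** Truth is a nonzero value, as for membership in [arithw] and opposite to [DP]: with one number
    argument the representing functional then yields the set itself. *)
Definition RP n (P : forall j, wd (W j) N1 -> (nat -> wd (W j) N0) -> Prop) :=
  exists F : val, RF n F /\ forall j Y e, P j Y e <-> F j Y e <> w0 (W j).

Lemma RP_eq n (F G : val) : RF n F -> RF n G -> RP n (fun j Y e => F j Y e = G j Y e).
Proof.
move=> hF hG.
(* One minus the distance, truncated, is nonzero exactly for equal arguments. *)
exists (fun j Y e => sb (HA j) (on (A j)) (@ad (A j) (sb (HA j) (F j Y e) (G j Y e)) (sb (HA j) (G j Y e) (F j Y e)))).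
split=> [|j Y e]; first by rf.
apply: (iff_trans _ (iff_sym (sb_pos (HA j) _ _))).
move: (F j Y e) (G j Y e) => x y.
have := sbP (HA j) x y; have := sbP (HA j) y x.
move: (sb (HA j) x y) (sb (HA j) y x) => u v h h'; split=> [e0|h0].
- by subst y; case: h => [h|[h ->]]; case: h' => [h'|[h' ->]]; zlra (HA j).
- change (@eq (num j) x y); by case: h => [h|[h e1]]; case: h' => [h'|[h' e2]]; zlra (HA j).
Qed.
Lemma RP_lt n (F G : val) : RF n F -> RF n G -> RP n (fun j Y e => @ltt (A j) (F j Y e) (G j Y e)).
Proof.
move=> hF hG; exists (fun j Y e => sb (HA j) (G j Y e) (F j Y e)).
by split=> [|j Y e]; [rf|exact: iff_sym (sb_pos (HA j) _ _)].
Qed.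
Lemma RP_in n (F : val) : RF n F -> RP n (fun j Y e => @inn (A j) (F j Y e) Y).
Proof. by move=> hF; exists (fun j Y e => Y $ F j Y e); split=> [|j Y e] //; exact: (RF_Y HW HK). Qed.

Lemma RF_ite n P (F G : val) : RP n P -> RF n F -> RF n G ->
  RF n (fun j Y e => ite (A := A j) (P j Y e) (F j Y e) (G j Y e)).
Proof.
move=> [C [hC H]] hF hG.
(* The factors 1 - C and 1 - (1 - C), with truncated subtraction, are 0 and 1 in one case and 1 and
   0 in the other, and select the branch. *)
apply: (RF_ext (G := fun j Y e => @ad (A j)
  (@ml (A j) (sb (HA j) (on (A j)) (C j Y e)) (G j Y e))
  (@ml (A j) (sb (HA j) (on (A j)) (sb (HA j) (on (A j)) (C j Y e))) (F j Y e)))); last by rf.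
move=> j Y e; have Hj := HA j; match goal with |- @eq _ ?a ?b => change (@eq (num j) a b) end.
have s0 : sb (HA j) (on (A j)) (zr (A j)) = on (A j) by apply: sb_eq; zlra Hj.
have s1 : sb (HA j) (on (A j)) (on (A j)) = zr (A j) by apply: sb_eq; zlra Hj.
case: (classic (P j Y e)) => p.
- rewrite ite_t //; have /(zero_lt Hj) h := proj1 (H j Y e) p.
  have -> : sb (HA j) (on (A j)) (C j Y e) = zr (A j) by apply: sb_le; zlra Hj.
  by rewrite s0; zlra Hj.
- rewrite ite_f //; have -> : C j Y e = zr (A j) by apply: NNPP => /(H j Y e).
  by rewrite s0 s1; zlra Hj.
Qed.

Lemma sq_RF : RF1 (fun j Y => sq (HA j)).
Proof.
apply: (prim_rec1_RF (a := fun j Y => zr (A j)) (f := fun j Y x y =>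
  ite (A := A j) (@ad (A j) x (on (A j)) = @ml (A j) (@ad (A j) y (on (A j))) (@ad (A j) y (on (A j))))
    (@ad (A j) y (on (A j))) y)).
- by rf.
- by apply: RF_ite; [apply: RP_eq| |]; rf.
- by move=> j Y; have Hj := HA j; sg.
- by move=> j Y; have Hj := HA j; apply: sq_unique; znra Hj.
- move=> j Y x; have Hj := HA j; have [h1 h2] := sqP (HA j) x.
  move: (sq (HA j) x) h1 h2 => s h1 h2.
  case: (classic (@ad (A j) x (on (A j)) = @ml (A j) (ad s (on (A j))) (ad s (on (A j))))) => h;
    [rewrite ite_t //|rewrite ite_f //]; apply: sq_unique; rewrite ?h.
  + exact: lt_irr.
  + by znra Hj.
  + by move=> h3; apply: h1; zlra Hj.
  + case: (lt_cases Hj (@ad (A j) x (on (A j))) (@ml (A j) (@ad (A j) s (on (A j))) (@ad (A j) s (on (A j))))) => [//|[//|h3]].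
    by exfalso; zlra Hj.
Qed.
Lemma fs_RF : RF1 (fun j Y => fs (HA j)).
Proof. by apply: RF_sb; [|apply: RF_mul]; rewrite /RF; first [exact: sq_RF|rf]. Qed.
Lemma sn_RF : RF1 (fun j Y => sn (HA j)).
Proof. by apply: RF_sb; [exact: sq_RF|exact: fs_RF]. Qed.
Lemma RF_fs n (F : val) : RF n F -> RF n (fun j Y e => fs (HA j) (F j Y e)).
Proof. exact: (RF_comp1 HW HK fs_RF). Qed.
Lemma RF_sn n (F : val) : RF n F -> RF n (fun j Y e => sn (HA j) (F j Y e)).
Proof. exact: (RF_comp1 HW HK sn_RF). Qed.
Lemma RF_spair n (F G : val) : RF n F -> RF n G -> RF n (fun j Y e => spair (A := A j) (F j Y e) (G j Y e)).
Proof. by move=> hF hG; apply: RF_add => //; apply: RF_mul; apply: RF_add. Qed.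

Lemma since_RF : RF1 (fun j Y => since (HA j) Y).
Proof.
apply: (prim_rec1_RF (a := fun j Y => zr (A j)) (f := fun j Y x y =>
  ite (A := A j) (@inn (A j) x Y) (zr (A j)) (@ad (A j) y (on (A j))))).
- by rf.
- by apply: RF_ite; [apply: RP_in| |]; rf.
- by move=> j Y; exact: since_Sf.
- by move=> j Y; exact: since0.
- by move=> j Y x; exact: sinceS.
Qed.
Lemma RF_last n (F : val) : RF n F -> RF n (fun j Y e => last (HA j) Y (F j Y e)).
Proof. by move=> hF; apply: RF_sb => //; apply: (RF_comp1 HW HK since_RF); rf. Qed.

Lemma Z1_RP : RP 1 (fun j Y e => Z1 (HA j) Y (e 0)).
Proof.
rewrite /Z1 /below1; apply: RP_lt; apply: RF_mul; last (apply: RF_add; last exact: RF_on);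
  last (do 2!apply: RF_sn); last by apply: RF_last; apply: RF_sn; rf.
- by apply: RF_fs; apply: RF_sn; apply: RF_last; apply: RF_sn; rf.
- by apply: RF_add; [apply: RF_sn; apply: RF_fs|]; rf.
- by do 2!apply: RF_fs; rf.
Qed.

Lemma pw_RF : RF1 (fun j Y => pw (HA j)).
Proof.
apply: (prim_rec1_RF (a := fun j Y => on (A j)) (f := fun j Y x y => @ad (A j) y y)).
- by rf.
- by rf.
- by move=> j Y; exact: pw_Sf.
- by move=> j Y; exact: pw0.
- by move=> j Y x; exact: pwS.
Qed.

Lemma digits_RF : RF2 (fun j Y => digits (HA j) Y).
Proof.
apply: (prim_rec_RF (a := fun j Y z => zr (A j)) (f := fun j Y z x y =>
  @ad (A j) (@ad (A j) (@ad (A j) (@ad (A j) y y) y) y) (bit (A := A j) Y x z))).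
- by rf.
- apply: RF_add; first by rf.
  by apply: RF_ite; [apply: RP_in; apply: RF_spair| |]; rf.
- by move=> j Y z; have Hj := HA j; have h := digits_Sf (HA j) Y; sg.
- by move=> j Y z; exact: digits0.
- by move=> j Y z x; exact: digitsS.
Qed.

Lemma Z2_RP : RP 1 (fun j Y e => Z2 (HA j) Y (e 0)).
Proof.
rewrite /Z2 /code2; apply: RP_eq; first by rf.
apply: RF_spair; first by apply: RF_fs; rf.
apply: RF_spair; first by apply: (RF_comp2 HW HK digits_RF); apply: RF_fs; rf.
apply: RF_sb; last by rf.
by apply: RF_mul; apply: (RF_comp1 HW HK pw_RF); apply: RF_fs; rf.
Qed.
End ClosedTerms.

Definition wmodel := { W : wstruc | iswr W }.
Definition wmod (j : wmodel) : wstruc := proj1_sig j.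
Definition wmodP (j : wmodel) : iswr (wmod j) := proj2_sig j.
(** An element of the product of all models counts as admissible only if one closed term yields all
    its components; this gives a term independent of the model. *)
Definition closed_value t (x : elt wmod t) :=
  exists c : wterm t, closed_term c /\ forall j (r : env (winterp (wmod j))), eval r c = x j.

Lemma closed_value_admissible : admissible closed_value.
Proof.
constructor.
- by exists (wzero (fun _ => 0)).
- by exists (wsucc (fun _ => 0)).
- by move=> s t; exists (wpi s t (fun _ => 0)).
- by move=> r s t; exists (wsigma r s t (fun _ => 0)).
- by exists (wrec (fun _ => 0)).
- move=> s t f x [c [hc Hc]] [d [hd Hd]]; exists (App c d); split.
  + by move=> u; rewrite /App /= hc hd.
  + by move=> j r; rewrite /= Hc Hd.
Qed.

Lemma closed_char P : RP closed_value 1 (fun j Y e => P j Y (e 0)) ->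
  exists t : wterm (N1 ~> N1), closed_term t /\
    forall (j : wmodel) (r : env (winterp (wmod j))) Y n,
      @inn (wstruc_struc (wmod j)) n (eval r t $ Y) <-> P j Y n.
Proof.
move=> [F [[c [[t [ht Ht]] Hc]] HF]]; exists t; split=> // j r Y n.
rewrite (HF j Y (fun _ => n)) -(Hc j Y (fun _ => n)) -(Ht j r); reflexivity.
Qed.

(* The value of a closed term t does not depend on the environment, but the
   evaluation of a formula containing t gets stuck on it under binders. The
   formula is therefore written with a variable of the sort of t, which no
   quantifier of the formula binds, and t is substituted for it. *)
Section ClosedInstance.
Variable s0 : ty.
Variable t : wterm s0.
Hypothesis ht : closed_term t.
Notation u := (repl (L := Lw) (s := s0) t).

Lemma up_repl_closed s : s <> s0 -> up (L := Lw) s u = u.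
Proof.
move=> hs; apply: sub_ext => s' n; rewrite /up /repl.
case: (@sort_dec Lw s0 s') => e.
- subst s'; case: (@sort_dec Lw s s0) => // _.
  by case: n => [|n] /=; rewrite ?ht // /shift; case: (@sort_dec Lw s s0).
- by case: n => [|n]; rewrite /shift /=; case: (ty_dec s s').
Qed.

(** Substitution without lifting under binders. For a closed term and a variable whose sort is never
    quantified it agrees with [fsubst], and on a concrete sentence it reduces by computation. *)
Fixpoint csubst (A : form Lw) : form Lw :=
  match A with
  | Rel r a => Rel r (asubst u a)
  | Bot => Bot
  | Imp A B => Imp (csubst A) (csubst B)
  | And A B => And (csubst A) (csubst B)
  | Or A B => Or (csubst A) (csubst B)
  | All s A => All s (csubst A)
  | Ex s A => Ex s (csubst A)
  end.
Fixpoint no_quant (A : form Lw) : bool :=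
  match A with
  | Rel _ _ | Bot => true
  | Imp A B | And A B | Or A B => no_quant A && no_quant B
  | All s A | Ex s A => match ty_dec s s0 with left _ => false | right _ => no_quant A end
  end.
Lemma csubstE A : no_quant A -> fsubst u A = csubst A.
Proof.
elim: A => //= [A IA B IB|A IA B IB|A IA B IB|s A IA|s A IA].
1-3: by move=> /andP [h h']; rewrite IA ?IB.
all: by case: ty_dec => // hs h; rewrite up_repl_closed ?IA.
Qed.
End ClosedInstance.

Lemma sat_closed_instance s0 (t : wterm s0) (Phi : whterm s0 -> hform Lw) (I : interp Lw) (r : env I) :
  closed_term t -> no_quant s0 (sentence (Phi (hconst (@Var Lw s0 0)))) ->
  csubst t (sentence (Phi (hconst (@Var Lw s0 0)))) = sentence (Phi (hconst t)) ->
  sat (fun s n => eval r (repl (L := Lw) t s n)) (sentence (Phi (hconst (@Var Lw s0 0)))) ->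
  sat r (sentence (Phi (hconst t))).
Proof.
move=> ht hq <- h; by rewrite -(csubstE ht hq); apply/sat_subst.
Qed.

Theorem functional1 : exists t1 : wterm (N1 ~> N1), primrec_functional t1 /\
     provable RCA0w
       ([ex] e1, [ALL] X, bw_instance X [->]
          computes e1 X (hconst t1 [@] X) [/\]
          (stcoh (hconst t1 [@] X) [->] bw_weak X)).
Proof.
have [t [ht Ht]] := closed_char (P := fun j Y n => Z1 (wstruc_isrca (wmodP j)) Y n)
  (Z1_RP wmodP closed_value_admissible).
exists t; split=> //; apply: RCA0w_complete => W r HWr.
(* The given model is one member of the family over which the term was built. *)
pose j : wmodel := exist _ W HWr; pose A := wstruc_struc W.
pose Phi := (fun T : whterm (N1 ~> N1) => @hex Lw N0 (fun e1 => @hall Lw N1 (fun X =>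
  @bw_instance Lw arithw X [->] @computes Lw arithw e1 X (T [@] X) [/\] (@stcoh Lw arithw (T [@] X) [->] @bw_weak Lw arithw X)))%fml).
apply: (@sat_closed_instance _ t Phi _ r ht); [by []|reflexivity|].
have [e he] := reduction1 (wstruc_isrca HWr).
suff : exists e : sd A Num, forall X : sd A Set2, sbw_instance X ->
    scomputes (A := A) e X (eval r t $ X) /\ (sstcoh (A := A) (eval r t $ X) -> sbw_weak X) by exact.
exists e => X hX; apply: (he X (eval r t $ X) hX) => n.
exact: (Ht j r X n).
Qed.

Theorem functional2 : exists t2 : wterm (N1 ~> N1), primrec_functional t2 /\
     provable RCA0w
       ([ex] e2, [ALL] Y,
          computes e2 Y (hconst t2 [@] Y) [/\]
          bw_instance (hconst t2 [@] Y) [/\]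
          (bw_weak (hconst t2 [@] Y) [->] stcoh Y)).
Proof.
have [t [ht Ht]] := closed_char (P := fun j Y n => Z2 (wstruc_isrca (wmodP j)) Y n)
  (Z2_RP wmodP closed_value_admissible).
exists t; split=> //; apply: RCA0w_complete => W r HWr.
pose j : wmodel := exist _ W HWr; pose A := wstruc_struc W.
pose Phi := (fun T : whterm (N1 ~> N1) => @hex Lw N0 (fun e2 => @hall Lw N1 (fun Y =>
  @computes Lw arithw e2 Y (T [@] Y) [/\] @bw_instance Lw arithw (T [@] Y) [/\]
  (@bw_weak Lw arithw (T [@] Y) [->] @stcoh Lw arithw Y)))%fml).
apply: (@sat_closed_instance _ t Phi _ r ht); [by []|reflexivity|].
have [e he] := reduction2 (wstruc_isrca HWr).
suff : exists e : sd A Num, forall Y : sd A Set2,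
    scomputes (A := A) e Y (eval r t $ Y) /\ sbw_instance (A := A) (eval r t $ Y) /\
    (sbw_weak (A := A) (eval r t $ Y) -> sstcoh Y) by exact.
exists e => Y; apply: (he Y (eval r t $ Y)) => n.
exact: (Ht j r Y n).
Qed.

Theorem theorem8 :
  provable RCA0
    ([ex] e1, [ALL] X, bw_instance X [->]
       [EX] Z, computes e1 X Z [/\] (stcoh Z [->] bw_weak X))
  /\
  provable RCA0
    ([ex] e2, [ALL] Y,
       [EX] Z, computes e2 Y Z [/\] bw_instance Z [/\] (bw_weak Z [->] stcoh Y))
  /\
  (exists t1 : wterm (N1 ~> N1), primrec_functional t1 /\
     provable RCA0w
       ([ex] e1, [ALL] X, bw_instance X [->]
          computes e1 X (hconst t1 [@] X) [/\]
          (stcoh (hconst t1 [@] X) [->] bw_weak X)))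
  /\
  (exists t2 : wterm (N1 ~> N1), primrec_functional t2 /\
     provable RCA0w
       ([ex] e2, [ALL] Y,
          computes e2 Y (hconst t2 [@] Y) [/\]
          bw_instance (hconst t2 [@] Y) [/\]
          (bw_weak (hconst t2 [@] Y) [->] stcoh Y))).
Proof.
split; first exact: RCA0_reduction1.
split; first exact: RCA0_reduction2.
split; [exact: functional1|exact: functional2].
Qed.
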